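(* Fix a prime number $p$ and a field $k$ of characteristic zero, and let $\mathscr{U}$ be a family of finite $p$-groups closed under quotients. Consider the group prime map $$\pi_0\mathscr{U}\to\mathrm{Spc}(\mathsf{D}(\mathscr{U})^c),\qquad G\mapsto\mathfrak{p}_G=\{X\in\mathsf{D}(\mathscr{U})^c\mid H_*(X(G))=0\},$$ where $\pi_0\mathscr{U}$ is the discrete space of isomorphism classes of groups in $\mathscr{U}$. This map is surjective if and only if $\mathscr{U}$ is essentially finite (i.e. $\pi_0\mathscr{U}$ is finite). In this case the map is a homeomorphism.
   Context: A family $\mathscr{U}$ of finite groups (closed under isomorphism) is regarded as a full subcategory of the category $\mathscr{G}$ of finite groups with morphisms the conjugacy classes of surjective group homomorphisms. $\mathsf{D}(\mathscr{U})$ is the derived category of $\mathrm{Fun}(\mathscr{U}^{\mathrm{op}},\mathrm{Mod}_k)$, with the pointwise tensor product over $k$, and $\mathsf{D}(\mathscr{U})^c$ is its full subcategory of compact objects, an essentially small tensor-triangulated category under the given hypotheses. The Balmer spectrum $\mathrm{Spc}(\mathscr{K})$ of an essentially small tensor-triangulated category $\mathscr{K}$ is the set of prime thick ideals of $\mathscr{K}$ (thick = triangulated and closed under retracts; ideal = closed under tensoring with any object; prime = proper and $X\otimes Y\in\mathfrak{p}$ implies $X\in\mathfrak{p}$ or $Y\in\mathfrak{p}$), with the topology having the sets $\mathrm{supp}(X)=\{\mathfrak{p}\mid X\notin\mathfrak{p}\}$ as a basis of closed sets. Each $\mathfrak{p}_G$ is a prime thick ideal. *)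

(* Defs.v *)
(* The objects here (families of finite groups, complexes of
   functors on them) live in universes above those of [eqType], [set] and
   [topologicalType], so subsets are plain predicates and topologies are given
   by their closed sets. *)
From HB Require Import structures.
From Stdlib Require List.
From mathcomp Require Import all_boot all_order all_algebra all_fingroup all_solvable.

Set Implicit Arguments.
Unset Strict Implicit.
Unset Printing Implicit Defensive.

Import GRing.Theory.
Local Open Scope ring_scope.

Definition closed_under_iso (U : finGroupType -> Prop) : Prop :=
  forall G H : finGroupType, [set: G] \isog [set: H] -> U G -> U H.

Definition closed_under_quotients (U : finGroupType -> Prop) : Prop :=
  forall (G : finGroupType) (N : {group G}),
    U G -> (N <| [set: G])%g -> U (coset_of N).

Record fam (U : finGroupType -> Prop) := Fam {
  fam_group :> finGroupType;
  fam_in : U fam_group }.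

Definition isog_class (U : finGroupType -> Prop) (G : fam U) : fam U -> Prop :=
  fun H => [set: G] \isog [set: H].

Record pi0 (U : finGroupType -> Prop) := Pi0 {
  pi0_set :> fam U -> Prop;
  pi0_setP : exists G : fam U, pi0_set = isog_class G }.

Definition pi0_class (U : finGroupType -> Prop) (G : fam U) : pi0 U :=
  Pi0 (ex_intro (fun H => isog_class G = isog_class H) G erefl).

Record surjection (G H : finGroupType) := Surjection {
  surj_fun :> {multiplicative G -> H};
  surj_onto : forall y : H, exists x : G, surj_fun x = y }.

Lemma surj_id_onto (G : finGroupType) (y : G) : exists x, idfun x = y.
Proof. by exists y. Qed.

Definition surj_id (G : finGroupType) : surjection G G :=
  @Surjection G G idfun (@surj_id_onto G).

Lemma surj_comp_onto (G H K : finGroupType) (b : surjection H K)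
  (a : surjection G H) (z : K) : exists x, (b \o a) x = z.
Proof.
by have [y <-] := surj_onto b z; have [x <-] := surj_onto a y; exists x.
Qed.

Definition surj_comp (G H K : finGroupType) (b : surjection H K)
  (a : surjection G H) : surjection G K :=
  @Surjection G K (b \o a) (surj_comp_onto b a).

Definition surj_conj (G H : finGroupType) (a b : surjection G H) : Prop :=
  exists h : H, forall x : G, b x = (a x ^ h)%g.

Section Derived.
Context (k : fieldType) (U : finGroupType -> Prop).

(* A functor on a category whose morphisms are conjugacy classes is a functor
   on surjections that takes conjugate surjections to the same map. *)
Record psh := Psh {
  psh_ob :> fam U -> lmodType k;
  psh_map : forall G H : fam U, surjection G H -> {linear psh_ob H -> psh_ob G};
  psh_map_id : forall (G : fam U) (x : psh_ob G), psh_map (surj_id G) x = x;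
  psh_map_comp : forall (G H K : fam U) (b : surjection H K)
    (a : surjection G H) (x : psh_ob K),
    psh_map (surj_comp b a) x = psh_map a (psh_map b x);
  psh_map_conj : forall (G H : fam U) (a b : surjection G H),
    surj_conj a b -> forall x, psh_map a x = psh_map b x }.

Record psh_hom (X Y : psh) := PshHom {
  psh_hom_fun :> forall G : fam U, {linear X G -> Y G};
  psh_hom_nat : forall (G H : fam U) (a : surjection G H) (x : X H),
    psh_hom_fun G (psh_map X a x) = psh_map Y a (psh_hom_fun H x) }.

(* Homological grading. The differential leaving degree [n] lands in degree
   [n - 1], so [d n] is the boundary map entering degree [n - 1] and
   [d (n - 1)] is the one leaving it. *)
Record cplx := Cplx {
  cplx_ob :> int -> psh;
  cplx_d : forall n : int, psh_hom (cplx_ob n) (cplx_ob (n - 1));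
  cplx_dd : forall (n : int) (G : fam U) (x : cplx_ob n G),
    cplx_d (n - 1) G (cplx_d n G x) = 0 }.

Record chmap (X Y : cplx) := ChMap {
  chmap_fun :> forall n : int, psh_hom (X n) (Y n);
  chmap_d : forall (n : int) (G : fam U) (x : X n G),
    chmap_fun (n - 1) G (cplx_d X n G x) = cplx_d Y n G (chmap_fun n G x) }.

(* The degree [n - 1] homology of [X(G)] vanishes for every [n]. *)
Definition acyclic_at (G : fam U) (X : cplx) : Prop :=
  forall (n : int) (x : X (n - 1) G), cplx_d X (n - 1) G x = 0 ->
    exists y : X n G, x = cplx_d X n G y.

(* Injectivity and surjectivity of the maps induced in degree [n - 1]
   homology. *)
Definition quasi_iso (X Y : cplx) (f : chmap X Y) : Prop :=
  forall (n : int) (G : fam U),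
    (forall x : X (n - 1) G, cplx_d X (n - 1) G x = 0 ->
      (exists y : Y n G, f (n - 1) G x = cplx_d Y n G y) ->
      exists x' : X n G, x = cplx_d X n G x')
    /\ (forall y : Y (n - 1) G, cplx_d Y (n - 1) G y = 0 ->
      exists (x : X (n - 1) G) (y' : Y n G),
        cplx_d X (n - 1) G x = 0 /\ y = f (n - 1) G x + cplx_d Y n G y').

Definition psh_hom_id (X : psh) : psh_hom X X :=
  @PshHom X X (fun G => idfun) (fun _ _ _ _ => erefl).

Lemma psh_hom_comp_nat (X Y Z : psh) (g : psh_hom Y Z) (f : psh_hom X Y)
  (G H : fam U) (a : surjection G H) (x : X H) :
  (g G \o f G) (psh_map X a x) = psh_map Z a ((g H \o f H) x).
Proof. by rewrite /= !psh_hom_nat. Qed.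

Definition psh_hom_comp (X Y Z : psh) (g : psh_hom Y Z) (f : psh_hom X Y) :
  psh_hom X Z :=
  @PshHom X Z (fun G => g G \o f G) (psh_hom_comp_nat g f).

Lemma psh_hom_add_nat (X Y : psh) (f g : psh_hom X Y)
  (G H : fam U) (a : surjection G H) (x : X H) :
  (f G \+ g G) (psh_map X a x) = psh_map Y a ((f H \+ g H) x).
Proof. by rewrite /= !psh_hom_nat linearD. Qed.

Definition psh_hom_add (X Y : psh) (f g : psh_hom X Y) : psh_hom X Y :=
  @PshHom X Y (fun G => f G \+ g G) (psh_hom_add_nat f g).

Definition chmap_id (X : cplx) : chmap X X :=
  @ChMap X X (fun n => psh_hom_id (X n)) (fun _ _ _ => erefl).

Lemma chmap_comp_d (X Y Z : cplx) (g : chmap Y Z) (f : chmap X Y)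
  (n : int) (G : fam U) (x : X n G) :
  psh_hom_comp (g (n - 1)) (f (n - 1)) G (cplx_d X n G x) =
  cplx_d Z n G (psh_hom_comp (g n) (f n) G x).
Proof. by rewrite /= !chmap_d. Qed.

Definition chmap_comp (X Y Z : cplx) (g : chmap Y Z) (f : chmap X Y) :
  chmap X Z :=
  @ChMap X Z (fun n => psh_hom_comp (g n) (f n)) (chmap_comp_d g f).

Lemma chmap_add_d (X Y : cplx) (f g : chmap X Y)
  (n : int) (G : fam U) (x : X n G) :
  psh_hom_add (f (n - 1)) (g (n - 1)) G (cplx_d X n G x) =
  cplx_d Y n G (psh_hom_add (f n) (g n) G x).
Proof. by rewrite /= !chmap_d linearD. Qed.

Definition chmap_add (X Y : cplx) (f g : chmap X Y) : chmap X Y :=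
  @ChMap X Y (fun n => psh_hom_add (f n) (g n)) (chmap_add_d f g).

(* Morphisms of [D(U)], the localization of the category of complexes at the
   quasi-isomorphisms: words in chain maps and formal inverses of
   quasi-isomorphisms, together with formal sums, modulo [deq]. Complexes form
   an additive category, so the localization is additive and has the same
   universal property among preadditive categories; adding formal sums to the
   words is therefore only a way of naming the sum of two morphisms. *)
Inductive dmor : cplx -> cplx -> Type :=
| dmap (X Y : cplx) (f : chmap X Y) : dmor X Y
| dinv (X Y : cplx) (f : chmap X Y) (qf : quasi_iso f) : dmor Y X
| dcomp (X Y Z : cplx) (v : dmor Y Z) (u : dmor X Y) : dmor X Z
| dzero (X Y : cplx) : dmor X Y
| dopp (X Y : cplx) (u : dmor X Y) : dmor X Y
| dadd (X Y : cplx) (u v : dmor X Y) : dmor X Y.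

Definition did (X : cplx) : dmor X X := dmap (chmap_id X).

Inductive deq : forall X Y : cplx, dmor X Y -> dmor X Y -> Prop :=
| deq_refl X Y (u : dmor X Y) : deq u u
| deq_sym X Y (u v : dmor X Y) : deq u v -> deq v u
| deq_trans X Y (u v w : dmor X Y) : deq u v -> deq v w -> deq u w
| deq_comp X Y Z (v v' : dmor Y Z) (u u' : dmor X Y) :
    deq v v' -> deq u u' -> deq (dcomp v u) (dcomp v' u')
| deq_opp X Y (u u' : dmor X Y) : deq u u' -> deq (dopp u) (dopp u')
| deq_add X Y (u u' v v' : dmor X Y) :
    deq u u' -> deq v v' -> deq (dadd u v) (dadd u' v')
| deq_compA X Y Z W (w : dmor Z W) (v : dmor Y Z) (u : dmor X Y) :
    deq (dcomp w (dcomp v u)) (dcomp (dcomp w v) u)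
| deq_comp1l X Y (u : dmor X Y) : deq (dcomp (did Y) u) u
| deq_comp1r X Y (u : dmor X Y) : deq (dcomp u (did X)) u
| deq_addA X Y (u v w : dmor X Y) :
    deq (dadd u (dadd v w)) (dadd (dadd u v) w)
| deq_addC X Y (u v : dmor X Y) : deq (dadd u v) (dadd v u)
| deq_add0 X Y (u : dmor X Y) : deq (dadd (dzero X Y) u) u
| deq_addN X Y (u : dmor X Y) : deq (dadd (dopp u) u) (dzero X Y)
| deq_compDl X Y Z (v v' : dmor Y Z) (u : dmor X Y) :
    deq (dcomp (dadd v v') u) (dadd (dcomp v u) (dcomp v' u))
| deq_compDr X Y Z (v : dmor Y Z) (u u' : dmor X Y) :
    deq (dcomp v (dadd u u')) (dadd (dcomp v u) (dcomp v u'))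
| deq_map_ext X Y (f g : chmap X Y) :
    (forall n G x, f n G x = g n G x) -> deq (dmap f) (dmap g)
| deq_map_comp X Y Z (g : chmap Y Z) (f : chmap X Y) :
    deq (dmap (chmap_comp g f)) (dcomp (dmap g) (dmap f))
| deq_map_add X Y (f g : chmap X Y) :
    deq (dmap (chmap_add f g)) (dadd (dmap f) (dmap g))
| deq_invl X Y (f : chmap X Y) (qf : quasi_iso f) :
    deq (dcomp (dinv qf) (dmap f)) (did X)
| deq_invr X Y (f : chmap X Y) (qf : quasi_iso f) :
    deq (dcomp (dmap f) (dinv qf)) (did Y).

Definition retract (X Y : cplx) : Prop :=
  exists (i : dmor X Y) (r : dmor Y X), deq (dcomp r i) (did X).

Definition is_coproduct (I : Type) (Y : I -> cplx) (C : cplx)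
  (inj : forall i, dmor (Y i) C) : Prop :=
  forall (Z : cplx) (g : forall i, dmor (Y i) Z),
    exists h : dmor C Z, (forall i, deq (dcomp h (inj i)) (g i))
      /\ (forall h' : dmor C Z,
            (forall i, deq (dcomp h' (inj i)) (g i)) -> deq h' h).

Definition dsum (I : Type) (Y : I -> cplx) (X C : cplx)
  (inj : forall i, dmor (Y i) C) (s : seq I) (g : forall i, dmor X (Y i)) :
  dmor X C :=
  (fix sum (s : seq I) : dmor X C :=
     if s is i :: s' then dadd (dcomp (inj i) (g i)) (sum s')
     else dzero X C) s.

(* The canonical map from the direct sum of the groups [Hom(X, Y i)] to
   [Hom(X, C)] is bijective whenever [C] is a coproduct of the [Y i]. A pair
   [(s, g)] with [s] duplicate-free stands for the element of the direct sum
   supported on [s] with components [g i] there. *)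
Definition compact_obj (X : cplx) : Prop :=
  forall (I : Type) (Y : I -> cplx) (C : cplx) (inj : forall i, dmor (Y i) C),
    is_coproduct inj ->
    (forall h : dmor X C, exists (s : seq I) (g : forall i, dmor X (Y i)),
        List.NoDup s /\ deq h (dsum inj s g))
    /\ (forall (s : seq I) (g : forall i, dmor X (Y i)), List.NoDup s ->
        deq (dsum inj s g) (dzero X C) ->
        forall i, List.In i s -> deq (g i) (dzero X (Y i))).

Section Shift.
Context (X : cplx).

Lemma shift_d_nat (n : int) (G H : fam U) (a : surjection G H)
  (x : X (n - 1) H) :
  (\- cplx_d X (n - 1) G) (psh_map (X (n - 1)) a x) =
  psh_map (X (n - 1 - 1)) a ((\- cplx_d X (n - 1) H) x).
Proof. by rewrite /= psh_hom_nat linearN. Qed.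

Definition shift_d (n : int) : psh_hom (X (n - 1)) (X (n - 1 - 1)) :=
  @PshHom (X (n - 1)) (X (n - 1 - 1))
    (fun G => \- cplx_d X (n - 1) G) (@shift_d_nat n).

Lemma shift_dd (n : int) (G : fam U) (x : X (n - 1) G) :
  shift_d (n - 1) G (shift_d n G x) = 0.
Proof. by rewrite /= linearN opprK cplx_dd. Qed.

Definition shift : cplx := @Cplx (fun n => X (n - 1)) shift_d shift_dd.
End Shift.

Section Biproduct.
Context (X Y : psh).

Definition prod_map_fun (G H : fam U) (a : surjection G H)
  (x : (X H * Y H)%type) : (X G * Y G)%type :=
  (psh_map X a x.1, psh_map Y a x.2).

Lemma prod_map_linear (G H : fam U) (a : surjection G H) :
  linear (prod_map_fun a).
Proof. by move=> c x y; rewrite /prod_map_fun /= !linearP. Qed.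

HB.instance Definition _ (G H : fam U) (a : surjection G H) :=
  GRing.isLinear.Build k (X H * Y H)%type (X G * Y G)%type _
    (prod_map_fun a) (prod_map_linear a).

Lemma prod_map_id (G : fam U) (x : (X G * Y G)%type) :
  prod_map_fun (surj_id G) x = x.
Proof. by case: x => x y; rewrite /prod_map_fun /= !psh_map_id. Qed.

Lemma prod_map_comp (G H K : fam U) (b : surjection H K) (a : surjection G H)
  (x : (X K * Y K)%type) :
  prod_map_fun (surj_comp b a) x = prod_map_fun a (prod_map_fun b x).
Proof. by rewrite /prod_map_fun /= !psh_map_comp. Qed.

Lemma prod_map_conj (G H : fam U) (a b : surjection G H) :
  surj_conj a b -> forall x, prod_map_fun a x = prod_map_fun b x.
Proof.
by move=> ab x; rewrite /prod_map_fun !(psh_map_conj ab).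
Qed.

Definition psh_prod : psh :=
  @Psh (fun G => (X G * Y G)%type) (fun G H a => @prod_map_fun G H a)
    prod_map_id prod_map_comp prod_map_conj.
End Biproduct.

Section Cone.
Context (X Y : cplx) (f : chmap X Y).

Definition cone_d_fun (n : int) (G : fam U)
  (z : psh_prod (Y n) (X (n - 1)) G) :
  psh_prod (Y (n - 1)) (X (n - 1 - 1)) G :=
  (cplx_d Y n G z.1 + f (n - 1) G z.2, - cplx_d X (n - 1) G z.2).

Lemma cone_d_linear (n : int) (G : fam U) : linear (@cone_d_fun n G).
Proof.
move=> c x y.
have e1 : cplx_d Y n G (c *: x.1 + y.1) + f (n - 1) G (c *: x.2 + y.2) =
    c *: (cplx_d Y n G x.1 + f (n - 1) G x.2) +
    (cplx_d Y n G y.1 + f (n - 1) G y.2).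
  by rewrite !linearP scalerDr addrACA.
have e2 : - cplx_d X (n - 1) G (c *: x.2 + y.2) =
    c *: (- cplx_d X (n - 1) G x.2) + (- cplx_d X (n - 1) G y.2).
  by rewrite linearP opprD scalerN.
exact: (congr2 pair e1 e2).
Qed.

HB.instance Definition _ (n : int) (G : fam U) :=
  GRing.isLinear.Build k _ _ _ (@cone_d_fun n G) (@cone_d_linear n G).

Lemma cone_d_nat (n : int) (G H : fam U) (a : surjection G H)
  (z : psh_prod (Y n) (X (n - 1)) H) :
  cone_d_fun (psh_map (psh_prod (Y n) (X (n - 1))) a z) =
  psh_map (psh_prod (Y (n - 1)) (X (n - 1 - 1))) a (cone_d_fun z).
Proof.
by rewrite /cone_d_fun /= /prod_map_fun /= !psh_hom_nat linearD linearN.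
Qed.

Definition cone_d (n : int) :
  psh_hom (psh_prod (Y n) (X (n - 1))) (psh_prod (Y (n - 1)) (X (n - 1 - 1))) :=
  @PshHom _ _ (fun G => @cone_d_fun n G) (@cone_d_nat n).

Lemma cone_dd (n : int) (G : fam U) (z : psh_prod (Y n) (X (n - 1)) G) :
  cone_d (n - 1) G (cone_d n G z) = 0.
Proof.
have e1 : cplx_d Y (n - 1) G (cplx_d Y n G z.1 + f (n - 1) G z.2) +
    f (n - 1 - 1) G (- cplx_d X (n - 1) G z.2) = 0.
  by rewrite linearD cplx_dd add0r linearN chmap_d subrr.
have e2 : - cplx_d X (n - 1 - 1) G (- cplx_d X (n - 1) G z.2) = 0.
  by rewrite linearN cplx_dd !oppr0.
exact: (congr2 pair e1 e2).
Qed.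

Definition cone : cplx :=
  @Cplx (fun n => psh_prod (Y n) (X (n - 1))) cone_d cone_dd.
End Cone.

(* [T] is the tensor product over [k] of the complexes [X] and [Y], computed
   pointwise: [T_n(G)] is the direct sum of the [X_i(G) (x) Y_j(G)] over
   [i + j = n], described by its universal property, with the usual functoriality
   and the usual differential. Since [k] is a field this is also the derived
   tensor product. *)
Definition is_tensor (X Y T : cplx) : Prop :=
  exists b : forall (i j n : int), i + j = n ->
      forall G : fam U, X i G -> Y j G -> T n G,
  [/\ forall i j n (e : i + j = n) (G : fam U),
        (forall x, linear (b i j n e G x)) /\
        (forall y, linear (fun x => b i j n e G x y)),
      forall i j n (e : i + j = n) (G H : fam U) (a : surjection G H) x y,
        psh_map (T n) a (b i j n e H x y) =
        b i j n e G (psh_map (X i) a x) (psh_map (Y j) a y),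
      forall i j n (e : i + j = n) (e1 : (i - 1) + j = n - 1)
        (e2 : i + (j - 1) = n - 1) (G : fam U) x y,
        cplx_d T n G (b i j n e G x y) =
        b (i - 1) j (n - 1) e1 G (cplx_d X i G x) y
        + ((-1) ^ i : k) *: b i (j - 1) (n - 1) e2 G x (cplx_d Y j G y)
    & forall (n : int) (G : fam U) (M : lmodType k)
        (phi : forall i j : int, i + j = n -> X i G -> Y j G -> M),
        (forall i j (e : i + j = n),
          (forall x, linear (phi i j e x)) /\
          (forall y, linear (fun x => phi i j e x y))) ->
        exists h : {linear T n G -> M},
          (forall i j e x y, h (b i j n e G x y) = phi i j e x y)
          /\ (forall h' : {linear T n G -> M},
                (forall i j e x y, h' (b i j n e G x y) = phi i j e x y) ->
                forall t, h' t = h t)].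

(* Every distinguished triangle of [D(U)] is isomorphic to the triangle
   [X -> Y -> cone f -> shift X] of a chain map [f], and closure under retracts
   includes closure under isomorphism, so two-out-of-three needs to be required
   only for these. *)
Record thick (P : cplx -> Prop) : Prop := {
  thick_nonempty : exists X, P X;
  thick_shift : forall X, P (shift X) <-> P X;
  thick_cone : forall (X Y : cplx) (f : chmap X Y), P X -> P Y -> P (cone f);
  thick_cone_src : forall (X Y : cplx) (f : chmap X Y),
    P Y -> P (cone f) -> P X;
  thick_cone_tgt : forall (X Y : cplx) (f : chmap X Y),
    P X -> P (cone f) -> P Y;
  thick_retract : forall X Y : cplx, retract X Y -> P Y -> P X }.

Record prime_ideal (P : cplx -> Prop) : Prop := {
  prime_compact : forall X, P X -> compact_obj X;
  prime_thick : thick P;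
  prime_ideal_tensor : forall X Y T : cplx,
    compact_obj Y -> is_tensor X Y T -> P X -> P T;
  prime_proper : exists X, compact_obj X /\ ~ P X;
  prime_prime : forall X Y T : cplx, compact_obj X -> compact_obj Y ->
    is_tensor X Y T -> P T -> P X \/ P Y }.

Record Spc := MkSpc {
  Spc_carrier :> cplx -> Prop;
  Spc_prime : prime_ideal Spc_carrier }.

Definition supp (X : cplx) : Spc -> Prop := fun P => ~ P X.

(* The closed sets of the topology having the supports of compact objects as a
   basis of closed sets: the intersections of families of supports. *)
Definition Spc_closed (Z : Spc -> Prop) : Prop :=
  exists F : cplx -> Prop, (forall X, F X -> compact_obj X) /\
    forall P : Spc, Z P <-> forall X, F X -> supp X P.

Definition group_prime (G : fam U) : cplx -> Prop :=
  fun X => compact_obj X /\ acyclic_at G X.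

End Derived.

Definition discrete_closed (T : Type) (Z : T -> Prop) : Prop := True.

Definition finite_type (T : Type) : Prop :=
  exists s : list T, forall x : T, List.In x s.

Definition closed_continuous (S T : Type) (closedS : (S -> Prop) -> Prop)
  (closedT : (T -> Prop) -> Prop) (f : S -> T) : Prop :=
  forall Z : T -> Prop, closedT Z -> closedS (fun x => Z (f x)).

Definition homeomorphism (S T : Type) (closedS : (S -> Prop) -> Prop)
  (closedT : (T -> Prop) -> Prop) (f : S -> T) : Prop :=
  closed_continuous closedS closedT f /\
  exists g : T -> S, [/\ closed_continuous closedT closedS g,
    (forall x, g (f x) = x) & (forall y, f (g y) = y)].

(* Main.v *)
(* In characteristic zero the functor freely generated by the restriction of [X]
   to isomorphisms is K-projective, and iterating it resolves every complex, so
   that morphisms of the derived category are homotopy classes of chain maps. A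
   K-projective [P] is compact if and only if each chain map from [P] to a direct
   sum is homotopic to its composite with the projection to finitely many
   summands. Tensoring with a representable functor preserves this, because pairs
   of surjections [K -> G], [K -> H] factor through finitely many subgroups of
   [G * H]; exchanging the factors extends this to all tensor products of compact
   objects. With the Kuenneth formula it follows that, for an ultrafilter on a
   family of groups, the compact objects acyclic at almost all of them form a
   prime ideal.

   If [U] has infinitely many isomorphism classes, take an ultrafilter avoiding
   every class. For each [G], all large enough groups of [U] surject onto one of
   the finitely many groups of order [p * #|G|], hence almost all of them surject
   onto a fixed one, [H]. The functor represented by [H] vanishes at [G] but is
   not in the ultrafilter prime, which is therefore not the prime of [G].

   If [U] has finitely many classes, functors with finite-dimensional values are
   compact. The unit is an iterated extension of the functors that are [k] on one
   class and zero elsewhere, so a prime [P] misses the one of some [G]. Tensoring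
   with it shows that [P] contains every compact object acyclic at [G]. An object
   of [P] that is not acyclic at [G] would, after tensoring with the regular
   representation of the outer automorphisms of [G], have that representation as
   a retract, and then the missed functor would be in [P] as well. Functors that
   are [k] on an arbitrary set of classes show that the topology is discrete. *)
Require Import Defs.
From HB Require Import structures.
From mathcomp Require Import all_boot all_order all_algebra all_fingroup all_solvable.
From mathcomp Require Import boolp.
From mathcomp Require classical_sets filter.
From Stdlib Require Import Setoid Morphisms.

Set Implicit Arguments.
Unset Strict Implicit.
Unset Printing Implicit Defensive.

Import GRing.Theory.
Local Open Scope ring_scope.

(** * Reflexive normalization in abelian groups *)

(** Morphisms of the derived category are words without a normal form, and [deq] is generated
    inductively, so nothing can be read off a word. Words are therefore made to act on homotopy
    classes of chain maps out of a K-projective complex; the action respects every generating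
    relation, and this is what turns an equality of words into a homotopy. The resolutions are
    finite at each group. A surjection between groups of equal order is an isomorphism, so if a
    functor vanishes up to order [m], the kernel of its counit vanishes up to order [m.+1], and no
    question of convergence arises. Compactness of tensor products is proved without building
    compact objects from representables. It follows from two properties of the internal hom from one
    factor [Y]: it preserves acyclic complexes, and it commutes with direct sums in homology. Both
    concern cycles at a group [G], and such a cycle is a chain map out of the tensor product of [Y]
    with a representable complex. The case of a representable factor, applied to this product, thus
    yields the case of an arbitrary K-projective [Y]. *)

Inductive zexp := ZVar of nat | ZZero | ZAdd of zexp & zexp | ZOpp of zexp.

Fixpoint zeval (V : zmodType) (env : seq V) (e : zexp) : V :=
  match e with
  | ZVar i => nth 0 env i
  | ZZero => 0
  | ZAdd a b => zeval env a + zeval env b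
  | ZOpp a => - zeval env a
  end.

Fixpoint zcoef (e : zexp) (i : nat) : int :=
  match e with
  | ZVar j => (i == j)%:R
  | ZZero => 0
  | ZAdd a b => zcoef a i + zcoef b i
  | ZOpp a => - zcoef a i
  end.

Lemma zevalE (V : zmodType) (env : seq V) e :
  zeval env e = \sum_(i < size env) nth 0 env i *~ zcoef e i.
Proof.
elim: e => [j||a IHa b IHb|a IHa] /=.
- have [jl|jl] := ltnP j (size env).
    rewrite (bigD1 (Ordinal jl)) //= eqxx mulr1z big1 ?addr0 // => i.
    by rewrite -val_eqE /= => /negPf ->; rewrite mulr0z.
  rewrite nth_default // big1 // => i _.
  by rewrite (ltn_eqF (leq_trans (ltn_ord i) jl)) mulr0z.
- by rewrite big1 // => i _; rewrite mulr0z.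
- by rewrite IHa IHb -big_split; apply: eq_bigr => i _; rewrite mulrzDr.
- by rewrite IHa -sumrN; apply: eq_bigr => i _; rewrite mulrNz.
Qed.

Lemma zeval_eq (V : zmodType) (env : seq V) a b :
  all (fun i => zcoef a i == zcoef b i) (iota 0 (size env)) ->
  zeval env a = zeval env b.
Proof.
move/allP=> h; rewrite !zevalE; apply: eq_bigr => i _.
by rewrite (eqP (h i _)) // mem_iota /= add0n.
Qed.

(* Atoms are compared up to conversion because the same map may appear with
   different paths to the structures it involves. *)
Ltac zlook x l :=
  lazymatch l with
  | ?y :: ?l' =>
    match constr:(Set) with
    | _ => let _ := match constr:(Set) with _ => unify x y end in constr:(0%N)
    | _ => let n := zlook x l' in constr:(S n)
    end
  end.

Ltac zatoms t l :=
  lazymatch t with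
  | @Algebra.add _ ?a ?b => let l1 := zatoms a l in zatoms b l1
  | @Algebra.opp _ ?a => zatoms a l
  | @Algebra.zero _ => l
  | _ => match l with
         | _ => let _ := zlook t l in l
         | _ => constr:(cons t l)
         end
  end.

Ltac zquote t l :=
  lazymatch t with
  | @Algebra.add _ ?a ?b =>
      let a' := zquote a l in let b' := zquote b l in constr:(ZAdd a' b')
  | @Algebra.opp _ ?a => let a' := zquote a l in constr:(ZOpp a')
  | @Algebra.zero _ => constr:(ZZero)
  | _ => let n := zlook t l in constr:(ZVar n)
  end.

Ltac zmod :=
  lazymatch goal with
  | |- @eq ?T ?a ?b =>
      let l := zatoms a (@nil T) in
      let l := zatoms b l in
      let a' := zquote a l in
      let b' := zquote b l in
      refine (@zeval_eq _ l a' b' _); vm_compute; reflexivity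
  end.

(** [zby] proves an equation as a signed sum of hypotheses: each hypothesis is added with one of the
    two signs, and [zmod] closes what remains. *)
Lemma zuse (V : zmodType) (c d a b : V) : c = d -> a + c = b + d -> a = b.
Proof. by move=> -> /addIr. Qed.

Lemma zuseN (V : zmodType) (c d a b : V) : c = d -> a + d = b + c -> a = b.
Proof. by move=> -> /addIr. Qed.

Tactic Notation "zby" constr(h1) :=
  solve [apply: (zuse h1); zmod | apply: (zuseN h1); zmod].
Tactic Notation "zby" constr(h1) constr(h2) :=
  solve [apply: (zuse h1); zby h2 | apply: (zuseN h1); zby h2].
Tactic Notation "zby" constr(h1) constr(h2) constr(h3) :=
  solve [apply: (zuse h1); zby h2 h3 | apply: (zuseN h1); zby h2 h3].
Tactic Notation "zby" constr(h1) constr(h2) constr(h3) constr(h4) :=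
  solve [apply: (zuse h1); zby h2 h3 h4 | apply: (zuseN h1); zby h2 h3 h4].

(** * Modules *)

Definition mklin (k : fieldType) (V W : lmodType k) (f : V -> W)
    (fl : linear f) : {linear V -> W} :=
  HB.pack f (GRing.isLinear.Build k V W _ f fl).

Record submod (k : fieldType) (V : lmodType k) := Submod {
  submod_pred :> V -> Prop;
  submod0 : submod_pred 0;
  submodP : forall (c : k) x y, submod_pred x -> submod_pred y ->
    submod_pred (c *: x + y) }.

Section SubModule.
Context (k : fieldType) (V : lmodType k) (S : submod V).

Definition subM := {x : V | S x}.

Lemma submodN x : S x -> S (- x).
Proof. by move=> Sx; have := submodP (-1) Sx (submod0 S); rewrite scaleN1r addr0. Qed.

Lemma submodD x y : S x -> S y -> S (x + y).
Proof. by move=> Sx Sy; have := submodP 1 Sx Sy; rewrite scale1r. Qed.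

Lemma submodZ c x : S x -> S (c *: x).
Proof. by move=> Sx; have := submodP c Sx (submod0 S); rewrite addr0. Qed.

Definition sub_zero : subM := exist _ 0 (submod0 S).
Definition sub_opp (x : subM) : subM := exist _ (- sval x) (submodN (svalP x)).
Definition sub_add (x y : subM) : subM :=
  exist _ (sval x + sval y) (submodD (svalP x) (svalP y)).
Definition sub_scale c (x : subM) : subM :=
  exist _ (c *: sval x) (submodZ c (svalP x)).

Lemma sub_inj (x y : subM) : sval x = sval y -> x = y.
Proof.
by case: x y => [x Sx] [y Sy] /= e; subst y; congr exist; apply: Prop_irrelevance.
Qed.

Lemma sub_addA : associative sub_add.
Proof. by move=> x y z; apply: sub_inj; rewrite /= addrA. Qed.
Lemma sub_addC : commutative sub_add.
Proof. by move=> x y; apply: sub_inj; rewrite /= addrC. Qed.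
Lemma sub_add0 : left_id sub_zero sub_add.
Proof. by move=> x; apply: sub_inj; rewrite /= add0r. Qed.
Lemma sub_addN : left_inverse sub_zero sub_opp sub_add.
Proof. by move=> x; apply: sub_inj; rewrite /= addNr. Qed.

HB.instance Definition _ := gen_eqMixin subM.
HB.instance Definition _ := gen_choiceMixin subM.
HB.instance Definition _ :=
  GRing.isZmodule.Build subM sub_addA sub_addC sub_add0 sub_addN.

Lemma sub_scaleA a b (x : subM) : sub_scale a (sub_scale b x) = sub_scale (a * b) x.
Proof. by apply: sub_inj; rewrite /= scalerA. Qed.
Lemma sub_scale1 : left_id 1 sub_scale.
Proof. by move=> x; apply: sub_inj; rewrite /= scale1r. Qed.
Lemma sub_scaleDr : right_distributive sub_scale +%R.
Proof. by move=> c x y; apply: sub_inj; rewrite /= scalerDr. Qed.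
Lemma sub_scaleDl (x : subM) : {morph sub_scale^~ x : a b / a + b}.
Proof. by move=> a b; apply: sub_inj; rewrite /= scalerDl. Qed.

HB.instance Definition _ :=
  GRing.Zmodule_isLmodule.Build k subM sub_scaleA sub_scale1 sub_scaleDr sub_scaleDl.

Lemma sval_linear : linear (fun x : subM => sval x).
Proof. by []. Qed.

Definition subval : {linear subM -> V} := mklin sval_linear.

Lemma subvalP (x : subM) : S (subval x).
Proof. exact: svalP. Qed.

Lemma subval_inj : injective subval.
Proof. by move=> x y; apply: sub_inj. Qed.

Definition Sub_ (x : V) (Sx : S x) : subM := exist _ x Sx.

Lemma subvalK x (Sx : S x) : subval (Sub_ Sx) = x.
Proof. by []. Qed.
End SubModule.

Section Pi.
Context (k : fieldType) (I : Type) (V : I -> lmodType k).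

Definition piM := forall i, V i.

Lemma pi_ext (f g : piM) : (forall i, f i = g i) -> f = g.
Proof. exact: functional_extensionality_dep. Qed.

Definition pi_zero : piM := fun i => 0.
Definition pi_opp (f : piM) : piM := fun i => - f i.
Definition pi_add (f g : piM) : piM := fun i => f i + g i.
Definition pi_scale (c : k) (f : piM) : piM := fun i => c *: f i.

Lemma pi_addA : associative pi_add.
Proof. by move=> x y z; apply: pi_ext => i; rewrite /pi_add addrA. Qed.
Lemma pi_addC : commutative pi_add.
Proof. by move=> x y; apply: pi_ext => i; rewrite /pi_add addrC. Qed.
Lemma pi_add0 : left_id pi_zero pi_add.
Proof. by move=> x; apply: pi_ext => i; rewrite /pi_add add0r. Qed.
Lemma pi_addN : left_inverse pi_zero pi_opp pi_add.
Proof. by move=> x; apply: pi_ext => i; rewrite /pi_add addNr. Qed.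

HB.instance Definition _ := gen_eqMixin piM.
HB.instance Definition _ := gen_choiceMixin piM.
HB.instance Definition _ :=
  GRing.isZmodule.Build piM pi_addA pi_addC pi_add0 pi_addN.

Lemma pi_scaleA a b (x : piM) : pi_scale a (pi_scale b x) = pi_scale (a * b) x.
Proof. by apply: pi_ext => i; rewrite /pi_scale scalerA. Qed.
Lemma pi_scale1 : left_id 1 pi_scale.
Proof. by move=> x; apply: pi_ext => i; rewrite /pi_scale scale1r. Qed.
Lemma pi_scaleDr : right_distributive pi_scale +%R.
Proof. by move=> c x y; apply: pi_ext => i; rewrite /pi_scale scalerDr. Qed.
Lemma pi_scaleDl (x : piM) : {morph pi_scale^~ x : a b / a + b}.
Proof. by move=> a b; apply: pi_ext => i; rewrite /pi_scale scalerDl. Qed.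

HB.instance Definition _ :=
  GRing.Zmodule_isLmodule.Build k piM pi_scaleA pi_scale1 pi_scaleDr pi_scaleDl.

Lemma piD (f g : piM) i : (f + g) i = f i + g i. Proof. by []. Qed.
Lemma piZ (c : k) (f : piM) i : (c *: f) i = c *: f i. Proof. by []. Qed.
End Pi.

(** * Generalized inverses of linear maps *)

Section Regular.
Context (k : fieldType) (V W : lmodType k) (f : {linear V -> W}).

(** Graphs of partial linear maps from [W] to [V] that invert [f] wherever the argument lies in the
    image of [f]. A maximal one is total, which avoids bases and complements. *)
Record section_graph (D : W * V -> Prop) : Prop := {
  sg0 : D (0, 0);
  sgP : forall c w v w' v', D (w, v) -> D (w', v') -> D (c *: w + w', c *: v + v');
  sg_fun : forall v, D (0, v) -> v = 0;
  sg_sec : forall w v u, D (w, v) -> w = f u -> f v = w }.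

Lemma section_graph_max : exists D, section_graph D /\
  forall D', section_graph D' -> (forall z, D z -> D' z) -> forall z, D' z -> D z.
Proof.
have [|D [[Dg|D0] Dmax]] :=
  @classical_sets.Zorn_bigcup _ (fun D : W * V -> Prop => section_graph D \/ forall z, ~ D z).
- move=> F FP Ftot.
  case: (pselect (exists D, F D /\ section_graph D)) => [[D0 [FD0 gD0]]|noD]; last first.
    right=> z [D FD Dz]; case: (FP _ FD) => [g|]; last by move/(_ z).
    by apply: noD; exists D.
  left; split.
  + by exists D0 => //; case: gD0.
  + move=> c w v w' v' [D1 FD1 D1z] [D2 FD2 D2z].
    have [le|le] := Ftot _ _ FD1 FD2.
    * case: (FP _ FD2) => [g|/(_ _ D2z)//]; exists D2 => //; apply: sgP => //.
      exact: le.
    * case: (FP _ FD1) => [g|/(_ _ D1z)//]; exists D1 => //; apply: sgP => //.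
      exact: le.
  + move=> v [D FD Dz]; case: (FP _ FD) => [g|/(_ _ Dz)//]; exact: sg_fun Dz.
  + move=> w v u [D FD Dz]; case: (FP _ FD) => [g|/(_ _ Dz)//]; exact: sg_sec Dz.
- exists D; split=> // D' gD' DD' z D'z; apply: contrapT => nDz.
  apply: (Dmax D'); last by left.
  by split=> // /(_ _ D'z).
- have g0 : section_graph (fun z => z = (0, 0)).
    split=> //.
    + by move=> c w v w' v' [-> ->] [-> ->]; rewrite !scaler0 !addr0.
    + by move=> v [].
    + by move=> w v u [-> ->] _; rewrite linear0.
  exfalso; apply: (Dmax (fun z => z = (0, 0))); last by left.
  by split=> [z /D0|/(_ (0, 0) erefl)/D0].
Qed.

(** Von Neumann regularity of linear maps over a field: the common source of the functionals and of
    the contractions below. *)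
Lemma regular_linear : exists g : {linear W -> V}, forall v, f (g (f v)) = f v.
Proof.
have [D [gD Dmax]] := section_graph_max.
have total w : exists v, D (w, v).
  apply: contrapT => nw.
  (* [v0] is to be the value at [w]. If some [w1] of the domain has [w1 + w] in the image of [f],
     this fixes [v0] up to the kernel of [f]; any other such [w'] differs from [w1] by an element of
     the domain that lies in the image, where [D] already inverts [f], so the same [v0] serves. *)
  have [v0 v0P] : exists v0, forall w' v' u, D (w', v') -> w' + w = f u -> f (v' + v0) = w' + w.
    case: (pselect (exists w1 v1 u, D (w1, v1) /\ w1 + w = f u)) => [[w1 [v1 [u [D1 e1]]]]|no].
      exists (u - v1) => w' v' u' D' e'.
      have D'' : D (w' - w1, v' - v1).
        by have := sgP gD (-1) D1 D'; rewrite !scaleN1r addrC [_ + v']addrC.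
      have e : w' - w1 = f (u' - u) by rewrite linearB -e1 -e' opprD addrACA subrr addr0.
      have es := sg_sec gD D'' e.
      by rewrite addrCA linearD es -e1 addrC subrKA.
    by exists 0 => w' v' u D' e; case: no; exists w', v', u.
  pose D' (z : W * V) := exists c, D (z.1 - c *: w, z.2 - c *: v0).
  have gD' : section_graph D'.
    split.
    - by exists 0; rewrite /= !scale0r !subr0; apply: sg0.
    - move=> c w1 v1 w2 v2 [c1 /= D1] [c2 /= D2]; exists (c * c1 + c2) => /=.
      have aux (L : lmodType k) (a b z : L) :
          c *: (a - c1 *: z) + (b - c2 *: z) = c *: a + b - (c * c1 + c2) *: z.
        by rewrite scalerBr scalerA addrACA -opprD -scalerDl.
      by have := sgP gD c D1 D2; rewrite !aux.
    - move=> v [c /=]; rewrite sub0r => Dz.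
      have [c0|c0] := eqVneq c 0.
        by move: Dz; rewrite c0 !scale0r oppr0 subr0; apply: sg_fun.
      exfalso; apply: nw; exists (- c^-1 *: (v - c *: v0)).
      have := sgP gD (- c^-1) Dz (sg0 gD).
      by rewrite !addr0 scalerN scaleNr opprK scalerA mulVf // scale1r.
    - move=> w1 v1 u [c /= Dz] e.
      have [c0|c0] := eqVneq c 0.
        by move: Dz; rewrite c0 !scale0r !subr0 => Dz; apply: (sg_sec gD Dz e).
      have := sgP gD c^-1 Dz (sg0 gD).
      rewrite !addr0 => Dz'.
      have e' : c^-1 *: (w1 - c *: w) + w = f (c^-1 *: u).
        by rewrite scalerBr scalerA mulVf // scale1r subrK linearZ e.
      have := v0P _ _ _ Dz' e'.
      rewrite !scalerBr !scalerA mulVf // !scale1r !subrK linearZ => h.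
      by apply: (scalerI (a := c^-1)) => //; rewrite invr_neq0.
  case: nw; exists v0.
  apply: (Dmax D' gD') => [[w' v'] Dz|]; first by exists 0; rewrite /= !scale0r !subr0.
  by exists 1; rewrite /= !scale1r !subrr; apply: sg0.
pose g w := sval (cid (total w)).
have gP w : D (w, g w) by rewrite /g; case: cid.
have guniq w v : D (w, v) -> v = g w.
  move=> Dz; apply/eqP; rewrite -subr_eq0; apply/eqP; apply: (sg_fun gD).
  by have := sgP gD (-1) (gP w) Dz; rewrite !scaleN1r addNr addrC.
have gl : linear g.
  by move=> c x y; apply/esym/guniq; apply: sgP.
by exists (mklin gl) => v /=; apply: (sg_sec gD (gP (f v)) erefl).
Qed.
End Regular.

Section Functionals.
Context (k : fieldType) (V : lmodType k).

(** For a generalized inverse [g] of the inclusion of [S], the map [x - g x] kills [S] and not [v].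
    It is followed by a generalized inverse of the line through the image of [v]. *)
Lemma sep_functional (S : submod V) (v : V) : ~ S v ->
  exists phi : {linear V -> k^o}, (forall x, S x -> phi x = 0) /\ phi v = 1.
Proof.
move=> nSv.
have [g gP] := regular_linear (subval S).
pose v' := v - subval S (g v).
have v'0 : v' != 0.
  rewrite /v' subr_eq0; apply/eqP => e; apply: nSv; rewrite e; exact: subvalP.
have il : linear (fun c : k^o => c *: v').
  by move=> c x y; rewrite scalerDl scalerA.
have [h hP] := regular_linear (mklin il).
have h1 : h v' = 1.
  have := hP 1; rewrite /= !scale1r => e.
  apply/eqP; rewrite -subr_eq0; have: (h v' - 1) *: v' = 0 by rewrite scalerBl e scale1r subrr.
  by move/eqP; rewrite scaler_eq0 (negPf v'0) orbF.
have pl : linear (fun x => h (x - subval S (g x))).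
  move=> c x y; rewrite -linearP; congr (h _).
  by rewrite [g _]linearP [X in _ - X = _]linearP scalerBr opprD addrACA.
exists (mklin pl); split=> [x Sx|]; last exact: h1.
rewrite -[LHS]/(h (x - subval S (g x))).
by have := gP (Sub_ Sx); rewrite subvalK => ->; rewrite subrr linear0.
Qed.

Lemma functional_eq0 (v : V) :
  (forall phi : {linear V -> k^o}, phi v = 0) -> v = 0.
Proof.
move=> h; apply: contrapT => v0.
have S0 : forall (c : k) (x y : V), x = 0 -> y = 0 -> c *: x + y = 0.
  by move=> c x y -> ->; rewrite scaler0 addr0.
have [phi [_]] := @sep_functional (@Submod k V (fun x => x = 0) erefl S0) v v0.
by rewrite h => /eqP; rewrite eq_sym oner_eq0.
Qed.
End Functionals.

(* The module on generators [E] whose linear maps to [k] are the functions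
   satisfying [B]: the span of the evaluations inside the functions on [B]. *)
Section Presented.
Context (k : fieldType) (E : Type) (B : (E -> k) -> Prop).

Definition testfun := {b : E -> k | B b}.
Definition evals := piM (fun _ : testfun => k^o).

Definition evl (e : E) : evals := fun b => sval b e.

Definition evsum (l : seq (k * E)) : evals := \sum_(p <- l) p.1 *: evl p.2.

Definition is_evsum (F : evals) : Prop := exists l, F = evsum l.

Lemma is_evsum0 : is_evsum 0.
Proof. by exists [::]; rewrite /evsum big_nil. Qed.

Lemma is_evsumP c x y : is_evsum x -> is_evsum y -> is_evsum (c *: x + y).
Proof.
move=> [l ->] [l' ->]; exists ([seq (c * p.1, p.2) | p <- l] ++ l').
rewrite /evsum big_cat big_map scaler_sumr; congr (_ + _).
by apply: eq_bigr => p _; rewrite scalerA.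
Qed.

Definition pres := subM (Submod is_evsum0 is_evsumP).
HB.instance Definition _ := GRing.Lmodule.on pres.

Lemma is_evsum_evl e : is_evsum (evl e).
Proof. by exists [:: (1, e)]; rewrite /evsum big_seq1 scale1r. Qed.

Definition gen (e : E) : pres := Sub_ (S := Submod is_evsum0 is_evsumP) (is_evsum_evl e).

Lemma presE (x : pres) : exists l : seq (k * E), x = \sum_(p <- l) p.1 *: gen p.2.
Proof.
have [l lE] := svalP x; exists l; apply: sub_inj; rewrite lE /evsum.
rewrite -[RHS]/(subval _ _) linear_sum.
by apply: eq_bigr => p _; rewrite linearZ.
Qed.

Lemma pres_ind (Q : pres -> Prop) : Q 0 ->
  (forall c e x, Q x -> Q (c *: gen e + x)) -> forall x, Q x.
Proof.
move=> Q0 QS x; have [l ->] := presE x.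
elim: l => [|p l IH]; first by rewrite big_nil.
by rewrite big_cons; apply: QS.
Qed.

Section Lift.
Context (M : lmodType k) (f : E -> M).
Hypothesis fB : forall phi : {linear M -> k^o}, B (fun e => phi (f e)).

(** Functionals separate the points of [M], and each of them pulls back along [f] to a test
    function, on which equal combinations of generators agree. *)
Lemma pres_lift_wd (l l' : seq (k * E)) :
  \sum_(p <- l) p.1 *: gen p.2 = \sum_(p <- l') p.1 *: gen p.2 ->
  \sum_(p <- l) p.1 *: f p.2 = \sum_(p <- l') p.1 *: f p.2.
Proof.
move=> e; apply/eqP; rewrite -subr_eq0; apply/eqP; apply: functional_eq0 => phi.
rewrite linearB; apply/eqP; rewrite subr_eq0; apply/eqP.
pose b : testfun := exist _ _ (fB phi).
have key (s : seq (k * E)) : phi (\sum_(p <- s) p.1 *: f p.2) =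
    (subval _ (\sum_(p <- s) p.1 *: gen p.2) : evals) b.
  rewrite !linear_sum; elim: s => [|p s IH]; first by rewrite !big_nil.
  by rewrite !big_cons !linearZ piD IH.
by rewrite !key e.
Qed.

Definition pres_lift_fun (x : pres) : M :=
  \sum_(p <- sval (cid (presE x))) p.1 *: f p.2.

Lemma pres_lift_funE (l : seq (k * E)) :
  pres_lift_fun (\sum_(p <- l) p.1 *: gen p.2) = \sum_(p <- l) p.1 *: f p.2.
Proof. by rewrite /pres_lift_fun; case: cid => l' /= /esym/pres_lift_wd. Qed.

Lemma pres_lift_linear : linear pres_lift_fun.
Proof.
move=> c x y; have [l ->] := presE x; have [l' ->] := presE y.
have -> : c *: (\sum_(p <- l) p.1 *: gen p.2) + \sum_(p <- l') p.1 *: gen p.2 =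
    \sum_(p <- [seq (c * p.1, p.2) | p <- l] ++ l') p.1 *: gen p.2.
  rewrite big_cat big_map scaler_sumr; congr (_ + _).
  by apply: eq_bigr => p _; rewrite scalerA.
rewrite !pres_lift_funE big_cat big_map scaler_sumr; congr (_ + _).
by apply: eq_bigr => p _; rewrite scalerA.
Qed.

Definition pres_lift : {linear pres -> M} := mklin pres_lift_linear.

Lemma pres_liftE e : pres_lift (gen e) = f e.
Proof.
have := pres_lift_funE [:: (1, e)]; rewrite !big_seq1 /= !scale1r.
by [].
Qed.
End Lift.

Lemma pres_eq (M : lmodType k) (f g : {linear pres -> M}) :
  (forall e, f (gen e) = g (gen e)) -> forall x, f x = g x.
Proof.
move=> h; apply: pres_ind => [|c e x IH]; first by rewrite !linear0.
by rewrite !linearP h IH.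
Qed.

Lemma gen_eq (e e' : E) : (forall b, B b -> b e = b e') -> gen e = gen e'.
Proof. by move=> h; apply: sub_inj; apply: pi_ext => -[b Bb] /=; apply: h. Qed.

Lemma gen_lin (c : k) (e1 e2 e3 : E) :
  (forall b, B b -> b e3 = c * b e1 + b e2) -> gen e3 = c *: gen e1 + gen e2.
Proof. by move=> h; apply: sub_inj; apply: pi_ext => -[b Bb] /=; apply: h. Qed.
End Presented.
Arguments pres_ind {k E B}.
Arguments pres_lift : simpl never.

(** * Chain complexes *)

Section Unpred.
Context (T : int -> Type).

(** The values of [unp] compute only in degrees of the form [n - 1]; this brings an arbitrary degree
    into that form. *)
Lemma pred_ind (Q : int -> Prop) : (forall n, Q (n - 1)) -> forall n, Q n.
Proof. by move=> h n; rewrite -[n](addrK 1); apply: h. Qed.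

(* Elements of degree [n - 1] are the sources of homotopies and the cycles in
   [acyclic_at], but data on all degrees has to be indexed by [n]. *)
Definition unp (F : forall n : int, T (n - 1)) (n : int) : T n :=
  eq_rect _ T (F (n + 1)) _ (addrK 1 n).

Lemma unpE F n : unp F (n - 1) = F n.
Proof.
rewrite /unp; move: (addrK 1 (n - 1)).
have: n - 1 + 1 = n by rewrite subrK.
move: (n - 1 + 1) => m E; subst m => e.
by rewrite (eq_irrelevance e erefl).
Qed.
End Unpred.

Section Complexes.
Context (k : fieldType) (U : finGroupType -> Prop).
Implicit Types (X Y Z P A : cplx k U) (M N : psh k U).

Definition mkhom M N (f : forall G, M G -> N G) (fl : forall G, linear (f G))
    (fn : forall (G H : fam U) (a : surjection G H) x,
      f G (psh_map M a x) = psh_map N a (f H x)) : psh_hom M N :=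
  @PshHom k U M N (fun G => mklin (fl G)) fn.

Lemma zero_linear (V W : lmodType k) : linear (fun _ : V => 0 : W).
Proof. by move=> c x y; rewrite scaler0 addr0. Qed.

Lemma hom0_nat M N (G H : fam U) (a : surjection G H) (x : M H) :
  0 = psh_map N a 0.
Proof. by rewrite linear0. Qed.

Definition hom0 M N : psh_hom M N :=
  mkhom (fun G => @zero_linear (M G) (N G)) (@hom0_nat M N).

Lemma homN_linear M N (f : psh_hom M N) G : linear (fun x => - f G x).
Proof. by move=> c x y; rewrite linearP opprD scalerN. Qed.

Lemma homN_nat M N (f : psh_hom M N) (G H : fam U) (a : surjection G H) x :
  - f G (psh_map M a x) = psh_map N a (- f H x).
Proof. by rewrite psh_hom_nat linearN. Qed.

Definition homN M N (f : psh_hom M N) : psh_hom M N :=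
  mkhom (homN_linear f) (homN_nat f).

Definition mkchmap X Y (f : forall n, psh_hom (X n) (Y n))
    (fd : forall n G x, f (n - 1) G (cplx_d X n G x) = cplx_d Y n G (f n G x)) :
  chmap X Y := ChMap fd.

Lemma ch0_d X Y n G (x : X n G) : hom0 (X (n - 1)) (Y (n - 1)) G (cplx_d X n G x) =
  cplx_d Y n G (hom0 (X n) (Y n) G x).
Proof. by rewrite /= linear0. Qed.

Definition ch0 X Y : chmap X Y := mkchmap (@ch0_d X Y).

Lemma chN_d X Y (f : chmap X Y) n G (x : X n G) :
  homN (f (n - 1)) G (cplx_d X n G x) = cplx_d Y n G (homN (f n) G x).
Proof. by rewrite /= chmap_d linearN. Qed.

Definition chN X Y (f : chmap X Y) : chmap X Y := mkchmap (chN_d f).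
Definition chB X Y (f g : chmap X Y) : chmap X Y := chmap_add f (chN g).

Lemma chBE X Y (f g : chmap X Y) n G x : chB f g n G x = f n G x - g n G x.
Proof. by []. Qed.

Lemma chmap_ext X Y (f g : chmap X Y) : (forall n G x, f n G x = g n G x) -> f = g.
Proof.
case: f g => [f fd] [g gd] /= h.
have e : f = g.
  apply: functional_extensionality_dep => n.
  have: forall G x, f n G x = g n G x by exact: h.
  move: (f n) (g n) => [u un] [v vn] /= {}h.
  have e : u = v.
    apply: functional_extensionality_dep => G.
    have: forall x, u G x = v G x by exact: h.
    move: (u G) (v G) => [u' [[u1] [u2]]] [v' [[v1] [v2]]] /= {}h.
    have e : u' = v' by apply/funext.
    subst v'.
    by rewrite (Prop_irrelevance u1 v1) (Prop_irrelevance u2 v2).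
  by subst v; rewrite (Prop_irrelevance un vn).
by subst g; rewrite (Prop_irrelevance fd gd).
Qed.

Definition grhom X Y := forall n, psh_hom (X n) (Y n).
Definition htpy X Y := forall n, psh_hom (X (n - 1)) (Y n).

Definition is_htpy X Y (h : htpy X Y) (f : grhom X Y) : Prop :=
  forall n G x, f (n - 1) G x =
    cplx_d Y n G (h n G x) + h (n - 1) G (cplx_d X (n - 1) G x).

Definition nullh X Y (f : grhom X Y) : Prop := exists h, is_htpy h f.

Lemma nullh_ext X Y (f g : grhom X Y) :
  (forall n G x, f n G x = g n G x) -> nullh f -> nullh g.
Proof. by move=> e [h hP]; exists h => n G x; rewrite -e hP. Qed.

Lemma nullh0 X Y : nullh (ch0 X Y).
Proof. by exists (fun n => hom0 _ _) => n G x /=; rewrite linear0 addr0. Qed.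

Lemma nullhD X Y (f g : chmap X Y) : nullh f -> nullh g -> nullh (chmap_add f g).
Proof.
move=> [h hP] [h' h'P]; exists (fun n => psh_hom_add (h n) (h' n)) => n G x /=.
by rewrite hP h'P linearD addrACA.
Qed.

Lemma nullhN X Y (f : chmap X Y) : nullh f -> nullh (chN f).
Proof.
move=> [h hP]; exists (fun n => homN (h n)) => n G x /=.
by rewrite hP linearN opprD.
Qed.

Lemma nullhB X Y (f g : chmap X Y) : nullh f -> nullh g -> nullh (chB f g).
Proof. by move=> hf hg; apply: nullhD => //; apply: nullhN. Qed.

Lemma nullh_compl X Y Z (g : chmap Y Z) (f : chmap X Y) :
  nullh f -> nullh (chmap_comp g f).
Proof.
move=> [h hP]; exists (fun n => psh_hom_comp (g n) (h n)) => n G x /=.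
by rewrite hP linearD chmap_d.
Qed.

Lemma nullh_compr X Y Z (g : chmap Y Z) (f : chmap X Y) :
  nullh g -> nullh (chmap_comp g f).
Proof.
move=> [h hP]; exists (fun n => psh_hom_comp (h n) (f (n - 1))) => n G x /=.
by rewrite hP chmap_d.
Qed.

Definition heq X Y (f g : chmap X Y) : Prop := nullh (chB f g).

Lemma heq_refl X Y (f : chmap X Y) : heq f f.
Proof. by apply: nullh_ext (nullh0 X Y) => n G x; rewrite chBE subrr. Qed.

Lemma heq_ext X Y (f g : chmap X Y) : (forall n G x, f n G x = g n G x) -> heq f g.
Proof. by move=> h; apply: nullh_ext (nullh0 X Y) => n G x; rewrite chBE h subrr. Qed.

Lemma heq_sym X Y (f g : chmap X Y) : heq f g -> heq g f.
Proof. by move/nullhN; apply: nullh_ext => n G x; rewrite /= opprB. Qed.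

Lemma heq_trans X Y (g f h : chmap X Y) : heq f g -> heq g h -> heq f h.
Proof.
move=> h1 h2; apply: nullh_ext (nullhD h1 h2) => n G x.
by rewrite /= subrKA.
Qed.

Lemma heqD X Y (f f' g g' : chmap X Y) : heq f f' -> heq g g' ->
  heq (chmap_add f g) (chmap_add f' g').
Proof.
move=> h1 h2; apply: nullh_ext (nullhD h1 h2) => n G x.
by rewrite /= opprD addrACA.
Qed.

Lemma heqN X Y (f f' : chmap X Y) : heq f f' -> heq (chN f) (chN f').
Proof. by move=> /nullhN; apply: nullh_ext => n G x; rewrite /= opprD. Qed.

Lemma heq_comp X Y Z (g g' : chmap Y Z) (f f' : chmap X Y) :
  heq g g' -> heq f f' -> heq (chmap_comp g f) (chmap_comp g' f').
Proof.
move=> h1 h2; apply: nullh_ext (nullhD (nullh_compr f h1) (nullh_compl g' h2)) => n G x.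
by rewrite /= linearB subrKA.
Qed.

Lemma heq0 X Y (f : chmap X Y) : heq f (ch0 X Y) <-> nullh f.
Proof. by split; apply: nullh_ext => n G x; rewrite /= subr0. Qed.

(** [ct] and [dr] absorb the equations between degrees that hold only propositionally, such as
    [n + 1 - 1 = n]. *)
Definition ct X a b (e : a = b) : psh_hom (X a) (X b) :=
  eq_rect a (fun c => psh_hom (X a) (X c)) (psh_hom_id (X a)) b e.

Lemma ct_id X a (e : a = a) G x : ct X e G x = x.
Proof. by rewrite (eq_irrelevance e erefl). Qed.

Definition dr X a b (e : b = a - 1) : psh_hom (X a) (X b) :=
  psh_hom_comp (ct X (esym e)) (cplx_d X a).

Lemma dr_id X a (e : a - 1 = a - 1) G x : dr X e G x = cplx_d X a G x.
Proof. by rewrite /dr /= ct_id. Qed.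

Lemma dr_dr X a b c (e : b = a - 1) (e' : c = b - 1) G x : dr X e' G (dr X e G x) = 0.
Proof. by subst b c; rewrite !dr_id cplx_dd. Qed.

Lemma chmap_dr X Y (f : chmap X Y) a b (e : b = a - 1) G x :
  f b G (dr X e G x) = dr Y e G (f a G x).
Proof. by subst b; rewrite !dr_id chmap_d. Qed.

Lemma ct_dr X a b b' (E : b = b') (e : b = a - 1) (e' : b' = a - 1) G x :
  ct X E G (dr X e G x) = dr X e' G x.
Proof. by subst b'; rewrite ct_id (eq_irrelevance e e'). Qed.

Lemma dr_ct X a a' b (E : a = a') (e : b = a' - 1) (e' : b = a - 1) G x :
  dr X e G (ct X E G x) = dr X e' G x.
Proof. by subst a'; rewrite ct_id (eq_irrelevance e e'). Qed.

Lemma chmap_ct X Y (f : chmap X Y) a b (e : a = b) G x :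
  f b G (ct X e G x) = ct Y e G (f a G x).
Proof. by subst b. Qed.

Lemma ct_ct X a b c (e : a = b) (e' : b = c) (e'' : a = c) G x :
  ct X e' G (ct X e G x) = ct X e'' G x.
Proof. by subst b c; rewrite (eq_irrelevance e'' erefl). Qed.

Lemma unshift_e (n : int) : n - 1 + 1 = n + 1 - 1.
Proof. by rewrite subrK addrK. Qed.

Definition unshift_d X n : psh_hom (X (n + 1)) (X (n - 1 + 1)) :=
  homN (dr X (unshift_e n)).

Lemma unshift_dd X n G x : unshift_d X (n - 1) G (unshift_d X n G x) = 0.
Proof.
rewrite -[LHS]/(- dr X _ G (- dr X _ G x)) [dr _ _ G (- _)]linearN opprK.
exact: dr_dr.
Qed.

Definition unshift X : cplx k U := Cplx (@unshift_dd X).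

Definition acyclic X := forall G, acyclic_at G X.

Lemma acyclic_drP G X : acyclic_at G X -> forall a b c (e : b = a - 1) (e' : c = b - 1)
  (x : X b G), dr X e' G x = 0 -> exists y, x = dr X e G y.
Proof.
move=> aX a b c e e' x; subst b c; rewrite dr_id => /aX [y ->].
by exists y; rewrite dr_id.
Qed.

Lemma unshift_dE X n G x : cplx_d (unshift X) n G x = - dr X (unshift_e n) G x.
Proof. by []. Qed.

Lemma unshift_acyclic_at X G : acyclic_at G X -> acyclic_at G (unshift X).
Proof.
move=> aX n x; rewrite unshift_dE => /eqP; rewrite oppr_eq0 => /eqP dx0.
have [y ->] := acyclic_drP aX (unshift_e n) dx0.
by exists (- y); rewrite unshift_dE linearN opprK.
Qed.

Definition Kproj P := forall A, acyclic A -> forall f : chmap P A, nullh f.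

Section Unsh.
Context X A (f : chmap (shift X) A).

(** The transpose of [f] under the adjunction of [shift] and [unshift]. K-projectivity and
    compactness of [shift X] are reduced to those of [X] through it. *)
Definition unsh_fun : grhom X (unshift A) :=
  unp (T := fun n => psh_hom (X n) (unshift A n))
    (fun n => psh_hom_comp (ct A (esym (subrK 1 n))) (f n)).

Lemma unsh_funE n G x : unsh_fun (n - 1) G x = ct A (esym (subrK 1 n)) G (f n G x).
Proof. by rewrite /unsh_fun unpE. Qed.

Lemma unsh_d n G (x : X n G) :
  unsh_fun (n - 1) G (cplx_d X n G x) = cplx_d (unshift A) n G (unsh_fun n G x).
Proof.
move: n x; apply: pred_ind => n x.
rewrite unshift_dE !unsh_funE.
have: f (n - 1) G (- cplx_d X (n - 1) G x) = cplx_d A n G (f n G x).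
  by rewrite -chmap_d.
rewrite linearN => /eqP; rewrite eqr_oppLR => /eqP ->.
rewrite linearN; congr (- _); rewrite -(dr_id erefl).
have e : n - 1 - 1 + 1 = n - 1 by rewrite subrK.
by rewrite (ct_dr _ _ e) (dr_ct _ _ e).
Qed.

Definition unsh : chmap X (unshift A) := mkchmap unsh_d.

Lemma unsh_null : nullh unsh -> nullh f.
Proof.
move=> [h hP].
exists (fun n => homN (psh_hom_comp (ct A (subrK 1 n)) (h (n - 1)))).
move=> n G x.
have := hP (n - 1) G x; rewrite [unsh _ _ _]unsh_funE => /(congr1 (ct A (subrK 1 (n - 1)) G)).
rewrite (ct_ct _ _ erefl) ct_id => ->.
rewrite linearD unshift_dE.
have -> : cplx_d A n G (homN (psh_hom_comp (ct A (subrK 1 n)) (h (n - 1))) G x) =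
    ct A (subrK 1 (n - 1)) G (- dr A (unshift_e (n - 1)) G (h (n - 1) G x)).
  rewrite /= [LHS]linearN [RHS]linearN -[in LHS](dr_id erefl).
  have e : n - 1 = n - 1 + 1 - 1 by rewrite subrK.
  by rewrite (ct_dr _ _ e) (dr_ct _ _ e).
congr (_ + _); rewrite /= !linearN opprK.
by [].
Qed.
End Unsh.
End Complexes.

(** * Mapping cones and quasi-isomorphisms *)

Section Cones.
Context (k : fieldType) (U : finGroupType -> Prop).
Implicit Types (X Y Z P A B : cplx k U) (M N : psh k U).

Lemma unshift_acyclic A : acyclic A -> acyclic (unshift A).
Proof. by move=> aA G; apply: unshift_acyclic_at. Qed.

Lemma Kproj_shift P : Kproj P -> Kproj (shift P).
Proof.
by move=> KP A aA f; apply: unsh_null; apply: KP; apply: unshift_acyclic.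
Qed.

Definition qis_at G X Y (f : chmap X Y) : Prop := forall n,
    (forall x : X (n - 1) G, cplx_d X (n - 1) G x = 0 ->
      (exists y : Y n G, f (n - 1) G x = cplx_d Y n G y) ->
      exists x' : X n G, x = cplx_d X n G x')
    /\ (forall y : Y (n - 1) G, cplx_d Y (n - 1) G y = 0 ->
      exists (x : X (n - 1) G) (y' : Y n G),
        cplx_d X (n - 1) G x = 0 /\ y = f (n - 1) G x + cplx_d Y n G y').

Lemma quasi_isoP X Y (f : chmap X Y) : quasi_iso f <-> forall G, qis_at G f.
Proof. by split=> h n G; apply: h. Qed.

Lemma cone_acyclic_at G X Y (f : chmap X Y) : qis_at G f -> acyclic_at G (cone f).
Proof.
move=> qf n [y x] [e1 e2].
have {}e1 : cplx_d Y (n - 1) G y + f (n - 1 - 1) G x = 0 := e1.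
have dx : cplx_d X (n - 1 - 1) G x = 0 by apply/eqP; rewrite -oppr_eq0; apply/eqP.
have [|x1 ex1] := (qf (n - 1)).1 x dx.
  by exists (- y); rewrite linearN (addr0_eq e1).
have [|x2 [y' [dx2 ey]]] := (qf n).2 (y + f (n - 1) G x1).
  by rewrite linearD -chmap_d -ex1.
exists (y', x2 - x1).
have e3 : y = cplx_d Y n G y' + f (n - 1) G (x2 - x1).
  by rewrite linearB; zby ey.
have e4 : x = - cplx_d X (n - 1) G (x2 - x1).
  by rewrite linearB dx2 sub0r opprK.
by rewrite {1}e3 {1}e4.
Qed.

Lemma acyclic_cone_qis G X Y (f : chmap X Y) : acyclic_at G (cone f) -> qis_at G f.
Proof.
move=> aC n; split; last first.
  move=> y dy; have [|[y' x'] [ey ex]] := aC n (y, 0).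
    by congr pair; rewrite /= ?dy !linear0 ?addr0 ?oppr0.
  exists x', y'; split; last by rewrite [RHS]addrC.
  by apply/eqP; rewrite -oppr_eq0 -ex.
move: n; apply: pred_ind => n x dx [y ey].
have [|[y' x'] [_ ex]] := aC n (- y, x).
  by congr pair; rewrite /= ?linearN ?dx ?oppr0 // ey addNr.
by exists (- x'); rewrite linearN.
Qed.

Lemma quasi_iso_cone X Y (f : chmap X Y) : quasi_iso f <-> acyclic (cone f).
Proof.
rewrite quasi_isoP; split=> h G; [exact: cone_acyclic_at|exact: acyclic_cone_qis].
Qed.

Section ConeMaps.
Context X Y (f : chmap X Y).

Lemma cone_in_linear n G : linear (fun y : Y n G => (y, 0) : cone f n G).
Proof. by move=> c x y; congr pair; rewrite /= ?scaler0 ?addr0. Qed.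
Lemma cone_in_nat n (G H : fam U) (a : surjection G H) (y : Y n H) :
  (psh_map (Y n) a y, 0) = psh_map (cone f n) a (y, 0).
Proof. by congr pair; rewrite /= linear0. Qed.
Lemma cone_in_d n G (y : Y n G) :
  mkhom (@cone_in_linear (n - 1)) (@cone_in_nat (n - 1)) G (cplx_d Y n G y) =
  cplx_d (cone f) n G (mkhom (@cone_in_linear n) (@cone_in_nat n) G y).
Proof. by congr pair; rewrite /= !linear0 ?addr0 ?oppr0. Qed.
Definition cone_in : chmap Y (cone f) := mkchmap cone_in_d.

Lemma cone_pr_linear n G : linear (fun z : cone f n G => z.2 : shift X n G).
Proof. by []. Qed.
Lemma cone_pr_nat n (G H : fam U) (a : surjection G H) (z : cone f n H) :
  (psh_map (cone f n) a z).2 = psh_map (shift X n) a z.2.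
Proof. by []. Qed.
Lemma cone_pr_d n G (z : cone f n G) :
  mkhom (@cone_pr_linear (n - 1)) (@cone_pr_nat (n - 1)) G (cplx_d (cone f) n G z) =
  cplx_d (shift X) n G (mkhom (@cone_pr_linear n) (@cone_pr_nat n) G z).
Proof. by []. Qed.
Definition cone_pr : chmap (cone f) (shift X) := mkchmap cone_pr_d.

Section Out.
Context Z (g : chmap Y Z) (h : htpy X Z).
Hypothesis hP : is_htpy h (chmap_comp g f).

Lemma cone_out_linear n G : linear (fun z : cone f n G => g n G z.1 + h n G z.2).
Proof. by move=> c x y; rewrite !linearP scalerDr addrACA. Qed.
Lemma cone_out_nat n (G H : fam U) (a : surjection G H) (z : cone f n H) :
  g n G (psh_map (cone f n) a z).1 + h n G (psh_map (cone f n) a z).2 =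
  psh_map (Z n) a (g n H z.1 + h n H z.2).
Proof. by rewrite linearD -!psh_hom_nat. Qed.
Lemma cone_out_d n G (z : cone f n G) :
  mkhom (@cone_out_linear (n - 1)) (@cone_out_nat (n - 1)) G (cplx_d (cone f) n G z) =
  cplx_d Z n G (mkhom (@cone_out_linear n) (@cone_out_nat n) G z).
Proof.
rewrite /= !linearD /= chmap_d linearN.
have /= e := hP z.2; zby e.
Qed.
Definition cone_out : chmap (cone f) Z := mkchmap cone_out_d.
End Out.
End ConeMaps.

Section ConeMor.
Context X Y X' Y' (f : chmap X Y) (f' : chmap X' Y') (p : chmap X' X) (q : chmap Y' Y).
Context (h : htpy X' Y) (hP : is_htpy h (chB (chmap_comp q f') (chmap_comp f p))).

Lemma cone_mor_linear n G :
  linear (fun z : cone f' n G => (q n G z.1 + h n G z.2, p (n - 1) G z.2) : cone f n G).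
Proof.
move=> c x y; congr pair; last by rewrite linearP.
by rewrite /= (linearP (q n G)) (linearP (h n G)) scalerDr addrACA.
Qed.
Lemma cone_mor_nat n (G H : fam U) (a : surjection G H) (z : cone f' n H) :
  (q n G (psh_map (cone f' n) a z).1 + h n G (psh_map (cone f' n) a z).2,
   p (n - 1) G (psh_map (cone f' n) a z).2) =
  psh_map (cone f n) a (q n H z.1 + h n H z.2, p (n - 1) H z.2).
Proof. by congr pair; rewrite /= ?linearD -!psh_hom_nat. Qed.
Lemma cone_mor_d n G (z : cone f' n G) :
  mkhom (@cone_mor_linear (n - 1)) (@cone_mor_nat (n - 1)) G (cplx_d (cone f') n G z) =
  cplx_d (cone f) n G (mkhom (@cone_mor_linear n) (@cone_mor_nat n) G z).
Proof.
have e := hP z.2; rewrite chBE /= in e.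
congr pair; last by rewrite /= linearN chmap_d.
by rewrite /= !linearD linearN chmap_d; zby e.
Qed.
Definition cone_mor : chmap (cone f') (cone f) := mkchmap cone_mor_d.

(** The cone of [cone_mor] is an extension of a shift of [cone p] by [cone q]. A cycle is bounded
    first in [cone p]; what remains, corrected by the homotopy, is bounded in [cone q]. *)
Lemma cone_mor_qis_at G : qis_at G p -> qis_at G q -> qis_at G cone_mor.
Proof.
move=> qp qq; apply: acyclic_cone_qis.
have ap := cone_acyclic_at qp; have aq := cone_acyclic_at qq.
move=> n [[y x] [y' x']] e0.
have e1 : cplx_d Y (n - 1) G y + f (n - 1 - 1) G x +
    (q (n - 1 - 1) G y' + h (n - 1 - 1) G x') = 0 := congr1 (fun z => z.1.1) e0.
have e2 : - cplx_d X (n - 1 - 1) G x + p (n - 1 - 1 - 1) G x' = 0 :=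
  congr1 (fun z => z.1.2) e0.
have e3 : - (cplx_d Y' (n - 1 - 1) G y' + f' (n - 1 - 1 - 1) G x') = 0 :=
  congr1 (fun z => z.2.1) e0.
have e4 : - (- cplx_d X' (n - 1 - 1 - 1) G x') = 0 := congr1 (fun z => z.2.2) e0.
have [|[x1 x1'] E] := ap (n - 1) (- x, x').
  congr pair; first by rewrite /= linearN.
  by rewrite /=; zby e4.
have E1 : - x = cplx_d X (n - 1) G x1 + p (n - 1 - 1) G x1' := congr1 fst E.
have E2 : x' = - cplx_d X' (n - 1 - 1) G x1' := congr1 snd E.
have hp := hP x1'; rewrite chBE /= in hp.
have [|[y2 y2'] F] := aq n (y - f (n - 1) G x1 + h (n - 1) G x1', y' - f' (n - 1 - 1) G x1').
  congr pair.
    rewrite /= !linearD !linearN /= -!chmap_d.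
    have E1' := congr1 (f (n - 1 - 1) G) E1; rewrite linearN linearD in E1'.
    have E2' := congr1 (h (n - 1 - 1) G) E2; rewrite linearN in E2'.
    by zby e1 hp E2' E1'.
  rewrite /= linearB -chmap_d.
  have E2' := congr1 (f' (n - 1 - 1 - 1) G) E2; rewrite linearN in E2'.
  by zby e3 E2'.
have F1 : y - f (n - 1) G x1 + h (n - 1) G x1' =
  cplx_d Y n G y2 + q (n - 1) G y2' := congr1 fst F.
have F2 : y' - f' (n - 1 - 1) G x1' = - cplx_d Y' (n - 1) G y2' := congr1 snd F.
exists ((y2, x1), (y2', - x1')).
congr (pair (pair _ _) (pair _ _)).
- by rewrite /= linearN; zby F1.
- by rewrite /= linearN; zby E1.
- by rewrite /= linearN; zby F2.
- by rewrite /= [cplx_d _ _ _ (- _)]linearN; zby E2.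
Qed.
End ConeMor.
End Cones.

#[global] Hint Resolve deq_refl : core.

#[global] Instance deq_equiv (k : fieldType) (U : finGroupType -> Prop) (X Y : cplx k U) :
  Equivalence (@deq k U X Y).
Proof.
split=> [u|u v|u v w]; [exact: deq_refl|exact: deq_sym|exact: deq_trans].
Qed.

#[global] Instance dcomp_proper (k : fieldType) (U : finGroupType -> Prop)
    (X Y Z : cplx k U) :
  Proper (@deq k U Y Z ==> @deq k U X Y ==> @deq k U X Z) (@dcomp k U X Y Z).
Proof. by move=> v v' ev u u' eu; apply: deq_comp. Qed.

#[global] Instance dadd_proper (k : fieldType) (U : finGroupType -> Prop)
    (X Y : cplx k U) :
  Proper (@deq k U X Y ==> @deq k U X Y ==> @deq k U X Y) (@dadd k U X Y).
Proof. by move=> v v' ev u u' eu; apply: deq_add. Qed.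

#[global] Instance dopp_proper (k : fieldType) (U : finGroupType -> Prop)
    (X Y : cplx k U) : Proper (@deq k U X Y ==> @deq k U X Y) (@dopp k U X Y).
Proof. by move=> v v' ev; apply: deq_opp. Qed.

(** * Morphisms of the derived category *)

Section Words.
Context (k : fieldType) (U : finGroupType -> Prop).
Implicit Types (X Y Z P A B C : cplx k U).

Lemma deq_addr0 X Y (u : dmor X Y) : deq (dadd u (dzero X Y)) u.
Proof. by rewrite deq_addC deq_add0. Qed.

Lemma deq_addrN X Y (u : dmor X Y) : deq (dadd u (dopp u)) (dzero X Y).
Proof. by rewrite deq_addC deq_addN. Qed.

Lemma deq_idem0 X Y (u : dmor X Y) : deq (dadd u u) u -> deq u (dzero X Y).
Proof.
move=> h; have e : deq (dadd (dopp u) (dadd u u)) (dadd (dopp u) u) by rewrite h.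
by rewrite deq_addA deq_addN deq_add0 in e.
Qed.

Lemma deq_comp0l X Y Z (u : dmor X Y) : deq (dcomp (dzero Y Z) u) (dzero X Z).
Proof. by apply: deq_idem0; rewrite -deq_compDl deq_add0. Qed.

Lemma deq_comp0r X Y Z (u : dmor Y Z) : deq (dcomp u (dzero X Y)) (dzero X Z).
Proof. by apply: deq_idem0; rewrite -deq_compDr deq_add0. Qed.

Lemma deq_oppP X Y (u v : dmor X Y) : deq (dadd u v) (dzero X Y) -> deq v (dopp u).
Proof.
move=> h; have e : deq (dadd (dopp u) (dadd u v)) (dadd (dopp u) (dzero X Y)) by rewrite h.
by rewrite deq_addA deq_addN deq_add0 deq_addr0 in e.
Qed.

Lemma deq_compNl X Y Z (v : dmor Y Z) (u : dmor X Y) :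
  deq (dcomp (dopp v) u) (dopp (dcomp v u)).
Proof. by apply: deq_oppP; rewrite -deq_compDl deq_addrN deq_comp0l. Qed.

Lemma deq_map0 X Y : deq (dmap (ch0 X Y)) (dzero X Y).
Proof.
apply: deq_idem0; rewrite -deq_map_add; apply: deq_map_ext => n G x.
by rewrite /= addr0.
Qed.

Lemma deq_mapN X Y (f : chmap X Y) : deq (dmap (chN f)) (dopp (dmap f)).
Proof.
apply: deq_oppP; rewrite -deq_map_add -(deq_map0 X Y).
by apply: deq_map_ext => n G x; rewrite /= subrr.
Qed.

Lemma deq_subP X Y (u v : dmor X Y) : deq (dadd u (dopp v)) (dzero X Y) -> deq u v.
Proof.
move=> h; have e : deq (dadd (dadd u (dopp v)) v) (dadd (dzero X Y) v) by rewrite h.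
by rewrite -deq_addA deq_addN deq_add0 deq_addr0 in e.
Qed.

Lemma ch0_qis X : acyclic X -> quasi_iso (ch0 X X).
Proof.
move=> aX n G; split=> [x /aX//|y /aX[y' ->]].
by exists 0, y'; rewrite !linear0 add0r.
Qed.

(** The zero endomorphism of an acyclic complex is a quasi-isomorphism and hence becomes
    invertible. *)
Lemma acyclic_id0 X : acyclic X -> deq (did X) (dzero X X).
Proof.
move=> aX; rewrite -(deq_invl (ch0_qis aX)) deq_map0.
exact: deq_comp0r.
Qed.

Lemma cone_id_acyclic X : acyclic (cone (chmap_id X)).
Proof.
move=> G n [y x] e.
have e1 : cplx_d X (n - 1) G y + x = 0 := congr1 fst e.
exists (0, y); congr pair; first by rewrite /= linear0 add0r.
by rewrite /=; zby e1.
Qed.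

Section NullFactor.
Context X Y (f : chmap X Y) (h : htpy X Y) (hP : is_htpy h f).

Definition null_out : chmap (cone (chmap_id X)) Y :=
  @cone_out k U X X (chmap_id X) Y f h hP.

Lemma null_outE n G x : null_out n G (cone_in (chmap_id X) n G x) = f n G x.
Proof. by rewrite /= linear0 addr0. Qed.
End NullFactor.

(** A null-homotopy factors [f] through the cone of the identity, which is acyclic. *)
Lemma nullh_deq X Y (f : chmap X Y) : nullh f -> deq (dmap f) (dzero X Y).
Proof.
move=> [h hP].
have -> : deq (dmap f) (dcomp (dmap (null_out hP)) (dmap (cone_in (chmap_id X)))).
  rewrite -deq_map_comp; apply: deq_map_ext => n G x.
  by rewrite -[LHS](null_outE hP).
rewrite -(deq_comp1l (dmap (cone_in _))) (acyclic_id0 (cone_id_acyclic (X := X))).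
by rewrite deq_comp0l deq_comp0r.
Qed.

Lemma heq_deq X Y (f g : chmap X Y) : heq f g -> deq (dmap f) (dmap g).
Proof.
move=> /nullh_deq h; apply: deq_subP; rewrite -h -deq_mapN -deq_map_add.
exact: deq_refl.
Qed.

(** Since [cone q] is acyclic, [f] followed by the inclusion into it is null-homotopic. One
    component of the homotopy is the lift [g], the other is a homotopy from [f] to [q g]. *)
Lemma Kproj_lift P A B (q : chmap A B) : Kproj P -> quasi_iso q ->
  forall f : chmap P B, exists g : chmap P A, heq f (chmap_comp q g).
Proof.
move=> KP qq f.
have [h hP] := KP _ ((quasi_iso_cone q).1 qq) (chmap_comp (cone_in q) f).
have h2nat n (G H : fam U) (a : surjection G H) (x : P (n - 1) H) :
    (h n G (psh_map (P (n - 1)) a x)).2 = psh_map (A (n - 1)) a (h n H x).2.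
  by rewrite psh_hom_nat.
have h2lin n G : linear (fun x : P (n - 1) G => (h n G x).2 : A (n - 1) G).
  by move=> c x y; rewrite linearP.
have h1nat n (G H : fam U) (a : surjection G H) (x : P (n - 1) H) :
    (h n G (psh_map (P (n - 1)) a x)).1 = psh_map (B n) a (h n H x).1.
  by rewrite psh_hom_nat.
have h1lin n G : linear (fun x : P (n - 1) G => (h n G x).1 : B n G).
  by move=> c x y; rewrite linearP.
pose g := unp (T := fun n => psh_hom (P n) (A n)) (fun n => mkhom (h2lin n) (h2nat n)).
have gE n G x : g (n - 1) G x = (h n G x).2 by rewrite /g unpE.
have gd n G x : g (n - 1) G (cplx_d P n G x) = cplx_d A n G (g n G x).
  move: n x; apply: pred_ind => n x; rewrite !gE.
  have := congr1 snd (hP n G x); rewrite /= => e.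
  by zby e.
exists (mkchmap gd), (fun n => mkhom (h1lin n) (h1nat n)) => n G x.
rewrite /= gE; have := congr1 fst (hP n G x); rewrite /= => e.
by zby e.
Qed.

(** Up to sign, [g] and a null-homotopy [t] of [q g] are the components of a chain map from
    [shift P] to the acyclic [cone q]; a component of its null-homotopy contracts [g]. *)
Lemma Kproj_faith P A B (q : chmap A B) : Kproj P -> quasi_iso q ->
  forall g : chmap P A, nullh (chmap_comp q g) -> nullh g.
Proof.
move=> KP qq g [t tP].
have zl n G : linear (fun x : shift P n G => (- t n G x, g (n - 1) G x) : cone q n G).
  by move=> c x y; congr pair; rewrite /= ?(linearP (t n G)) ?(linearP (g _ G)) // opprD scalerN.
have zn n (G H : fam U) (a : surjection G H) (x : shift P n H) :
    (- t n G (psh_map (shift P n) a x), g (n - 1) G (psh_map (shift P n) a x)) =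
    psh_map (cone q n) a (- t n H x, g (n - 1) H x).
  by congr pair; rewrite /= !psh_hom_nat // linearN.
have zd n G (x : shift P n G) :
    mkhom (@zl (n - 1)) (@zn (n - 1)) G (cplx_d (shift P) n G x) =
    cplx_d (cone q) n G (mkhom (@zl n) (@zn n) G x).
  have := tP n G x; rewrite /= => e.
  congr pair; last by rewrite /= linearN chmap_d.
  by rewrite /= (linearN (t (n - 1) G)) (linearN (cplx_d B n G)); zby e.
have [h hP] := Kproj_shift KP ((quasi_iso_cone q).1 qq) (mkchmap zd).
have h2lin n G : linear (fun x : P (n - 1 - 1) G => - (h n G x).2 : A (n - 1) G).
  by move=> c x y; rewrite linearP /= opprD scalerN.
have h2nat n (G H : fam U) (a : surjection G H) (x : P (n - 1 - 1) H) :
    - (h n G (psh_map (P (n - 1 - 1)) a x)).2 = psh_map (A (n - 1)) a (- (h n H x).2).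
  by rewrite [h n G _]psh_hom_nat linearN.
exists (unp (T := fun n => psh_hom (P (n - 1)) (A n)) (fun n => mkhom (h2lin n) (h2nat n))).
move=> n; move: n; apply: pred_ind => n G x; rewrite !unpE /=.
have e1 := congr1 snd (hP n G x).
have {}e1 : g (n - 1 - 1) G x = - cplx_d A (n - 1) G (h n G x).2 +
   (h (n - 1) G (- cplx_d P (n - 1 - 1) G x)).2 := e1.
have e2 : (h (n - 1) G (- cplx_d P (n - 1 - 1) G x)).2 =
    - (h (n - 1) G (cplx_d P (n - 1 - 1) G x)).2 by rewrite (linearN (h (n - 1) G)).
by rewrite e1 e2 (linearN (cplx_d A (n - 1) G)).
Qed.

Lemma heq_faith P A B (q : chmap A B) : Kproj P -> quasi_iso q ->
  forall g g' : chmap P A, heq (chmap_comp q g) (chmap_comp q g') -> heq g g'.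
Proof.
move=> KP qq g g' e; apply: (Kproj_faith KP qq).
by apply: nullh_ext e => n G x; rewrite /= linearB.
Qed.

(** Subtracting a null-homotopy of the restriction to [Y] leaves a chain map out of [shift X], which
    is K-projective too. *)
Lemma Kproj_cone X Y (f : chmap X Y) : Kproj X -> Kproj Y -> Kproj (cone f).
Proof.
move=> KX KY A aA g.
have [h hP] := KY A aA (chmap_comp g (cone_in f)).
have gl n G : linear (fun x : shift X n G => g n G (0, x) - h n G (f (n - 1) G x)).
  move=> c x y; rewrite (linearP (f (n - 1) G)) (linearP (h n G)).
  have -> : g n G (0, c *: x + y) = c *: g n G (0, x) + g n G (0, y).
    by rewrite -linearP; congr (g n G _); congr pair; rewrite /= ?scaler0 ?addr0.
  by rewrite scalerBr; zmod.
have gn n (G H : fam U) (a : surjection G H) (x : shift X n H) :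
    g n G (0, psh_map (shift X n) a x) - h n G (f (n - 1) G (psh_map (shift X n) a x)) =
    psh_map (A n) a (g n H (0, x) - h n H (f (n - 1) H x)).
  rewrite linearB -!psh_hom_nat; congr (g n G _ - _).
  by congr pair; rewrite /= linear0.
have gd n G (x : shift X n G) :
    mkhom (@gl (n - 1)) (@gn (n - 1)) G (cplx_d (shift X) n G x) =
    cplx_d A n G (mkhom (@gl n) (@gn n) G x).
  have e : g (n - 1) G (f (n - 1) G x, 0) = cplx_d A n G (h n G (f (n - 1) G x)) +
      h (n - 1) G (cplx_d Y (n - 1) G (f (n - 1) G x)) := hP n G (f (n - 1) G x).
  have eg := chmap_d g (0, x : X (n - 1) G).
  have ec : cplx_d (cone f) n G (0, x) = (0, - cplx_d X (n - 1) G x) + (f (n - 1) G x, 0).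
    by congr pair; rewrite /= ?linear0 ?addr0.
  rewrite ec (linearD (g (n - 1) G)) in eg.
  rewrite -[LHS]/(g (n - 1) G (0, - cplx_d X (n - 1) G x) -
     h (n - 1) G (f (n - 1 - 1) G (- cplx_d X (n - 1) G x))).
  rewrite -[RHS]/(cplx_d A n G (g n G (0, x) - h n G (f (n - 1) G x))).
  rewrite (linearN (f (n - 1 - 1) G)) (linearN (h (n - 1) G)) (linearB (cplx_d A n G)).
  by rewrite -chmap_d in e; zby e eg.
have [t tP] := Kproj_shift KX aA (mkchmap gd).
have rl n G : linear (fun z : cone f (n - 1) G => h n G z.1 + t n G z.2).
  by move=> c x y; rewrite !linearP scalerDr addrACA.
have rn n (G H : fam U) (a : surjection G H) (z : cone f (n - 1) H) :
    h n G (psh_map (cone f (n - 1)) a z).1 + t n G (psh_map (cone f (n - 1)) a z).2 =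
    psh_map (A n) a (h n H z.1 + t n H z.2).
  by rewrite linearD -!psh_hom_nat.
exists (fun n => mkhom (@rl n) (@rn n)) => n G [y x].
have e1 : g (n - 1) G (y, 0) = cplx_d A n G (h n G y) + h (n - 1) G (cplx_d Y (n - 1) G y) :=
  hP n G y.
have e2 : g (n - 1) G (0, x) - h (n - 1) G (f (n - 1 - 1) G x) =
  cplx_d A n G (t n G x) + t (n - 1) G (- cplx_d X (n - 1 - 1) G x) := tP n G x.
have -> : (y, x) = (y, 0) + (0, x) :> cone f (n - 1) G.
  by congr pair; rewrite /= ?addr0 ?add0r.
rewrite linearD /= addr0 add0r (linearD (cplx_d A n G)) (linearD (h (n - 1) G)).
by zby e1 e2.
Qed.
End Words.

(** * Acyclicity in triangles, and rotation of triangles *)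

Section Rotations.
Context (k : fieldType) (U : finGroupType -> Prop).
Implicit Types (X Y Z P A B C : cplx k U).

Lemma acyclic_at_shift G X : acyclic_at G (shift X) <-> acyclic_at G X.
Proof.
split=> aX.
  apply: pred_ind => n x dx.
  have [|y ->] := aX n x; first by rewrite /= dx oppr0.
  by exists (- y); rewrite /= linearN.
move=> n x dx; have [|y ->] := aX (n - 1) x.
  by apply/eqP; rewrite -oppr_eq0; apply/eqP.
by exists (- y); rewrite /= linearN opprK.
Qed.

Lemma acyclic_at_cone G X Y (f : chmap X Y) :
  acyclic_at G X -> acyclic_at G Y -> acyclic_at G (cone f).
Proof.
move=> aX aY; apply: cone_acyclic_at => n; split=> [x /aX //|y /aY[y' ->]].
by exists 0, y'; rewrite !linear0 add0r.
Qed.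

Lemma acyclic_at_cone_src G X Y (f : chmap X Y) :
  acyclic_at G Y -> acyclic_at G (cone f) -> acyclic_at G X.
Proof.
move=> aY /acyclic_cone_qis qf n x dx; apply: (qf n).1 => //.
by apply: aY; rewrite -chmap_d dx linear0.
Qed.

Lemma acyclic_at_cone_tgt G X Y (f : chmap X Y) :
  acyclic_at G X -> acyclic_at G (cone f) -> acyclic_at G Y.
Proof.
move=> aX /acyclic_cone_qis qf n y dy.
have [x [y' [/aX[x' ->] ->]]] := (qf n).2 y dy.
by exists (f n G x' + y'); rewrite linearD chmap_d.
Qed.

Context (X Y : cplx k U) (f : chmap X Y).

(** Up to quasi-isomorphism the cone of [cone_in f] is [shift X] and that of [cone_pr f] is
    [shift Y]. Two-out-of-three for compact objects is reduced to [compact_cone] by these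
    rotations. *)
Lemma rot_in_linear n G : linear (fun z : cone (cone_in f) n G => z.1.2 : shift X n G).
Proof. by []. Qed.
Lemma rot_in_nat n (G H : fam U) (a : surjection G H) (z : cone (cone_in f) n H) :
  (psh_map (cone (cone_in f) n) a z).1.2 = psh_map (shift X n) a z.1.2.
Proof. by []. Qed.
Lemma rot_in_d n G (z : cone (cone_in f) n G) :
  mkhom (@rot_in_linear (n - 1)) (@rot_in_nat (n - 1)) G (cplx_d _ n G z) =
  cplx_d (shift X) n G (mkhom (@rot_in_linear n) (@rot_in_nat n) G z).
Proof. by rewrite /= addr0. Qed.
Definition rot_in : chmap (cone (cone_in f)) (shift X) := mkchmap rot_in_d.

Lemma rot_in_qis : quasi_iso rot_in.
Proof.
move=> n G; split.
  move=> [[y x] y'] dz [x0 ex].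
  have e1 : cplx_d Y (n - 1) G y + f (n - 1 - 1) G x + y' = 0 := congr1 (fun z => z.1.1) dz.
  have {}ex : x = - cplx_d X (n - 1) G x0 := ex.
  exists ((0, x0), y - f (n - 1) G x0).
  congr (pair (pair _ _) _); rewrite //=; first by rewrite linear0; zmod.
    by rewrite addr0.
  have e2 := congr1 (f (n - 1 - 1) G) ex; rewrite linearN in e2.
  by rewrite linearB -chmap_d; zby e1 e2.
move=> x dx; exists ((0, x), - f (n - 1 - 1) G x), 0.
have {}dx : - cplx_d X (n - 1 - 1) G x = 0 := dx.
split; last by rewrite linear0 addr0.
congr (pair (pair _ _) _); rewrite /= ?addr0 //; first by rewrite linear0; zmod.
by rewrite linearN opprK -chmap_d -[cplx_d X _ G x]opprK dx oppr0 linear0.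
Qed.

Lemma rot_pr_linear n G :
  linear (fun z : cone (cone_pr f) n G => z.2.1 + f (n - 1) G z.1 : shift Y n G).
Proof. by move=> c x y; rewrite (linearP (f (n - 1) G)) scalerDr addrACA. Qed.
Lemma rot_pr_nat n (G H : fam U) (a : surjection G H) (z : cone (cone_pr f) n H) :
  (psh_map (cone (cone_pr f) n) a z).2.1 + f (n - 1) G (psh_map (cone (cone_pr f) n) a z).1 =
  psh_map (shift Y n) a (z.2.1 + f (n - 1) H z.1).
Proof. by rewrite linearD -psh_hom_nat. Qed.
Lemma rot_pr_d n G (z : cone (cone_pr f) n G) :
  mkhom (@rot_pr_linear (n - 1)) (@rot_pr_nat (n - 1)) G (cplx_d _ n G z) =
  cplx_d (shift Y) n G (mkhom (@rot_pr_linear n) (@rot_pr_nat n) G z).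
Proof.
case: z => x [y x'].
rewrite -[LHS]/(- (cplx_d Y (n - 1) G y + f (n - 1 - 1) G x') +
  f (n - 1 - 1) G (- cplx_d X (n - 1) G x + x')).
rewrite -[RHS]/(- cplx_d Y (n - 1) G (y + f (n - 1) G x)).
rewrite (linearD (f (n - 1 - 1) G)) (linearN (f (n - 1 - 1) G)).
by rewrite (linearD (cplx_d Y (n - 1) G)) -chmap_d; zmod.
Qed.
Definition rot_pr : chmap (cone (cone_pr f)) (shift Y) := mkchmap rot_pr_d.

Lemma rot_pr_qis : quasi_iso rot_pr.
Proof.
move=> n G; split.
  move=> [x [y x']] dz [y0 ey].
  have e1 : - cplx_d X (n - 1 - 1) G x + x' = 0 := congr1 (fun z => z.1) dz.
  have {}ey : y + f (n - 1 - 1) G x = - cplx_d Y (n - 1) G y0 := ey.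
  exists (0, (y0, x)).
  congr (pair _ (pair _ _)); rewrite /=.
  - by rewrite linear0 oppr0 add0r.
  - by zby ey.
  - by zby e1.
move=> y dy; have {}dy : - cplx_d Y (n - 1 - 1) G y = 0 := dy.
exists (0, (y, 0)), 0; split; last by rewrite /= !linear0 !addr0.
by congr (pair _ (pair _ _)); rewrite /= ?linear0 ?oppr0 ?addr0.
Qed.
End Rotations.

(** * The action of words on homotopy classes *)

Section Action.
Context (k : fieldType) (U : finGroupType -> Prop) (P : cplx k U).
Implicit Types (X Y Z A B C : cplx k U).

(* The action of a word on homotopy classes of maps out of [P], as a relation;
   it is the graph of a function when [P] is K-projective. *)
Fixpoint act X Y (u : dmor X Y) : chmap P X -> chmap P Y -> Prop :=
  match u in dmor X Y return chmap P X -> chmap P Y -> Prop with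
  | dmap _ _ f => fun a b => heq b (chmap_comp f a)
  | dinv _ _ f _ => fun a b => heq (chmap_comp f b) a
  | dcomp _ _ _ v u => fun a c => exists b, act u a b /\ act v b c
  | dzero _ _ => fun _ b => nullh b
  | dopp _ _ u => fun a b => act u a (chN b)
  | dadd _ _ u v => fun a b =>
      exists b1 b2, [/\ act u a b1, act v a b2 & heq b (chmap_add b1 b2)]
  end.

Lemma act_heq X Y (u : dmor X Y) a a' b b' :
  act u a b -> heq a a' -> heq b b' -> act u a' b'.
Proof.
elim: u a a' b b' => {X Y} /=.
- move=> X Y f a a' b b' h1 h2 h3; apply: heq_trans (heq_sym h3) _.
  by apply: heq_trans h1 _; apply: heq_comp => //; apply: heq_refl.
- move=> X Y f qf a a' b b' h1 h2 h3; apply: heq_trans h2.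
  by apply: heq_trans h1; apply: heq_comp (heq_refl _) (heq_sym h3).
- move=> X Y Z v IHv u IHu a a' c c' [b [h1 h2]] ha hc; exists b; split.
    exact: IHu h1 ha (heq_refl _).
  exact: IHv h2 (heq_refl _) hc.
- move=> X Y a a' b b' h _ hb; apply/heq0; apply: heq_trans (heq_sym hb) _.
  by apply/heq0.
- move=> X Y u IHu a a' b b' h1 ha hb; apply: IHu h1 ha _; exact: heqN.
- move=> X Y u IHu v IHv a a' b b' [b1 [b2 [h1 h2 h3]]] ha hb; exists b1, b2; split.
  + exact: IHu h1 ha (heq_refl _).
  + exact: IHv h2 ha (heq_refl _).
  + exact: heq_trans (heq_sym hb) h3.
Qed.

Lemma chNK X Y (f : chmap X Y) : chN (chN f) = f.
Proof. by apply: chmap_ext => n G x; rewrite /= opprK. Qed.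

Lemma act_word X Y (u : dmor X Y) a b :
  act u a b -> deq (dcomp u (dmap a)) (dmap b).
Proof.
elim: u a b => {X Y} /=.
- by move=> X Y f a b /heq_deq ->; rewrite deq_map_comp.
- move=> X Y f qf a b /heq_deq <-.
  by rewrite deq_map_comp deq_compA deq_invl deq_comp1l.
- by move=> X Y Z v IHv u IHu a c [b [/IHu h1 /IHv h2]]; rewrite -deq_compA h1 h2.
- by move=> X Y a b /nullh_deq ->; rewrite deq_comp0l.
- by move=> X Y u IHu a b /IHu h; rewrite deq_compNl h -deq_mapN chNK.
- move=> X Y u IHu v IHv a b [b1 [b2 [/IHu h1 /IHv h2 /heq_deq ->]]].
  by rewrite deq_compDl h1 h2 deq_map_add.
Qed.

(** This is what the relation [deq_compDr] demands of the action. *)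
Lemma act_add X Y (u : dmor X Y) a a' b b' :
  act u a b -> act u a' b' -> act u (chmap_add a a') (chmap_add b b').
Proof.
have compD A B (g : chmap A B) (f f' : chmap P A) :
    chmap_comp g (chmap_add f f') = chmap_add (chmap_comp g f) (chmap_comp g f').
  by apply: chmap_ext => n G x; rewrite /= linearD.
elim: u a a' b b' => {X Y} /=.
- by move=> X Y f a a' b b' h1 h2; rewrite compD; apply: heqD.
- by move=> X Y f qf a a' b b' h1 h2; rewrite compD; apply: heqD.
- move=> X Y Z v IHv u IHu a a' c c' [b [h1 h2]] [b' [h1' h2']].
  by exists (chmap_add b b'); split; [apply: IHu|apply: IHv].
- by move=> X Y a a' b b' h h'; apply: nullhD.
- move=> X Y u IHu a a' b b' h h'.
  have -> : chN (chmap_add b b') = chmap_add (chN b) (chN b').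
    by apply: chmap_ext => n G x; rewrite /= opprD.
  exact: IHu.
- move=> X Y u IHu v IHv a a' b b' [b1 [b2 [h1 h2 h3]]] [b1' [b2' [h1' h2' h3']]].
  exists (chmap_add b1 b1'), (chmap_add b2 b2'); split; [exact: IHu|exact: IHv|].
  apply: heq_trans (heqD h3 h3') _; apply: heq_ext => n G x.
  by rewrite /= addrACA.
Qed.

Hypothesis KP : Kproj P.

Lemma act_total X Y (u : dmor X Y) a : exists b, act u a b.
Proof.
elim: u a => {X Y} /=.
- by move=> X Y f a; exists (chmap_comp f a); apply: heq_refl.
- move=> X Y f qf a; have [b hb] := Kproj_lift KP qf a.
  by exists b; apply: heq_sym.
- move=> X Y Z v IHv u IHu a; have [b hb] := IHu a; have [c hc] := IHv b.
  by exists c, b.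
- by move=> X Y a; exists (ch0 _ _); apply: nullh0.
- by move=> X Y u IHu a; have [b hb] := IHu a; exists (chN b); rewrite chNK.
- move=> X Y u IHu v IHv a; have [b hb] := IHu a; have [c hc] := IHv a.
  by exists (chmap_add b c), b, c; split=> //; apply: heq_refl.
Qed.

Lemma act_fun X Y (u : dmor X Y) a b b' : act u a b -> act u a b' -> heq b b'.
Proof.
elim: u a b b' => {X Y} /=.
- by move=> X Y f a b b' h1 h2; apply: heq_trans h1 (heq_sym h2).
- by move=> X Y f qf a b b' h1 h2; apply: (heq_faith KP qf); apply: heq_trans h1 (heq_sym h2).
- move=> X Y Z v IHv u IHu a c c' [b [h1 h2]] [b' [h1' h2']].
  apply: IHv h2' => //; apply: act_heq h2 _ (heq_refl _); exact: IHu h1 h1'.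
- by move=> X Y a b b' h h'; apply: nullhB.
- by move=> X Y u IHu a b b' h h'; rewrite -[b]chNK -[b']chNK; apply: heqN; apply: IHu h h'.
- move=> X Y u IHu v IHv a b b' [b1 [b2 [h1 h2 h3]]] [b1' [b2' [h1' h2' h3']]].
  apply: heq_trans h3 _; apply: heq_trans (heq_sym h3'); apply: heqD.
    exact: IHu h1 h1'.
  exact: IHv h2 h2'.
Qed.

(** Each generating relation of [deq] is checked for the action. Applied to the identity of [P], the
    result recovers a chain map from its class in the derived category up to homotopy
    ([deq_heq]). *)
Lemma act_deq X Y (u v : dmor X Y) : deq u v -> forall a b b',
  act u a b -> act v a b' -> heq b b'.
Proof.
have compr A B (u' : dmor A B) a b c : act u' a b -> heq c b -> act u' a c.
  by move=> h h'; apply: act_heq h (heq_refl _) (heq_sym h').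
have compl A B (u' : dmor A B) a b c : act u' a b -> heq c a -> act u' c b.
  by move=> h h'; apply: act_heq h (heq_sym h') (heq_refl _).
elim=> {X Y u v} /=.
- by move=> X Y u a b b'; apply: act_fun.
- by move=> X Y u v _ IH a b b' h h'; apply: heq_sym; apply: IH h' h.
- move=> X Y u v w _ IH1 _ IH2 a b b' h h'; have [c hc] := act_total v a.
  exact: heq_trans (IH1 _ _ _ h hc) (IH2 _ _ _ hc h').
- move=> X Y Z v v' u u' _ IHv _ IHu a c c' [b [h1 h2]] [b' [h1' h2']].
  by apply: IHv h2 _; apply: compl h2' _; apply: IHu h1 h1'.
- move=> X Y u u' _ IH a b b' h h'; rewrite -[b]chNK -[b']chNK.
  by apply: heqN; apply: IH h h'.
- move=> X Y u u' v v' _ IHu _ IHv a b b' [b1 [b2 [h1 h2 h3]]] [b1' [b2' [h1' h2' h3']]].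
  apply: heq_trans h3 _; apply: heq_trans (heq_sym h3'); apply: heqD.
    exact: IHu h1 h1'.
  exact: IHv h2 h2'.
- move=> X Y Z W w v u a d d' [c [[b [h1 h2]] h3]] [b' [h1' [c' [h2' h3']]]].
  apply: act_fun h3 (compl _ _ _ _ _ _ h3' _).
  exact: act_fun h2 (compl _ _ _ _ _ _ h2' (act_fun h1 h1')).
- move=> X Y u a b b' [c [h1 h2]] h; apply: heq_trans h2 _.
  by apply: heq_trans (act_fun h1 h); apply: heq_ext.
- move=> X Y u a b b' [c [h1 h2]] h; apply: act_fun h2 (compl _ _ _ _ _ _ h _).
  by apply: heq_trans h1 _; apply: heq_ext.
- move=> X Y u v w a b b' [b1 [b2 [h1 [c1 [c2 [h2 h3 h4]]] h5]]].
  move=> [b1' [b2' [[c1' [c2' [h1' h2' h3']]] h4' h5']]].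
  apply: heq_trans h5 _; apply: heq_trans (heq_sym h5').
  apply: heq_trans (heqD (heq_refl _) h4) _.
  apply: heq_trans (heq_sym (heqD h3' (heq_refl _))).
  have e1 := act_fun h1 h1'; have e2 := act_fun h2 h2'; have e3 := act_fun h3 h4'.
  apply: heq_trans (heqD e1 (heqD e2 e3)) _.
  by apply: heq_ext => n G x; rewrite /= addrA.
- move=> X Y u v a b b' [b1 [b2 [h1 h2 h3]]] [b1' [b2' [h1' h2' h3']]].
  apply: heq_trans h3 _; apply: heq_trans (heq_sym h3').
  apply: heq_trans (heqD (act_fun h1 h2') (act_fun h2 h1')) _.
  by apply: heq_ext => n G x; rewrite /= addrC.
- move=> X Y u a b b' [b1 [b2 [h1 h2 h3]]] h; apply: heq_trans h3 _.
  apply: heq_trans (heqD ((heq0 _).2 h1) (act_fun h2 h)) _.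
  by apply: heq_ext => n G x; rewrite /= add0r.
- move=> X Y u a b b' [b1 [b2 [h1 h2 h3]]] h; apply: heq_trans h3 _.
  apply: heq_trans (heqD (heq_refl b1) (heq_sym (act_fun h1 h2))) _.
  apply: heq_trans (heq_sym ((heq0 _).2 h)); apply: heq_ext => n G x.
  by rewrite /= subrr.
- move=> X Y Z v v' u a c c' [b [h1 [c1 [c2 [h2 h3 h4]]]]].
  move=> [c1' [c2' [[b1 [e1 e2]] [b2 [e3 e4]] e5]]].
  apply: heq_trans h4 _; apply: heq_trans (heq_sym e5); apply: heqD.
    exact: act_fun h2 (compl _ _ _ _ _ _ e2 (act_fun h1 e1)).
  exact: act_fun h3 (compl _ _ _ _ _ _ e4 (act_fun h1 e3)).
- move=> X Y Z v u u' a c c' [b [[b1 [b2 [h1 h2 h3]]] h4]].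
  move=> [c1' [c2' [[b1' [e1 e2]] [b2' [e3 e4]] e5]]].
  apply: heq_trans (heq_sym e5).
  apply: act_fun h4 (compl _ _ _ _ _ _ (act_add e2 e4) _).
  apply: heq_trans h3 _; apply: heqD; [exact: act_fun h1 e1|exact: act_fun h2 e3].
- move=> X Y f g e a b b' h h'; apply: heq_trans h _; apply: heq_trans (heq_sym h').
  by apply: heq_ext => n G x; rewrite /= e.
- move=> X Y Z g f a b b' h [c [h1 h2]]; apply: heq_trans h _.
  apply: heq_trans (heq_sym h2).
  apply: heq_trans (heq_comp (heq_refl g) (heq_sym h1)); exact: heq_ext.
- move=> X Y f g a b b' h [b1 [b2 [h1 h2 h3]]]; apply: heq_trans h _.
  apply: heq_trans (heq_sym h3); apply: heq_trans (heq_sym (heqD h1 h2)).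
  exact: heq_ext.
- move=> X Y f qf a b b' [c [h1 h2]] h; apply: (heq_faith KP qf).
  apply: heq_trans h2 _; apply: heq_trans h1 _.
  apply: heq_comp (heq_refl _) (heq_sym _); apply: heq_trans h _; exact: heq_ext.
- move=> X Y f qf a b b' [c [h1 h2]] h; apply: heq_trans h2 _.
  apply: heq_trans h1 _; apply: heq_sym; apply: heq_trans h _; exact: heq_ext.
Qed.

Lemma deq_heq X (f g : chmap P X) : deq (dmap f) (dmap g) -> heq f g.
Proof.
move=> e; apply: (act_deq e (a := chmap_id P)); exact: heq_ext.
Qed.

Lemma word_lift X Y (v : dmor X Y) (f : chmap P X) :
  exists g : chmap P Y, deq (dcomp v (dmap f)) (dmap g).
Proof. by have [g /act_word] := act_total v f; exists g. Qed.

End Action.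

(** * Surjections of finite groups *)

Section Surjections.

Definition mksurj (G H : finGroupType) (f : G -> H)
    (fM : {morph f : x y / (x * y)%g}) (fs : forall y, exists x, f x = y) :
    surjection G H :=
  @Surjection G H (HB.pack f (isMultiplicative.Build G H f fM)) fs.

Lemma surj_ext (G H : finGroupType) (a b : surjection G H) :
  (forall x, a x = b x) -> a = b.
Proof.
case: a b => [[a [[aM]]] ao] [[b [[bM]]] bo] /= h.
have e : a = b by apply/funext.
by subst b; rewrite (Prop_irrelevance aM bM) (Prop_irrelevance ao bo).
Qed.

Lemma surjM (G H : finGroupType) (a : surjection G H) x y :
  a (x * y)%g = (a x * a y)%g.
Proof. exact: gmulfM. Qed.

Lemma surj1 (G H : finGroupType) (a : surjection G H) : a 1%g = 1%g.
Proof. by apply: (mulgI (a 1%g)); rewrite -surjM !mulg1. Qed.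

Lemma surjV (G H : finGroupType) (a : surjection G H) x : a x^-1%g = (a x)^-1%g.
Proof. by apply: (mulgI (a x)); rewrite -surjM !mulgV surj1. Qed.

Lemma surjJ (G H : finGroupType) (a : surjection G H) x y : a (x ^ y)%g = (a x ^ a y)%g.
Proof. by rewrite !conjgE !surjM surjV. Qed.

Lemma surj_comp_inj (G H K : finGroupType) (a a' : surjection H K) (b : surjection G H) :
  surj_comp a b = surj_comp a' b -> a = a'.
Proof.
move=> e; apply: surj_ext => y; have [x <-] := surj_onto b y.
exact: (congr1 (fun f : surjection G K => f x) e).
Qed.

Lemma surj_compA (G H K L : finGroupType) (c : surjection K L) (b : surjection H K)
  (a : surjection G H) : surj_comp c (surj_comp b a) = surj_comp (surj_comp c b) a.
Proof. exact: surj_ext. Qed.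

Lemma surj_comp1 (G H : finGroupType) (a : surjection G H) : surj_comp (surj_id H) a = a.
Proof. exact: surj_ext. Qed.

Lemma surj_compr1 (G H : finGroupType) (a : surjection G H) : surj_comp a (surj_id G) = a.
Proof. exact: surj_ext. Qed.

Lemma surj_card (G H : finGroupType) (a : surjection G H) : (#|H| <= #|G|)%N.
Proof.
have <- : #|[seq a x | x in predT]| = #|H|.
  by apply: eq_card => y; have [x <-] := surj_onto a y; rewrite image_f.
exact: leq_image_card.
Qed.

Lemma surj_card_inj (G H : finGroupType) (a : surjection G H) :
  (#|G| <= #|H|)%N -> injective a.
Proof.
move=> le.
suff h : {in predT &, injective a} by move=> x y; apply: h.
apply/image_injP; rewrite eqn_leq leq_image_card /=.
apply: leq_trans le _; rewrite subset_leq_card //; apply/subsetP => y _.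
by have [x <-] := surj_onto a y; rewrite image_f.
Qed.

Lemma surj_card_lt (G H : finGroupType) (a : surjection G H) :
  ~ injective a -> (#|H| < #|G|)%N.
Proof. by move=> na; rewrite ltnNge; apply/negP => /surj_card_inj. Qed.

Section Inverse.
Context (G H : finGroupType) (c : surjection G H) (ci : injective c).

Definition surj_inv_fun (y : H) : G := sval (cid (surj_onto c y)).
Lemma surj_inv_funK y : c (surj_inv_fun y) = y.
Proof. by rewrite /surj_inv_fun; case: cid. Qed.
Lemma surj_inv_funM : {morph surj_inv_fun : x y / (x * y)%g}.
Proof. by move=> x y; apply: ci; rewrite surjM !surj_inv_funK. Qed.
Lemma surj_inv_onto x : exists y, surj_inv_fun y = x.
Proof. by exists (c x); apply: ci; rewrite surj_inv_funK. Qed.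
Definition surj_inv : surjection H G := mksurj surj_inv_funM surj_inv_onto.

Lemma surj_invK : surj_comp c surj_inv = surj_id H.
Proof. by apply: surj_ext => y; apply: surj_inv_funK. Qed.
Lemma surj_Kinv : surj_comp surj_inv c = surj_id G.
Proof. by apply: surj_ext => x; apply: ci; apply: surj_inv_funK. Qed.
Lemma surj_inv_inj : injective surj_inv.
Proof.
by move=> x y /(congr1 c) e; rewrite -[x]surj_inv_funK -[y]surj_inv_funK.
Qed.
End Inverse.

Lemma comp_injective (G H K : finGroupType) (b : surjection H K) (a : surjection G H) :
  injective b -> injective a -> injective (surj_comp b a).
Proof. by move=> bi ai; apply: inj_comp. Qed.

Lemma inner_onto (G : finGroupType) (g y : G) : exists x, (x ^ g)%g = y.
Proof. by exists (y ^ g^-1)%g; rewrite conjgKV. Qed.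

Definition inner (G : finGroupType) (g : G) : surjection G G :=
  mksurj (fun x y => conjMg x y g) (inner_onto g).

Lemma inner_inj (G : finGroupType) (g : G) : injective (inner g).
Proof. exact: conjg_inj. Qed.

Lemma surj_conjE (G H : finGroupType) (a b : surjection G H) :
  surj_conj a b <-> exists h, b = surj_comp (inner h) a.
Proof.
split=> [[h hP]|[h ->]]; last by exists h.
by exists h; apply: surj_ext.
Qed.

Definition surj_ffun (G H : finGroupType) (a : surjection G H) : {ffun G -> H} :=
  [ffun x => a x].
Definition surj_of_ffun (G H : finGroupType) (f : {ffun G -> H}) : option (surjection G H) :=
  match pselect (exists a : surjection G H, surj_ffun a = f) with
  | left e => Some (sval (cid e))
  | right _ => None
  end.
Lemma surj_ffunK (G H : finGroupType) : pcancel (@surj_ffun G H) (@surj_of_ffun G H).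
Proof.
move=> a; rewrite /surj_of_ffun; case: pselect => [e|[]]; last by exists a.
case: cid => b /= eb; congr Some; apply: surj_ext => x.
by have := congr1 (fun f : {ffun G -> H} => f x) eb; rewrite !ffunE.
Qed.

HB.instance Definition _ (G H : finGroupType) :=
  Finite.copy (surjection G H) (pcan_type (@surj_ffunK G H)).

Lemma surj_image_morphic (G H : finGroupType) (a : surjection G H) :
  {in [set: G] &, {morph a : x y / (x * y)%g}}.
Proof. by move=> x y _ _; apply: surjM. Qed.

Definition surj_morphism (G H : finGroupType) (a : surjection G H) :
  {morphism [set: G] >-> H} := Morphism (surj_image_morphic a).

Lemma surj_morphism_im (G H : finGroupType) (a : surjection G H) :
  (surj_morphism a @* [set: G])%g = [set: H].
Proof.
apply/setP => y; rewrite inE; have [x <-] := surj_onto a y.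
by apply: (mem_morphim (surj_morphism a)); rewrite inE.
Qed.

Lemma isogE (G H : finGroupType) :
  ([set: G] \isog [set: H])%g <-> exists c : surjection G H, injective c.
Proof.
split=> [/isogP[f fi fH]|[c ci]].
  have fM : {morph f : x y / (x * y)%g} by move=> x y; rewrite morphM ?inE.
  have fs y : exists x, f x = y.
    have: y \in (f @* [set: G])%g by rewrite fH inE.
    by case/morphimP => x _ _ ->; exists x.
  exists (mksurj fM fs) => x y e.
  by apply: (injmP fi); rewrite ?inE.
apply/isogP; exists (surj_morphism c); last exact: surj_morphism_im.
by apply/injmP => x y _ _; apply: ci.
Qed.

Lemma surj_closed (U : finGroupType -> Prop) (U_iso : closed_under_iso U)
    (U_quo : closed_under_quotients U) (G H : finGroupType) (a : surjection G H) :
  U G -> U H.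
Proof.
move=> UG; pose f := surj_morphism a.
have nK : ('ker f <| [set: G])%g := ker_normal f.
apply: U_iso (U_quo _ _ UG nK).
have i1 := first_isog f; rewrite surj_morphism_im in i1.
apply: isog_trans i1; apply/isogP.
have e : [set: coset_of ('ker f)] = ([set: G] / 'ker f)%g.
  apply/setP => y; rewrite inE; have [x Nx ->] := cosetP y.
  by rewrite mem_quotient // inE.
exists (idm [set: coset_of ('ker f)]); first exact: injm_idm.
by rewrite morphim_idm // e.
Qed.

Lemma pi0_isog (U : finGroupType -> Prop) (G H : fam U) :
  pi0_class G = pi0_class H <-> exists c : surjection G H, injective c.
Proof.
rewrite -isogE; split=> [e|i].
  have: isog_class G H = isog_class H H by move/(congr1 (@pi0_set U)): e => /= ->.
  by rewrite /isog_class => ->; apply: isog_refl.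
have e : isog_class G = isog_class H.
  apply/funext => K; apply/propext; rewrite /isog_class; split=> h.
    by apply: isog_trans h; rewrite isog_sym.
  exact: isog_trans i h.
rewrite /pi0_class; move: (ex_intro _ G _) (ex_intro _ H _); rewrite e => p q.
by rewrite (Prop_irrelevance p q).
Qed.
End Surjections.

(* Modules live in a universe below that of [fam U], so families of modules are
   indexed by multiplication tables instead of groups. *)
Section Skeleton.
Context (U : finGroupType -> Prop).

Definition table := (nat * (nat -> nat -> nat))%type.

Definition table_of (G : finGroupType) : table :=
  (#|G|, fun i j => index (nth 1 (enum G) i * nth 1 (enum G) j)%g (enum G)).

Lemma table_iso (G H : finGroupType) : #|G| = #|H| ->
  (forall i j, (i < #|G|)%N -> (j < #|G|)%N -> (table_of G).2 i j = (table_of H).2 i j) ->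
  exists c : surjection G H, injective c.
Proof.
move=> cGH e.
pose f (x : G) : H := nth 1%g (enum H) (index x (enum G)).
have sG : size (enum G) = #|G| by rewrite -cardE.
have sH : size (enum H) = #|H| by rewrite -cardE.
have iG x : (index x (enum G) < #|G|)%N by rewrite -sG index_mem mem_enum.
have fM : {morph f : x y / (x * y)%g}.
  move=> x y; rewrite /f.
  have := e _ _ (iG x) (iG y).
  rewrite /table_of /=; rewrite !nth_index ?mem_enum // => ->.
  by rewrite nth_index // mem_enum.
have fs y : exists x, f x = y.
  exists (nth 1%g (enum G) (index y (enum H))); rewrite /f index_uniq ?enum_uniq //.
    by rewrite nth_index // mem_enum.
  by rewrite sG cGH -sH index_mem mem_enum.
by exists (mksurj fM fs); apply: surj_card_inj; rewrite cGH.
Qed.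

Definition skel := {t : table | exists G : fam U, table_of G = t}.
Definition rep (j : skel) : fam U := sval (cid (svalP j)).
Definition skel_of (G : fam U) : skel := exist _ (table_of G) (ex_intro _ G erefl).

Lemma rep_iso (G : fam U) : exists c : surjection G (rep (skel_of G)), injective c.
Proof.
have e : table_of (rep (skel_of G)) = table_of G by rewrite /rep; case: cid.
by apply: table_iso => [|i j _ _]; [have [] := e|rewrite e].
Qed.

Definition to_rep (G : fam U) : surjection G (rep (skel_of G)) := sval (cid (rep_iso G)).
Lemma to_rep_inj G : injective (to_rep G).
Proof. by rewrite /to_rep; case: cid. Qed.
Definition of_rep (G : fam U) : surjection (rep (skel_of G)) G := surj_inv (@to_rep_inj G).
Lemma of_rep_inj G : injective (of_rep G).
Proof. exact: surj_inv_inj. Qed.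
Lemma to_repK G : surj_comp (of_rep G) (to_rep G) = surj_id G.
Proof. exact: surj_Kinv. Qed.
End Skeleton.

(** * Free resolutions *)

Section SubPsh.
Context (k : fieldType) (U : finGroupType -> Prop).
Implicit Types (M N : psh k U) (X Y : cplx k U).

Section Sub.
Context (M : psh k U) (S : forall G : fam U, submod (M G)).
Hypothesis Sst : forall (G H : fam U) (a : surjection G H) x, S H x -> S G (psh_map M a x).

Definition sub_map_fun (G H : fam U) (a : surjection G H) (x : subM (S H)) : subM (S G) :=
  Sub_ (Sst a (subvalP x)).

Lemma sub_map_linear (G H : fam U) (a : surjection G H) : linear (sub_map_fun a).
Proof. by move=> c x y; apply: sub_inj; rewrite /= -[LHS]/(psh_map M a _) linearP. Qed.

Lemma sub_map_id (G : fam U) x : mklin (sub_map_linear (surj_id G)) x = x.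
Proof. by apply: sub_inj; rewrite /= psh_map_id. Qed.

Lemma sub_map_comp (G H K : fam U) (b : surjection H K) (a : surjection G H) x :
  mklin (sub_map_linear (surj_comp b a)) x =
  mklin (sub_map_linear a) (mklin (sub_map_linear b) x).
Proof. by apply: sub_inj; rewrite /= psh_map_comp. Qed.

Lemma sub_map_conj (G H : fam U) (a b : surjection G H) : surj_conj a b ->
  forall x, mklin (sub_map_linear a) x = mklin (sub_map_linear b) x.
Proof. by move=> ab x; apply: sub_inj; rewrite /= (psh_map_conj ab). Qed.

Definition psh_sub : psh k U :=
  @Psh k U (fun G => subM (S G)) (fun G H a => mklin (sub_map_linear a))
    sub_map_id sub_map_comp sub_map_conj.

Definition sub_in : psh_hom psh_sub M :=
  @PshHom k U psh_sub M (fun G => subval (S G)) (fun _ _ _ _ => erefl).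
End Sub.

Section Prod.
Context (I : Type) (M : I -> psh k U).

Definition pi_map_fun (G H : fam U) (a : surjection G H)
  (x : piM (fun i => M i H)) : piM (fun i => M i G) := fun i => psh_map (M i) a (x i).

Lemma pi_map_linear (G H : fam U) (a : surjection G H) : linear (pi_map_fun a).
Proof. by move=> c x y; apply: pi_ext => i; rewrite /pi_map_fun linearP. Qed.

Lemma pi_map_id (G : fam U) x : mklin (pi_map_linear (surj_id G)) x = x.
Proof. by apply: pi_ext => i; rewrite /= /pi_map_fun psh_map_id. Qed.

Lemma pi_map_comp (G H K : fam U) (b : surjection H K) (a : surjection G H) x :
  mklin (pi_map_linear (surj_comp b a)) x =
  mklin (pi_map_linear a) (mklin (pi_map_linear b) x).
Proof. by apply: pi_ext => i; rewrite /= /pi_map_fun psh_map_comp. Qed.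

Lemma pi_map_conj (G H : fam U) (a b : surjection G H) : surj_conj a b ->
  forall x, mklin (pi_map_linear a) x = mklin (pi_map_linear b) x.
Proof. by move=> ab x; apply: pi_ext => i; rewrite /= /pi_map_fun (psh_map_conj ab). Qed.

Definition psh_pi : psh k U :=
  @Psh k U (fun G => piM (fun i => M i G)) (fun G H a => mklin (pi_map_linear a))
    pi_map_id pi_map_comp pi_map_conj.
End Prod.

Section Ker.
Context (X Y : cplx k U) (f : chmap X Y).

Lemma ker0 n G : f n G 0 = 0. Proof. exact: linear0. Qed.
Lemma kerP n G (c : k) x y : f n G x = 0 -> f n G y = 0 -> f n G (c *: x + y) = 0.
Proof. by move=> ex ey; rewrite linearP ex ey scaler0 addr0. Qed.
Definition ker_submod n G : submod (X n G) := @Submod k (X n G) (fun x => f n G x = 0) (ker0 n G) (@kerP n G).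
Lemma ker_st n (G H : fam U) (a : surjection G H) x :
  ker_submod n H x -> ker_submod n G (psh_map (X n) a x).
Proof. by rewrite /= psh_hom_nat => ->; rewrite linear0. Qed.
Definition ker_ob n : psh k U := psh_sub (@ker_st n).
Lemma ker_d_mem n G (x : ker_ob n G) : ker_submod (n - 1) G (cplx_d X n G (subval _ x)).
Proof. by rewrite /= chmap_d (subvalP x) linear0. Qed.
Lemma ker_d_linear n G :
  linear (fun x : ker_ob n G => Sub_ (ker_d_mem x) : ker_ob (n - 1) G).
Proof. by move=> c x y; apply: sub_inj; rewrite /= -[LHS]/(cplx_d X n G _) linearP. Qed.
Lemma ker_d_nat n (G H : fam U) (a : surjection G H) (x : ker_ob n H) :
  (Sub_ (ker_d_mem (psh_map (ker_ob n) a x)) : ker_ob (n - 1) G) =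
  psh_map (ker_ob (n - 1)) a (Sub_ (ker_d_mem x)).
Proof. by apply: sub_inj; rewrite /= -psh_hom_nat. Qed.
Definition ker_d n : psh_hom (ker_ob n) (ker_ob (n - 1)) :=
  mkhom (@ker_d_linear n) (@ker_d_nat n).
Lemma ker_dd n G x : ker_d (n - 1) G (ker_d n G x) = 0.
Proof. by apply: sub_inj; apply: cplx_dd. Qed.
Definition kerc : cplx k U := Cplx ker_dd.
Lemma ker_in_d n G (x : kerc n G) :
  sub_in (@ker_st (n - 1)) G (cplx_d kerc n G x) = cplx_d X n G (sub_in (@ker_st n) G x).
Proof. by []. Qed.
Definition ker_in : chmap kerc X := mkchmap ker_in_d.
Lemma ker_inK n G (x : kerc n G) : f n G (ker_in n G x) = 0.
Proof. exact: (subvalP x). Qed.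
Lemma ker_in_inj n G : injective (ker_in n G).
Proof. exact: subval_inj. Qed.
End Ker.
End SubPsh.

(** * Free functors, syzygies and the terms of the resolution *)

Section Free.
Context (k : fieldType) (U : finGroupType -> Prop).
Implicit Types (M N : psh k U) (X Y A : cplx k U).

(* The left adjoint to restriction from functors on [U] to functors on its
   groupoid of isomorphisms, applied to the restriction of [M]. *)
Section FreePsh.
Context (M : psh k U).

Definition fgen (K : fam U) := {c : skel U & (surjection K (rep c) * M (rep c))%type}.

(** Dually, generators [(al, x)] are linear in [x], and isomorphisms move across: the coend over the
    groupoid of isomorphisms. *)
Definition free_rel (K : fam U) (b : fgen K -> k) : Prop :=
  (forall c (al : surjection K (rep c)) (s : k) x y,
     b (existT _ c (al, s *: x + y)) = s * b (existT _ c (al, x)) + b (existT _ c (al, y)))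
  /\ (forall c c' (th : surjection (rep c) (rep c')), injective th ->
     forall (al : surjection K (rep c)) x,
     b (existT _ c' (surj_comp th al, x)) = b (existT _ c (al, psh_map M th x))).

Definition fmod (K : fam U) : lmodType k := pres (@free_rel K).

Definition fg (K : fam U) c (al : surjection K (rep c)) x : fmod K :=
  gen (@free_rel K) (existT _ c (al, x)).

Lemma fg_lin (K : fam U) c (al : surjection K (rep c)) : linear (fg al).
Proof. by move=> s x y; apply: gen_lin => b [bl _]; apply: bl. Qed.

Lemma fg_iso (K : fam U) c c' (th : surjection (rep c) (rep c')) :
  injective th -> forall (al : surjection K (rep c)) x,
  fg (surj_comp th al) x = fg al (psh_map M th x).
Proof. by move=> ti al x; apply: gen_eq => b [_ bi]; apply: bi. Qed.

Lemma fg0 (K : fam U) c (al : surjection K (rep c)) : fg al 0 = 0.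
Proof. exact: (linear0 (mklin (fg_lin al))). Qed.

Lemma fmod_ind (K : fam U) (Q : fmod K -> Prop) : Q 0 ->
  (forall c (al : surjection K (rep c)) x y, Q y -> Q (fg al x + y)) -> forall x, Q x.
Proof.
move=> Q0 QS; apply: pres_ind => // s [c [al x]] y Qy.
have -> : s *: gen (@free_rel K) (existT _ c (al, x)) = fg al (s *: x).
  exact: (esym (linearZ_LR (mklin (fg_lin al)) s x)).
exact: QS.
Qed.

Section Lift.
Context (K : fam U) (L : lmodType k) (f : forall c, surjection K (rep c) -> M (rep c) -> L).
Hypothesis fl : forall c al, linear (@f c al).
Hypothesis fi : forall c c' (th : surjection (rep c) (rep c')), injective th ->
  forall al x, f (surj_comp th al) x = f al (psh_map M th x).

Lemma flift_test (phi : {linear L -> k^o}) :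
  free_rel (fun e : fgen K => phi (f (projT2 e).1 (projT2 e).2)).
Proof.
split=> [c al s x y|c c' th ti al x] /=; first by rewrite fl linearP.
by rewrite fi.
Qed.

Definition flift : {linear fmod K -> L} :=
  pres_lift (f := fun e : fgen K => f (projT2 e).1 (projT2 e).2) flift_test.

Lemma fliftE c (al : surjection K (rep c)) x : flift (fg al x) = f al x.
Proof. exact: pres_liftE. Qed.
End Lift.

Lemma fmod_eq (K : fam U) (L : lmodType k) (f g : {linear fmod K -> L}) :
  (forall c (al : surjection K (rep c)) x, f (fg al x) = g (fg al x)) ->
  forall x, f x = g x.
Proof. by move=> h; apply: pres_eq => -[c [al x]]; apply: h. Qed.

Definition fmap (G H : fam U) (a : surjection G H) : {linear fmod H -> fmod G} :=
  @flift H (fmod G) (fun c al x => fg (surj_comp al a) x)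
    (fun c al => fg_lin (surj_comp al a))
    (fun c c' th ti al x => etrans (congr1 (fun b => fg b x) (esym (surj_compA th al a)))
        (fg_iso ti (surj_comp al a) x)).

#[local] Arguments fmap : simpl never.

Lemma fmapE (G H : fam U) (a : surjection G H) c (al : surjection H (rep c)) x :
  fmap a (fg al x) = fg (surj_comp al a) x.
Proof. exact: fliftE. Qed.

Lemma fmap_id (G : fam U) x : fmap (surj_id G) x = x.
Proof.
apply: (@fmod_eq G _ (fmap (surj_id G)) idfun) => c al y.
by rewrite fmapE surj_compr1.
Qed.

Lemma fmap_comp (G H K : fam U) (b : surjection H K) (a : surjection G H) x :
  fmap (surj_comp b a) x = fmap a (fmap b x).
Proof.
apply: (@fmod_eq K _ (fmap (surj_comp b a)) (fmap a \o fmap b)) => c al y.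
by rewrite -[RHS]/(fmap a (fmap b (fg al y))) !fmapE surj_compA.
Qed.

Lemma surj_comp_inner (G H : finGroupType) (al : surjection G H) g :
  surj_comp al (inner g) = surj_comp (inner (al g)) al.
Proof. by apply: surj_ext => x; apply: surjJ. Qed.

Lemma psh_map_inner N (G : fam U) g x : psh_map N (inner g : surjection G G) x = x.
Proof.
rewrite -[RHS](psh_map_id x); apply/esym/psh_map_conj; exists g => y; exact: erefl.
Qed.

(** Conjugation passes through [al] to an inner automorphism of its target, moves across as an
    isomorphism, and acts trivially on [M]. *)
Lemma fmap_conj (G H : fam U) (a b : surjection G H) : surj_conj a b ->
  forall x, fmap a x = fmap b x.
Proof.
move=> /surj_conjE[h ->]; apply: fmod_eq => c al y; rewrite !fmapE.
rewrite surj_compA surj_comp_inner -surj_compA fg_iso ?psh_map_inner //.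
exact: inner_inj.
Qed.

Definition free : psh k U := @Psh k U fmod fmap fmap_id fmap_comp fmap_conj.

(** A generator at an arbitrary group of [U], transported to its representative in [skel U]. *)
Definition fgen_at (K H : fam U) (al : surjection K H) (x : M H) : free K :=
  fg (surj_comp (to_rep H) al) (psh_map M (of_rep H) x).

Lemma fgen_at_lin (K H : fam U) (al : surjection K H) : linear (fgen_at al).
Proof. by move=> s x y; rewrite /fgen_at linearP fg_lin. Qed.

Lemma fgen_at_iso (K H H' : fam U) (th : surjection H H') : injective th ->
  forall (al : surjection K H) x, fgen_at (surj_comp th al) x = fgen_at al (psh_map M th x).
Proof.
move=> ti al x; rewrite /fgen_at.
pose ph := surj_comp (surj_comp (to_rep H') th) (of_rep H).
have pi : injective ph.
  by do !apply: comp_injective => //; [apply: to_rep_inj|apply: of_rep_inj].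
have -> : surj_comp (to_rep H') (surj_comp th al) =
    surj_comp ph (surj_comp (to_rep H) al).
  rewrite /ph -!surj_compA; do 2 congr surj_comp.
  by rewrite surj_compA to_repK surj_comp1.
rewrite fg_iso // -!psh_map_comp; congr (fg _ (psh_map M _ x)).
by rewrite /ph !surj_compA to_repK surj_comp1.
Qed.

Lemma fgen_at_rep (K : fam U) c (al : surjection K (rep c)) x : fgen_at al x = fg al x.
Proof.
rewrite /fgen_at fg_iso; last exact: to_rep_inj.
by rewrite -psh_map_comp to_repK psh_map_id.
Qed.

Lemma fmap_at (G K H : fam U) (a : surjection G K) (al : surjection K H) x :
  psh_map free a (fgen_at al x) = fgen_at (surj_comp al a) x.
Proof. by rewrite -[LHS]/(fmap a (fg _ _)) fmapE -surj_compA. Qed.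

Definition funit (G : fam U) (x : M G) : free G := fgen_at (surj_id G) x.

Lemma funit_lin (G : fam U) : linear (@funit G).
Proof. exact: fgen_at_lin. Qed.

Lemma fgen_atE (K H : fam U) (al : surjection K H) x :
  fgen_at al x = psh_map free al (funit x).
Proof. by rewrite fmap_at surj_comp1. Qed.

Lemma fgE (K : fam U) c (al : surjection K (rep c)) x : fg al x = psh_map free al (funit x).
Proof. by rewrite -fgen_atE fgen_at_rep. Qed.

(** Naturality is confined to isomorphisms: [free M] sees nothing of the maps of [M] along other
    surjections. *)
Lemma funit_iso (G H : fam U) (c : surjection G H) (x : M H) : injective c ->
  funit (psh_map M c x) = psh_map free c (funit x).
Proof. by move=> ci; rewrite -fgen_atE /funit -fgen_at_iso // surj_compr1. Qed.

Section Out.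
Context (N : psh k U) (s : forall H : fam U, M H -> N H).
Hypothesis sl : forall H, linear (@s H).
Hypothesis si : forall (G H : fam U) (c : surjection G H), injective c ->
  forall x, s (psh_map M c x) = psh_map N c (s x).

Lemma fout_lin (K : fam U) c (al : surjection K (rep c)) :
  linear (fun x => psh_map N al (s x)).
Proof. by move=> t x y; rewrite sl linearP. Qed.

Lemma fout_iso (K : fam U) c c' (th : surjection (rep c) (rep c')) : injective th ->
  forall (al : surjection K (rep c)) x,
  psh_map N (surj_comp th al) (s x) = psh_map N al (s (psh_map M th x)).
Proof. by move=> ti al x; rewrite psh_map_comp si. Qed.

Definition fout_fun (K : fam U) : {linear free K -> N K} :=
  flift (@fout_lin K) (@fout_iso K).

Lemma fout_nat (G H : fam U) (a : surjection G H) x :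
  fout_fun G (psh_map free a x) = psh_map N a (fout_fun H x).
Proof.
apply: (@fmod_eq H _ (fout_fun G \o psh_map free a) (psh_map N a \o fout_fun H)).
move=> c al y; rewrite -[LHS]/(fout_fun G (fmap a (fg al y))) fmapE.
by rewrite -[RHS]/(psh_map N a (fout_fun H (fg al y))) /fout_fun !fliftE psh_map_comp.
Qed.

Definition fout : psh_hom free N := PshHom fout_nat.

Lemma fout_unit H (x : M H) : fout H (funit x) = s x.
Proof.
rewrite -[LHS]/(fout_fun H (fg _ _)) /fout_fun fliftE si; last exact: of_rep_inj.
by rewrite -psh_map_comp surj_compr1 to_repK psh_map_id.
Qed.
End Out.

Lemma free_ext (N : psh k U) (f g : psh_hom free N) :
  (forall H (x : M H), f H (funit x) = g H (funit x)) -> forall K x, f K x = g K x.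
Proof.
by move=> h K; apply: fmod_eq => c al x; rewrite !fgE !psh_hom_nat h.
Qed.
End FreePsh.

Definition feps M : psh_hom (free M) M :=
  @fout M M (fun H x => x) (fun H c x y => erefl) (fun G H c ci x => erefl).

Lemma feps_unit M H (x : M H) : feps M H (funit x) = x.
Proof. exact: fout_unit. Qed.

Section FreeMap.
Context M N (f : psh_hom M N).
Lemma freemap_lin H : linear (fun x => funit (f H x)).
Proof. by move=> c x y; rewrite linearP funit_lin. Qed.
Lemma freemap_iso (G H : fam U) (c : surjection G H) : injective c ->
  forall x, funit (f G (psh_map M c x)) = psh_map (free N) c (funit (f H x)).
Proof. by move=> ci x; rewrite psh_hom_nat funit_iso. Qed.
Definition freemap : psh_hom (free M) (free N) := fout freemap_lin freemap_iso.
Lemma freemap_unit H (x : M H) : freemap H (funit x) = funit (f H x).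
Proof. exact: fout_unit. Qed.
End FreeMap.

Lemma funit0 M (H : fam U) : funit (0 : M H) = 0.
Proof. exact: (linear0 (mklin (@funit_lin M H))). Qed.

Lemma freec_dd X n G x : freemap (cplx_d X (n - 1)) G (freemap (cplx_d X n) G x) = 0.
Proof.
apply: (@free_ext _ _ (psh_hom_comp (freemap (cplx_d X (n - 1))) (freemap (cplx_d X n)))
  (hom0 _ _)) => H y.
rewrite -[LHS]/(freemap (cplx_d X (n - 1)) H (freemap (cplx_d X n) H (funit y))).
by rewrite !freemap_unit cplx_dd funit0.
Qed.

Definition freec X : cplx k U := Cplx (@freec_dd X).

Lemma freec_dE X n G (x : X n G) :
  cplx_d (freec X) n G (funit x) = funit (cplx_d X n G x).
Proof. exact: freemap_unit. Qed.

Lemma fepsc_d X n G (x : freec X n G) :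
  feps (X (n - 1)) G (cplx_d (freec X) n G x) = cplx_d X n G (feps (X n) G x).
Proof.
apply: (@free_ext _ _ (psh_hom_comp (feps _) (cplx_d (freec X) n))
  (psh_hom_comp (cplx_d X n) (feps _))) => H y.
rewrite -[LHS]/(feps _ H (freemap (cplx_d X n) H (funit y))).
by rewrite -[RHS]/(cplx_d X n H (feps _ H (funit y))) freemap_unit !feps_unit.
Qed.

Definition fepsc X : chmap (freec X) X := mkchmap (@fepsc_d X).

Lemma fepsc_unit X n G (x : X n G) : fepsc X n G (funit x) = x.
Proof. exact: feps_unit. Qed.

Definition syz X : cplx k U := kerc (fepsc X).
Definition syz_in X : chmap (syz X) (freec X) := ker_in (fepsc X).

Lemma syz_proj_mem X n G (w : freec X n G) :
  ker_submod (fepsc X) n G (w - funit (fepsc X n G w)).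
Proof.
rewrite -[ker_submod _ _ _ _]/(fepsc X n G (w - funit (fepsc X n G w)) = 0).
by rewrite linearB fepsc_unit subrr.
Qed.

(** [funit] splits the counit at each group, though not naturally in surjections. The resulting
    projection to the kernel commutes with the differentials but is not a map of functors. *)
Definition syz_proj X n G (w : freec X n G) : syz X n G := Sub_ (syz_proj_mem w).

Lemma syz_projE X n G (w : freec X n G) :
  syz_in X n G (syz_proj w) = w - funit (fepsc X n G w).
Proof. by []. Qed.

Lemma syz_eps X n G (x : syz X n G) : fepsc X n G (syz_in X n G x) = 0.
Proof. exact: ker_inK. Qed.

Lemma syz_projK X n G (x : syz X n G) : syz_proj (syz_in X n G x) = x.
Proof.
apply: (@ker_in_inj _ _ _ _ (fepsc X)).
by rewrite [LHS]syz_projE syz_eps funit0 subr0.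
Qed.

Lemma syz_proj_d X n G (w : freec X n G) :
  syz_proj (cplx_d (freec X) n G w) = cplx_d (syz X) n G (syz_proj w).
Proof.
have e : syz_in X (n - 1) G (cplx_d (syz X) n G (syz_proj w)) =
    cplx_d (freec X) n G (w - funit (fepsc X n G w)) := chmap_d (syz_in X) (syz_proj w).
apply: (@ker_in_inj _ _ _ _ (fepsc X)); rewrite -/(syz_in X) e syz_projE.
by rewrite (linearB (cplx_d (freec X) n G)) freec_dE chmap_d.
Qed.

(** A generator on an injective surjection is a unit, and one on a surjection to a smaller group is
    zero by hypothesis. *)
Lemma free_unit_of M (G : fam U) : (forall H : fam U, (#|H| < #|G|)%N -> forall x : M H, x = 0) ->
  forall x : free M G, exists y, x = funit y.
Proof.
move=> M0; apply: fmod_ind; first by exists 0; rewrite funit0.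
move=> c al x y [y' ->]; have [ai|ai] := pselect (injective al).
  exists (psh_map M al x + y'); rewrite fgE.
  have -> : psh_map (free M) al (funit x) = funit (psh_map M al x) by rewrite funit_iso.
  by have := funit_lin 1 (psh_map M al x) y'; rewrite !scale1r => ->.
exists y'; have -> : x = 0 by apply: M0; apply: surj_card_lt ai.
by rewrite fg0 add0r.
Qed.

Definition zero_upto (m : nat) X := forall (G : fam U), (#|G| <= m)%N ->
  forall n (x : X n G), x = 0.

(** Up to order [m.+1] the free functor consists of units, on which the counit is injective. This
    makes the resolution finite at each group. *)
Lemma syz_zero m X : zero_upto m X -> zero_upto m.+1 (syz X).
Proof.
move=> X0 G Gm n x; apply: (@ker_in_inj _ _ _ _ (fepsc X)).
have [H HG y|y ey] := @free_unit_of (X n) G _ (syz_in X n G x).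
  by apply: X0; rewrite -ltnS; apply: leq_trans HG Gm.
have := syz_eps x; rewrite ey fepsc_unit => y0.
by rewrite y0 funit0; apply: esym (linear0 (syz_in X n G)).
Qed.

Lemma free_zero m X : zero_upto m X -> zero_upto m (freec X).
Proof.
move=> X0 G Gm n; apply: fmod_ind => // c al x y ->; rewrite addr0.
have -> : x = 0 by apply: X0; apply: leq_trans Gm; apply: surj_card.
exact: fg0.
Qed.

(* The terms of the resolution, already shifted into their total degree. *)
Fixpoint bar (m : nat) X : cplx k U :=
  if m is m'.+1 then shift (bar m' (syz X)) else freec X.

Lemma bar_zero m m' X : zero_upto m' X -> zero_upto (m' + m)%N (bar m X).
Proof.
elim: m m' X => [|m IH] m' X X0; first by rewrite addn0; apply: free_zero.
move=> G Gm n x; apply: (IH _ _ (syz_zero X0)) => //.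
by rewrite addSnnS.
Qed.

Lemma bar_zero0 m X : zero_upto m (bar m X).
Proof.
rewrite -[X in zero_upto X](add0n m); apply: bar_zero => G.
rewrite leqn0 => /eqP/card0_eq/(_ 1%g); by rewrite inE.
Qed.

(** The horizontal differential, obtained by splicing: the counit onto a syzygy followed by its
    inclusion in the preceding term. The shift built into [bar] makes it anticommute with the
    vertical differential. *)
Fixpoint bar_del (m : nat) : forall X n, psh_hom (bar m.+1 X n) (bar m X (n - 1)) :=
  match m return forall X n, psh_hom (bar m.+1 X n) (bar m X (n - 1)) with
  | 0 => fun X n => psh_hom_comp (syz_in X (n - 1)) (fepsc (syz X) (n - 1))
  | m'.+1 => fun X n => bar_del m' (syz X) (n - 1)
  end.

Lemma bar_del_d m X n G (w : bar m.+1 X n G) :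
  bar_del m X (n - 1) G (cplx_d (bar m.+1 X) n G w) =
  - cplx_d (bar m X) (n - 1) G (bar_del m X n G w).
Proof.
elim: m X n w => [|m IH] X n w.
  rewrite -[LHS]/(syz_in X _ G (fepsc (syz X) _ G (- cplx_d (freec (syz X)) (n - 1) G w))).
  by rewrite !linearN !chmap_d.
rewrite -[LHS]/(bar_del m (syz X) (n - 1 - 1) G (- cplx_d (bar m.+1 (syz X)) (n - 1) G w)).
by rewrite linearN IH.
Qed.

Lemma bar_del2 m X n G (w : bar m.+2 X n G) : bar_del m X (n - 1) G (bar_del m.+1 X n G w) = 0.
Proof.
elim: m X n w => [|m IH] X n w; last exact: IH.
rewrite -[LHS]/(syz_in X _ G (fepsc (syz X) _ G (syz_in (syz X) _ G (fepsc (syz (syz X)) _ G w)))).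
by rewrite syz_eps linear0.
Qed.

(** A contraction of the horizontal differential at each group, made from the splitting [funit]. It
    is not natural in surjections, but exactness is tested at one group at a time. *)
Fixpoint bar_h (m : nat) : forall X n G, bar m X (n - 1) G -> bar m.+1 X n G :=
  match m return forall X n G, bar m X (n - 1) G -> bar m.+1 X n G with
  | 0 => fun X n G w => funit (syz_proj w)
  | m'.+1 => fun X n G => @bar_h m' (syz X) (n - 1) G
  end.

Lemma funitN M (H : fam U) (x : M H) : funit (- x) = - funit x.
Proof. exact: (linearN (mklin (@funit_lin M H))). Qed.

Lemma syz_projN X n G (w : freec X n G) : syz_proj (- w) = - syz_proj w.
Proof.
apply: (@ker_in_inj _ _ _ _ (fepsc X)).
have -> : ker_in (fepsc X) n G (- syz_proj w) = - syz_in X n G (syz_proj w).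
  exact: (linearN (syz_in X n G)).
apply: etrans (syz_projE (- w)) _; rewrite syz_projE (linearN (fepsc X n G)) funitN.
by rewrite opprB opprK addrC.
Qed.

Lemma bar_hN m X n G (w : bar m X (n - 1) G) : bar_h (- w) = - bar_h w.
Proof.
elim: m X n w => [|m IH] X n w; last exact: IH.
by rewrite -[LHS]/(funit (syz_proj (- w))) syz_projN funitN.
Qed.

Lemma bar_h_d m X n G (w : bar m X (n - 1) G) :
  @bar_h m X (n - 1) G (cplx_d (bar m X) (n - 1) G w) =
  - cplx_d (bar m.+1 X) n G (bar_h w).
Proof.
elim: m X n w => [|m IH] X n w.
  rewrite -[RHS]/(- - cplx_d (freec (syz X)) (n - 1) G (funit (syz_proj w))).
  rewrite opprK freec_dE -syz_proj_d; exact: erefl.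
rewrite -[LHS]/(@bar_h m (syz X) (n - 1 - 1) G (- cplx_d (bar m (syz X)) (n - 1 - 1) G w)).
by rewrite bar_hN IH.
Qed.

Lemma bar_del_h0 X n G (w : bar 0 X (n - 1) G) :
  bar_del 0 X n G (bar_h w) = w - funit (fepsc X (n - 1) G w).
Proof.
by rewrite -[LHS]/(syz_in X _ G (fepsc (syz X) _ G (funit (syz_proj w)))) fepsc_unit syz_projE.
Qed.

Lemma bar_del_hS m X n G (w : bar m.+1 X (n - 1) G) :
  bar_del m.+1 X n G (bar_h w) + bar_h (bar_del m X (n - 1) G w) = w.
Proof.
elim: m X n w => [|m IH] X n w; last exact: IH.
have e1 : bar_del 1 X n G (bar_h w) =
    (w : freec (syz X) (n - 1 - 1) G) - funit (fepsc (syz X) (n - 1 - 1) G w) :=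
  @bar_del_h0 (syz X) (n - 1) G w.
have e2 : bar_h (bar_del 0 X (n - 1) G w) = funit (fepsc (syz X) (n - 1 - 1) G w) :=
  congr1 (@funit _ G) (syz_projK (fepsc (syz X) (n - 1 - 1) G w)).
by rewrite e1 e2; apply: subrK.
Qed.
End Free.

(** * Contractions that commute with isomorphisms *)

Section Contraction.
Context (k : fieldType) (U : finGroupType -> Prop).
Implicit Types (X Y A : cplx k U).

(** With generalized inverses [g] of the differentials, the contraction is [a -> g (a - g (d a))]:
    the argument of the outer [g] is a cycle, hence a boundary, and [d g] is the identity on
    boundaries. *)
Lemma contraction_at G A : acyclic_at G A ->
  exists s : forall n, {linear A (n - 1) G -> A n G},
    forall n x, x = cplx_d A n G (s n x) + s (n - 1) (cplx_d A (n - 1) G x).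
Proof.
move=> aA.
pose g n := sval (cid (regular_linear (cplx_d A n G))).
have gP n x : cplx_d A n G (g n (cplx_d A n G x)) = cplx_d A n G x.
  by rewrite /g; case: cid.
have sl n : linear (fun a => g n (a - g (n - 1) (cplx_d A (n - 1) G a))).
  move=> c x y; rewrite -(linearP (g n)); congr (g n _).
  rewrite (linearP (cplx_d A (n - 1) G)) (linearP (g (n - 1))) scalerBr.
  by zmod.
exists (fun n => mklin (sl n)) => n a.
have e1 : cplx_d A (n - 1) G (a - g (n - 1) (cplx_d A (n - 1) G a)) = 0.
  by rewrite linearB gP subrr.
have [y ey] := aA n _ e1.
rewrite /= ey gP -ey cplx_dd linear0 subr0.
by zmod.
Qed.

Definition class_rep (c : pi0 U) : fam U := sval (cid (pi0_setP c)).

Lemma class_repP (c : pi0 U) : pi0_class (class_rep c) = c.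
Proof.
rewrite /class_rep; case: cid => G /=; case: c => c e /= ec; subst c.
by rewrite /pi0_class; congr Pi0; apply: Prop_irrelevance.
Qed.

Lemma class_iso (G : fam U) (c : pi0 U) : pi0_class G = c ->
  exists th : surjection G (class_rep c), injective th.
Proof. by move=> e; apply/pi0_isog; rewrite class_repP. Qed.

Lemma endo_inj (G : finGroupType) (th : surjection G G) : injective th.
Proof. exact: surj_card_inj. Qed.

Lemma surj_comp_invr (G H K : finGroupType) (b : surjection H K) (a : surjection G H)
    (bi : injective b) (ai : injective a) (ci : injective (surj_comp b a)) :
  surj_comp a (surj_inv ci) = surj_inv bi.
Proof.
have bi' := bi; apply: surj_ext => y; apply: bi'; rewrite [RHS]surj_inv_funK.
exact: (surj_inv_funK (surj_comp b a) y).
Qed.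

Hypothesis k_char0 : [pchar k] =i pred0.

Lemma natr_neq0 n : (0 < n)%N -> n%:R != 0 :> k.
Proof.
by move=> n0; rewrite ((pcharf0P k).1 k_char0) -lt0n.
Qed.

(** The conjugates of a contraction by the automorphisms [th] of [G] are averaged; their number is
    invertible in characteristic zero. *)
Lemma contraction_equiv (G : fam U) A : acyclic_at G A ->
  exists s : forall n, A (n - 1) G -> A n G,
  [/\ forall n, linear (s n),
      forall n (c : surjection G G) x, s n (psh_map (A (n - 1)) c x) = psh_map (A n) c (s n x)
    & forall n x, x = cplx_d A n G (s n x) + s (n - 1) (cplx_d A (n - 1) G x)].
Proof.
move=> aA; have [s sP] := contraction_at aA.
pose iv (th : surjection G G) := surj_inv (@endo_inj _ th).
pose t n (th : surjection G G) x := psh_map (A n) th (s n (psh_map (A (n - 1)) (iv th) x)).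
pose N : k := #|{: surjection G G}|%:R.
have N0 : N != 0 by apply: natr_neq0; apply/card_gt0P; exists (surj_id G).
have tl n th : linear (t n th) by move=> c x y; rewrite /t !linearP.
exists (fun n x => N^-1 *: \sum_th t n th x); split.
- move=> n c x y; rewrite [c *: (_ *: _)]scalerA [c * _]mulrC -scalerA -scalerDr.
  congr (_ *: _).
  by rewrite scaler_sumr -big_split; apply: eq_bigr => th _; rewrite tl.
- move=> n c x; rewrite /= linearZ_LR (linear_sum (psh_map (A n) c)); congr (_ *: _).
  rewrite (reindex_inj (h := fun th => surj_comp th c)) /=; last first.
    by move=> th th' /surj_comp_inj.
  apply: eq_bigr => th _; rewrite /t psh_map_comp; congr (psh_map _ _ (psh_map _ _ (s n _))).
  by rewrite -psh_map_comp /iv (surj_comp_invr (@endo_inj _ th) (@endo_inj _ c)).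
- move=> n x; rewrite /= linearZ_LR -scalerDr (linear_sum (cplx_d A n G)) -big_split /=.
  rewrite (eq_bigr (fun=> x)); last first.
    move=> th _; rewrite /t (psh_hom_nat (cplx_d A n)) -(psh_hom_nat (cplx_d A (n - 1))).
    rewrite -linearD -sP -psh_map_comp.
    by rewrite /iv surj_Kinv psh_map_id.
  by rewrite sumr_const -scaler_nat scalerA mulVf // scale1r.
Qed.

(* Averaging over automorphisms makes the contractions commute with isomorphisms. *)
Lemma contraction_iso A : acyclic A ->
  exists s : forall n (G : fam U), A (n - 1) G -> A n G,
  [/\ forall n G, linear (s n G),
      forall n (G H : fam U) (c : surjection G H), injective c ->
        forall x, s n G (psh_map (A (n - 1)) c x) = psh_map (A n) c (s n H x)
    & forall n G x, x = cplx_d A n G (s n G x) + s (n - 1) G (cplx_d A (n - 1) G x)].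
Proof.
move=> aA.
pose s1 (c : pi0 U) := sval (cid (contraction_equiv (aA (class_rep c)))).
have s1l c n : linear (s1 c n) by rewrite /s1; case: cid => s [].
have s1c c n th x : s1 c n (psh_map (A (n - 1)) th x) = psh_map (A n) th (s1 c n x).
  by rewrite /s1; case: cid => s [].
have s1P c n x : x = cplx_d A n (class_rep c) (s1 c n x) +
    s1 c (n - 1) (cplx_d A (n - 1) (class_rep c) x).
  by rewrite /s1; case: cid => s [].
pose ka (G : fam U) := sval (cid (@class_iso G _ erefl)).
have kai G : injective (ka G) by rewrite /ka; case: cid.
pose s n (G : fam U) x := psh_map (A n) (ka G)
  (s1 (pi0_class G) n (psh_map (A (n - 1)) (surj_inv (@kai G)) x)).
(* The transported contraction does not depend on the isomorphism to the representative, because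
   [s1] commutes with automorphisms. *)
have sE n (G : fam U) c (e : pi0_class G = c) (th : surjection G (class_rep c))
    (ti : injective th) x :
    s n G x = psh_map (A n) th (s1 c n (psh_map (A (n - 1)) (surj_inv ti) x)).
  subst c; rewrite /s.
  pose ta := surj_comp th (surj_inv (@kai G)).
  have -> : psh_map (A n) th = psh_map (A n) (surj_comp ta (ka G)).
    by rewrite /ta -surj_compA surj_Kinv surj_compr1.
  rewrite psh_map_comp -s1c -psh_map_comp; congr (psh_map _ _ (s1 _ _ (psh_map _ _ _))).
  by rewrite /ta surj_compA surj_Kinv surj_comp1.
exists s; split.
- by move=> n G c x y; rewrite /s linearP s1l linearP.
- move=> n G H c ci x.
  have e : pi0_class G = pi0_class H by apply/pi0_isog; exists c.
  have ti := comp_injective (@kai H) ci.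
  have e2 : psh_map (A (n - 1)) (surj_inv ti) (psh_map (A (n - 1)) c x) =
      psh_map (A (n - 1)) (surj_inv (@kai H)) x.
    by rewrite -psh_map_comp (surj_comp_invr (@kai H) ci).
  by rewrite (sE _ _ _ e _ ti) e2 psh_map_comp.
- move=> n G x; rewrite /s (psh_hom_nat (cplx_d A n)) -(psh_hom_nat (cplx_d A (n - 1))).
  rewrite -(linearD (psh_map (A (n - 1)) (ka G))) -s1P -psh_map_comp surj_Kinv.
  by rewrite psh_map_id.
Qed.

(** A homotopy out of a free functor is given by its values on units, which only have to be
    compatible with isomorphisms; a contraction [s] applied to the values of [f] is. *)
Lemma freec_Kproj X : Kproj (freec X).
Proof.
move=> A aA f; have [s [sl si sP]] := contraction_iso aA.
have hl n (H : fam U) : linear (fun x : X (n - 1) H => s n H (f (n - 1) H (funit x))).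
  by move=> c x y; rewrite funit_lin linearP sl.
have hi n (G H : fam U) (c : surjection G H) : injective c -> forall x : X (n - 1) H,
    s n G (f (n - 1) G (funit (psh_map (X (n - 1)) c x))) =
    psh_map (A n) c (s n H (f (n - 1) H (funit x))).
  by move=> ci x; rewrite funit_iso // psh_hom_nat si.
exists (fun n => fout (@hl n) (@hi n)) => n.
pose h := fun n => fout (@hl n) (@hi n).
apply: (@free_ext _ _ _ _ (f (n - 1)) (psh_hom_add (psh_hom_comp (cplx_d A n) (h n))
  (psh_hom_comp (h (n - 1)) (cplx_d (freec X) (n - 1))))) => H x.
rewrite -[RHS]/(cplx_d A n H (h n H (funit x)) +
  h (n - 1) H (cplx_d (freec X) (n - 1) H (funit x))).
rewrite freec_dE /h !fout_unit.
have e : f (n - 1 - 1) H (funit (cplx_d X (n - 1) H x)) =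
    cplx_d A (n - 1) H (f (n - 1) H (funit x)) by rewrite -chmap_d freec_dE.
by rewrite e; apply: sP.
Qed.

Lemma bar_Kproj m X : Kproj (bar m X).
Proof.
elim: m X => [|m IH] X; first exact: freec_Kproj.
exact/Kproj_shift/IH.
Qed.
End Contraction.

(** * The total complex of the resolution *)

Section Resolution.
Context (k : fieldType) (U : finGroupType -> Prop).
Implicit Types (X Y A : cplx k U).

(** The term of index [m] vanishes on groups of order at most [m], so at each group this product is
    a finite direct sum. *)
Definition res_ob X n : psh k U := psh_pi (fun m => bar m X n).

Definition res_d_fun X n G (b : res_ob X n G) : res_ob X (n - 1) G :=
  fun m => cplx_d (bar m X) n G (b m) + bar_del m X n G (b m.+1).

Lemma res_d_linear X n G : linear (@res_d_fun X n G).
Proof.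
move=> c x y; apply: pi_ext => m; rewrite /res_d_fun.
rewrite -[LHS]/(cplx_d (bar m X) n G (c *: x m + y m) +
  bar_del m X n G (c *: x m.+1 + y m.+1)).
rewrite (linearP (cplx_d (bar m X) n G)) (linearP (bar_del m X n G)) [RHS]piD piZ.
by rewrite scalerDr addrACA.
Qed.

Lemma res_d_nat X n (G H : fam U) (a : surjection G H) (b : res_ob X n H) :
  res_d_fun (psh_map (res_ob X n) a b) = psh_map (res_ob X (n - 1)) a (res_d_fun b).
Proof.
apply: pi_ext => m; rewrite -[LHS]/(cplx_d (bar m X) n G (psh_map _ a (b m)) +
  bar_del m X n G (psh_map _ a (b m.+1))).
rewrite -[RHS]/(psh_map (bar m X (n - 1)) a (res_d_fun b m)).
by rewrite linearD -!psh_hom_nat.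
Qed.

Definition res_d X n : psh_hom (res_ob X n) (res_ob X (n - 1)) :=
  mkhom (@res_d_linear X n) (@res_d_nat X n).

Lemma res_dE X n G (b : res_ob X n G) m :
  res_d X n G b m = cplx_d (bar m X) n G (b m) + bar_del m X n G (b m.+1).
Proof. by []. Qed.

Lemma res_dd X n G x : res_d X (n - 1) G (res_d X n G x) = 0.
Proof.
apply: pi_ext => m; rewrite !res_dE (linearD (cplx_d (bar m X) (n - 1) G)) cplx_dd.
rewrite (linearD (bar_del m X (n - 1) G)) bar_del_d bar_del2 -[RHS]/(0).
by zmod.
Qed.

Definition res X : cplx k U := Cplx (@res_dd X).

Lemma res_cplx_dE X n G (b : res X n G) m : cplx_d (res X) n G b m =
  cplx_d (bar m X) n G (b m) + bar_del m X n G (b m.+1).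
Proof. by []. Qed.

Lemma res_eps_linear X n G : linear (fun b : res X n G => fepsc X n G (b 0)).
Proof. by move=> c x y; rewrite -linearP. Qed.
Lemma res_eps_nat X n (G H : fam U) (a : surjection G H) (b : res X n H) :
  fepsc X n G ((psh_map (res X n) a b) 0) = psh_map (X n) a (fepsc X n H (b 0)).
Proof. by rewrite -psh_hom_nat. Qed.
Lemma res_eps_d X n G (b : res X n G) :
  mkhom (@res_eps_linear X (n - 1)) (@res_eps_nat X (n - 1)) G (cplx_d (res X) n G b) =
  cplx_d X n G (mkhom (@res_eps_linear X n) (@res_eps_nat X n) G b).
Proof.
rewrite -[LHS]/(fepsc X (n - 1) G (cplx_d (freec X) n G (b 0) +
  syz_in X (n - 1) G (fepsc (syz X) (n - 1) G (b 1)))).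
by rewrite linearD syz_eps addr0 chmap_d.
Qed.
Definition res_eps X : chmap (res X) X := mkchmap (@res_eps_d X).

Lemma res_epsE X n G (b : res X n G) : res_eps X n G b = fepsc X n G (b 0).
Proof. by []. Qed.

Lemma res_qis X : quasi_iso (res_eps X).
Proof.
move=> n G; split.
  move=> b db [x ex].
  have db' m : cplx_d (bar m X) (n - 1) G (b m) + bar_del m X (n - 1) G (b m.+1) = 0.
    exact: (congr1 (fun f : res X (n - 1 - 1) G => f m) db).
  (* [bar_h] raises the index by one; in index 0 the unit of [x] accounts for the part that [bar_h]
     does not see. *)
  exists ((fun m => match m return bar m X n G with
                    | 0 => funit x | m'.+1 => bar_h (b m') end) : res X n G).
  apply: pi_ext => -[|m]; rewrite [RHS]res_dE.
    rewrite bar_del_h0 freec_dE -ex res_epsE.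
    by zmod.
  have e1 := bar_h_d (b m); have e2 := bar_del_hS (b m.+1).
  have e3 := db' m.
  have e4 : bar_h (cplx_d (bar m X) (n - 1) G (b m)) +
      bar_h (bar_del m X (n - 1) G (b m.+1)) = 0.
    have -> : cplx_d (bar m X) (n - 1) G (b m) = - bar_del m X (n - 1) G (b m.+1).
      by apply/eqP; rewrite -addr_eq0; apply/eqP.
    by rewrite bar_hN addNr.
  by zby e1 e2 e4.
move=> y dy.
exists ((fun m => match m return bar m X (n - 1) G with
         | 0 => funit y | _.+1 => 0 end) : res X (n - 1) G), 0.
split; last by rewrite res_epsE linear0 addr0 fepsc_unit.
apply: pi_ext => -[|m]; rewrite [LHS]res_dE.
  by rewrite freec_dE dy funit0 linear0 addr0.
by rewrite !linear0 addr0.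
Qed.

Definition res_inc_fun m X n G (w : bar m X n G) : res X n G := fun m' =>
  match @eqP _ m m' with
  | ReflectT e => eq_rect m (fun j => bar j X n G) w m' e
  | ReflectF _ => 0
  end.

Lemma res_inc_same m X n G (w : bar m X n G) : res_inc_fun w m = w.
Proof. by rewrite /res_inc_fun; case: eqP => // e; rewrite (eq_irrelevance e erefl). Qed.

Lemma res_inc_diff m m' X n G (w : bar m X n G) : m <> m' -> res_inc_fun w m' = 0.
Proof. by rewrite /res_inc_fun; case: eqP. Qed.

Lemma res_inc_linear m X n G : linear (@res_inc_fun m X n G).
Proof.
move=> c x y; apply: pi_ext => m'; rewrite [RHS]piD [X in _ = X + _]piZ.
have [e|ne] := pselect (m = m'); first by subst m'; rewrite !res_inc_same.
by rewrite !res_inc_diff // scaler0 addr0.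
Qed.

Lemma res_inc_nat m X n (G H : fam U) (a : surjection G H) (w : bar m X n H) :
  res_inc_fun (psh_map (bar m X n) a w) = psh_map (res X n) a (res_inc_fun w).
Proof.
apply: pi_ext => m'; rewrite -[RHS]/(psh_map (bar m' X n) a (res_inc_fun w m')).
have [e|ne] := pselect (m = m'); first by subst m'; rewrite !res_inc_same.
by rewrite !res_inc_diff // linear0.
Qed.

Definition res_inc m X n : psh_hom (bar m X n) (res X n) :=
  mkhom (@res_inc_linear m X n) (@res_inc_nat m X n).

Lemma res_inc_d0 X n G (w : bar 0 X n G) :
  cplx_d (res X) n G (res_inc 0 X n G w) = res_inc 0 X (n - 1) G (cplx_d (bar 0 X) n G w).
Proof.
apply: pi_ext => m; rewrite [LHS]res_dE /=.
rewrite (@res_inc_diff 0 m.+1) // linear0 addr0.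
have [e|ne] := pselect (0%N = m); first by subst m; rewrite !res_inc_same.
by rewrite !res_inc_diff // linear0.
Qed.

Lemma res_inc_dS m X n G (w : bar m.+1 X n G) :
  cplx_d (res X) n G (res_inc m.+1 X n G w) =
  res_inc m.+1 X (n - 1) G (cplx_d (bar m.+1 X) n G w) +
  res_inc m X (n - 1) G (bar_del m X n G w).
Proof.
apply: pi_ext => m'; rewrite [LHS]res_dE [RHS]piD.
rewrite -[RHS]/(res_inc_fun (cplx_d (bar m.+1 X) n G w) m' +
  res_inc_fun (bar_del m X n G w) m').
rewrite -[LHS]/(cplx_d (bar m' X) n G (res_inc_fun w m') +
  bar_del m' X n G (res_inc_fun w m'.+1)).
have [e|ne] := pselect (m.+1 = m').
  subst m'; rewrite !res_inc_same !(@res_inc_diff _ m.+2) ?linear0; last by move=> [] /n_Sn.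
  by rewrite [in RHS]res_inc_diff // => /n_Sn.
rewrite (res_inc_diff w ne) (@res_inc_diff m.+1 m') // linear0 !add0r.
have [e|ne'] := pselect (m = m'); first by subst m'; rewrite !res_inc_same.
rewrite !res_inc_diff ?linear0 // => -[] e; exact: ne'.
Qed.

Lemma pi_sum (I : Type) (V : I -> lmodType k) (J : Type) (r : seq J) (F : J -> piM V) i :
  (\sum_(j <- r) F j) i = \sum_(j <- r) F j i.
Proof. by elim: r => [|j r IH]; rewrite ?big_nil // !big_cons piD IH. Qed.

Lemma sum_tail0 (V : zmodType) (F : nat -> V) g g' : (g' <= g)%N ->
  (forall m, (g' <= m)%N -> F m = 0) -> \sum_(m < g) F m = \sum_(m < g') F m.
Proof.
move=> le F0; rewrite -!(big_mkord xpredT F) (big_cat_nat (leq0n _) le) /=.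
by rewrite [X in _ + X]big_nat_cond [X in _ + X]big1 ?addr0 // => m /andP[/andP[/F0]].
Qed.

Lemma res_decomp X n (G : fam U) (b : res X n G) :
  b = \sum_(m < #|G|) res_inc m X n G (b m).
Proof.
apply: pi_ext => m; rewrite pi_sum.
have [lt|le] := ltnP m #|G|.
  rewrite (bigD1 (Ordinal lt)) //= [X in X + _]res_inc_same big1 ?addr0 // => i ne.
  apply: res_inc_diff => e; move: ne; rewrite -val_eqE /= e; exact/negP/negPn.
rewrite big1 => [|i _]; first exact: (bar_zero0 le).
by apply: res_inc_diff => e; move: (ltn_ord i); rewrite e ltnNge le.
Qed.

Hypothesis k_char0 : [pchar k] =i pred0.

Section Null.
Context X A (aA : acyclic A) (f : chmap (res X) A).

Let hm m := forall n, psh_hom (bar m X (n - 1)) (A n).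
Let fm m n G (w : bar m X n G) : A n G := f n G (res_inc m X n G w).

Lemma fm_d0 n G (w : bar 0 X n G) : cplx_d A n G (fm w) = fm (cplx_d (bar 0 X) n G w).
Proof. by rewrite /fm -chmap_d res_inc_d0. Qed.

Lemma fm_dS m n G (w : bar m.+1 X n G) :
  cplx_d A n G (fm w) = fm (cplx_d (bar m.+1 X) n G w) + fm (bar_del m X n G w).
Proof. by rewrite /fm -chmap_d res_inc_dS linearD. Qed.

(** The null-homotopy is built one term at a time. [good h] is the condition under which [f] minus
    [h] after [bar_del] is a chain map on the next term, whose K-projectivity then continues the
    homotopy; [bar_del2] makes the new piece good again. *)
Let good m (h : hm m) := forall n G (w : bar m.+1 X n G),
  fm (bar_del m X n G w) = cplx_d A n G (h n G (bar_del m X n G w)) +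
    h (n - 1) G (cplx_d (bar m X) (n - 1) G (bar_del m X n G w)).

Let next m (h : hm m) (h' : hm m.+1) := forall n G (w : bar m.+1 X (n - 1) G),
  fm w = cplx_d A n G (h' n G w) + h' (n - 1) G (cplx_d (bar m.+1 X) (n - 1) G w) +
    h (n - 1) G (bar_del m X (n - 1) G w).

Lemma res_null0 : exists h : hm 0, good h /\
  forall n G (w : bar 0 X (n - 1) G),
    fm w = cplx_d A n G (h n G w) + h (n - 1) G (cplx_d (bar 0 X) (n - 1) G w).
Proof.
have fd n G (w : bar 0 X n G) :
    psh_hom_comp (f (n - 1)) (res_inc 0 X (n - 1)) G (cplx_d (bar 0 X) n G w) =
    cplx_d A n G (psh_hom_comp (f n) (res_inc 0 X n) G w).
  by have := fm_d0 w => /esym.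
have [h hP] := bar_Kproj k_char0 aA (mkchmap fd).
by exists h; split=> n G w; apply: hP.
Qed.

Lemma res_nullS m (h : hm m) : good h -> exists h' : hm m.+1, good h' /\ next h h'.
Proof.
move=> gh.
pose g n : psh_hom (bar m.+1 X n) (A n) := psh_hom_add
  (psh_hom_comp (f n) (res_inc m.+1 X n)) (homN (psh_hom_comp (h n) (bar_del m X n))).
have gE n G w : g n G w = fm w - h n G (bar_del m X n G w) by [].
have gd n G (w : bar m.+1 X n G) :
    g (n - 1) G (cplx_d (bar m.+1 X) n G w) = cplx_d A n G (g n G w).
  rewrite !gE linearB fm_dS bar_del_d (linearN (h (n - 1) G)) gh.
  by zmod.
have [h' hP] := bar_Kproj k_char0 aA (mkchmap gd).
have nx : next h h'.
  by move=> n G w; have := hP n G w; rewrite -[LHS]/(g (n - 1) G w) gE => e; zby e.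
exists h'; split=> // n G w; rewrite nx.
by rewrite bar_del2 (linear0 (h (n - 1) G)) addr0.
Qed.

Lemma res_null : nullh f.
Proof.
have [h0 [gh0 h0P]] := res_null0.
pose step m (h : {h : hm m | good h}) : {h : hm m.+1 | good h} :=
  let e := cid (res_nullS (svalP h)) in exist _ (sval e) (svalP e).1.
pose hs := fix hs m : {h : hm m | good h} :=
  match m return {h : hm m | good h} with
  | 0 => exist _ h0 gh0 | m'.+1 => step m' (hs m') end.
pose h m := sval (hs m).
have hn m : next (h m) (h m.+1).
  by rewrite /h /= /step /=; case: cid => h' [].
(* The pieces add up to a homotopy on the product: at [G] only the terms of index below the order of
   [G] are nonzero. *)
pose H n G (b : res X (n - 1) G) := \sum_(m < #|fam_group G|) h m n G (b m).
have Hl n G : linear (@H n G).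
  move=> c x y; rewrite /H scaler_sumr -big_split /=; apply: eq_bigr => m _.
  exact: (linearP (h m n G)).
have hz m n (G : fam U) (b : res X (n - 1) G) : (#|G| <= m)%N -> h m n G (b m) = 0.
  by move=> le; rewrite (bar_zero0 le (b m)) linear0.
have Hn n (G G' : fam U) (a : surjection G G') (b : res X (n - 1) G') :
    H n G (psh_map (res X (n - 1)) a b) = psh_map (A n) a (H n G' b).
  rewrite /H linear_sum (sum_tail0 (surj_card a)
    (F := fun m => h m n G (psh_map (res X (n - 1)) a b m))) => [|m lem]; last first.
    rewrite -[X in h _ _ _ X]/(psh_map (bar m X (n - 1)) a (b m)) psh_hom_nat.
    by rewrite hz // linear0.
  apply: eq_bigr => m _.
  by rewrite -[X in h _ _ _ X]/(psh_map (bar m X (n - 1)) a (b m)) psh_hom_nat.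
exists (fun n => mkhom (@Hl n) (@Hn n)) => n G b.
rewrite -[RHS]/(cplx_d A n G (H n G b) + H (n - 1) G (cplx_d (res X) (n - 1) G b)).
have -> : f (n - 1) G b = \sum_(m < #|G|) fm (b m).
  by rewrite {1}(res_decomp b) linear_sum.
rewrite /H.
pose dd m := cplx_d A n G (h m n G (b m)) + h m (n - 1) G (cplx_d (bar m X) (n - 1) G (b m)).
pose t m := h m (n - 1) G (bar_del m X (n - 1) G (b m.+1)).
have f0 : fm (b 0) = dd 0%N by rewrite /dd h0P.
have fS m : fm (b m.+1) = dd m.+1 + t m by rewrite hn.
have tz m : (#|G| <= m.+1)%N -> t m = 0.
  by move=> le; rewrite /t (bar_zero0 le (b m.+1)) !linear0.
have key m : h m (n - 1) G (cplx_d (res X) (n - 1) G b m) =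
    h m (n - 1) G (cplx_d (bar m X) (n - 1) G (b m)) + t m.
  apply: etrans (congr1 (h m (n - 1) G) (res_cplx_dE b m)) _.
  exact: (linearD (h m (n - 1) G)).
rewrite linear_sum -big_split /=.
rewrite [RHS](eq_bigr (fun m : 'I__ => dd m + t m)); last first.
  move=> m _; apply: etrans (congr2 +%R (erefl _) (key m)) _; rewrite /dd.
  by zmod.
rewrite big_split /=.
have : (0 < #|G|)%N by apply/card_gt0P; exists 1%g.
move: tz; case: #|G| => // g tz _.
rewrite big_ord_recl f0 (eq_bigr (fun m : 'I__ => dd m.+1 + t m)) => [|m _]; last exact: fS.
rewrite big_split /= [X in _ = X + _]big_ord_recl [X in _ = _ + X]big_ord_recr /=.
by rewrite tz // addr0 addrA.
Qed.
End Null.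

Lemma res_Kproj X : Kproj (res X).
Proof. by move=> A aA f; apply: res_null. Qed.

Lemma resolution X : exists (P : cplx k U) (q : chmap P X), Kproj P /\ quasi_iso q.
Proof.
by exists (res X), (res_eps X); split; [apply: res_Kproj|apply: res_qis].
Qed.
End Resolution.

(** * Direct sums and compactness *)

Lemma dchoice (I : Type) (T : I -> Type) (Q : forall i, T i -> Prop) :
  (forall i, exists x, Q i x) -> exists f : forall i, T i, forall i, Q i (f i).
Proof. by move=> h; exists (fun i => sval (cid (h i))) => i; case: cid. Qed.

Section DirectSum.
Context (k : fieldType) (U : finGroupType -> Prop) (I : Type).

Section Psh.
Context (M : I -> psh k U).

Definition ds_el (G : fam U) i (x : M i G) : {i : I & M i G} := existT _ i x.

Definition ds_rel (G : fam U) (b : {i : I & M i G} -> k) : Prop :=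
  forall i (s : k) (x y : M i G), b (ds_el (s *: x + y)) = s * b (ds_el x) + b (ds_el y).

Definition ds_mod (G : fam U) : lmodType k := pres (@ds_rel G).

Definition ds_inc (G : fam U) i (x : M i G) : ds_mod G := gen (@ds_rel G) (ds_el x).

Lemma ds_inc_lin (G : fam U) i : linear (@ds_inc G i).
Proof. by move=> s x y; apply: gen_lin => b; apply. Qed.

Lemma ds_ind (G : fam U) (Q : ds_mod G -> Prop) : Q 0 ->
  (forall i x y, Q y -> Q (@ds_inc G i x + y)) -> forall x, Q x.
Proof.
move=> Q0 QS; apply: pres_ind => // s [i x] y Qy.
have -> : s *: gen (@ds_rel G) (ds_el x) = ds_inc (s *: x).
  exact: (esym (linearZ_LR (mklin (@ds_inc_lin G i)) s x)).
exact: QS.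
Qed.

Lemma ds_eq (G : fam U) (L : lmodType k) (f g : {linear ds_mod G -> L}) :
  (forall i x, f (@ds_inc G i x) = g (ds_inc x)) -> forall x, f x = g x.
Proof. by move=> h; apply: pres_eq => -[i x]; apply: h. Qed.

Lemma ds_test (G : fam U) (L : lmodType k) (f : forall i, {linear M i G -> L})
  (phi : {linear L -> k^o}) : ds_rel (fun e => phi (f (projT1 e) (projT2 e))).
Proof. by move=> i s x y; rewrite /= !linearP. Qed.

Definition ds_lift (G : fam U) (L : lmodType k) (f : forall i, {linear M i G -> L}) :
  {linear ds_mod G -> L} :=
  pres_lift (f := fun e => f (projT1 e) (projT2 e)) (ds_test f).

Lemma ds_liftE (G : fam U) (L : lmodType k) (f : forall i, {linear M i G -> L}) i x :
  ds_lift f (ds_inc x) = f i x.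
Proof. exact: pres_liftE. Qed.

Lemma ds_map_lin (G H : fam U) (a : surjection G H) i :
  linear (fun x : M i H => ds_inc (psh_map (M i) a x)).
Proof. by move=> s x y; rewrite linearP ds_inc_lin. Qed.

Definition ds_map (G H : fam U) (a : surjection G H) : {linear ds_mod H -> ds_mod G} :=
  ds_lift (fun i => mklin (@ds_map_lin G H a i)).

Lemma ds_mapE (G H : fam U) (a : surjection G H) i (x : M i H) :
  ds_map a (ds_inc x) = ds_inc (psh_map (M i) a x).
Proof. exact: ds_liftE. Qed.

Lemma ds_map_id (G : fam U) x : ds_map (surj_id G) x = x.
Proof. by apply: (@ds_eq G _ (ds_map (surj_id G)) idfun) => i y; rewrite ds_mapE psh_map_id. Qed.

Lemma ds_map_comp (G H K : fam U) (b : surjection H K) (a : surjection G H) x :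
  ds_map (surj_comp b a) x = ds_map a (ds_map b x).
Proof.
apply: (@ds_eq K _ (ds_map (surj_comp b a)) (ds_map a \o ds_map b)) => i y.
by rewrite -[RHS]/(ds_map a (ds_map b (ds_inc y))) !ds_mapE psh_map_comp.
Qed.

Lemma ds_map_conj (G H : fam U) (a b : surjection G H) : surj_conj a b ->
  forall x, ds_map a x = ds_map b x.
Proof. by move=> ab; apply: ds_eq => i y; rewrite !ds_mapE (psh_map_conj ab). Qed.

Definition dsP : psh k U := @Psh k U ds_mod ds_map ds_map_id ds_map_comp ds_map_conj.

Lemma dsP_inc_nat i (G H : fam U) (a : surjection G H) (x : M i H) :
  ds_inc (psh_map (M i) a x) = psh_map dsP a (ds_inc x).
Proof. exact: (esym (ds_mapE a x)). Qed.

Definition dsP_inc i : psh_hom (M i) dsP :=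
  @mkhom k U (M i) dsP (fun G => @ds_inc G i) (fun G => @ds_inc_lin G i) (@dsP_inc_nat i).

Section Out.
Context (N : psh k U) (f : forall i, psh_hom (M i) N).

Lemma dsP_out_nat (G H : fam U) (a : surjection G H) x :
  ds_lift (fun i => f i G) (psh_map dsP a x) = psh_map N a (ds_lift (fun i => f i H) x).
Proof.
apply: (@ds_eq H _ (ds_lift (fun i => f i G) \o ds_map a)
  (psh_map N a \o ds_lift (fun i => f i H))) => i y.
rewrite -[LHS]/(ds_lift (fun i => f i G) (ds_map a (ds_inc y))) ds_mapE.
by rewrite -[RHS]/(psh_map N a (ds_lift (fun i => f i H) (ds_inc y))) !ds_liftE psh_hom_nat.
Qed.

Definition dsP_out : psh_hom dsP N := PshHom dsP_out_nat.

Lemma dsP_out_inc i G x : dsP_out G (dsP_inc i G x) = f i G x.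
Proof. exact: ds_liftE. Qed.
End Out.

Lemma dsP_ext (N : psh k U) (f g : psh_hom dsP N) :
  (forall i G x, f G (dsP_inc i G x) = g G (dsP_inc i G x)) -> forall G x, f G x = g G x.
Proof. by move=> h G; apply: ds_eq => i x; apply: h. Qed.
End Psh.

Context (Z : I -> cplx k U).

Definition dsc_d n : psh_hom (dsP (fun i => Z i n)) (dsP (fun i => Z i (n - 1))) :=
  dsP_out (fun i => psh_hom_comp (dsP_inc (fun i => Z i (n - 1)) i) (cplx_d (Z i) n)).

Lemma dsc_d_inc n i G (x : Z i n G) :
  dsc_d n G (dsP_inc (fun i => Z i n) i G x) =
  dsP_inc (fun i => Z i (n - 1)) i G (cplx_d (Z i) n G x).
Proof. exact: dsP_out_inc. Qed.

Lemma dsc_dd n G x : dsc_d (n - 1) G (dsc_d n G x) = 0.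
Proof.
apply: (@dsP_ext _ _ (psh_hom_comp (dsc_d (n - 1)) (dsc_d n)) (hom0 _ _)) => i H y.
rewrite -[LHS]/(dsc_d (n - 1) H (dsc_d n H _)) !dsc_d_inc cplx_dd.
by rewrite linear0.
Qed.

Definition dsc : cplx k U := Cplx dsc_dd.

Lemma dinc_d i n G (x : Z i n G) :
  dsP_inc (fun i => Z i (n - 1)) i G (cplx_d (Z i) n G x) =
  cplx_d dsc n G (dsP_inc (fun i => Z i n) i G x).
Proof. exact: (esym (dsc_d_inc x)). Qed.

Definition dinc i : chmap (Z i) dsc :=
  @mkchmap k U (Z i) dsc (fun n => dsP_inc (fun i => Z i n) i) (@dinc_d i).

Lemma dsc_ext n (N : psh k U) (f g : psh_hom (dsc n) N) :
  (forall i G x, f G (dinc i n G x) = g G (dinc i n G x)) -> forall G x, f G x = g G x.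
Proof. exact: dsP_ext. Qed.

Lemma dsc_ind n G (Q : dsc n G -> Prop) : Q 0 ->
  (forall i x y, Q y -> Q (dinc i n G x + y)) -> forall x, Q x.
Proof. exact: ds_ind. Qed.

Section OutC.
Context (W : cplx k U) (f : forall i, chmap (Z i) W).

Lemma dout_d n G (x : dsc n G) :
  dsP_out (fun i => f i (n - 1)) G (cplx_d dsc n G x) =
  cplx_d W n G (dsP_out (fun i => f i n) G x).
Proof.
apply: (@dsc_ext n _ (psh_hom_comp (dsP_out (fun i => f i (n - 1))) (cplx_d dsc n))
  (psh_hom_comp (cplx_d W n) (dsP_out (fun i => f i n)))) => i H y.
rewrite -[LHS]/(dsP_out (fun i => f i (n - 1)) H (cplx_d dsc n H (dinc i n H y))).
rewrite -[RHS]/(cplx_d W n H (dsP_out (fun i => f i n) H (dinc i n H y))).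
by rewrite -chmap_d !dsP_out_inc chmap_d.
Qed.

Definition dout : chmap dsc W :=
  @mkchmap k U dsc W (fun n => dsP_out (fun i => f i n)) dout_d.

Lemma dout_inc i n G x : dout n G (dinc i n G x) = f i n G x.
Proof. exact: dsP_out_inc. Qed.
End OutC.

Lemma nullh_dsc (W : cplx k U) (f : chmap dsc W) :
  (forall i, nullh (chmap_comp f (dinc i))) -> nullh f.
Proof.
move=> /dchoice[h hP].
pose H n : psh_hom (dsc (n - 1)) (W n) := dsP_out (fun i => h i n).
have HE n i G x : H n G (dinc i (n - 1) G x) = h i n G x by apply: dsP_out_inc.
exists H => n; apply: (@dsc_ext _ _ (f (n - 1)) (psh_hom_add (psh_hom_comp (cplx_d W n) (H n))
  (psh_hom_comp (H (n - 1)) (cplx_d dsc (n - 1))))) => i G x.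
rewrite -[RHS]/(cplx_d W n G (H n G (dinc i (n - 1) G x)) +
  H (n - 1) G (cplx_d dsc (n - 1) G (dinc i (n - 1) G x))).
by rewrite -chmap_d !HE; apply: hP.
Qed.

Lemma dsc_Kproj : (forall i, Kproj (Z i)) -> Kproj dsc.
Proof. by move=> KZ A aA f; apply: nullh_dsc => i; apply: KZ. Qed.

(** The idempotent that keeps the summands in [s]. It goes by membership, so lists may be enlarged
    and joined without regard to repetitions. *)
Definition dsel (s : seq I) : chmap dsc dsc :=
  dout (fun i => if pselect (List.In i s) then dinc i else ch0 _ _).

Lemma dsel_inc s i n G x : List.In i s -> dsel s n G (dinc i n G x) = dinc i n G x.
Proof. by rewrite /dsel dout_inc; case: pselect. Qed.

Lemma dsel_out s i n G x : ~ List.In i s -> dsel s n G (dinc i n G x) = 0.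
Proof. by rewrite /dsel dout_inc; case: pselect. Qed.

Lemma dsel_sel s s' n G x : List.incl s s' -> dsel s' n G (dsel s n G x) = dsel s n G x.
Proof.
move=> ss'; apply: (@dsc_ext n _ (psh_hom_comp (dsel s' n) (dsel s n)) (dsel s n)) => i H y.
rewrite -[LHS]/(dsel s' n H (dsel s n H (dinc i n H y))).
have [si|nsi] := pselect (List.In i s).
  by rewrite !dsel_inc //; apply: ss'.
by rewrite !dsel_out // linear0.
Qed.

Lemma dsel_fin n G (x : dsc n G) :
  exists s, forall s', List.incl s s' -> dsel s' n G x = x.
Proof.
elim/dsc_ind: x => [|i x y [s sP]]; first by exists [::] => s' _; rewrite linear0.
exists (i :: s) => s' ss'; rewrite linearD dsel_inc; last by apply: ss'; left.
by rewrite sP // => j sj; apply: ss'; right.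
Qed.

Definition dlt j i : chmap (Z j) (Z i) :=
  match pselect (j = i) with
  | left e => eq_rect j (fun i => chmap (Z j) (Z i)) (chmap_id (Z j)) i e
  | right _ => ch0 _ _
  end.

Lemma dlt_id i : dlt i i = chmap_id (Z i).
Proof. by rewrite /dlt; case: pselect => // e; rewrite (Prop_irrelevance e erefl). Qed.

Lemma dlt_neq j i : j <> i -> dlt j i = ch0 _ _.
Proof. by rewrite /dlt; case: pselect. Qed.

Definition dpr i : chmap dsc (Z i) := dout (fun j => dlt j i).

Lemma dpr_inc i n G x : dpr i n G (dinc i n G x) = x.
Proof. by rewrite /dpr dout_inc dlt_id. Qed.

Lemma dpr_inc0 i j n G x : j <> i -> dpr i n G (dinc j n G x) = 0.
Proof. by move=> ne; rewrite /dpr dout_inc dlt_neq. Qed.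

Lemma dsel_sum s n G (x : dsc n G) : List.NoDup s ->
  dsel s n G x = \sum_(i <- s) dinc i n G (dpr i n G x).
Proof.
elim: s => [_|j s IH ns].
  rewrite big_nil; apply: (@dsc_ext n _ (dsel [::] n) (hom0 _ _)) => i H y.
  exact: dsel_out.
inversion ns as [|j' s' nj ns']; subst; rewrite big_cons -IH //.
apply: (@dsc_ext n _ (dsel (j :: s) n) (psh_hom_add (psh_hom_comp (dinc j n) (dpr j n))
  (dsel s n))) => i H y.
rewrite -[RHS]/(dinc j n H (dpr j n H (dinc i n H y)) + dsel s n H (dinc i n H y)).
have [e|ne] := pselect (i = j).
  by subst i; rewrite dpr_inc (dsel_out (s := s)) // addr0 dsel_inc //; left.
rewrite dpr_inc0 // linear0 add0r; have [si|nsi] := pselect (List.In i s).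
  by rewrite !dsel_inc //; right.
by rewrite !dsel_out // => -[e|//]; apply: ne.
Qed.

Definition dedup (s : seq I) : seq I := List.nodup (fun x y => pselect (x = y)) s.

Lemma dsc_decomp n G (x : dsc n G) :
  exists s, List.NoDup s /\ x = \sum_(i <- s) dinc i n G (dpr i n G x).
Proof.
have [s sP] := dsel_fin x; exists (dedup s); split; first exact: List.NoDup_nodup.
rewrite -dsel_sum; last exact: List.NoDup_nodup.
by rewrite sP // => i; rewrite List.nodup_In.
Qed.
End DirectSum.

Section DirectSumMap.
Context (k : fieldType) (U : finGroupType -> Prop) (I : Type).
Context (A B : I -> cplx k U) (q : forall i, chmap (A i) (B i)).

Definition dsmap : chmap (dsc A) (dsc B) := dout (fun i => chmap_comp (dinc B i) (q i)).

Lemma dsmap_inc i n G x : dsmap n G (dinc A i n G x) = dinc B i n G (q i n G x).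
Proof. exact: dout_inc. Qed.

Lemma dsmap_pr i n G x : dpr B i n G (dsmap n G x) = q i n G (dpr A i n G x).
Proof.
apply: (@dsc_ext _ _ _ _ n _ (psh_hom_comp (dpr B i n) (dsmap n))
  (psh_hom_comp (q i n) (dpr A i n))) => j H y.
rewrite -[LHS]/(dpr B i n H (dsmap n H (dinc A j n H y))) dsmap_inc.
rewrite -[RHS]/(q i n H (dpr A i n H (dinc A j n H y))).
have [e|ne] := pselect (j = i); first by subst j; rewrite !dpr_inc.
by rewrite !dpr_inc0 // linear0.
Qed.

Lemma dsmap_qis : (forall i, quasi_iso (q i)) -> quasi_iso dsmap.
Proof.
move=> qq n G; split.
  move=> x dx [y ey].
  have [s [_ xE]] := dsc_decomp x.
  have /dchoice[x' x'P] : forall i, exists x', dpr A i (n - 1) G x = cplx_d (A i) n G x'.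
    move=> i; apply: (qq i n G).1; first by rewrite -chmap_d dx linear0.
    by exists (dpr B i n G y); rewrite -chmap_d -ey dsmap_pr.
  exists (\sum_(i <- s) dinc A i n G (x' i)).
  by rewrite linear_sum xE; apply: eq_bigr => i _; rewrite -chmap_d x'P.
move=> y dy; have [s [_ yE]] := dsc_decomp y.
have /dchoice[x xP] : forall i, exists x : A i (n - 1) G, exists y' : B i n G,
    cplx_d (A i) (n - 1) G x = 0 /\ dpr B i (n - 1) G y = q i (n - 1) G x + cplx_d (B i) n G y'.
  by move=> i; apply: (qq i n G).2; rewrite -chmap_d dy linear0.
have {xP} /dchoice[y' xP] := xP.
exists (\sum_(i <- s) dinc A i (n - 1) G (x i)), (\sum_(i <- s) dinc B i n G (y' i)); split.
  by rewrite linear_sum big1 // => i _; rewrite -chmap_d (xP i).1 linear0.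
have e i : dinc B i (n - 1) G (dpr B i (n - 1) G y) =
    dsmap (n - 1) G (dinc A i (n - 1) G (x i)) + cplx_d (dsc B) n G (dinc B i n G (y' i)).
  by rewrite dsmap_inc -chmap_d -linearD (xP i).2.
rewrite {1}yE (eq_bigr _ (fun i _ => e i)) big_split.
by congr (_ + _); apply: esym; apply: linear_sum.
Qed.
End DirectSumMap.

(** * Coproducts and compactness in the derived category *)

Section Coproduct.
Context (k : fieldType) (U : finGroupType -> Prop) (k_char0 : [pchar k] =i pred0).
Implicit Types (X Y P : cplx k U).

Lemma deq_cancel_qis X Y P (q : chmap X Y) : quasi_iso q -> forall u v : dmor Y P,
  deq (dcomp u (dmap q)) (dcomp v (dmap q)) -> deq u v.
Proof.
move=> qq u v e.
have {}e : deq (dcomp (dcomp u (dmap q)) (dinv qq)) (dcomp (dcomp v (dmap q)) (dinv qq)).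
  by rewrite e.
by rewrite -!deq_compA !deq_invr !deq_comp1r in e.
Qed.

(** On the resolutions of the [Z i] the given words become chain maps, which are assembled on the
    direct sum of the resolutions; a direct sum of quasi-isomorphisms is again one. Uniqueness holds
    because that direct sum is K-projective. *)
Lemma dsc_coproduct (I : Type) (Z : I -> cplx k U) :
  is_coproduct (fun i => dmap (dinc Z i)).
Proof.
move=> W g.
pose r i := res_eps (Z i).
have qr : quasi_iso (dsmap r) by apply: dsmap_qis => i; apply: res_qis.
have /dchoice[f fP] : forall i, exists f, deq (dcomp (g i) (dmap (r i))) (dmap f).
  by move=> i; apply: word_lift; apply: res_Kproj.
have rinc i : deq (dcomp (dmap (dsmap r)) (dmap (dinc (fun i => res (Z i)) i)))
    (dcomp (dmap (dinc Z i)) (dmap (r i))).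
  by rewrite -!deq_map_comp; apply: deq_map_ext => n G x; apply: dsmap_inc.
exists (dcomp (dmap (dout f)) (dinv qr)); split.
  move=> i; apply: (deq_cancel_qis (res_qis (Z i))).
  rewrite -/(r i) fP -!deq_compA -rinc.
  rewrite [X in deq (dcomp _ X) _]deq_compA deq_invl deq_comp1l -deq_map_comp.
  by apply: deq_map_ext => n G x; apply: dout_inc.
move=> h' h'P; apply: (deq_cancel_qis qr).
rewrite -[X in deq _ X]deq_compA deq_invl deq_comp1r.
have KP : Kproj (dsc (fun i => res (Z i))) by apply: dsc_Kproj => i; apply: res_Kproj.
have [m mP] := word_lift KP h' (dsmap r).
rewrite mP; apply: heq_deq; apply: nullh_dsc => i.
have : deq (dmap (chmap_comp m (dinc (fun i => res (Z i)) i))) (dmap (f i)).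
  by rewrite deq_map_comp -mP -deq_compA rinc deq_compA h'P fP.
move/(deq_heq (res_Kproj k_char0 (X:=_))); apply: nullh_ext => n G x.
rewrite /= -[LHS]/(m n G (dinc (fun i => res (Z i)) i n G x) - f i n G x).
by rewrite -[f i n G x](dout_inc f).
Qed.

Lemma dsum_comp (I : Type) (Y : I -> cplx k U) (X C D : cplx k U)
  (inj : forall i, dmor (Y i) C) s (g : forall i, dmor X (Y i)) (v : dmor C D) :
  deq (dcomp v (dsum inj s g)) (dsum (fun i => dcomp v (inj i)) s g).
Proof.
elim: s => [|i s IH] /=; first exact: deq_comp0r.
by rewrite deq_compDr IH deq_compA.
Qed.

Lemma dsum_compr (I : Type) (Y : I -> cplx k U) (X X' C : cplx k U)
  (inj : forall i, dmor (Y i) C) s (g : forall i, dmor X (Y i)) (v : dmor X' X) :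
  deq (dcomp (dsum inj s g) v) (dsum inj s (fun i => dcomp (g i) v)).
Proof.
elim: s => [|i s IH] /=; first exact: deq_comp0l.
by rewrite deq_compDl IH deq_compA.
Qed.

Lemma dsum_congr (I : Type) (Y : I -> cplx k U) (X C : cplx k U)
  (inj inj' : forall i, dmor (Y i) C) s (g : forall i, dmor X (Y i)) :
  (forall i, List.In i s -> deq (inj i) (inj' i)) -> deq (dsum inj s g) (dsum inj' s g).
Proof.
elim: s => [|i s IH] //= h.
by rewrite IH ?h //; [left|move=> j sj; apply: h; right].
Qed.

Lemma dsum_dlt0 (I : Type) (Y : I -> cplx k U) (X : cplx k U) i s
  (g : forall i, dmor X (Y i)) : ~ List.In i s ->
  deq (dsum (fun j => dmap (dlt Y j i)) s g) (dzero _ _).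
Proof.
elim: s => [|j s IH] //= ns; rewrite IH; last by move=> h; apply: ns; right.
rewrite dlt_neq; last by move=> h; apply: ns; left.
by rewrite deq_map0 deq_comp0l deq_add0.
Qed.

Lemma dsum_dlt (I : Type) (Y : I -> cplx k U) (X : cplx k U) i s
  (g : forall i, dmor X (Y i)) : List.NoDup s -> List.In i s ->
  deq (dsum (fun j => dmap (dlt Y j i)) s g) (g i).
Proof.
elim: s => [|j s IH] //= ns; inversion ns as [|j' s' nj ns']; subst => -[e|si].
  subst j; rewrite dsum_dlt0 // dlt_id -/(did (Y i)) deq_comp1l.
  exact: deq_addr0.
rewrite IH // dlt_neq; last by move=> e; apply: nj; rewrite e.
by rewrite deq_map0 deq_comp0l deq_add0.
Qed.

(** The injectivity half follows by composing with the map from the coproduct to its [i]-th object,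
    which recovers the component [g i]. *)
Lemma compact_objE X : compact_obj X <->
  forall (I : Type) (Y : I -> cplx k U) (C : cplx k U) (inj : forall i, dmor (Y i) C),
    is_coproduct inj -> forall h : dmor X C, exists (s : seq I) (g : forall i, dmor X (Y i)),
      List.NoDup s /\ deq h (dsum inj s g).
Proof.
split=> [cX I Y C inj ci|cX I Y C inj ci]; first exact: (cX I Y C inj ci).1.
split; first exact: cX.
move=> s g ns e i si.
have [p [pP _]] := ci (Y i) (fun j => dmap (dlt Y j i)).
have e' : deq (dcomp p (dsum inj s g)) (dcomp p (dzero X C)) by rewrite e.
by move: e'; rewrite deq_comp0r dsum_comp (dsum_congr g (fun j _ => pP j)) dsum_dlt.
Qed.

Lemma compact_retract X Y : retract X Y -> compact_obj Y -> compact_obj X.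
Proof.
move=> [i [r ri]] /compact_objE cY; apply/compact_objE => I Z C inj ci h.
have [s [g [ns e]]] := cY I Z C inj ci (dcomp h r).
exists s, (fun j => dcomp (g j) i); split=> //.
by rewrite -dsum_compr -e -deq_compA ri deq_comp1r.
Qed.

Lemma qis_retract X Y (q : chmap X Y) : quasi_iso q -> retract X Y /\ retract Y X.
Proof.
move=> qq; split.
  by exists (dmap q), (dinv qq); apply: deq_invl.
by exists (dinv qq), (dmap q); apply: deq_invr.
Qed.

(* For K-projective [P] this is compactness, because direct sums of complexes are
   coproducts in the derived category. *)
Definition cpt P : Prop := forall (I : Type) (Z : I -> cplx k U) (f : chmap P (dsc Z)),
  exists s, heq f (chmap_comp (dsel Z s) f).

Lemma compact_cpt X P (q : chmap P X) : Kproj P -> quasi_iso q -> compact_obj X -> cpt P.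
Proof.
move=> KP qq /compact_objE cX I Z f.
have [s [g [ns e]]] := cX I Z _ _ (@dsc_coproduct I Z) (dcomp (dmap f) (dinv qq)).
exists s; apply: (deq_heq KP).
have ef : deq (dmap f) (dcomp (dsum (fun i => dmap (dinc Z i)) s g) (dmap q)).
  by rewrite -e -deq_compA deq_invl deq_comp1r.
rewrite deq_map_comp ef deq_compA dsum_comp.
rewrite (@dsum_congr _ _ _ _ (fun i => dcomp (dmap (dsel Z s)) (dmap (dinc Z i)))
  (fun i => dmap (dinc Z i))) // => i si.
by rewrite -deq_map_comp; apply: deq_map_ext => n G x; apply: dsel_inc.
Qed.

Lemma dsel_dsum (I : Type) (Z : I -> cplx k U) P (f : chmap P (dsc Z)) s : List.NoDup s ->
  deq (dmap (chmap_comp (dsel Z s) f))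
    (dsum (fun i => dmap (dinc Z i)) s (fun i => dmap (chmap_comp (dpr Z i) f))).
Proof.
elim: s => [|j s IH] ns /=.
  rewrite -deq_map0; apply: deq_map_ext => n G x.
  by rewrite /= -[LHS]/(dsel Z [::] n G (f n G x)) dsel_sum // big_nil.
inversion ns as [|j' s' nj ns']; subst; rewrite -IH // -deq_map_comp -deq_map_add.
apply: deq_map_ext => n G x.
rewrite -[LHS]/(dsel Z (j :: s) n G (f n G x)) dsel_sum // big_cons.
by rewrite -[RHS]/(dinc Z j n G (dpr Z j n G (f n G x)) + dsel Z s n G (f n G x)) dsel_sum.
Qed.

Lemma cpt_compact X P (q : chmap P X) : Kproj P -> quasi_iso q -> cpt P -> compact_obj X.
Proof.
move=> KP qq cP; apply/compact_objE => I Z C inj ci h.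
(* [C] is an arbitrary coproduct of the [Z i]; [ps] and [ph] compare it with the direct sum, to
   which [cP] applies. *)
have [ps [psP _]] := ci _ (fun i => dmap (dinc Z i)).
have [ph [phP _]] := @dsc_coproduct I Z C inj.
have e1 : deq (dcomp ph ps) (did C).
  have [u [_ uP]] := ci C inj.
  rewrite (uP (dcomp ph ps)); last by move=> i; rewrite -deq_compA psP phP.
  by rewrite (uP (did C)) // => i; rewrite deq_comp1l.
have [f fP] := word_lift KP (dcomp ps h) q.
have [s sP] := cP I Z f; exists (dedup s).
exists (fun i => dcomp (dmap (chmap_comp (dpr Z i) f)) (dinv qq)).
have ns : List.NoDup (dedup s) by apply: List.NoDup_nodup.
split=> //; rewrite -dsum_compr.
rewrite -(@dsum_congr _ _ _ _ (fun i => dcomp ph (dmap (dinc Z i))) inj); last by move=> i _; apply: phP.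
rewrite -dsum_comp -dsel_dsum //.
have -> : deq (dmap (chmap_comp (dsel Z (dedup s)) f)) (dmap f).
  rewrite (heq_deq sP); apply: deq_map_ext => n G x /=.
  rewrite -!/(dsel _ _ _ _ _).
  apply: (@dsc_ext _ _ _ _ n _ (dsel Z (dedup s) n) (dsel Z s n)) => i H y.
  have [si|nsi] := pselect (List.In i s).
    by rewrite !dsel_inc // List.nodup_In.
  by rewrite !dsel_out // List.nodup_In.
by rewrite -fP -!deq_compA deq_invr deq_comp1r deq_compA e1 deq_comp1l.
Qed.
End Coproduct.

Section ConeFactor.
Context (k : fieldType) (U : finGroupType -> Prop) (X Y Z : cplx k U) (f : chmap X Y).

(** Exactness of homotopy classes at the cone: [u], corrected by the null-homotopy of its
    restriction to [Y], depends only on the component in [shift X]. *)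
Lemma cone_factor (u : chmap (cone f) Z) : nullh (chmap_comp u (cone_in f)) ->
  exists v : chmap (shift X) Z, heq u (chmap_comp v (cone_pr f)).
Proof.
move=> [h hP].
have gl n G : linear (fun x : shift X n G => u n G (0, x) - h n G (f (n - 1) G x)).
  move=> c x y; rewrite (linearP (f (n - 1) G)) (linearP (h n G)).
  have -> : u n G (0, c *: x + y) = c *: u n G (0, x) + u n G (0, y).
    by rewrite -linearP; congr (u n G _); congr pair; rewrite /= ?scaler0 ?addr0.
  by rewrite scalerBr; zmod.
have gn n (G H : fam U) (a : surjection G H) (x : shift X n H) :
    u n G (0, psh_map (shift X n) a x) - h n G (f (n - 1) G (psh_map (shift X n) a x)) =
    psh_map (Z n) a (u n H (0, x) - h n H (f (n - 1) H x)).
  rewrite linearB -!psh_hom_nat; congr (u n G _ - _).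
  by congr pair; rewrite /= linear0.
have gd n G (x : shift X n G) :
    mkhom (@gl (n - 1)) (@gn (n - 1)) G (cplx_d (shift X) n G x) =
    cplx_d Z n G (mkhom (@gl n) (@gn n) G x).
  have e : u (n - 1) G (f (n - 1) G x, 0) = cplx_d Z n G (h n G (f (n - 1) G x)) +
      h (n - 1) G (cplx_d Y (n - 1) G (f (n - 1) G x)) := hP n G (f (n - 1) G x).
  have eg := chmap_d u (0, x : X (n - 1) G).
  have ec : cplx_d (cone f) n G (0, x) = (0, - cplx_d X (n - 1) G x) + (f (n - 1) G x, 0).
    by congr pair; rewrite /= ?linear0 ?addr0.
  rewrite ec (linearD (u (n - 1) G)) in eg.
  rewrite -[LHS]/(u (n - 1) G (0, - cplx_d X (n - 1) G x) -
     h (n - 1) G (f (n - 1 - 1) G (- cplx_d X (n - 1) G x))).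
  rewrite -[RHS]/(cplx_d Z n G (u n G (0, x) - h n G (f (n - 1) G x))).
  rewrite (linearN (f (n - 1 - 1) G)) (linearN (h (n - 1) G)) (linearB (cplx_d Z n G)).
  by rewrite -chmap_d in e; zby e eg.
exists (mkchmap gd).
have rl n G : linear (fun z : cone f (n - 1) G => h n G z.1).
  by move=> c x y; rewrite -linearP.
have rn n (G H : fam U) (a : surjection G H) (z : cone f (n - 1) H) :
    h n G (psh_map (cone f (n - 1)) a z).1 = psh_map (Z n) a (h n H z.1).
  by rewrite -psh_hom_nat.
exists (fun n => mkhom (@rl n) (@rn n)) => n G [y x].
have e1 : u (n - 1) G (y, 0) = cplx_d Z n G (h n G y) + h (n - 1) G (cplx_d Y (n - 1) G y) :=
  hP n G y.
rewrite -[LHS]/(u (n - 1) G (y, x) - (u (n - 1) G (0, x) - h (n - 1) G (f (n - 1 - 1) G x))).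
rewrite -[RHS]/(cplx_d Z n G (h n G y) +
  h (n - 1) G (cplx_d Y (n - 1) G y + f (n - 1 - 1) G x)).
have -> : (y, x) = (y, 0) + (0, x) :> cone f (n - 1) G.
  by congr pair; rewrite /= ?addr0 ?add0r.
rewrite (linearD (u (n - 1) G)) (linearD (h (n - 1) G)).
by zby e1.
Qed.
End ConeFactor.

(** * Compact objects form a thick subcategory *)

Section ThickCompact.
Context (k : fieldType) (U : finGroupType -> Prop) (k_char0 : [pchar k] =i pred0).
Implicit Types (X Y P Q : cplx k U).

Lemma cpt_shift P : cpt P -> cpt (shift P).
Proof.
move=> cP I Z f.
pose Z' i := unshift (Z i).
(* [unshift (dsc Z)] and [dsc Z'] have the same terms, and their differentials agree on each
   summand. *)
have td n G (x : unshift (dsc Z) n G) :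
    psh_hom_id (dsc Z' (n - 1)) G (cplx_d (unshift (dsc Z)) n G x) =
    cplx_d (dsc Z') n G (psh_hom_id (dsc Z' n) G x).
  apply: (@dsc_ext _ _ _ Z' n _ (cplx_d (unshift (dsc Z)) n) (cplx_d (dsc Z') n)) => i H y.
  rewrite -chmap_d [LHS]unshift_dE unshift_dE -/(dinc Z i (n + 1) H y).
  rewrite -[dinc Z' i n H y]/(dinc Z i (n + 1) H y) -chmap_dr.
  by rewrite -[RHS]/(dinc Z i (n - 1 + 1) H (- _)) linearN.
pose th : chmap (unshift (dsc Z)) (dsc Z') :=
  @mkchmap k U (unshift (dsc Z)) (dsc Z') (fun n => psh_hom_id (dsc Z' n)) td.
have td' n G (x : dsc Z' n G) :
    psh_hom_id (dsc Z' (n - 1)) G (cplx_d (dsc Z') n G x) =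
    cplx_d (unshift (dsc Z)) n G (psh_hom_id (dsc Z' n) G x).
  exact: (esym (td n G x)).
pose th' : chmap (dsc Z') (unshift (dsc Z)) :=
  @mkchmap k U (dsc Z') (unshift (dsc Z)) (fun n => psh_hom_id (dsc Z' n)) td'.
have [s sP] := cP I Z' (chmap_comp th (unsh f)); exists s.
apply: unsh_null.
apply: nullh_ext (nullh_compl th' sP).
apply: pred_ind => n G x.
rewrite -[RHS]/(unsh_fun _ (n - 1) G x) unsh_funE.
rewrite -[LHS]/(unsh_fun f (n - 1) G x - dsel Z' s (n - 1) G (unsh_fun f (n - 1) G x)).
rewrite unsh_funE chBE linearB -[chmap_comp _ _ _ _ _]/(dsel Z s n G (f n G x)).
congr (_ - _); rewrite -[in RHS](chmap_ct (dsel Z s)).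
move: (ct (dsc Z) _ G (f n G x)) => y.
apply: (@dsc_ext _ _ _ Z' (n - 1) _ (dsel Z' s (n - 1)) (dsel Z s (n - 1 + 1))) => i H z.
rewrite -[X in _ = dsel Z s _ _ X]/(dinc Z i (n - 1 + 1) H z).
have [si|nsi] := pselect (List.In i s); first by rewrite !dsel_inc.
by rewrite !dsel_out.
Qed.

Lemma cpt_unshift P : cpt (shift P) -> cpt P.
Proof.
move=> cP I Z f.
pose Z' i := shift (Z i).
pose f' n : psh_hom (shift P n) (dsc Z' n) := f (n - 1).
have f'd n G (x : shift P n G) :
    f' (n - 1) G (cplx_d (shift P) n G x) = cplx_d (dsc Z') n G (f' n G x).
  rewrite -[LHS]/(f (n - 1 - 1) G (- cplx_d P (n - 1) G x)) (linearN (f (n - 1 - 1) G)) chmap_d.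
  rewrite /f'; move: (f (n - 1) G x) => y.
  apply: (@dsc_ext _ _ _ Z' n _ (homN (cplx_d (dsc Z) (n - 1))) (cplx_d (dsc Z') n)) => i H z.
  rewrite -chmap_d -[LHS]/(- cplx_d (dsc Z) (n - 1) H (dinc Z i (n - 1) H z)) -chmap_d.
  by rewrite -[RHS]/(dinc Z i (n - 1 - 1) H (- _)) linearN.
have [s [h hP]] := cP I Z' (mkchmap f'd); exists s.
exists (unp (T := fun n => psh_hom (P (n - 1)) (dsc Z n)) (fun n => homN (h n))).
apply: pred_ind => n G x; rewrite !unpE.
have es y : dsel Z' s (n - 1) G y = dsel Z s (n - 1 - 1) G y.
  apply: (@dsc_ext _ _ _ Z' (n - 1) _ (dsel Z' s (n - 1)) (dsel Z s (n - 1 - 1))) => i H z.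
  rewrite -[X in _ = dsel Z s _ _ X]/(dinc Z i (n - 1 - 1) H z).
  have [si|nsi] := pselect (List.In i s); first by rewrite !dsel_inc.
  by rewrite !dsel_out.
have e := hP n G x.
have {}e : f (n - 1 - 1) G x - dsel Z' s (n - 1) G (f (n - 1 - 1) G x) =
  cplx_d (dsc Z') n G (h n G x) + h (n - 1) G (- cplx_d P (n - 1 - 1) G x) := e.
rewrite es in e.
rewrite -[LHS]/(f (n - 1 - 1) G x - dsel Z s (n - 1 - 1) G (f (n - 1 - 1) G x)) e.
rewrite (linearN (h (n - 1) G)); congr (_ + _).
rewrite -[RHS]/(cplx_d (dsc Z) (n - 1) G (- h n G x)) linearN.
move: (h n G x) => y.
apply: (@dsc_ext _ _ _ Z' n _ (cplx_d (dsc Z') n) (homN (cplx_d (dsc Z) (n - 1)))) => i H z.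
rewrite -chmap_d -[RHS]/(- cplx_d (dsc Z) (n - 1) H (dinc Z i (n - 1) H z)) -chmap_d.
by rewrite -[LHS]/(dinc Z i (n - 1 - 1) H (- _)) linearN.
Qed.

(** A list [s] takes care of the restriction to [Y]. The difference of [h] and its part in [s] then
    factors through [shift X], whose list [t] is joined to [s]. *)
Lemma cpt_cone X Y (f : chmap X Y) : cpt X -> cpt Y -> cpt (cone f).
Proof.
move=> cX cY I Z h.
have [s sP] := cY I Z (chmap_comp h (cone_in f)).
pose u := chB h (chmap_comp (dsel Z s) h).
have [|v vP] := @cone_factor _ _ _ _ _ f u.
  by apply: nullh_ext sP.
have [t tP] := cpt_shift cX v.
pose w := (s ++ t)%SEQ; exists w.
have sw : List.incl s w by move=> i si; apply/List.in_or_app; left.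
have tw : List.incl t w by move=> i si; apply/List.in_or_app; right.
have ut : heq u (chmap_comp (dsel Z t) u).
  apply: (heq_trans vP).
  apply: heq_trans (heq_comp tP (heq_refl (cone_pr f))) _.
  exact: heq_comp (heq_refl (dsel Z t)) (heq_sym vP).
have uw : heq u (chmap_comp (dsel Z w) u).
  apply: (heq_trans ut); apply: heq_trans (heq_comp (heq_refl (dsel Z w)) (heq_sym ut)).
  by apply: heq_ext => n G x; rewrite /= -!/(dsel _ _ _ _ _); apply: esym; apply: dsel_sel.
apply: nullh_ext uw => n G x.
have e1 : dsel Z w n G (u n G x) = dsel Z w n G (h n G x) - dsel Z s n G (h n G x).
  by rewrite chBE (linearB (dsel Z w n G)) -[in RHS](dsel_sel (h n G x) sw).
have eu : u n G x = h n G x - dsel Z s n G (h n G x) by [].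
have E : u n G x - dsel Z w n G (u n G x) = h n G x - dsel Z w n G (h n G x).
  rewrite e1 eu; move: (h n G x) (dsel Z s n G _) (dsel Z w n G _) => a b c.
  by zmod.
exact: E.
Qed.

Lemma cone_resolution X Y (f : chmap X Y) P Q (p : chmap P X) (q : chmap Q Y) :
  Kproj P -> quasi_iso p -> quasi_iso q ->
  exists (f' : chmap P Q) (c : chmap (cone f') (cone f)), quasi_iso c.
Proof.
move=> KP qp qq.
have [f' /heq_sym[h hP]] := Kproj_lift KP qq (chmap_comp f p).
exists f', (cone_mor hP); apply/quasi_isoP => G.
by apply: cone_mor_qis_at; [exact: (quasi_isoP p).1|exact: (quasi_isoP q).1].
Qed.

Lemma compact_cone X Y (f : chmap X Y) :
  compact_obj X -> compact_obj Y -> compact_obj (cone f).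
Proof.
move=> cX cY.
have [P [p [KP qp]]] := resolution k_char0 X.
have [Q [q [KQ qq]]] := resolution k_char0 Y.
have [f' [c qc]] := cone_resolution f KP qp qq.
apply: (cpt_compact k_char0 (Kproj_cone (f := f') KP KQ) qc).
by apply: cpt_cone; [apply: (compact_cpt k_char0 KP qp)|apply: (compact_cpt k_char0 KQ qq)].
Qed.

Lemma shift_qis X Y (q : chmap X Y) : quasi_iso q ->
  exists q' : chmap (shift X) (shift Y), quasi_iso q'.
Proof.
move=> qq.
have sd n G (x : shift X n G) : q (n - 1 - 1) G (cplx_d (shift X) n G x) =
    cplx_d (shift Y) n G (q (n - 1) G x).
  by rewrite linearN chmap_d.
exists (@mkchmap k U (shift X) (shift Y) (fun n => q (n - 1)) sd) => n G; split.
  move=> x dx [y ey]; have [||x' ->] := (qq (n - 1) G).1 x.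
  - by apply/eqP; rewrite -oppr_eq0; apply/eqP.
  - by exists (- y); rewrite linearN; apply: ey.
  by exists (- x'); rewrite /= linearN opprK.
move=> y dy; have [|x [y' [dx ->]]] := (qq (n - 1) G).2 y.
  by apply/eqP; rewrite -oppr_eq0; apply/eqP.
exists x, (- y'); split; first by rewrite /= dx oppr0.
by rewrite /= linearN opprK.
Qed.

Lemma compact_shift X : compact_obj (shift X) <-> compact_obj X.
Proof.
have [P [p [KP qp]]] := resolution k_char0 X.
have [p' qp'] := shift_qis qp.
split=> cX.
  apply: (cpt_compact k_char0 KP qp); apply: cpt_unshift.
  exact: (compact_cpt k_char0 (Kproj_shift KP) qp').
apply: (cpt_compact k_char0 (Kproj_shift KP) qp'); apply: cpt_shift.
exact: (compact_cpt k_char0 KP qp).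
Qed.

Lemma compact_cone_src X Y (f : chmap X Y) :
  compact_obj Y -> compact_obj (cone f) -> compact_obj X.
Proof.
move=> cY cC; apply/compact_shift.
have [_ r] := qis_retract (rot_in_qis f).
by apply: compact_retract r _; apply: compact_cone.
Qed.

Lemma compact_cone_tgt X Y (f : chmap X Y) :
  compact_obj X -> compact_obj (cone f) -> compact_obj Y.
Proof.
move=> cX cC; apply/compact_shift.
have [_ r] := qis_retract (rot_pr_qis f).
by apply: compact_retract r _; apply: compact_cone => //; apply/compact_shift.
Qed.

Lemma acyclic_retract X Y : acyclic X -> retract X Y.
Proof.
move=> aX; exists (dzero _ _), (dzero _ _).
by rewrite (acyclic_id0 aX) deq_comp0r.
Qed.

Lemma compact_acyclic X : acyclic X -> compact_obj X.
Proof.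
move=> aX; apply/compact_objE => I Y C inj ci h; exists [::].
exists (fun i => dzero _ _); split; first by constructor.
by rewrite -(deq_comp1r h) (acyclic_id0 aX) deq_comp0r.
Qed.
End ThickCompact.

(** * Tensor products *)

Section Sign.
Context (k : fieldType).

Definition sg (i : int) : k := (-1) ^ i.

Lemma sgD i j : sg (i + j) = sg i * sg j.
Proof. by rewrite /sg expfzDr // oppr_eq0 oner_eq0. Qed.

Lemma sgN1 : sg (-1) = -1.
Proof. by rewrite /sg exprN1 invrN1. Qed.

Lemma sg_pred i : sg (i - 1) = - sg i.
Proof. by rewrite sgD sgN1 mulrN1. Qed.

Lemma sgN i : sg (- i) = sg i.
Proof. by rewrite /sg -exprz_inv invrN1. Qed.

Lemma sgK i : sg i * sg i = 1.
Proof. by rewrite -{2}(sgN i) -sgD subrr. Qed.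
End Sign.

Section TensorData.
Context (k : fieldType) (U : finGroupType -> Prop).
Implicit Types (X Y Z T P : cplx k U).

Definition bilin (A B M : lmodType k) (f : A -> B -> M) : Prop :=
  (forall x, linear (f x)) /\ (forall y, linear (f^~ y)).

(** A witness of [is_tensor] as a record, so that its components can be named and new tensor
    products made from given ones. *)
Record tdata X Y T := TData {
  tb : forall i j n : int, i + j = n -> forall G : fam U, X i G -> Y j G -> T n G;
  tb_bilin : forall i j n (e : i + j = n) (G : fam U), bilin (@tb i j n e G);
  tb_nat : forall i j n (e : i + j = n) (G H : fam U) (a : surjection G H) x y,
    psh_map (T n) a (@tb i j n e H x y) = @tb i j n e G (psh_map (X i) a x) (psh_map (Y j) a y);
  tb_d : forall i j n (e : i + j = n) (e1 : (i - 1) + j = n - 1)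
    (e2 : i + (j - 1) = n - 1) (G : fam U) x y,
    cplx_d T n G (@tb i j n e G x y) =
      @tb (i - 1) j (n - 1) e1 G (cplx_d X i G x) y
      + sg k i *: @tb i (j - 1) (n - 1) e2 G x (cplx_d Y j G y);
  tb_univ : forall (n : int) (G : fam U) (M : lmodType k)
    (phi : forall i j : int, i + j = n -> X i G -> Y j G -> M),
    (forall i j (e : i + j = n), bilin (phi i j e)) ->
    exists h : {linear T n G -> M},
      (forall i j e x y, h (@tb i j n e G x y) = phi i j e x y)
      /\ (forall h' : {linear T n G -> M},
            (forall i j e x y, h' (@tb i j n e G x y) = phi i j e x y) ->
            forall t, h' t = h t) }.

Lemma is_tensorP X Y T : is_tensor X Y T <-> exists D : tdata X Y T, True.
Proof.
split=> [[b [h1 h2 h3 h4]]|[[b h1 h2 h3 h4] _]]; last by exists b; split.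
by exists (@TData X Y T b h1 h2 h3 h4).
Qed.

Lemma tens_el (i j n : int) : i + j = n -> (i - 1) + j = n - 1.
Proof. by move=> <-; rewrite addrAC. Qed.
Lemma tens_er (i j n : int) : i + j = n -> i + (j - 1) = n - 1.
Proof. by move=> <-; rewrite addrA. Qed.
Lemma tens_eli (i j n : int) : (i - 1) + j = n - 1 -> i + j = n.
Proof. by rewrite addrAC => /addIr. Qed.

Section Data.
Context X Y T (D : tdata X Y T).

Lemma tb0l i j n (e : i + j = n) G y : tb D e (0 : X i G) y = 0.
Proof. exact: (linear0 (mklin ((tb_bilin D e G).2 y))). Qed.
Lemma tb0r i j n (e : i + j = n) G x : tb D e x (0 : Y j G) = 0.
Proof. exact: (linear0 (mklin ((tb_bilin D e G).1 x))). Qed.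
Lemma tbNl i j n (e : i + j = n) G (x : X i G) y : tb D e (- x) y = - tb D e x y.
Proof. exact: (linearN (mklin ((tb_bilin D e G).2 y))). Qed.
Lemma tbDl i j n (e : i + j = n) G (x x' : X i G) y :
  tb D e (x + x') y = tb D e x y + tb D e x' y.
Proof. exact: (linearD (mklin ((tb_bilin D e G).2 y))). Qed.

Section Lift.
Context n (G : fam U) (M : lmodType k) (phi : forall i j : int, i + j = n -> X i G -> Y j G -> M).
Hypothesis phib : forall i j (e : i + j = n), bilin (phi e).

Definition tlift : {linear T n G -> M} := sval (cid (tb_univ D phib)).

Lemma tliftE i j (e : i + j = n) x y : tlift (tb D e x y) = phi e x y.
Proof. by rewrite /tlift; case: cid => h []. Qed.
End Lift.

Lemma t_ext n (G : fam U) (M : lmodType k) (f g : {linear T n G -> M}) :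
  (forall i j (e : i + j = n) x y, f (tb D e x y) = g (tb D e x y)) -> forall t, f t = g t.
Proof.
move=> fg.
have gb i j (e : i + j = n) : bilin (fun x y => g (tb D e x y)).
  by split=> [x c y y'|y c x x']; rewrite ?(tb_bilin D e G).1 ?(tb_bilin D e G).2 linearP.
have [h [_ hu]] := tb_univ D gb.
by move=> t; rewrite (hu f) // (hu g).
Qed.

Section Hom.
Context n (N : psh k U) (phi : forall (i j : int), i + j = n -> forall G, X i G -> Y j G -> N G).
Hypothesis phib : forall i j (e : i + j = n) (G : fam U), bilin (@phi i j e G).
Hypothesis phin : forall i j (e : i + j = n) (G H : fam U) (a : surjection G H) x y,
  psh_map N a (phi e x y) = phi e (psh_map (X i) a x) (psh_map (Y j) a y).

Lemma thom_nat (G H : fam U) (a : surjection G H) (t : T n H) :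
  tlift (fun i j e => @phib i j e G) (psh_map (T n) a t) =
  psh_map N a (tlift (fun i j e => @phib i j e H) t).
Proof.
apply: (@t_ext n H _ (tlift (fun i j e => @phib i j e G) \o psh_map (T n) a)
  (psh_map N a \o tlift (fun i j e => @phib i j e H))) => i j e x y.
rewrite -[LHS]/(tlift (fun i j e => @phib i j e G) (psh_map (T n) a (tb D e x y))).
rewrite -[RHS]/(psh_map N a (tlift (fun i j e => @phib i j e H) (tb D e x y))).
by rewrite tb_nat !tliftE phin.
Qed.

Definition thom : psh_hom (T n) N :=
  @PshHom k U (T n) N (fun G => tlift (fun i j e => @phib i j e G)) thom_nat.

Lemma thomE i j (e : i + j = n) G (x : X i G) (y : Y j G) : thom G (tb D e x y) = phi e x y.
Proof. exact: tliftE. Qed.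
End Hom.

Lemma thom_ext n (N : psh k U) (f g : psh_hom (T n) N) :
  (forall i j (e : i + j = n) G x y, f G (tb D e x y) = g G (tb D e x y)) ->
  forall G t, f G t = g G t.
Proof. by move=> h G; apply: t_ext => i j e x y; apply: h. Qed.

Section Chmap.
Context Z (phi : forall n (i j : int), i + j = n -> forall G, X i G -> Y j G -> Z n G).
Hypothesis phib : forall n i j (e : i + j = n) (G : fam U), bilin (@phi n i j e G).
Hypothesis phin : forall n i j (e : i + j = n) (G H : fam U) (a : surjection G H) x y,
  psh_map (Z n) a (phi e x y) = phi e (psh_map (X i) a x) (psh_map (Y j) a y).
Hypothesis phid : forall n i j (e : i + j = n) (G : fam U) (x : X i G) (y : Y j G),
  cplx_d Z n G (phi e x y) = phi (tens_el e) (cplx_d X i G x) y +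
    sg k i *: phi (tens_er e) x (cplx_d Y j G y).

Lemma tchmap_d n G (t : T n G) :
  thom (@phib (n - 1)) (@phin (n - 1)) G (cplx_d T n G t) =
  cplx_d Z n G (thom (@phib n) (@phin n) G t).
Proof.
apply: (@thom_ext n _ (psh_hom_comp (thom (@phib (n - 1)) (@phin (n - 1))) (cplx_d T n))
  (psh_hom_comp (cplx_d Z n) (thom (@phib n) (@phin n)))) => i j e H x y.
rewrite -[LHS]/(thom (@phib (n - 1)) (@phin (n - 1)) H (cplx_d T n H (tb D e x y))).
rewrite -[RHS]/(cplx_d Z n H (thom (@phib n) (@phin n) H (tb D e x y))).
rewrite thomE phid (tb_d D e (tens_el e) (tens_er e)) linearD linearZ_LR.
by rewrite !thomE.
Qed.

Definition tchmap : chmap T Z :=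
  @mkchmap k U T Z (fun n => thom (@phib n) (@phin n)) tchmap_d.

Lemma tchmapE n i j (e : i + j = n) G (x : X i G) (y : Y j G) :
  tchmap n G (tb D e x y) = phi e x y.
Proof. exact: thomE. Qed.
End Chmap.
End Data.

Section Functor.
Context X Y T X' Y' T' (D : tdata X Y T) (D' : tdata X' Y' T').
Context (f : chmap X X') (g : chmap Y Y').

Let phi n i j (e : i + j = n) G (x : X i G) (y : Y j G) : T' n G :=
  tb D' e (f i G x) (g j G y).

Lemma tmap_b n i j (e : i + j = n) (G : fam U) : bilin (@phi n i j e G).
Proof.
by split=> [x|y] c z z'; rewrite /phi linearP ?(tb_bilin D' e G).1 ?(tb_bilin D' e G).2.
Qed.
Lemma tmap_n n i j (e : i + j = n) (G H : fam U) (a : surjection G H) x y :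
  psh_map (T' n) a (phi e x y) = phi e (psh_map (X i) a x) (psh_map (Y j) a y).
Proof. by rewrite /phi tb_nat !psh_hom_nat. Qed.
Lemma tmap_d n i j (e : i + j = n) (G : fam U) (x : X i G) (y : Y j G) :
  cplx_d T' n G (phi e x y) = phi (tens_el e) (cplx_d X i G x) y +
    sg k i *: phi (tens_er e) x (cplx_d Y j G y).
Proof. by rewrite /phi (tb_d D' e (tens_el e) (tens_er e)) !chmap_d. Qed.

Definition tmap : chmap T T' := tchmap D tmap_b tmap_n tmap_d.

Lemma tmapE n i j (e : i + j = n) G (x : X i G) (y : Y j G) :
  tmap n G (tb D e x y) = tb D' e (f i G x) (g j G y).
Proof. exact: tchmapE. Qed.
End Functor.

Section Acyclic.
Context X Y T (D : tdata X Y T) (G : fam U).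

(** A linear contraction of [X] at [G], tensored with the identity of [Y], contracts [T] at [G]. *)
Lemma tens_acyclic : acyclic_at G X -> acyclic_at G T.
Proof.
move=> /contraction_at[s sP].
pose F n := unp (T := fun i => forall j, i + j = n - 1 -> X i G -> Y j G -> T n G)
  (fun i j e x y => tb D (tens_eli e) (s i x) y).
have FE n i j (e : (i - 1) + j = n - 1) x y :
    @F n (i - 1) j e x y = tb D (tens_eli e) (s i x) y by rewrite /F unpE.
have Fb n i j (e : i + j = n - 1) : bilin (@F n i j e).
  move: i e; apply: pred_ind => i e.
  by split=> [x|y] c z z'; rewrite !FE ?linearP ?(tb_bilin D _ G).1 ?(tb_bilin D _ G).2.
pose S n := tlift D (Fb n).
have SE n i j (e : (i - 1) + j = n - 1) x y :
    S n (tb D e x y) = tb D (tens_eli e) (s i x) y by rewrite /S tliftE FE.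
have key n : forall t : T (n - 1) G, t = cplx_d T n G (S n t) + S (n - 1) (cplx_d T (n - 1) G t).
  have hl : linear (fun t => cplx_d T n G (S n t) + S (n - 1) (cplx_d T (n - 1) G t)).
    by move=> c x y; rewrite !linearP scalerDr addrACA.
  apply: (@t_ext _ _ _ D _ _ _ idfun (mklin hl)).
  apply: pred_ind => i j e x y.
  rewrite -[RHS]/(cplx_d T n G (S n (tb D e x y)) + S (n - 1) (cplx_d T (n - 1) G (tb D e x y))).
  have e' := tens_eli e.
  rewrite SE (tb_d D _ e (tens_er e')) (tb_d D e (tens_el e) (tens_er e)).
  rewrite linearD linearZ_LR !SE sg_pred scaleNr.
  rewrite (eq_irrelevance (tens_eli (tens_el e)) e).
  rewrite (eq_irrelevance (tens_eli (tens_er e)) (tens_er e')).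
  rewrite /= [in LHS](sP i x) tbDl.
  by zmod.
move=> n t dt; exists (S n t).
by rewrite {1}(key n t) dt linear0 addr0.
Qed.
End Acyclic.

Section Swap.
Context X Y T (D : tdata X Y T).

Let e_swap (i j n : int) : i + j = n -> j + i = n.
Proof. by rewrite addrC. Qed.

(** The exchange of factors carries the Koszul sign, without which it would not commute with the
    differentials. *)
Definition swap_b (i j n : int) (e : i + j = n) (G : fam U) (y : Y i G) (x : X j G) : T n G :=
  sg k (i * j) *: tb D (e_swap e) x y.

Lemma swap_bilin i j n (e : i + j = n) (G : fam U) : bilin (@swap_b i j n e G).
Proof.
split=> [y|x] c z z'; rewrite /swap_b ?(tb_bilin D _ G).1 ?(tb_bilin D _ G).2;
  by rewrite scalerDr !scalerA [c * _]mulrC.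
Qed.

Lemma swap_nat i j n (e : i + j = n) (G H : fam U) (a : surjection G H) y x :
  psh_map (T n) a (@swap_b i j n e H y x) =
  @swap_b i j n e G (psh_map (Y i) a y) (psh_map (X j) a x).
Proof. by rewrite /swap_b linearZ_LR tb_nat. Qed.

Lemma swap_d i j n (e : i + j = n) (e1 : (i - 1) + j = n - 1)
    (e2 : i + (j - 1) = n - 1) (G : fam U) y x :
  cplx_d T n G (@swap_b i j n e G y x) =
  @swap_b (i - 1) j (n - 1) e1 G (cplx_d Y i G y) x
  + sg k i *: @swap_b i (j - 1) (n - 1) e2 G y (cplx_d X j G x).
Proof.
have s1 : sg k (i * j) * sg k j = sg k ((i - 1) * j) by rewrite mulrBl mul1r sgD sgN.
have s2 : sg k i * sg k (i * (j - 1)) = sg k (i * j).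
  by rewrite mulrBr mulr1 sgD sgN mulrCA sgK mulr1.
rewrite /swap_b linearZ_LR (tb_d D _ (e_swap e2) (e_swap e1)) scalerDr [LHS]addrC.
by rewrite !scalerA s1 s2.
Qed.

Lemma swap_univ (n : int) (G : fam U) (M : lmodType k)
    (phi : forall i j : int, i + j = n -> Y i G -> X j G -> M) :
    (forall i j (e : i + j = n), bilin (phi i j e)) ->
    exists h : {linear T n G -> M},
      (forall i j e x y, h (@swap_b i j n e G x y) = phi i j e x y)
      /\ (forall h' : {linear T n G -> M},
            (forall i j e x y, h' (@swap_b i j n e G x y) = phi i j e x y) ->
            forall t, h' t = h t).
Proof.
move=> phib.
pose psi i j (e : i + j = n) (x : X i G) (y : Y j G) := sg k (j * i) *: phi j i (e_swap e) y x.
have psib i j (e : i + j = n) : bilin (psi i j e).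
  split=> [x|y] c z z'; rewrite /psi ?(phib _ _ _).1 ?(phib _ _ _).2;
  by rewrite scalerDr !scalerA [c * _]mulrC.
exists (tlift D psib); split=> [i j e y x|h' h'P].
  rewrite /swap_b linearZ_LR tliftE /psi scalerA sgK scale1r.
  by rewrite (eq_irrelevance (e_swap (e_swap e)) e).
apply: (t_ext (D := D)) => i j e x y; rewrite tliftE /psi -h'P /swap_b.
rewrite linearZ_LR scalerA sgK scale1r.
by rewrite (eq_irrelevance (e_swap (e_swap e)) e).
Qed.

Definition swap_data : tdata Y X T := TData swap_bilin swap_nat swap_d swap_univ.
End Swap.

Section ConeTensor.
Context X' X Y T' T (D' : tdata X' Y T') (D : tdata X Y T) (f : chmap X' X).

Let tf := tmap D' D f (chmap_id Y).

Definition tcone_b (i j n : int) (e : i + j = n) (G : fam U) (z : cone f i G) (y : Y j G) :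
  cone tf n G := (tb D e z.1 y, tb D' (tens_el e) z.2 y).

Lemma tcone_bilin i j n (e : i + j = n) (G : fam U) : bilin (@tcone_b i j n e G).
Proof.
split=> [z c y y'|y c z z']; congr pair; rewrite /= -?(tb_bilin D e G).1 -?(tb_bilin D' _ G).1 //.
  by rewrite -(tb_bilin D e G).2.
by rewrite -(tb_bilin D' _ G).2.
Qed.

Lemma tcone_nat i j n (e : i + j = n) (G H : fam U) (a : surjection G H) z y :
  psh_map (cone tf n) a (@tcone_b i j n e H z y) =
  @tcone_b i j n e G (psh_map (cone f i) a z) (psh_map (Y j) a y).
Proof. by congr pair; rewrite /= tb_nat. Qed.

Lemma tcone_d i j n (e : i + j = n) (e1 : (i - 1) + j = n - 1)
    (e2 : i + (j - 1) = n - 1) (G : fam U) z y :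
  cplx_d (cone tf) n G (@tcone_b i j n e G z y) =
  @tcone_b (i - 1) j (n - 1) e1 G (cplx_d (cone f) i G z) y
  + sg k i *: @tcone_b i (j - 1) (n - 1) e2 G z (cplx_d Y j G y).
Proof.
case: z => x x'.
have t1 : cplx_d T n G (tb D e x y) + tf (n - 1) G (tb D' (tens_el e) x' y) =
    tb D e1 (cplx_d X i G x + f (i - 1) G x') y + sg k i *: tb D e2 x (cplx_d Y j G y).
  rewrite (tb_d D e e1 e2) tbDl /tf tmapE (eq_irrelevance (tens_el e) e1) -[chmap_id Y j G y]/(y).
  by zmod.
have t2 : - cplx_d T' (n - 1) G (tb D' (tens_el e) x' y) =
    tb D' (tens_el e1) (- cplx_d X' (i - 1) G x') y +
    sg k i *: tb D' (tens_el e2) x' (cplx_d Y j G y).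
  rewrite (tb_d D' _ (tens_el e1) (tens_el e2)) tbNl sg_pred scaleNr.
  by zmod.
exact: (congr2 pair t1 t2).
Qed.

Lemma tcone_univ (n : int) (G : fam U) (M : lmodType k)
    (phi : forall i j : int, i + j = n -> cone f i G -> Y j G -> M) :
    (forall i j (e : i + j = n), bilin (phi i j e)) ->
    exists h : {linear cone tf n G -> M},
      (forall i j e x y, h (@tcone_b i j n e G x y) = phi i j e x y)
      /\ (forall h' : {linear cone tf n G -> M},
            (forall i j e x y, h' (@tcone_b i j n e G x y) = phi i j e x y) ->
            forall t, h' t = h t).
Proof.
move=> phib.
pose phi1 i j (e : i + j = n) (x : X i G) y := phi i j e (x, 0) y.
have phi1b i j (e : i + j = n) : bilin (phi1 i j e).
  split=> [x|y] c z z'; rewrite /phi1; first exact: (phib _ _ _).1.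
  by rewrite -(phib _ _ _).2; congr phi; congr pair; rewrite /= ?scaler0 ?addr0.
pose F := unp (T := fun i => forall j, i + j = n - 1 -> X' i G -> Y j G -> M)
  (fun i j e x' y => phi i j (tens_eli e) (0, x') y).
have FE i j (e : (i - 1) + j = n - 1) x y :
    @F (i - 1) j e x y = phi i j (tens_eli e) (0, x) y by rewrite /F unpE.
have Fb i j (e : i + j = n - 1) : bilin (@F i j e).
  move: i e; apply: pred_ind => i e.
  split=> [x|y] c z z'; rewrite !FE; first exact: (phib _ _ _).1.
  by rewrite -(phib _ _ _).2; congr phi; congr pair; rewrite /= ?scaler0 ?addr0.
have hl : linear (fun t : cone tf n G => tlift D phi1b t.1 + tlift D' Fb t.2).
  by move=> c x y; rewrite !linearP scalerDr addrACA.
exists (mklin hl); split=> [i j e [x x'] y|h' h'P].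
  rewrite /= !tliftE FE /phi1 (eq_irrelevance (tens_eli (tens_el e)) e).
  rewrite -[phi i j e (x, 0) y + _]addr0 addr0.
  rewrite -[LHS](linearD (mklin ((phib i j e).2 y))) /=; congr phi.
  by congr pair; rewrite /= ?addr0 ?add0r.
move=> [t t'].
have l1 : linear (fun t : T n G => h' (t, 0)).
  move=> c z z'; rewrite -linearP; congr (h' _).
  by congr pair; rewrite /= ?scaler0 ?addr0.
have l2 : linear (fun t : T' (n - 1) G => h' (0, t)).
  move=> c z z'; rewrite -linearP; congr (h' _).
  by congr pair; rewrite /= ?scaler0 ?addr0.
have -> : (t, t') = (t, 0) + (0, t') :> cone tf n G.
  by congr pair; rewrite /= ?addr0 ?add0r.
rewrite linearD /= addr0 add0r; congr (_ + _).
  apply: (@t_ext _ _ _ D _ _ _ (mklin l1)) => i j e x y; rewrite tliftE /phi1 -h'P.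
  by rewrite /tcone_b /= tb0l.
apply: (@t_ext _ _ _ D' _ _ _ (mklin l2)); apply: pred_ind => i j e x y.
rewrite tliftE FE -h'P /tcone_b /= tb0l.
by rewrite (eq_irrelevance (tens_el (tens_eli e)) e).
Qed.

Definition tcone_data : tdata (cone f) Y (cone tf) :=
  TData tcone_bilin tcone_nat tcone_d tcone_univ.

(** Cones commute with tensor products: the cone of [tf] is a tensor product of the acyclic [cone f]
    with [Y]. *)
Lemma tmap_qis : quasi_iso f -> quasi_iso tf.
Proof.
by move=> /quasi_iso_cone aC; apply/quasi_iso_cone => G; apply: (tens_acyclic tcone_data).
Qed.
End ConeTensor.

Lemma tmap_qisr X Y Y' T T' (D : tdata X Y T) (D' : tdata X Y' T') (g : chmap Y Y') :
  quasi_iso g -> quasi_iso (tmap D D' (chmap_id X) g).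
Proof.
move=> qg; have q' := tmap_qis (swap_data D) (swap_data D') qg.
have e : tmap D D' (chmap_id X) g = tmap (swap_data D) (swap_data D') g (chmap_id X).
  apply: chmap_ext => n G t.
  apply: (t_ext (D := swap_data D) (f := tmap D D' (chmap_id X) g n G)) => i j e y x.
  rewrite [RHS]tmapE; apply: etrans (linearZ_LR (tmap D D' (chmap_id X) g n G) _ _) _.
  by rewrite tmapE.
by rewrite e.
Qed.

Section Kunneth.
Context X Y T (D : tdata X Y T) (G : fam U).

Definition at_deg Z (n : int) (M : lmodType k) (phi : {linear Z n G -> M}) (i : int)
    (x : Z i G) : M :=
  match @eqP _ i n with
  | ReflectT e => phi (ct Z e G x)
  | ReflectF _ => 0
  end.

Lemma at_deg_linear Z n (M : lmodType k) (phi : {linear Z n G -> M}) i :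
  linear (@at_deg Z n M phi i).
Proof.
move=> c x y; rewrite /at_deg; case: eqP => [e|_]; last by rewrite scaler0 addr0.
by rewrite !linearP.
Qed.

Lemma at_deg_id Z n (M : lmodType k) (phi : {linear Z n G -> M}) x : at_deg phi x = phi x.
Proof. by rewrite /at_deg; case: eqP => // e; rewrite ct_id. Qed.

(** A cycle with a functional that is 1 on it and kills boundaries replaces a homology class.
    Besides the Kuenneth formula, this is used to split off a representation in [irep_retract]. *)
Lemma not_acyclic_functional Z : ~ acyclic_at G Z ->
  exists n (x : Z (n - 1) G) (phi : {linear Z (n - 1) G -> k^o}),
  [/\ cplx_d Z (n - 1) G x = 0, phi x = 1
    & forall i (z : Z i G), at_deg phi (cplx_d Z i G z) = 0].
Proof.
move=> nZ; have [n [x [dx nx]]] : exists n (x : Z (n - 1) G),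
    cplx_d Z (n - 1) G x = 0 /\ ~ exists y, x = cplx_d Z n G y.
  apply: contrapT => h; apply: nZ => n x dx; apply: contrapT => h'.
  by apply: h; exists n, x.
have S0 : exists y, 0 = cplx_d Z n G y by exists 0; rewrite linear0.
have SP (c : k) (u v : Z (n - 1) G) : (exists y, u = cplx_d Z n G y) ->
    (exists y, v = cplx_d Z n G y) -> exists y, c *: u + v = cplx_d Z n G y.
  by move=> [y ->] [y' ->]; exists (c *: y + y'); rewrite linearP.
have [phi [phi0 phi1]] := sep_functional (S := Submod S0 SP) nx.
exists n, x, phi; split=> // i z; rewrite /at_deg; case: eqP => // e.
have e' : i = n := addIr (-1) e; subst i; rewrite ct_id.
by apply: phi0; exists z.
Qed.

(** If neither factor is acyclic, the tensor product of the two cycles is a cycle on which the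
    product of the two functionals is 1, while it kills all boundaries. *)
Lemma kunneth : acyclic_at G T -> acyclic_at G X \/ acyclic_at G Y.
Proof.
move=> aT; have [aX|/not_acyclic_functional] := pselect (acyclic_at G X); first by left.
move=> [n [x [phi [dx phix phid]]]].
have [aY|/not_acyclic_functional] := pselect (acyclic_at G Y); first by right.
move=> [m [y [psi [dy psiy psid]]]]; exfalso.
have E : (n - 1) + (m - 1) = n + (m - 1) - 1 by rewrite addrAC.
pose F i j (e : i + j = n + (m - 1) - 1) (x : X i G) (y : Y j G) : k^o :=
  (at_deg phi x : k) * (at_deg psi y : k).
have Fb i j (e : i + j = n + (m - 1) - 1) : bilin (F i j e).
  split=> [u|v] c z z'; rewrite /F at_deg_linear.
    by rewrite mulrDr; congr (_ + _); rewrite mulrCA.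
  by rewrite mulrDl; congr (_ + _); rewrite -mulrA.
have [|t et] := aT (n + (m - 1)) (tb D E x y).
  rewrite (tb_d D E (tens_el E) (tens_er E)) dx dy tb0l tb0r scaler0.
  exact: addr0.
have h0 t' : tlift D Fb (cplx_d T (n + (m - 1)) G t') = 0.
  apply: (@t_ext _ _ _ D _ _ _ (tlift D Fb \o cplx_d T (n + (m - 1)) G)
    (mklin (@zero_linear k (T (n + (m - 1)) G) k^o))) => i j e u v.
  rewrite -[LHS]/(tlift D Fb (cplx_d T (n + (m - 1)) G (tb D e u v))).
  rewrite (tb_d D e (tens_el e) (tens_er e)) linearD linearZ_LR !tliftE /F phid psid.
  by rewrite mul0r mulr0 scaler0 addr0.
have := h0 t; rewrite -et tliftE /F !at_deg_id phix psiy mulr1 => /eqP.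
by rewrite oner_eq0.
Qed.
End Kunneth.
End TensorData.

Section TensorExists.
Context (k : fieldType) (U : finGroupType -> Prop) (X Y : cplx k U).

Record tel (n : int) (G : fam U) := Tel {
  tel_i : int; tel_j : int; tel_e : tel_i + tel_j = n;
  tel_x : X tel_i G; tel_y : Y tel_j G }.

Definition tel_rel n G (b : tel n G -> k) : Prop :=
  forall i j (e : i + j = n),
    (forall x (c : k) y y', b (Tel e x (c *: y + y')) = c * b (Tel e x y) + b (Tel e x y'))
    /\ (forall y (c : k) x x', b (Tel e (c *: x + x') y) = c * b (Tel e x y) + b (Tel e x' y)).

Definition tmod n G : lmodType k := pres (@tel_rel n G).

Definition tel_b i j n (e : i + j = n) (G : fam U) (x : X i G) (y : Y j G) : tmod n G :=
  gen (@tel_rel n G) (Tel e x y).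

Lemma tel_bilin i j n (e : i + j = n) (G : fam U) : bilin (@tel_b i j n e G).
Proof.
split=> [x|y] c z z'; apply: gen_lin => b bb.
  exact: (bb i j e).1.
exact: (bb i j e).2.
Qed.

Section Lift.
Context n (G : fam U) (M : lmodType k) (phi : forall i j : int, i + j = n -> X i G -> Y j G -> M).
Hypothesis phib : forall i j (e : i + j = n), bilin (phi e).

Lemma tel_test (f : {linear M -> k^o}) :
  tel_rel (fun t : tel n G => f (phi (tel_e t) (tel_x t) (tel_y t))).
Proof.
move=> i j e; split=> [x|y] c z z' /=; rewrite ?(phib e).1 ?(phib e).2 linearP //.
Qed.

Definition tel_lift : {linear tmod n G -> M} :=
  pres_lift (f := fun t : tel n G => phi (tel_e t) (tel_x t) (tel_y t)) tel_test.

Lemma tel_liftE i j (e : i + j = n) x y : tel_lift (tel_b e x y) = phi e x y.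
Proof. exact: pres_liftE. Qed.
End Lift.

Lemma tel_ext n (G : fam U) (M : lmodType k) (f g : {linear tmod n G -> M}) :
  (forall i j (e : i + j = n) x y, f (tel_b e x y) = g (tel_b e x y)) -> forall t, f t = g t.
Proof. by move=> h; apply: pres_eq => -[i j e x y]; apply: h. Qed.

Lemma tel_map_b n (G H : fam U) (a : surjection G H) i j (e : i + j = n) :
  bilin (fun (x : X i H) (y : Y j H) => tel_b e (psh_map (X i) a x) (psh_map (Y j) a y)).
Proof.
by split=> [x|y] c z z'; rewrite linearP ?(tel_bilin e G).1 ?(tel_bilin e G).2.
Qed.

Definition tel_map n (G H : fam U) (a : surjection G H) : {linear tmod n H -> tmod n G} :=
  tel_lift (@tel_map_b n G H a).

Lemma tel_mapE n (G H : fam U) (a : surjection G H) i j (e : i + j = n) x y :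
  tel_map n a (tel_b e x y) = tel_b e (psh_map (X i) a x) (psh_map (Y j) a y).
Proof. exact: (tel_liftE (@tel_map_b n G H a)). Qed.

Lemma tel_map_id n (G : fam U) x : tel_map n (surj_id G) x = x.
Proof.
apply: (@tel_ext n G _ (tel_map n (surj_id G)) idfun) => i j e y z.
by rewrite tel_mapE !psh_map_id.
Qed.

Lemma tel_map_comp n (G H K : fam U) (b : surjection H K) (a : surjection G H) x :
  tel_map n (surj_comp b a) x = tel_map n a (tel_map n b x).
Proof.
apply: (@tel_ext n K _ (tel_map n (surj_comp b a)) (tel_map n a \o tel_map n b)) => i j e y z.
rewrite -[RHS]/(tel_map n a (tel_map n b (tel_b e y z))).
by rewrite !tel_mapE !psh_map_comp.
Qed.

Lemma tel_map_conj n (G H : fam U) (a b : surjection G H) : surj_conj a b ->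
  forall x, tel_map n a x = tel_map n b x.
Proof. by move=> ab; apply: tel_ext => i j e y z; rewrite !tel_mapE !(psh_map_conj ab). Qed.

Definition tens_ob n : psh k U :=
  @Psh k U (tmod n) (tel_map n) (@tel_map_id n) (@tel_map_comp n) (@tel_map_conj n).

Lemma tel_d_b n (G : fam U) i j (e : i + j = n) :
  bilin (fun (x : X i G) (y : Y j G) => tel_b (tens_el e) (cplx_d X i G x) y +
    sg k i *: tel_b (tens_er e) x (cplx_d Y j G y)).
Proof.
split=> [x|y] c z z'; rewrite linearP.
  by rewrite !(tel_bilin _ G).1 !scalerDr !scalerA [c * _]mulrC addrACA.
by rewrite !(tel_bilin _ G).2 !scalerDr !scalerA [c * _]mulrC addrACA.
Qed.

Definition tel_d n G : {linear tmod n G -> tmod (n - 1) G} := tel_lift (@tel_d_b n G).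

Lemma tel_dE n G i j (e : i + j = n) (x : X i G) (y : Y j G) :
  tel_d n G (tel_b e x y) = tel_b (tens_el e) (cplx_d X i G x) y +
    sg k i *: tel_b (tens_er e) x (cplx_d Y j G y).
Proof. exact: (tel_liftE (@tel_d_b n G)). Qed.

Lemma tel_d_nat n (G H : fam U) (a : surjection G H) x :
  tel_d n G (psh_map (tens_ob n) a x) = psh_map (tens_ob (n - 1)) a (tel_d n H x).
Proof.
apply: (@tel_ext n H _ (tel_d n G \o tel_map n a) (tel_map (n - 1) a \o tel_d n H)) => i j e y z.
rewrite -[LHS]/(tel_d n G (tel_map n a (tel_b e y z))).
rewrite -[RHS]/(tel_map (n - 1) a (tel_d n H (tel_b e y z))).
by rewrite tel_mapE !tel_dE linearD linearZ_LR !tel_mapE !psh_hom_nat.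
Qed.

Definition tens_d n : psh_hom (tens_ob n) (tens_ob (n - 1)) :=
  @PshHom k U (tens_ob n) (tens_ob (n - 1)) (tel_d n) (@tel_d_nat n).

Lemma tens_dd n G x : tens_d (n - 1) G (tens_d n G x) = 0.
Proof.
apply: (@tel_ext n G _ (tel_d (n - 1) G \o tel_d n G)
  (mklin (@zero_linear k (tmod n G) (tmod (n - 1 - 1) G)))) => i j e y z.
rewrite -[LHS]/(tel_d (n - 1) G (tel_d n G (tel_b e y z))) -[RHS]/(0).
rewrite tel_dE linearD linearZ_LR !tel_dE !cplx_dd.
rewrite -(linear0 (mklin ((tel_bilin (tens_el (tens_el e)) G).2 z))) /=.
have -> : tel_b (tens_er (tens_er e)) y 0 = 0.
  exact: (linear0 (mklin ((tel_bilin _ G).1 y))).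
have -> : tel_b (tens_el (tens_el e)) 0 z = 0.
  exact: (linear0 (mklin ((tel_bilin _ G).2 z))).
rewrite scaler0 addr0 add0r sg_pred scaleNr.
by rewrite (eq_irrelevance (tens_el (tens_er e)) (tens_er (tens_el e))) addNr.
Qed.

Definition tens : cplx k U := Cplx tens_dd.

Lemma tens_tb_d i j n (e : i + j = n) (e1 : (i - 1) + j = n - 1)
    (e2 : i + (j - 1) = n - 1) (G : fam U) x y :
  cplx_d tens n G (@tel_b i j n e G x y) =
  @tel_b (i - 1) j (n - 1) e1 G (cplx_d X i G x) y
  + sg k i *: @tel_b i (j - 1) (n - 1) e2 G x (cplx_d Y j G y).
Proof.
rewrite -[LHS]/(tel_d n G (tel_b e x y)) tel_dE.
by rewrite (eq_irrelevance (tens_el e) e1) (eq_irrelevance (tens_er e) e2).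
Qed.

Lemma tens_univ (n : int) (G : fam U) (M : lmodType k)
    (phi : forall i j : int, i + j = n -> X i G -> Y j G -> M) :
    (forall i j (e : i + j = n), bilin (phi i j e)) ->
    exists h : {linear tens n G -> M},
      (forall i j e x y, h (@tel_b i j n e G x y) = phi i j e x y)
      /\ (forall h' : {linear tens n G -> M},
            (forall i j e x y, h' (@tel_b i j n e G x y) = phi i j e x y) ->
            forall t, h' t = h t).
Proof.
move=> phib; exists (tel_lift phib); split=> [i j e x y|h' h'P].
  exact: (tel_liftE phib).
by apply: tel_ext => i j e x y; rewrite h'P (tel_liftE phib).
Qed.

Definition tens_data : tdata X Y tens :=
  @TData k U X Y tens (fun i j n e G => @tel_b i j n e G)
    (fun i j n e G => @tel_bilin i j n e G)
    (fun i j n e G H a x y => tel_mapE a e x y) tens_tb_d tens_univ.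
End TensorExists.

(** * Representable functors *)

Section Concentrated.
Context (k : fieldType) (U : finGroupType -> Prop).
Implicit Types (X Y Z A : cplx k U).

Section Conc.
Context (n : int) (M : psh k U).

Lemma conc0 (i : int) (G : fam U) : i <> n -> (0 : M G) = 0.
Proof. by []. Qed.
Lemma concP (i : int) (G : fam U) (c : k) (x y : M G) :
  (i <> n -> x = 0) -> (i <> n -> y = 0) -> i <> n -> c *: x + y = 0.
Proof. by move=> ex ey ne; rewrite ex // ey // scaler0 addr0. Qed.

Definition conc_submod (i : int) (G : fam U) : submod (M G) :=
  @Submod k (M G) (fun x => i <> n -> x = 0) (@conc0 i G) (@concP i G).

Lemma conc_st (i : int) (G H : fam U) (a : surjection G H) x :
  conc_submod i H x -> conc_submod i G (psh_map M a x).
Proof. by move=> h ne; rewrite h // linear0. Qed.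

(* Outside degree [n] the only element is [0]. *)
Definition conc_ob (i : int) : psh k U := psh_sub (@conc_st i).

Lemma conc_dd (i : int) G (x : conc_ob i G) :
  hom0 (conc_ob (i - 1)) (conc_ob (i - 1 - 1)) G (hom0 (conc_ob i) (conc_ob (i - 1)) G x) = 0.
Proof. by []. Qed.

Definition conc : cplx k U :=
  @Cplx k U conc_ob (fun i => hom0 (conc_ob i) (conc_ob (i - 1))) conc_dd.

Lemma conc_d i G (x : conc i G) : cplx_d conc i G x = 0.
Proof. by []. Qed.

Definition c_out i : psh_hom (conc i) M := sub_in (@conc_st i).

Lemma c_out_inj i G : injective (c_out i G).
Proof. exact: subval_inj. Qed.

Lemma c_out_neq i G (x : conc i G) : i <> n -> x = 0.
Proof. by move=> ne; apply: c_out_inj; rewrite linear0; apply: (subvalP x). Qed.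

Definition c_in G (x : M G) : conc n G :=
  @Sub_ k (M G) (conc_submod n G) x (fun ne => False_ind _ (ne erefl)).

Lemma c_inK G (x : M G) : c_out n G (c_in x) = x.
Proof. by []. Qed.

Lemma c_outK G (x : conc n G) : c_in (c_out n G x) = x.
Proof. exact: c_out_inj. Qed.

Lemma c_in_lin G : linear (@c_in G).
Proof. by move=> c x y; apply: c_out_inj. Qed.

Lemma c_in_nat (G H : fam U) (a : surjection G H) x :
  psh_map (conc n) a (c_in x) = c_in (psh_map M a x).
Proof. exact: c_out_inj. Qed.

Lemma conc_zero i G (x : conc i G) : (forall y : M G, y = 0) -> x = 0.
Proof. by move=> h; apply: c_out_inj; rewrite linear0; apply: h. Qed.
End Conc.

Lemma conc_lift n (M : psh k U) Z (u : psh_hom M (Z n)) :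
  (forall G x, cplx_d Z n G (u G x) = 0) ->
  exists f : chmap (conc n M) Z, forall G x, f n G (c_in n x) = u G x.
Proof.
move=> du.
pose F i G (x : conc n M i G) : Z i G :=
  match @eqP _ n i with
  | ReflectT e => ct Z e G (u G (c_out n M i G x))
  | ReflectF _ => 0
  end.
have Fl i G : linear (@F i G).
  move=> c x y; rewrite /F; case: eqP => [e|_]; last by rewrite scaler0 addr0.
  by rewrite !linearP.
have Fn i (G H : fam U) (a : surjection G H) x :
    F i G (psh_map (conc n M i) a x) = psh_map (Z i) a (F i H x).
  rewrite /F; case: eqP => [e|_]; last by rewrite linear0.
  by rewrite !psh_hom_nat.
have Fd i G x : mkhom (@Fl (i - 1)) (@Fn (i - 1)) G (cplx_d (conc n M) i G x) =
    cplx_d Z i G (mkhom (@Fl i) (@Fn i) G x).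
  rewrite conc_d linear0 -[RHS]/(cplx_d Z i G (F i G x)) /F.
  case: eqP => [e|_]; last by rewrite linear0.
  by subst i; rewrite ct_id du.
exists (@mkchmap k U (conc n M) Z (fun i => mkhom (@Fl i) (@Fn i)) Fd) => G x.
rewrite -[LHS]/(F n G (c_in n x)) /F; case: eqP => // e.
by rewrite ct_id c_inK.
Qed.

Section Representable.
Context (G : fam U).

Definition er_rel (K : fam U) (b : surjection K G -> k) : Prop :=
  forall a a', surj_conj a a' -> b a = b a'.

Definition er_mod (K : fam U) : lmodType k := pres (@er_rel K).
Definition eg (K : fam U) (a : surjection K G) : er_mod K := gen (@er_rel K) a.

Lemma eg_conj (K : fam U) (a a' : surjection K G) : surj_conj a a' -> eg a = eg a'.
Proof. by move=> h; apply: gen_eq => b; apply. Qed.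

Section Lift.
Context (K : fam U) (L : lmodType k) (f : surjection K G -> L).
Hypothesis fc : forall a a', surj_conj a a' -> f a = f a'.

Lemma er_test (phi : {linear L -> k^o}) : er_rel (fun a => phi (f a)).
Proof. by move=> a a' h; rewrite (fc h). Qed.

Definition er_lift : {linear er_mod K -> L} := pres_lift er_test.

Lemma er_liftE a : er_lift (eg a) = f a.
Proof. exact: pres_liftE. Qed.
End Lift.

Lemma er_eq (K : fam U) (L : lmodType k) (f g : {linear er_mod K -> L}) :
  (forall a, f (eg a) = g (eg a)) -> forall x, f x = g x.
Proof. exact: pres_eq. Qed.

Lemma surj_conj_comp (K K' L : finGroupType) (a a' : surjection K L) (b : surjection K' K) :
  surj_conj a a' -> surj_conj (surj_comp a b) (surj_comp a' b).
Proof. by move=> [h hP]; exists h => x; apply: hP. Qed.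

Lemma surj_conj_compl (K L M : finGroupType) (a a' : surjection K L) (b : surjection L M) :
  surj_conj a a' -> surj_conj (surj_comp b a) (surj_comp b a').
Proof.
move=> /surj_conjE[h ->]; apply/surj_conjE; exists (b h).
by rewrite surj_compA surj_comp_inner surj_compA.
Qed.

Lemma er_map_conj_ (K K' : fam U) (b : surjection K' K) (a a' : surjection K G) :
  surj_conj a a' -> eg (surj_comp a b) = eg (surj_comp a' b).
Proof. by move=> h; apply: eg_conj; apply: surj_conj_comp. Qed.

Definition er_map (K' K : fam U) (b : surjection K' K) : {linear er_mod K -> er_mod K'} :=
  er_lift (@er_map_conj_ K K' b).

Lemma er_mapE (K' K : fam U) (b : surjection K' K) (a : surjection K G) :
  er_map b (eg a) = eg (surj_comp a b).
Proof. exact: (er_liftE (@er_map_conj_ K K' b)). Qed.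

Lemma er_map_id (K : fam U) x : er_map (surj_id K) x = x.
Proof. by apply: (@er_eq K _ (er_map (surj_id K)) idfun) => a; rewrite er_mapE surj_compr1. Qed.

Lemma er_map_comp (K L M : fam U) (b : surjection L M) (a : surjection K L) x :
  er_map (surj_comp b a) x = er_map a (er_map b x).
Proof.
apply: (@er_eq M _ (er_map (surj_comp b a)) (er_map a \o er_map b)) => c.
by rewrite -[RHS]/(er_map a (er_map b (eg c))) !er_mapE surj_compA.
Qed.

Lemma er_map_conj (K L : fam U) (a b : surjection K L) : surj_conj a b ->
  forall x, er_map a x = er_map b x.
Proof.
move=> ab; apply: er_eq => c; rewrite !er_mapE; apply: eg_conj.
exact: surj_conj_compl.
Qed.

Definition erep : psh k U := @Psh k U er_mod er_map er_map_id er_map_comp er_map_conj.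

Lemma erep_mapE (K' K : fam U) (b : surjection K' K) (a : surjection K G) :
  psh_map erep b (eg a) = eg (surj_comp a b).
Proof. exact: er_mapE. Qed.

Lemma erep_zero (K : fam U) : ~ (exists a : surjection K G, True) -> forall x : erep K, x = 0.
Proof.
move=> na; apply: pres_ind => // c a x ->.
by case: na; exists a.
Qed.

Lemma eg_neq0 (K : fam U) (a : surjection K G) : eg a <> 0.
Proof.
have h : forall a a' : surjection K G, surj_conj a a' -> 1 = 1 :> k^o by [].
move=> e; have := er_liftE h a; rewrite e linear0 => /eqP.
by rewrite eq_sym oner_eq0.
Qed.
End Representable.

Section RepCompact.
Context (n : int) (G : fam U).

Definition c_eg (K : fam U) (a : surjection K G) : conc n (erep G) n K :=
  @c_in n (erep G) K (eg a).

Definition rep_gen : conc n (erep G) n G := c_eg (surj_id G).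

Lemma rep_hom_ext (N : psh k U) i (f g : psh_hom (conc n (erep G) i) N) :
  (forall (K : fam U) (a : surjection K G) (e : i = n), f K (ct _ (esym e) K (c_eg a)) =
    g K (ct _ (esym e) K (c_eg a))) -> forall K x, f K x = g K x.
Proof.
have [e|ne] := pselect (i = n); last by move=> _ K x; rewrite (c_out_neq x ne) !linear0.
subst i => h K x; rewrite -(c_outK x).
have fl : linear (fun y => f K (@c_in n (erep G) K y)) by move=> c y z; rewrite c_in_lin linearP.
have gl : linear (fun y => g K (@c_in n (erep G) K y)) by move=> c y z; rewrite c_in_lin linearP.
apply: (@er_eq G K _ (mklin fl) (mklin gl)) => a.
by have := h K a erefl; rewrite !ct_id.
Qed.

Lemma rep_genE (K : fam U) (a : surjection K G) :
  c_eg a = psh_map (conc n (erep G) n) a rep_gen.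
Proof. by rewrite /rep_gen /c_eg c_in_nat erep_mapE surj_comp1. Qed.
End RepCompact.

Lemma rep_chmap_ext n G Z (f g : chmap (conc n (erep G)) Z) :
  f n G (rep_gen n G) = g n G (rep_gen n G) -> forall i K x, f i K x = g i K x.
Proof.
move=> h i; apply: rep_hom_ext => K a e; subst i.
by rewrite !ct_id rep_genE !psh_hom_nat h.
Qed.

(** Yoneda: a chain map out of a representable complex is the image of its generator, and an element
    bounding that image is a null-homotopy. *)
Lemma rep_null n G A (f : chmap (conc (n - 1) (erep G)) A) (y : A n G) :
  f (n - 1) G (rep_gen (n - 1) G) = cplx_d A n G y -> nullh f.
Proof.
move=> ey.
have yc (K : fam U) (a a' : surjection K G) : surj_conj a a' ->
    psh_map (A n) a y = psh_map (A n) a' y by move=> h; apply: psh_map_conj.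
pose H m (K : fam U) (x : conc (n - 1) (erep G) (m - 1) K) : A m K :=
  match @eqP _ n m with
  | ReflectT e => ct A e K (er_lift (yc K) (c_out (n - 1) (erep G) (m - 1) K x))
  | ReflectF _ => 0
  end.
have Hl m K : linear (@H m K).
  move=> c x x'; rewrite /H; case: eqP => [e|_]; last by rewrite scaler0 addr0.
  by rewrite !linearP.
have yn (K' K : fam U) (b : surjection K' K) x :
    er_lift (yc K') (psh_map (erep G) b x) = psh_map (A n) b (er_lift (yc K) x).
  apply: (@er_eq G K _ (er_lift (yc K') \o er_map G b) (psh_map (A n) b \o er_lift (yc K))) => a.
  rewrite -[LHS]/(er_lift (yc K') (er_map G b (eg a))) er_mapE.
  by rewrite -[RHS]/(psh_map (A n) b (er_lift (yc K) (eg a))) !er_liftE psh_map_comp.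
have Hn m (K' K : fam U) (b : surjection K' K) x :
    H m K' (psh_map (conc (n - 1) (erep G) (m - 1)) b x) = psh_map (A m) b (H m K x).
  rewrite /H; case: eqP => [e|_]; last by rewrite linear0.
  by rewrite psh_hom_nat yn psh_hom_nat.
exists (fun m => mkhom (@Hl m) (@Hn m)) => m K x.
rewrite conc_d linear0 addr0.
have [e|ne] := pselect (m = n); last first.
  have -> : x = 0 by apply: c_out_neq => /addIr.
  by rewrite !linear0.
subst m; rewrite -[RHS]/(cplx_d A n K (H n K x)) /H.
case: eqP => // e; rewrite ct_id -{1}(c_outK x); move: (c_out _ _ _ _ x) => z.
have fl : linear (fun z => f (n - 1) K (@c_in (n - 1) (erep G) K z)).
  by move=> c u v; rewrite c_in_lin linearP.
apply: (@er_eq G K _ (mklin fl) (cplx_d A n K \o er_lift (yc K))) => a.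
rewrite -[RHS]/(cplx_d A n K (er_lift (yc K) (eg a))) er_liftE psh_hom_nat -ey.
by rewrite -[LHS]/(f (n - 1) K (c_eg (n - 1) a)) rep_genE psh_hom_nat.
Qed.

Lemma rep_Kproj n G : Kproj (conc n (erep G)).
Proof.
move: n; apply: pred_ind => n A aA f.
have [|y ey] := aA G n (f (n - 1) G (rep_gen (n - 1) G)).
  by rewrite -chmap_d conc_d linear0.
exact: rep_null ey.
Qed.

(** The image of the generator lies in finitely many summands and determines the chain map. *)
Lemma rep_cpt n G : cpt (conc n (erep G)).
Proof.
move=> I Z f; have [s sP] := dsel_fin (f n G (rep_gen n G)).
exists s; apply: heq_ext; apply: rep_chmap_ext.
by rewrite -[RHS]/(dsel Z s n G (f n G (rep_gen n G))) sP.
Qed.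

Lemma rep_acyclic n G K : acyclic_at K (conc n (erep G)) <-> forall x : erep G K, x = 0.
Proof.
split=> [aC x|h m x _]; last by exists 0; rewrite linear0; apply: conc_zero.
move: n aC; apply: pred_ind => n aC.
have [y ey] := aC n (c_in (n - 1) x) (conc_d _).
by rewrite -(c_inK (n - 1) x) ey conc_d linear0.
Qed.
End Concentrated.

(* Pairs of surjections [K -> G], [K -> H] factor uniquely through the wide
   subgroup of [G * H] which is their image. *)
Section Wide.
Context (U : finGroupType -> Prop) (U_iso : closed_under_iso U)
  (U_quo : closed_under_quotients U) (G H : fam U).

Section Image.
Context (K : fam U) (a : surjection K G) (b : surjection K H).

Definition pair_img : {set (G * H)%type} := [set (a x, b x) | x : K].

Lemma pair_img_group : group_set pair_img.
Proof.
apply/group_setP; split.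
  by apply/imsetP; exists 1%g; rewrite ?surj1.
move=> _ _ /imsetP[x _ ->] /imsetP[y _ ->]; apply/imsetP; exists (x * y)%g => //.
by rewrite !surjM.
Qed.

Definition pimg : {group (G * H)%type} := Group pair_img_group.
End Image.

(** Being an image of a group of [U] makes [W] a quotient of that group, hence itself a member of
    [U]. *)
Definition wide (W : {group (G * H)%type}) : Prop :=
  exists (K : fam U) (a : surjection K G) (b : surjection K H), pimg a b = W.

Lemma pimg_mem (K : fam U) (a : surjection K G) (b : surjection K H) W :
  pimg a b = W -> forall x, (a x, b x) \in W.
Proof. by move=> <- x; apply/imsetP; exists x. Qed.

Section Factor.
Context (K : fam U) (a : surjection K G) (b : surjection K H) (W : {group (G * H)%type}).
Context (e : pimg a b = W).

Definition pfac_fun (x : K) : subg_of W := subg W (a x, b x).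

Lemma pfac_val x : sgval (pfac_fun x) = (a x, b x).
Proof. by rewrite subgK //; apply: pimg_mem. Qed.

Lemma pfac_mul : {morph pfac_fun : x y / (x * y)%g}.
Proof.
move=> x y; apply: subg_inj; rewrite pfac_val.
by rewrite -[RHS]/(sgval (pfac_fun x) * sgval (pfac_fun y))%g !pfac_val !surjM.
Qed.

Lemma pfac_onto y : exists x, pfac_fun x = y.
Proof.
have : sgval y \in pimg a b by rewrite e; apply: subgP.
move=> /imsetP[x _ ex]; exists x; apply: subg_inj.
by rewrite pfac_val ex.
Qed.

Definition pfac : surjection K (subg_of W) := mksurj pfac_mul pfac_onto.
End Factor.

Section WideGroup.
Context (W : {group (G * H)%type}) (hW : wide W).

Lemma wide_in : U (subg_of W).
Proof.
have [K [a [b e]]] := hW.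
exact: (surj_closed U_iso U_quo (pfac e) (fam_in K)).
Qed.

Definition wfam : fam U := Fam wide_in.

Lemma wpr1_onto y : exists x : wfam, (sgval x).1 = y.
Proof.
have [K [a [b e]]] := hW; have [x <-] := surj_onto a y.
by exists (pfac e x); rewrite [sgval _]pfac_val.
Qed.
Lemma wpr2_onto y : exists x : wfam, (sgval x).2 = y.
Proof.
have [K [a [b e]]] := hW; have [x <-] := surj_onto b y.
by exists (pfac e x); rewrite [sgval _]pfac_val.
Qed.
Definition wpr1 : surjection wfam G :=
  @mksurj wfam G (fun x : subg_of W => (sgval x).1) (fun x y => erefl) wpr1_onto.
Definition wpr2 : surjection wfam H :=
  @mksurj wfam H (fun x : subg_of W => (sgval x).2) (fun x y => erefl) wpr2_onto.
End WideGroup.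

Lemma wide_pimg (K : fam U) (a : surjection K G) (b : surjection K H) : wide (pimg a b).
Proof. by exists K, a, b. Qed.

Definition wfac (K : fam U) (a : surjection K G) (b : surjection K H) :
  surjection K (wfam (wide_pimg a b)) := pfac (erefl (pimg a b)).

Lemma wfac1 (K : fam U) (a : surjection K G) (b : surjection K H) :
  surj_comp (wpr1 (wide_pimg a b)) (wfac a b) = a.
Proof. by apply: surj_ext => x; rewrite /= pfac_val. Qed.

Lemma wfac2 (K : fam U) (a : surjection K G) (b : surjection K H) :
  surj_comp (wpr2 (wide_pimg a b)) (wfac a b) = b.
Proof. by apply: surj_ext => x; rewrite /= pfac_val. Qed.

(** Every pair is pulled back from one of the finitely many universal pairs [wpr1], [wpr2]. *)
Lemma wide_ind (R : forall K : fam U, surjection K G -> surjection K H -> Prop) :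
  (forall W (hW : wide W), R _ (wpr1 hW) (wpr2 hW)) ->
  (forall (K' K : fam U) (c : surjection K' K) (a : surjection K G) (b : surjection K H),
    R K a b -> R K' (surj_comp a c) (surj_comp b c)) ->
  forall (K : fam U) (a : surjection K G) (b : surjection K H), R K a b.
Proof.
move=> R1 R2 K a b; have := R2 _ _ (wfac a b) _ _ (R1 _ (wide_pimg a b)).
by rewrite wfac1 wfac2.
Qed.

Section Lift.
Context (k : fieldType) (k_char0 : [pchar k] =i pred0).
Context (N : psh k U) (v : forall K : fam U, surjection K G -> surjection K H -> N K).
Hypothesis vn : forall (K' K : fam U) (c : surjection K' K) (a : surjection K G)
  (b : surjection K H), psh_map N c (v a b) = v (surj_comp a c) (surj_comp b c).
Hypothesis vc : forall (K : fam U) (a a' : surjection K G) (b b' : surjection K H),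
  surj_conj a a' -> surj_conj b b' -> v a b = v a' b'.

(* Preimages are chosen over the wide subgroups, and averaging makes them invariant
   under conjugation. *)
Lemma wide_lift (M : psh k U) (f : psh_hom M N) :
  (forall (K : fam U) (a : surjection K G) (b : surjection K H), exists u, f K u = v a b) ->
  exists u : forall K : fam U, surjection K G -> surjection K H -> M K,
  [/\ forall (K' K : fam U) (c : surjection K' K) (a : surjection K G)
        (b : surjection K H), psh_map M c (u K a b) = u K' (surj_comp a c) (surj_comp b c),
      forall (K : fam U) (a a' : surjection K G) (b b' : surjection K H),
        surj_conj a a' -> surj_conj b b' -> u K a b = u K a' b'
    & forall (K : fam U) (a : surjection K G) (b : surjection K H), f K (u K a b) = v a b].
Proof.
move=> fs.
pose y W (hW : wide W) := sval (cid (fs _ (wpr1 hW) (wpr2 hW))).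
have yP W (hW : wide W) : f _ (y W hW) = v (wpr1 hW) (wpr2 hW) by rewrite /y; case: cid.
pose u0 (K : fam U) (a : surjection K G) (b : surjection K H) :=
  psh_map M (wfac a b) (y _ (wide_pimg a b)).
have u0P (K : fam U) (a : surjection K G) (b : surjection K H) : f K (u0 K a b) = v a b.
  by rewrite /u0 psh_hom_nat yP vn wfac1 wfac2.
(* A pair that factors through [W] by a surjection has image [W], so its preimage is the one chosen
   over [W]. *)
have u0E (K : fam U) W (hW : wide W) (c : surjection K (wfam hW)) :
    u0 K (surj_comp (wpr1 hW) c) (surj_comp (wpr2 hW) c) = psh_map M c (y W hW).
  rewrite /u0.
  have cE a b : a = surj_comp (wpr1 hW) c -> b = surj_comp (wpr2 hW) c ->
      forall x : K, sgval (c x : subg_of W) = (a x, b x).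
    by move=> -> -> x /=; case: (sgval _).
  move: (surj_comp _ c) (surj_comp _ c) (cE _ _ erefl erefl) => b a {}cE.
  have eW : pimg a b = W.
    apply/val_inj/setP => z /=; apply/imsetP/idP => [[x _ ->]|Wz].
      by rewrite -cE; apply: subgP.
    have [x ex] := surj_onto c (subg W z); exists x => //.
    by rewrite -cE ex subgK.
  subst W; rewrite (Prop_irrelevance hW (wide_pimg a b)) in c cE *.
  congr (psh_map M _ _); apply: surj_ext => x; apply: subg_inj.
  by rewrite cE; apply: pfac_val.
have u0n (K' K : fam U) (c : surjection K' K) (a : surjection K G) (b : surjection K H) :
    psh_map M c (u0 K a b) = u0 K' (surj_comp a c) (surj_comp b c).
  have := u0E K' _ (wide_pimg a b) (surj_comp (wfac a b) c).
  by rewrite !surj_compA wfac1 wfac2 => ->; rewrite psh_map_comp.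
pose C : k := (#|fam_group G| * #|fam_group H|)%:R.
have C0 : C != 0.
  apply: natr_neq0 => //; rewrite muln_gt0.
  by apply/andP; split; apply/card_gt0P; exists 1%g.
pose u (K : fam U) (a : surjection K G) (b : surjection K H) :=
  C^-1 *: \sum_(g : G) \sum_(h : H) u0 K (surj_comp (inner g) a) (surj_comp (inner h) b).
have innerM (L : finGroupType) (g h : L) : surj_comp (inner g) (inner h) = inner (h * g)%g.
  by apply: surj_ext => x; rewrite /= conjgM.
exists u; split.
- move=> K' K c a b; rewrite /u linearZ_LR linear_sum; congr (_ *: _).
  apply: eq_bigr => g _; rewrite linear_sum; apply: eq_bigr => h _.
  by rewrite u0n -!surj_compA.
- move=> K a a' b b' /surj_conjE[g0 ->] /surj_conjE[h0 ->]; rewrite /u; congr (_ *: _).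
  rewrite (reindex_inj (mulgI g0)) /=; apply: eq_bigr => g _.
  rewrite (reindex_inj (mulgI h0)) /=; apply: eq_bigr => h _.
  by rewrite !surj_compA !innerM.
- move=> K a b; rewrite /u linearZ_LR linear_sum.
  rewrite (eq_bigr (fun=> v a b *+ #|fam_group H|)); last first.
    move=> g _; rewrite linear_sum (eq_bigr (fun=> v a b)) ?sumr_const // => h _.
    by rewrite u0P; apply: vc; apply/surj_conjE; [exists g^-1%g|exists h^-1%g];
      rewrite surj_compA innerM mulgV; apply: surj_ext => x; rewrite /= conjg1.
  by rewrite sumr_const -mulrnA mulnC -scaler_nat scalerA mulVf // scale1r.
Qed.
End Lift.
End Wide.

(** * Internal homs *)

Lemma tb_dr (k : fieldType) (U : finGroupType -> Prop) (X Y T : cplx k U) (D : tdata X Y T)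
    i j n n' (e : i + j = n) (e3 : n' = n - 1) (e1 : (i - 1) + j = n') (e2 : i + (j - 1) = n')
    G (x : X i G) (y : Y j G) :
  dr T e3 G (tb D e x y) = tb D e1 (cplx_d X i G x) y + sg k i *: tb D e2 x (cplx_d Y j G y).
Proof. by subst n'; rewrite dr_id (tb_d D e e1 e2). Qed.

Section Psi.
Context (k : fieldType) (U : finGroupType -> Prop) (Y : cplx k U).
Implicit Types (X Z A P T : cplx k U).

Section Object.
Context (Z : cplx k U).

(* The elements of degree [n] of the internal hom at [G]. They are defined on all
   of [U], so to form a module they are replaced by their restrictions to [skel U]. *)
Record nfam (n : int) (G : fam U) := NFam {
  nf : forall (K : fam U), surjection K G -> forall i j : int, n + i = j -> Y i K -> Z j K;
  nf_lin : forall (K : fam U) (a : surjection K G) i j (e : n + i = j), linear (nf a e);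
  nf_nat : forall (K' K : fam U) (c : surjection K' K) (a : surjection K G) i j (e : n + i = j) y,
    psh_map (Z j) c (nf a e y) = nf (surj_comp a c) e (psh_map (Y i) c y);
  nf_conj : forall (K : fam U) (a a' : surjection K G) i j (e : n + i = j) y,
    surj_conj a a' -> nf a e y = nf a' e y }.

Record pidx (n : int) (G : fam U) := PIdx {
  px_c : skel U;
  px_a : surjection (rep px_c) G;
  px_i : int;
  px_j : int;
  px_e : n + px_i = px_j;
  px_y : Y px_i (rep px_c) }.

Section Degree.
Context (n : int) (G : fam U).

Definition restr (w : nfam n G) : piM (fun x : pidx n G => Z (px_j x) (rep (px_c x))) :=
  fun x => nf w (px_a x) (px_e x) (px_y x).

Lemma nfam_rep (w : nfam n G) (K : fam U) (a : surjection K G) i j (e : n + i = j) y :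
  nf w a e y = psh_map (Z j) (to_rep K)
    (restr w (PIdx (surj_comp a (of_rep K)) e (psh_map (Y i) (of_rep K) y))).
Proof.
by rewrite /restr /= nf_nat -surj_compA to_repK surj_compr1 -psh_map_comp to_repK psh_map_id.
Qed.

Lemma nfam0_nat (K' K : fam U) (c : surjection K' K) i j (e : n + i = j) (y : Y i K) :
  psh_map (Z j) c 0 = 0.
Proof. exact: linear0. Qed.

Lemma nfam0_lin (K : fam U) i j : linear (fun _ : Y i K => 0 : Z j K).
Proof. exact: zero_linear. Qed.

Definition nfam0 : nfam n G :=
  @NFam n G (fun _ _ _ _ _ _ => 0) (fun K _ i j _ => @nfam0_lin K i j)
    (fun K' K c a i j e y => nfam0_nat c e y) (fun _ _ _ _ _ _ _ _ => erefl).

Section Combine.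
Context (c : k) (w w' : nfam n G).

Lemma nfamP_lin (K : fam U) (a : surjection K G) i j (e : n + i = j) :
  linear (fun y => c *: nf w a e y + nf w' a e y).
Proof.
move=> b x y; rewrite !nf_lin !scalerDr !scalerA [c * b]mulrC.
by zmod.
Qed.
Lemma nfamP_nat (K' K : fam U) (b : surjection K' K) (a : surjection K G) i j (e : n + i = j) y :
  psh_map (Z j) b (c *: nf w a e y + nf w' a e y) =
  c *: nf w (surj_comp a b) e (psh_map (Y i) b y) + nf w' (surj_comp a b) e (psh_map (Y i) b y).
Proof. by rewrite linearP !nf_nat. Qed.
Lemma nfamP_conj (K : fam U) (a a' : surjection K G) i j (e : n + i = j) y :
  surj_conj a a' -> c *: nf w a e y + nf w' a e y = c *: nf w a' e y + nf w' a' e y.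
Proof. by move=> h; rewrite !(nf_conj _ _ _ h). Qed.
Definition nfamP : nfam n G :=
  @NFam n G (fun K a i j e y => c *: nf w a e y + nf w' a e y) nfamP_lin nfamP_nat nfamP_conj.
End Combine.

Lemma psi_sub0 : exists w : nfam n G, 0 = restr w.
Proof. by exists nfam0. Qed.
Lemma psi_subP (c : k) (x y : piM (fun x : pidx n G => Z (px_j x) (rep (px_c x)))) :
  (exists w, x = restr w) -> (exists w, y = restr w) -> exists w, c *: x + y = restr w.
Proof. by move=> [w ->] [w' ->]; exists (nfamP c w w'). Qed.

Definition psi_sub := @Submod k _ _ psi_sub0 psi_subP.

Definition of_fam (w : nfam n G) : subM psi_sub := @Sub_ _ _ psi_sub (restr w) (ex_intro _ w erefl).

(** Some family restricting to [r] is chosen; by [pevE] there is only one. *)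
Definition pev (r : subM psi_sub) (K : fam U) (a : surjection K G) i j (e : n + i = j) :
  Y i K -> Z j K := nf (sval (cid (subvalP r))) a e.

Lemma pevE (r : subM psi_sub) (K : fam U) (a : surjection K G) i j (e : n + i = j) y :
  pev r a e y = psh_map (Z j) (to_rep K)
    (subval psi_sub r (PIdx (surj_comp a (of_rep K)) e (psh_map (Y i) (of_rep K) y))).
Proof. by rewrite /pev; case: cid => w /= ew; rewrite ew -nfam_rep. Qed.

Lemma pev_fam w (K : fam U) (a : surjection K G) i j (e : n + i = j) y :
  pev (of_fam w) a e y = nf w a e y.
Proof. by rewrite pevE -nfam_rep. Qed.

Lemma pev_lin r (K : fam U) (a : surjection K G) i j (e : n + i = j) : linear (pev r a e).
Proof. exact: nf_lin. Qed.
Lemma pev_nat r (K' K : fam U) (c : surjection K' K) (a : surjection K G) i j (e : n + i = j) y :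
  psh_map (Z j) c (pev r a e y) = pev r (surj_comp a c) e (psh_map (Y i) c y).
Proof. exact: nf_nat. Qed.
Lemma pev_conj r (K : fam U) (a a' : surjection K G) i j (e : n + i = j) y :
  surj_conj a a' -> pev r a e y = pev r a' e y.
Proof. exact: nf_conj. Qed.
Lemma pevP (K : fam U) (a : surjection K G) i j (e : n + i = j) y c r s :
  pev (c *: r + s) a e y = c *: pev r a e y + pev s a e y.
Proof. by rewrite !pevE -linearP. Qed.

Lemma psi_ext (r s : subM psi_sub) :
  (forall (K : fam U) (a : surjection K G) i j (e : n + i = j) y, pev r a e y = pev s a e y) ->
  r = s.
Proof.
move=> h; apply: sub_inj; have := h; rewrite /pev.
case: cid => w /= ew; case: cid => w' /= ew' {}h.
rewrite [LHS]ew [RHS]ew'; apply: pi_ext => x; exact: h.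
Qed.

Lemma pev0 (K : fam U) (a : surjection K G) i j (e : n + i = j) y : pev 0 a e y = 0.
Proof. by rewrite pevE !linear0. Qed.
Lemma pevD (K : fam U) (a : surjection K G) i j (e : n + i = j) y r s :
  pev (r + s) a e y = pev r a e y + pev s a e y.
Proof. by have := pevP a e y 1 r s; rewrite !scale1r. Qed.
Lemma pevB (K : fam U) (a : surjection K G) i j (e : n + i = j) y r s :
  pev (r - s) a e y = pev r a e y - pev s a e y.
Proof.
have -> : r - s = (-1) *: s + r by rewrite scaleN1r; apply: addrC.
by rewrite pevP scaleN1r; apply: addrC.
Qed.
Lemma pev_0 r (K : fam U) (a : surjection K G) i j (e : n + i = j) : pev r a e 0 = 0.
Proof. exact: (linear0 (mklin (pev_lin r a e))). Qed.
End Degree.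

Section Restriction.
Context (n : int) (G H : fam U) (b : surjection G H) (r : subM (psi_sub n H)).
Lemma psi_map_nat (K' K : fam U) (c : surjection K' K) (a : surjection K G) i j (e : n + i = j) y :
  psh_map (Z j) c (pev r (surj_comp b a) e y) =
  pev r (surj_comp b (surj_comp a c)) e (psh_map (Y i) c y).
Proof. by rewrite pev_nat surj_compA. Qed.
Lemma psi_map_conj (K : fam U) (a a' : surjection K G) i j (e : n + i = j) y :
  surj_conj a a' -> pev r (surj_comp b a) e y = pev r (surj_comp b a') e y.
Proof. by move=> h; apply: pev_conj; apply: surj_conj_compl. Qed.
Definition psi_map_fam : nfam n G :=
  @NFam n G (fun K a i j e => pev r (surj_comp b a) e) (fun K a i j e => pev_lin r _ e)
    psi_map_nat psi_map_conj.
Definition psi_map := of_fam psi_map_fam.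
Lemma psi_mapE (K : fam U) (a : surjection K G) i j (e : n + i = j) y :
  pev psi_map a e y = pev r (surj_comp b a) e y.
Proof. exact: pev_fam. Qed.
End Restriction.

Section Psh.
Context (n : int).
Lemma psi_map_lin (G H : fam U) (b : surjection G H) : linear (@psi_map n G H b).
Proof. by move=> c r s; apply: psi_ext => K a i j e y; rewrite pevP !psi_mapE pevP. Qed.
Lemma psi_map_id G (r : subM (psi_sub n G)) : psi_map (surj_id G) r = r.
Proof. by apply: psi_ext => K a i j e y; rewrite psi_mapE surj_comp1. Qed.
Lemma psi_map_comp (G H L : fam U) (b : surjection H L) (a : surjection G H)
  (x : subM (psi_sub n L)) : psi_map (surj_comp b a) x = psi_map a (psi_map b x).
Proof. by apply: psi_ext => K c i j e y; rewrite !psi_mapE surj_compA. Qed.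
Lemma psi_map_cj (G H : fam U) (a b : surjection G H) :
  surj_conj a b -> forall x : subM (psi_sub n H), psi_map a x = psi_map b x.
Proof.
move=> h x; apply: psi_ext => K c i j e y; rewrite !psi_mapE.
by apply: pev_conj; apply: surj_conj_comp.
Qed.
Definition psi_psh : psh k U :=
  @Psh k U (fun G => subM (psi_sub n G)) (fun G H b => mklin (@psi_map_lin G H b))
    psi_map_id psi_map_comp psi_map_cj.
End Psh.

Section Diff.
Context (n : int) (G : fam U) (r : subM (psi_sub n G)).
Lemma psi_e1 (i j : int) : n - 1 + i = j -> n + i = j + 1.
Proof. by move=> <-; rewrite addrAC subrK. Qed.
Lemma psi_e2 (i j : int) : n - 1 + i = j -> n + (i - 1) = j.
Proof. by move=> <-; rewrite addrAC addrA. Qed.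
Lemma psi_e3 (j : int) : j = j + 1 - 1.
Proof. by rewrite addrK. Qed.
(** The usual differential of the internal hom, [d r - (-1) ^ n r d]. *)
Definition psi_d_fun (K : fam U) (a : surjection K G) i j (e : n - 1 + i = j) (y : Y i K) : Z j K :=
  dr Z (psi_e3 j) K (pev r a (psi_e1 e) y) - sg k n *: pev r a (psi_e2 e) (cplx_d Y i K y).
Lemma psi_d_lin (K : fam U) (a : surjection K G) i j (e : n - 1 + i = j) : linear (psi_d_fun a e).
Proof.
move=> c x y; rewrite /psi_d_fun pev_lin !linearP pev_lin scalerDr scalerA.
rewrite scalerDr scalerN !scalerA [c * _]mulrC.
by zmod.
Qed.
Lemma psi_d_nat (K' K : fam U) (c : surjection K' K) (a : surjection K G) i j (e : n - 1 + i = j) y :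
  psh_map (Z j) c (psi_d_fun a e y) = psi_d_fun (surj_comp a c) e (psh_map (Y i) c y).
Proof.
by rewrite /psi_d_fun linearB linearZ_LR -psh_hom_nat !pev_nat psh_hom_nat.
Qed.
Lemma psi_d_conj (K : fam U) (a a' : surjection K G) i j (e : n - 1 + i = j) y :
  surj_conj a a' -> psi_d_fun a e y = psi_d_fun a' e y.
Proof. by move=> h; rewrite /psi_d_fun !(pev_conj _ _ _ h). Qed.
Definition psi_dd_fam : nfam (n - 1) G := NFam psi_d_lin psi_d_nat psi_d_conj.
Definition psi_del := of_fam psi_dd_fam.
Lemma psi_delE (K : fam U) (a : surjection K G) i j (e : n - 1 + i = j) j' (e1 : n + i = j')
    (e2 : n + (i - 1) = j) (e3 : j = j' - 1) y :
  pev psi_del a e y =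
  dr Z e3 K (pev r a e1 y) - sg k n *: pev r a e2 (cplx_d Y i K y).
Proof.
rewrite pev_fam /= /psi_d_fun.
have ej : j + 1 = j' by rewrite e3 subrK.
case: j' / ej e1 e3 => e1 e3; rewrite (eq_irrelevance e1 (psi_e1 e)) (eq_irrelevance e2 (psi_e2 e)).
by rewrite (eq_irrelevance e3 (psi_e3 j)).
Qed.
End Diff.

Lemma psi_del_lin n G : linear (@psi_del n G).
Proof.
move=> c r s; apply: psi_ext => K a i j e y.
rewrite pevP !(psi_delE _ _ e (psi_e1 e) (psi_e2 e) (psi_e3 j)) !pevP linearP.
rewrite !scalerDr !scalerN !scalerA [c * _]mulrC.
by zmod.
Qed.
Lemma psi_del_nat n (G H : fam U) (b : surjection G H) (x : psi_psh n H) :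
  psi_del (psh_map (psi_psh n) b x) = psh_map (psi_psh (n - 1)) b (psi_del x).
Proof.
apply: psi_ext => K a i j e y.
rewrite [RHS]psi_mapE !(psi_delE _ _ e (psi_e1 e) (psi_e2 e) (psi_e3 j)).
by rewrite -[psh_map _ _ x]/(psi_map b x) !psi_mapE.
Qed.
Definition psi_diff n : psh_hom (psi_psh n) (psi_psh (n - 1)) :=
  @mkhom k U (psi_psh n) (psi_psh (n - 1)) (@psi_del n) (@psi_del_lin n) (@psi_del_nat n).
Lemma psi_dd n G (x : psi_psh n G) : psi_diff (n - 1) G (psi_diff n G x) = 0.
Proof.
apply: psi_ext => K a i j e y; rewrite pev0.
have e1 := psi_e1 e; have e2 := psi_e2 e; have e3 := psi_e3 j.
rewrite [LHS](psi_delE _ _ e e1 e2 e3).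
have e4 : n + (i - 1) = j + 1 by zby e.
have e5 : n + (i - 1 - 1) = j by zby e.
rewrite (psi_delE _ _ e1 (psi_e1 e1) e4 (psi_e3 _)) (psi_delE _ _ e2 e4 e5 e3).
by rewrite cplx_dd pev_0 scaler0 subr0 sg_pred scaleNr linearB linearZ_LR dr_dr sub0r opprK addNr.
Qed.
Definition psi : cplx k U := Cplx psi_dd.
Lemma pev_d n G (r : psi n G) (K : fam U) (a : surjection K G) i j (e : n - 1 + i = j) j'
    (e1 : n + i = j') (e2 : n + (i - 1) = j) (e3 : j = j' - 1) y :
  pev (cplx_d psi n G r) a e y =
  dr Z e3 K (pev r a e1 y) - sg k n *: pev r a e2 (cplx_d Y i K y).
Proof. exact: psi_delE. Qed.
Lemma pev_map n (G H : fam U) (b : surjection G H) (r : psi n H) (K : fam U) (a : surjection K G)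
    i j (e : n + i = j) y :
  pev (psh_map (psi n) b r : psi n G) a e y = pev r (surj_comp b a) e y.
Proof. exact: psi_mapE. Qed.
End Object.

Section Functor.
Context (Z Z' : cplx k U) (u : chmap Z Z').

Section At.
Context (n : int) (G : fam U) (r : psi Z n G).
Definition pmap_fun (K : fam U) (a : surjection K G) i j (e : n + i = j) (y : Y i K) : Z' j K :=
  u j K (pev r a e y).
Lemma pmap_fun_lin (K : fam U) (a : surjection K G) i j (e : n + i = j) : linear (pmap_fun a e).
Proof. by move=> c x y; rewrite /pmap_fun pev_lin linearP. Qed.
Lemma pmap_fun_nat (K' K : fam U) (c : surjection K' K) (a : surjection K G) i j (e : n + i = j) y :
  psh_map (Z' j) c (pmap_fun a e y) = pmap_fun (surj_comp a c) e (psh_map (Y i) c y).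
Proof. by rewrite /pmap_fun -psh_hom_nat pev_nat. Qed.
Lemma pmap_fun_conj (K : fam U) (a a' : surjection K G) i j (e : n + i = j) y :
  surj_conj a a' -> pmap_fun a e y = pmap_fun a' e y.
Proof. by move=> h; rewrite /pmap_fun (pev_conj _ _ _ h). Qed.
Definition pmap_at : psi Z' n G := of_fam (NFam pmap_fun_lin pmap_fun_nat pmap_fun_conj).
Lemma pmap_atE (K : fam U) (a : surjection K G) i j (e : n + i = j) y :
  pev pmap_at a e y = u j K (pev r a e y).
Proof. exact: pev_fam. Qed.
End At.

Lemma pmap_lin n G : linear (@pmap_at n G).
Proof. by move=> c x y; apply: psi_ext => K a i j e z; rewrite pevP !pmap_atE pevP linearP. Qed.
Lemma pmap_nat n (G H : fam U) (b : surjection G H) (x : psi Z n H) :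
  pmap_at (psh_map (psi Z n) b x) = psh_map (psi Z' n) b (pmap_at x).
Proof. by apply: psi_ext => K a i j e z; rewrite pev_map !pmap_atE pev_map. Qed.
Lemma pmap_d n G (x : psi Z n G) :
  pmap_at (cplx_d (psi Z) n G x) = cplx_d (psi Z') n G (pmap_at x).
Proof.
apply: psi_ext => K a i j e z.
rewrite pmap_atE !(pev_d _ _ e (psi_e1 e) (psi_e2 e) (psi_e3 j)) !pmap_atE.
by rewrite linearB linearZ_LR chmap_dr.
Qed.
Definition pmap : chmap (psi Z) (psi Z') :=
  @mkchmap k U (psi Z) (psi Z') (fun n => @mkhom k U (psi Z n) (psi Z' n) (@pmap_at n) (@pmap_lin n) (@pmap_nat n)) pmap_d.
Lemma pmapE n G (r : psi Z n G) (K : fam U) (a : surjection K G) i j (e : n + i = j) y :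
  pev (pmap n G r) a e y = u j K (pev r a e y).
Proof. exact: pmap_atE. Qed.
End Functor.

Section Adjunction.
Context (P T : cplx k U) (D : tdata P Y T) (Z : cplx k U) (h : chmap T Z).

Section At.
Context (n : int) (G : fam U) (x : P n G).
Definition adj_fun (K : fam U) (a : surjection K G) i j (e : n + i = j) (y : Y i K) : Z j K :=
  h j K (tb D e (psh_map (P n) a x) y).
Lemma adj_fun_lin (K : fam U) (a : surjection K G) i j (e : n + i = j) : linear (adj_fun a e).
Proof. by move=> c y y'; rewrite /adj_fun (tb_bilin D e K).1 linearP. Qed.
Lemma adj_fun_nat (K' K : fam U) (c : surjection K' K) (a : surjection K G) i j (e : n + i = j) y :
  psh_map (Z j) c (adj_fun a e y) = adj_fun (surj_comp a c) e (psh_map (Y i) c y).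
Proof. by rewrite /adj_fun -psh_hom_nat tb_nat psh_map_comp. Qed.
Lemma adj_fun_conj (K : fam U) (a a' : surjection K G) i j (e : n + i = j) y :
  surj_conj a a' -> adj_fun a e y = adj_fun a' e y.
Proof. by move=> aa; rewrite /adj_fun (psh_map_conj aa). Qed.
Definition adj_at : psi Z n G := of_fam (NFam adj_fun_lin adj_fun_nat adj_fun_conj).
Lemma adj_atE (K : fam U) (a : surjection K G) i j (e : n + i = j) y :
  pev adj_at a e y = h j K (tb D e (psh_map (P n) a x) y).
Proof. exact: pev_fam. Qed.
End At.

Lemma adj_lin n G : linear (@adj_at n G).
Proof.
move=> c x x'; apply: psi_ext => K a i j e y.
by rewrite pevP !adj_atE linearP (tb_bilin D e K).2 linearP.
Qed.
Lemma adj_nat n (G H : fam U) (b : surjection G H) (x : P n H) :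
  adj_at (psh_map (P n) b x) = psh_map (psi Z n) b (adj_at x).
Proof. by apply: psi_ext => K a i j e z; rewrite pev_map !adj_atE psh_map_comp. Qed.
Lemma adj_d n G (x : P n G) : adj_at (cplx_d P n G x) = cplx_d (psi Z) n G (adj_at x).
Proof.
apply: psi_ext => K a i j e y.
have e1 := psi_e1 e; have e2 := psi_e2 e; have e3 := psi_e3 j.
rewrite adj_atE (pev_d _ _ e e1 e2 e3) !adj_atE -chmap_dr -linearZ_LR -linearB.
congr (h j K _); rewrite -psh_hom_nat; move: (psh_map _ _ _) => {}x.
by rewrite (tb_dr D e1 e3 e e2) addrK.
Qed.
Definition adj : chmap P (psi Z) :=
  @mkchmap k U P (psi Z) (fun n => @mkhom k U (P n) (psi Z n) (@adj_at n) (@adj_lin n) (@adj_nat n)) adj_d.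
Lemma adjE n G (x : P n G) (K : fam U) (a : surjection K G) i j (e : n + i = j) y :
  pev (adj n G x) a e y = h j K (tb D e (psh_map (P n) a x) y).
Proof. exact: adj_atE. Qed.
End Adjunction.
End Psi.

Section PsiCompact.
Context (k : fieldType) (U : finGroupType -> Prop) (Y : cplx k U).
Implicit Types (X Z A P T : cplx k U).

(** A homotopy into the internal hom, evaluated at the identity surjection, is a homotopy on the
    tensor product. *)
Lemma adj_null P T (D : tdata P Y T) Z (h : chmap T Z) : nullh (adj D h) -> nullh h.
Proof.
move=> [s sP].
pose F m := unp (T := fun i => forall j, i + j = m - 1 -> forall G, P i G -> Y j G -> Z m G)
  (fun i j e G x y => pev (s i G x) (surj_id G) (tens_eli e) y).
have FE m i j (e : i - 1 + j = m - 1) G x y :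
  @F m (i - 1) j e G x y = pev (s i G x) (surj_id G) (tens_eli e) y by rewrite /F unpE.
have Fb m i j (e : i + j = m - 1) G : bilin (@F m i j e G).
  move: i e; apply: pred_ind => i e.
  by split=> [x|y] c z z'; rewrite !FE ?pev_lin // linearP pevP.
have Fn m i j (e : i + j = m - 1) (G H : fam U) (a : surjection G H) x y :
    psh_map (Z m) a (@F m i j e H x y) = @F m i j e G (psh_map (P i) a x) (psh_map (Y j) a y).
  move: i e x; apply: pred_ind => i e x.
  by rewrite !FE pev_nat psh_hom_nat pev_map surj_comp1 surj_compr1.
pose S m := thom D (Fb m) (Fn m).
have SE m i j (e : i - 1 + j = m - 1) G x y :
  S m G (tb D e x y) = pev (s i G x) (surj_id G) (tens_eli e) y by rewrite /S thomE FE.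
exists S => n.
apply: (@thom_ext _ _ _ _ _ D (n - 1) (Z (n - 1)) (h (n - 1)) (psh_hom_add (psh_hom_comp (cplx_d Z n) (S n))
  (psh_hom_comp (S (n - 1)) (cplx_d T (n - 1))))).
apply: pred_ind => i j e G x y.
rewrite -[RHS]/(cplx_d Z n G (S n G (tb D e x y)) + S (n - 1) G (cplx_d T (n - 1) G (tb D e x y))).
have e' := tens_eli e; have e2 : i + (j - 1) = n - 1 by zby e.
rewrite (tb_d D e (tens_el e) (tens_er e)) linearD linearZ_LR !SE.
have -> : h (n - 1) G (tb D e x y) = pev (adj D h (i - 1) G x) (surj_id G) e y.
  by rewrite adjE psh_map_id.
rewrite sP pevD (pev_d _ _ e e' e2 erefl) dr_id sg_pred scaleNr.
rewrite (eq_irrelevance (tens_eli e) e') (eq_irrelevance (tens_eli (tens_el e)) e).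
by rewrite (eq_irrelevance (tens_eli (tens_er e)) e2); zmod.
Qed.

Lemma adj_heq P T (D : tdata P Y T) Z (f g : chmap T Z) : heq (adj D f) (adj D g) -> heq f g.
Proof.
move=> h; apply: (@adj_null _ _ D); apply: nullh_ext h => n G x.
apply: psi_ext => K a i j e y; rewrite chBE pevB !adjE.
by rewrite chBE.
Qed.

(** [psi_exact] makes tensoring with [Y] preserve K-projective complexes; with [psi_finite], by
    which a cycle with values in a direct sum is homologous to its part in finitely many summands,
    it makes tensoring preserve compact ones. *)
Definition psi_exact : Prop := forall A, acyclic A -> acyclic (psi Y A).
Definition psi_finite : Prop := forall (I : Type) (Z : I -> cplx k U) n G
  (w : psi Y (dsc Z) (n - 1) G), cplx_d (psi Y (dsc Z)) (n - 1) G w = 0 ->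
  exists s w', w = pmap Y (dsel Z s) (n - 1) G w + cplx_d (psi Y (dsc Z)) n G w'.

Lemma tens_Kproj P T (D : tdata P Y T) : psi_exact -> Kproj P -> Kproj T.
Proof. by move=> yA KP A aA f; apply: (adj_null (D := D)); apply: KP; apply: yA. Qed.

Lemma dsel_dedup (I : Type) (Z : I -> cplx k U) s n G x : dsel Z (dedup s) n G x = dsel Z s n G x.
Proof.
apply: (@dsc_ext k U I Z n _ (dsel Z (dedup s) n) (dsel Z s n)) => i H y.
have [si|nsi] := pselect (List.In i s).
  by rewrite !dsel_inc //; apply/List.nodup_In.
by rewrite !dsel_out // => /List.nodup_In.
Qed.

Section Kappa.
Context (I : Type) (Z : I -> cplx k U).

(** The comparison from the direct sum of the internal homs; [psi_finite] makes it a
    quasi-isomorphism. *)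
Definition kap : chmap (dsc (fun i => psi Y (Z i))) (psi Y (dsc Z)) :=
  dout (fun i => pmap Y (dinc Z i)).

Lemma pev_sum (W : cplx k U) n G (s : seq I) (r : I -> psi Y W n G) (K : fam U) (a : surjection K G)
    i j (e : n + i = j) y :
  pev (\sum_(x <- s) r x) a e y = \sum_(x <- s) pev (r x) a e y.
Proof.
have hl : linear (fun r : psi Y W n G => pev r a e y) by move=> c x x'; apply: pevP.
exact: (linear_sum (mklin hl)).
Qed.

Lemma pmap_dsel s n G (w : psi Y (dsc Z) n G) : pmap Y (dsel Z s) n G w =
  \sum_(i <- dedup s) pmap Y (dinc Z i) n G (pmap Y (dpr Z i) n G w).
Proof.
apply: psi_ext => K a i j e y; rewrite pmapE pev_sum -dsel_dedup dsel_sum; last first.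
  exact: List.NoDup_nodup.
by apply: eq_bigr => x _; rewrite !pmapE.
Qed.

Lemma kap_inc i n G x : kap n G (dinc (fun i => psi Y (Z i)) i n G x) = pmap Y (dinc Z i) n G x.
Proof. exact: dout_inc. Qed.

Lemma kap_pr i n G x : pmap Y (dpr Z i) n G (kap n G x) = dpr (fun i => psi Y (Z i)) i n G x.
Proof.
apply: (@dsc_ext k U I (fun i => psi Y (Z i)) n _ (psh_hom_comp (pmap Y (dpr Z i) n) (kap n))
  (dpr (fun i => psi Y (Z i)) i n)) => j H y.
rewrite -[LHS]/(pmap Y (dpr Z i) n H (kap n H (dinc (fun i => psi Y (Z i)) j n H y))) kap_inc.
apply: psi_ext => K a i' j' e z; rewrite !pmapE.
have [e'|ne] := pselect (j = i); first by subst j; rewrite !dpr_inc.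
by rewrite !dpr_inc0 // pev0.
Qed.

Lemma kap_dsel s n G x : pmap Y (dsel Z s) n G (kap n G x) =
  kap n G (dsel (fun i => psi Y (Z i)) s n G x).
Proof.
rewrite pmap_dsel -dsel_dedup dsel_sum; last exact: List.NoDup_nodup.
by rewrite linear_sum; apply: eq_bigr => i _; rewrite kap_pr kap_inc.
Qed.

Lemma kap_qis : psi_finite -> quasi_iso kap.
Proof.
move=> yF n G; split=> [x dx [w ew]|w dw].
  have [s [_ xE]] := dsc_decomp x.
  exists (\sum_(i <- s) dinc (fun i => psi Y (Z i)) i n G (pmap Y (dpr Z i) n G w)).
  rewrite {1}xE linear_sum; apply: eq_bigr => i _.
  by rewrite -chmap_d -chmap_d -ew kap_pr.
have [s [w' ew]] := yF I Z n G w dw.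
exists (\sum_(i <- dedup s) dinc (fun i => psi Y (Z i)) i (n - 1) G (pmap Y (dpr Z i) (n - 1) G w)), w'.
split.
  by rewrite linear_sum big1 // => i _; rewrite -!chmap_d dw !linear0.
rewrite {1}ew pmap_dsel linear_sum; congr (_ + _).
by apply: eq_bigr => i _; rewrite kap_inc.
Qed.
End Kappa.

(** The transpose of [f] lifts through [kap] to a direct sum of internal homs, where the compactness
    of [P] applies. *)
Lemma tens_cpt P T (D : tdata P Y T) : psi_finite -> Kproj P -> cpt P -> cpt T.
Proof.
move=> yF KP cP I Z f.
have [g hg] := Kproj_lift KP (kap_qis Z yF) (adj D f).
have [s hs] := cP I _ g; exists s; apply: (adj_heq (D := D)).
apply: (heq_trans hg).
apply: heq_trans (heq_comp (heq_refl (kap Z)) hs) _.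
apply: (heq_trans (g := chmap_comp (pmap Y (dsel Z s)) (chmap_comp (kap Z) g))).
  by apply: heq_ext => n G x; rewrite -[RHS]/(pmap Y (dsel Z s) n G (kap Z n G (g n G x))) kap_dsel.
apply: heq_trans (heq_comp (heq_refl _) (heq_sym hg)) _.
apply: heq_ext => n G x; apply: psi_ext => K a i j e y.
by rewrite -[chmap_comp _ _ _ _ _]/(pmap Y (dsel Z s) n G (adj D f n G x)) pmapE !adjE.
Qed.
End PsiCompact.

(** * Internal homs from representable complexes *)

Section RepresentableFactor.
Context (k : fieldType) (U : finGroupType -> Prop) (m : int) (H : fam U).
Implicit Types (Z A : cplx k U).
Local Notation C := (conc m (erep k H)).

Lemma c_eg_nat (K' K : fam U) (c : surjection K' K) (b : surjection K H) :
  psh_map (C m) c (c_eg k m b) = c_eg k m (surj_comp b c).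
Proof. by rewrite /c_eg c_in_nat erep_mapE. Qed.

Lemma c_eg_conj (K : fam U) (b b' : surjection K H) : surj_conj b b' -> c_eg k m b = c_eg k m b'.
Proof. by move=> h; rewrite /c_eg (eg_conj k h). Qed.

Lemma rep_lin_ext (K : fam U) (L : lmodType k) (f g : {linear C m K -> L}) :
  (forall b, f (c_eg k m b) = g (c_eg k m b)) -> forall y, f y = g y.
Proof.
move=> h y; rewrite -(c_outK y).
have fl (f' : {linear C m K -> L}) : linear (fun z => f' (@c_in k U m (erep k H) K z)).
  by move=> c u v; rewrite c_in_lin linearP.
exact: (@er_eq k U H K _ (mklin (fl f)) (mklin (fl g))).
Qed.

Lemma psi_rep_ext Z n G (r s : psi C Z n G) :
  (forall (K : fam U) (a : surjection K G) (b : surjection K H) j (e : n + m = j),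
    pev r a e (c_eg k m b) = pev s a e (c_eg k m b)) -> r = s.
Proof.
move=> h; apply: psi_ext => K a i j e y.
have [ei|ne] := pselect (i = m); last by rewrite (c_out_neq y ne) !pev_0.
subst i; apply: (rep_lin_ext (f := mklin (pev_lin r a e)) (g := mklin (pev_lin s a e))) => b.
exact: h.
Qed.

Section Lift.
Context (Z : cplx k U) (n j0 : int) (e0 : n + m = j0) (G : fam U).
Context (u : forall K : fam U, surjection K G -> surjection K H -> Z j0 K).
Hypothesis un : forall (K' K : fam U) (c : surjection K' K) (a : surjection K G)
  (b : surjection K H), psh_map (Z j0) c (u a b) = u (surj_comp a c) (surj_comp b c).
Hypothesis uc : forall (K : fam U) (a a' : surjection K G) (b b' : surjection K H),
  surj_conj a a' -> surj_conj b b' -> u a b = u a' b'.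

Lemma surj_conj_refl (K L : finGroupType) (a : surjection K L) : surj_conj a a.
Proof. by exists 1%g => x; rewrite conjg1. Qed.

Let ucr (K : fam U) (a : surjection K G) (b b' : surjection K H) (h : surj_conj b b') :
  u a b = u a b' := uc (surj_conj_refl a) h.

Let deg i j (e : n + i = j) (ei : i = m) : j0 = j.
Proof. by rewrite -e0 -e ei. Qed.

Let F (K : fam U) (a : surjection K G) i j (e : n + i = j) (y : C i K) : Z j K :=
  match @eqP _ i m with
  | ReflectT ei => ct Z (deg e ei) K (er_lift (ucr a) (c_out m (erep k H) i K y))
  | ReflectF _ => 0
  end.

Lemma psi_rep_lift : exists r : psi C Z n G,
  forall (K : fam U) (a : surjection K G) (b : surjection K H),
    pev r a e0 (c_eg k m b) = u a b.
Proof.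
have Fl (K : fam U) (a : surjection K G) i j (e : n + i = j) : linear (F a e).
  move=> c x y; rewrite /F; case: eqP => [ei|_]; last by rewrite scaler0 addr0.
  by rewrite !linearP.
have Fn (K' K : fam U) (c : surjection K' K) (a : surjection K G) i j (e : n + i = j) y :
    psh_map (Z j) c (F a e y) = F (surj_comp a c) e (psh_map (C i) c y).
  rewrite /F; case: eqP => [ei|_]; last by rewrite linear0.
  rewrite -psh_hom_nat; congr (ct _ _ _ _); rewrite psh_hom_nat.
  apply: (@er_eq k U H K _ (psh_map (Z j0) c \o er_lift (ucr a))
    (er_lift (ucr (surj_comp a c)) \o psh_map (erep k H) c)) => b.
  rewrite -[LHS]/(psh_map (Z j0) c (er_lift (ucr a) (eg k b))).
  rewrite -[RHS]/(er_lift (ucr (surj_comp a c)) (psh_map (erep k H) c (eg k b))).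
  by rewrite erep_mapE !er_liftE un.
have Fc (K : fam U) (a a' : surjection K G) i j (e : n + i = j) y :
    surj_conj a a' -> F a e y = F a' e y.
  move=> aa; rewrite /F; case: eqP => // ei; congr (ct _ _ _ _).
  apply: er_eq => b; rewrite !er_liftE; apply: uc => //; exact: surj_conj_refl.
exists (of_fam (NFam Fl Fn Fc)) => K a b; rewrite pev_fam /= /F.
by case: eqP => // ei; rewrite ct_id c_inK er_liftE.
Qed.
End Lift.

Context (U_iso : closed_under_iso U) (U_quo : closed_under_quotients U).

(** An element of this internal hom is a natural, conjugation-invariant family indexed by pairs of
    surjections. A cycle is a family of cycles in the acyclic [A], and [wide_lift] chooses elements
    bounding them in a natural and invariant way. *)
Lemma rep_psi_exact : [pchar k] =i pred0 -> psi_exact C.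
Proof.
move=> k_char0 A aA G n w dw.
pose v (K : fam U) (a : surjection K G) (b : surjection K H) : A (n - 1 + m) K :=
  pev w a erefl (c_eg k m b).
have eA : n - 1 + m = n + m - 1 by zmod.
have eA' : n - 1 + m - 1 = n - 1 + m - 1 by [].
have vA (K : fam U) (a : surjection K G) (b : surjection K H) :
    exists u, dr A eA K u = v K a b.
  have dv : dr A eA' K (v K a b) = 0.
    have e : n - 1 - 1 + m = n - 1 + m - 1 by zmod.
    have e2 : n - 1 + (m - 1) = n - 1 + m - 1 by zmod.
    have := pev_d w a e erefl e2 eA' (c_eg k m b).
    by rewrite dw pev0 conc_d pev_0 scaler0 subr0.
  by have [u ->] := acyclic_drP (aA K) eA dv; exists u.
have vn (K' K : fam U) (c : surjection K' K) (a : surjection K G) (b : surjection K H) :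
    psh_map (A _) c (v K a b) = v K' (surj_comp a c) (surj_comp b c).
  by rewrite /v pev_nat c_eg_nat.
have vc (K : fam U) (a a' : surjection K G) (b b' : surjection K H) :
    surj_conj a a' -> surj_conj b b' -> v K a b = v K a' b'.
  by move=> aa bb; rewrite /v (pev_conj _ _ _ aa) (c_eg_conj bb).
have [u [un uc uv]] := wide_lift U_iso U_quo k_char0 vn vc vA.
have [r rE] := psi_rep_lift (erefl (n + m)) un uc.
exists r; apply: psi_rep_ext => K a b j e; subst j.
have e2 : n + (m - 1) = n - 1 + m by zmod.
by rewrite (pev_d r a _ erefl e2 eA) conc_d pev_0 scaler0 subr0 rE uv.
Qed.

(** The family is determined by its values at the finitely many wide subgroups of [G * H], each of
    which lies in finitely many summands. *)
Lemma rep_psi_finite : psi_finite C.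
Proof.
move=> I Z n G w _.
pose v (K : fam U) (a : surjection K G) (b : surjection K H) : dsc Z (n - 1 + m) K :=
  pev w a erefl (c_eg k m b).
have /dchoice[s sP] : forall W : {group (G * H)%type}, exists s, forall hW : wide W, forall s',
    List.incl s s' ->
    dsel Z s' _ _ (v _ (wpr1 U_iso U_quo hW) (wpr2 U_iso U_quo hW)) =
    v _ (wpr1 U_iso U_quo hW) (wpr2 U_iso U_quo hW).
  move=> W; have [hW|nW] := pselect (wide W); last by exists [::] => hW; case: (nW hW).
  have [s sP] := dsel_fin (v _ (wpr1 U_iso U_quo hW) (wpr2 U_iso U_quo hW)).
  by exists s => hW'; rewrite (Prop_irrelevance hW' hW).
have [t tP] : exists t, forall W, List.incl (s W) t.
  have [t tP] : exists t, forall W, W \in enum {: {group (G * H)%type}} -> List.incl (s W) t.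
    elim: (enum _) => [|W l [t tP]]; first by exists [::].
    exists (s W ++ t) => W'; rewrite inE => /orP[/eqP ->|W'l] i si; apply/List.in_or_app.
      by left.
    by right; apply: tP W'l _ si.
  by exists t => W; apply: tP; rewrite mem_enum.
have fixv : forall (K : fam U) (a : surjection K G) (b : surjection K H),
    v K a b = dsel Z t _ K (v K a b).
  apply: (wide_ind (R := fun K a b => v K a b = dsel Z t _ K (v K a b))) => [W hW|].
    by rewrite sP.
  move=> K' K c a b h.
  by rewrite /v -c_eg_nat -pev_nat psh_hom_nat -h.
exists t, 0; rewrite linear0 addr0; apply: psi_rep_ext => K a b j e; subst j.
by rewrite pmapE; apply: fixv.
Qed.
End RepresentableFactor.

Lemma sg_mul_pred (k : fieldType) (a i : int) : sg k (a * (i - 1)) = sg k (a * i) * sg k a.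
Proof. by rewrite mulrBr mulr1 [LHS]sgD sgN. Qed.

Section GeneralFactor.
Context (k : fieldType) (U : finGroupType -> Prop) (Y : cplx k U) (n : int) (G : fam U).
Implicit Types (Z A : cplx k U).
Local Notation R := (conc (n - 1) (erep k G)).
Context (T : cplx k U) (D : tdata Y R T).

(* A cycle of degree [n - 1] of [psi Y Z] at [G] amounts to a chain map from the
   tensor product of [Y] with the representable complex at [G]; the sign comes
   from moving the generator past the elements of [Y]. *)
Definition represents Z (w : psi Y Z (n - 1) G) (f : chmap T Z) : Prop :=
  forall i j (e : i + (n - 1) = j) (e' : n - 1 + i = j) (K : fam U) (a : surjection K G) x,
    f j K (tb D e x (c_eg k (n - 1) a)) = sg k ((n - 1) * i) *: pev w a e' x.

Section Cycle.
Context (Z : cplx k U) (w : psi Y Z (n - 1) G).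
Hypothesis dw : cplx_d (psi Y Z) (n - 1) G w = 0.

Let wc (K : fam U) i j (e : n - 1 + i = j) (x : Y i K) (a a' : surjection K G)
  (h : surj_conj a a') : pev w a e x = pev w a' e x := pev_conj w e x h.

Let deg i j m (e : i + j = m) (ej : j = n - 1) : n - 1 + i = m.
Proof. by rewrite -e ej addrC. Qed.

Let phi m i j (e : i + j = m) (K : fam U) (x : Y i K) (y : R j K) : Z m K :=
  match @eqP _ j (n - 1) with
  | ReflectT ej => sg k ((n - 1) * i) *: er_lift (wc (deg e ej) x) (c_out (n - 1) (erep k G) j K y)
  | ReflectF _ => 0
  end.

Let phiE m i (e : i + (n - 1) = m) (e' : n - 1 + i = m) (K : fam U) (a : surjection K G) x :
  phi e x (c_eg k (n - 1) a) = sg k ((n - 1) * i) *: pev w a e' x.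
Proof.
rewrite /phi; case: eqP => // ej; rewrite c_inK er_liftE.
by rewrite (eq_irrelevance (deg e ej) e').
Qed.

Let phi_r m i j (e : i + j = m) (K : fam U) x : linear (@phi m i j e K x).
Proof.
move=> c y y'; rewrite /phi; case: eqP => [ej|_]; last by rewrite scaler0 addr0.
by rewrite !linearP.
Qed.

Let phi_ext m i j (e : i + j = m) (K : fam U) (L : lmodType k) (f g : {linear R j K -> L}) :
  (j = n - 1 -> forall (ej : n - 1 = j) a, f (ct R ej K (c_eg k (n - 1) a)) = g (ct R ej K (c_eg k (n - 1) a))) ->
  forall y, f y = g y.
Proof.
have [ej|ne] := pselect (j = n - 1); last by move=> _ y; rewrite (c_out_neq y ne) !linear0.
subst j => h; apply: rep_lin_ext => a.
by have := h erefl erefl a; rewrite !ct_id.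
Qed.

Let phib m i j (e : i + j = m) (K : fam U) : bilin (@phi m i j e K).
Proof.
split=> [x|y]; first exact: phi_r.
move=> c x x'; move: y.
have hl : linear (fun y => c *: phi e x y + phi e x' y).
  move=> b y y'; rewrite !phi_r !scalerDr !scalerA [b * c]mulrC.
  by zmod.
apply: (@phi_ext m i j e K _ (mklin (phi_r e (c *: x + x'))) (mklin hl)) => ej; subst j => ej a.
by rewrite !ct_id /= !(phiE e (deg e erefl)) pev_lin scalerDr !scalerA [c * _]mulrC.
Qed.

Let phin m i j (e : i + j = m) (K' K : fam U) (b : surjection K' K) x y :
  psh_map (Z m) b (phi e x y) = phi e (psh_map (Y i) b x) (psh_map (R j) b y).
Proof.
move: y; apply: (@phi_ext m i j e K _ (psh_map (Z m) b \o mklin (phi_r e x))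
  (mklin (phi_r e (psh_map (Y i) b x)) \o psh_map (R j) b)) => ej; subst j => ej a.
rewrite !ct_id -[LHS]/(psh_map (Z m) b (phi e x (c_eg k (n - 1) a))).
rewrite -[RHS]/(phi e (psh_map (Y i) b x) (psh_map (R (n - 1)) b (c_eg k (n - 1) a))).
by rewrite c_eg_nat !(phiE e (deg e erefl)) linearZ_LR pev_nat.
Qed.

Let phid m i j (e : i + j = m) (K : fam U) x (y : R j K) :
  cplx_d Z m K (phi e x y) = phi (tens_el e) (cplx_d Y i K x) y +
    sg k i *: phi (tens_er e) x (cplx_d R j K y).
Proof.
have p0 : phi (tens_er e) x 0 = 0 := linear0 (mklin (phi_r (tens_er e) x)).
rewrite conc_d p0 scaler0 addr0; move: y.
apply: (@phi_ext m i j e K _ (cplx_d Z m K \o mklin (phi_r e x))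
  (mklin (phi_r (tens_el e) (cplx_d Y i K x)))) => ej; subst j => ej a.
rewrite !ct_id -[LHS]/(cplx_d Z m K (phi e x (c_eg k (n - 1) a))).
rewrite -[RHS]/(phi (tens_el e) (cplx_d Y i K x) (c_eg k (n - 1) a)).
have e1 : n - 1 + i = m := deg e erefl.
have e2 : n - 1 + (i - 1) = m - 1 by zby e1.
have e3 : n - 1 - 1 + i = m - 1 by zby e1.
rewrite (phiE e e1) (phiE (tens_el e) e2) linearZ_LR.
have := pev_d w a e3 e1 e2 erefl x; rewrite dw pev0 dr_id => /esym/eqP.
rewrite subr_eq0 => /eqP ->; rewrite scalerA; congr (_ *: _).
by rewrite sg_mul_pred.
Qed.

Lemma represents_ex : exists f, represents w f.
Proof.
exists (tchmap D phib phin phid) => i j e e' K a x.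
by rewrite tchmapE (phiE e e').
Qed.
End Cycle.

(** The bounding element is the homotopy evaluated on the generators [c_eg], with the sign of
    [represents]. *)
Lemma represents_null Z (w : psi Y Z (n - 1) G) (f : chmap T Z) :
  represents w f -> nullh f -> exists w', w = cplx_d (psi Y Z) n G w'.
Proof.
move=> wf [h hP].
have deg i j : n + i = j -> i + (n - 1) = j - 1 by move=> e; zby e.
pose F (K : fam U) (a : surjection K G) i j (e : n + i = j) (y : Y i K) : Z j K :=
  sg k ((n - 1) * i) *: h j K (tb D (deg i j e) y (c_eg k (n - 1) a)).
have Fl (K : fam U) (a : surjection K G) i j (e : n + i = j) : linear (F K a i j e).
  move=> c y y'; rewrite /F (tb_bilin D _ K).2 linearP scalerDr !scalerA.
  by rewrite [c * _]mulrC.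
have Fn (K' K : fam U) (b : surjection K' K) (a : surjection K G) i j (e : n + i = j) y :
    psh_map (Z j) b (F K a i j e y) = F K' (surj_comp a b) i j e (psh_map (Y i) b y).
  by rewrite /F linearZ_LR -psh_hom_nat tb_nat c_eg_nat.
have Fc (K : fam U) (a a' : surjection K G) i j (e : n + i = j) y :
    surj_conj a a' -> F K a i j e y = F K a' i j e y.
  by move=> aa; rewrite /F (c_eg_conj k (n - 1) aa).
exists (of_fam (NFam Fl Fn Fc)); apply: psi_ext => K a i.
apply: pred_ind => j e y.
have e1 : n + i = j by zby e.
have e2 : n + (i - 1) = j - 1 by zby e.
have eD : i + (n - 1) = j - 1 by zby e.
rewrite (pev_d _ a e e1 e2 erefl) dr_id !pev_fam /= /F.
have := hP j K (tb D eD y (c_eg k (n - 1) a)).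
rewrite (wf _ _ eD e) => /(congr1 (fun z => sg k ((n - 1) * i) *: z)).
rewrite scalerA sgK scale1r => ->.
have eD1 : i - 1 + (n - 1) = j - 1 - 1 by zby e.
have eD2 : i + (n - 1 - 1) = j - 1 - 1 by zby e.
rewrite (tb_d D eD eD1 eD2) conc_d tb0r scaler0 addr0 scalerDr linearZ_LR.
rewrite (eq_irrelevance (deg i j e1) eD) (eq_irrelevance (deg (i - 1) (j - 1) e2) eD1).
congr (_ + _); rewrite scalerA -scaleNr; congr (_ *: _).
by rewrite sg_mul_pred sg_pred !mulrN opprK mulrCA sgK mulr1.
Qed.
End GeneralFactor.

(** * Compactness of tensor products *)

Section TensorCompact.
Context (k : fieldType) (U : finGroupType -> Prop) (U_iso : closed_under_iso U)
  (U_quo : closed_under_quotients U) (k_char0 : [pchar k] =i pred0).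
Implicit Types (X Y Z A T P Q : cplx k U).

Section Factor.
Context (Y : cplx k U) (KY : Kproj Y).

Lemma tens_rep_Kproj n (G : fam U) : Kproj (tens Y (conc n (erep k G))).
Proof.
apply: tens_Kproj (tens_data _ _) _ KY.
exact: rep_psi_exact.
Qed.

(** A cycle at [G] is represented by a chain map out of the tensor product of [Y] with a
    representable complex, which is K-projective because the representable factor satisfies
    [psi_exact]. *)
Lemma psi_exact_Kproj : psi_exact Y.
Proof.
move=> A aA G n w dw.
have [f fw] := represents_ex (tens_data Y (conc (n - 1) (erep k G))) dw.
apply: (represents_null fw).
exact: (tens_rep_Kproj aA).
Qed.

(** The chain map representing [w] starts from a compact complex, so it is homotopic to its part in
    finitely many summands. The difference represents [w] minus its part there, which is therefore a
    boundary. *)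
Lemma psi_finite_cpt : cpt Y -> psi_finite Y.
Proof.
move=> cY I Z n G w dw.
have [f fw] := represents_ex (tens_data Y (conc (n - 1) (erep k G))) dw.
have [s hs] := tens_cpt (tens_data Y (conc (n - 1) (erep k G)))
  (rep_psi_finite U_iso U_quo) KY cY f.
have rs : represents (tens_data Y (conc (n - 1) (erep k G)))
    (w - pmap Y (dsel Z s) (n - 1) G w) (chB f (chmap_comp (dsel Z s) f)).
  move=> i j e e' K a x; rewrite chBE -[chmap_comp _ _ _ _ _]/(dsel Z s j K (f j K _)).
  by rewrite (fw _ _ e e') linearZ_LR pevB pmapE scalerBr.
have [w' ew] := represents_null rs hs.
by exists s, w'; rewrite -ew [RHS]addrC subrK.
Qed.
End Factor.

(** Replacing both factors by K-projective resolutions changes the tensor product by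
    quasi-isomorphisms only. *)
Lemma compact_tensor X Y T : compact_obj X -> compact_obj Y -> is_tensor X Y T -> compact_obj T.
Proof.
move=> cX cY /is_tensorP[D _].
have [P [p [KP pq]]] := resolution k_char0 X.
have [Q [q [KQ qq]]] := resolution k_char0 Y.
have cP := compact_cpt k_char0 KP pq cX; have cQ := compact_cpt k_char0 KQ qq cY.
pose D1 := tens_data P Q; pose D2 := tens_data P Y.
have cT1 : compact_obj (tens P Q).
  apply: (@cpt_compact k U k_char0 _ (tens P Q) (chmap_id _)).
  - exact: tens_Kproj D1 (psi_exact_Kproj KQ) KP.
  - move=> n G; split=> [x _ [y ey]|y dy]; first by exists y.
    by exists y, 0; rewrite linear0 addr0.
  - exact: tens_cpt D1 (psi_finite_cpt KQ cQ) KP cP.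
have [_ r1] := qis_retract (tmap_qisr D1 D2 qq).
have [_ r2] := qis_retract (tmap_qis D2 D pq).
exact: compact_retract r2 (compact_retract r1 cT1).
Qed.
End TensorCompact.

(** * Primes *)

Section Primes.
Context (k : fieldType) (U : finGroupType -> Prop) (U_iso : closed_under_iso U)
  (U_quo : closed_under_quotients U) (k_char0 : [pchar k] =i pred0).
Implicit Types (X Y Z A T : cplx k U).

(** The retraction exists only in the derived category, so a cycle at [G] is turned into a map [f]
    out of a representable complex. Its composite with [i] vanishes because [Y] is acyclic at [G],
    hence [f] is null-homotopic and the cycle is a boundary. *)
Lemma acyclic_at_retract (G : fam U) X Y : retract X Y -> acyclic_at G Y -> acyclic_at G X.
Proof.
move=> [i [r ri]] aY n x dx.
have ux (K : fam U) : exists u : {linear erep k G K -> X (n - 1) K},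
    forall a, u (eg k a) = psh_map (X (n - 1)) a x.
  have xc (a a' : surjection K G) : surj_conj a a' ->
    psh_map (X (n - 1)) a x = psh_map (X (n - 1)) a' x by move=> h; apply: psh_map_conj.
  by exists (er_lift xc) => a; rewrite er_liftE.
have [u uE] := dchoice ux.
have un (K K' : fam U) (b : surjection K K') z :
    u K (psh_map (erep k G) b z) = psh_map (X (n - 1)) b (u K' z).
  apply: (@er_eq k U G K' _ (u K \o psh_map (erep k G) b) (psh_map (X (n - 1)) b \o u K')) => a.
  rewrite -[LHS]/(u K (psh_map (erep k G) b (eg k a))) erep_mapE uE psh_map_comp.
  by rewrite -[RHS]/(psh_map (X (n - 1)) b (u K' (eg k a))) uE.
have du (K : fam U) z : cplx_d X (n - 1) K (u K z) = 0.
  apply: (@er_eq k U G K _ (cplx_d X (n - 1) K \o u K) (hom0 (erep k G) _ K)) => a.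
  by rewrite -[LHS]/(cplx_d X (n - 1) K (u K (eg k a))) uE psh_hom_nat dx linear0.
have [f fE] := conc_lift (u := PshHom un) du.
have fx : f (n - 1) G (rep_gen k (n - 1) G) = x.
  by rewrite /rep_gen /c_eg fE -[LHS]/(u G (eg k (surj_id G))) uE psh_map_id.
have KC := @rep_Kproj k U (n - 1) G.
have [g gE] := word_lift KC i f.
have [y ey] : exists y, g (n - 1) G (rep_gen k (n - 1) G) = cplx_d Y n G y.
  by apply: aY; rewrite -chmap_d conc_d linear0.
have f0 : deq (dmap f) (dmap (ch0 _ _)).
  by rewrite -[dmap f]deq_comp1l -ri -deq_compA gE (nullh_deq (rep_null ey)) deq_comp0r deq_map0.
have /heq0[h hP] := deq_heq KC f0.
exists (h n G (rep_gen k (n - 1) G)).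
by rewrite -{1}fx hP conc_d linear0 addr0.
Qed.

Lemma id_qis X : quasi_iso (chmap_id X).
Proof.
move=> n G; split=> [x _ [y ey]|y dy]; first by exists y.
by exists y, 0; rewrite linear0 addr0.
Qed.

Lemma rep_compact n (G : fam U) : compact_obj (conc n (erep k G)).
Proof.
apply: (cpt_compact k_char0 _ (@id_qis (conc n (erep k G)))).
  exact: rep_Kproj.
exact: rep_cpt.
Qed.

Lemma acyclic_at_iso (G H : fam U) (c : surjection G H) X : injective c ->
  acyclic_at H X -> acyclic_at G X.
Proof.
move=> ci aH n x dx.
have [|y ey] := aH n (psh_map (X (n - 1)) (surj_inv ci) x).
  by rewrite psh_hom_nat dx linear0.
exists (psh_map (X n) c y); rewrite psh_hom_nat -ey -psh_map_comp surj_Kinv.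
by rewrite psh_map_id.
Qed.

(** The quotient of [G] by itself. Its representable functor vanishes nowhere, which shows that the
    primes below are proper. *)
Lemma trivial_group (G : fam U) : exists E : fam U,
  forall K : fam U, exists a : surjection K E, True.
Proof.
have nG : ([set: G] <| [set: G])%g := normal_refl [group of [set: G]].
pose E := Fam (U_quo (fam_in G) nG).
have e1 (y : E) : y = 1%g.
  have [x _ ->] := cosetP (y : coset_of [set: G]%G).
  by rewrite coset_id ?inE.
exists E => K.
have m (x y : K) : 1%g = (1 * 1)%g :> E by rewrite mulg1.
have s (y : E) : exists x : K, 1%g = y by exists 1%g; rewrite (e1 y).
by exists (mksurj m s).
Qed.

Section Ultra.
Context (I : Type) (Gs : I -> fam U) (F : (I -> Prop) -> Prop).
Hypotheses (FT : F (fun _ => True : Prop)) (F0 : ~ F (fun _ => False))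
  (FI : forall A B : I -> Prop, F A -> F B -> F (fun i => A i /\ B i))
  (FS : forall A B : I -> Prop, (forall i, A i -> B i) -> F A -> F B)
  (FC : forall A : I -> Prop, F A \/ F (fun i => ~ A i)).

Definition ultra_prime X : Prop := compact_obj X /\ F (fun i => acyclic_at (Gs i) X).

Lemma ultra_primeP : prime_ideal ultra_prime.
Proof.
have [i0] : exists i : I, True.
  by apply: contrapT => h; apply: F0; apply: FS FT => i _; apply: h; exists i.
have [E EP] := trivial_group (Gs i0); move=> _.
split=> [X []//||X Y T cY XYT [cX aX]||X Y T cX cY /is_tensorP[D _] [_ aT]].
- split.
  + exists (cone (chmap_id (conc 0 (erep k E)))); split.
      by apply: compact_acyclic; apply: cone_id_acyclic.
    by apply: FS FT => i _; apply: cone_id_acyclic.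
  + move=> X; split=> -[cX aX]; split; try exact/compact_shift.
      by apply: FS aX => i; apply: (acyclic_at_shift _ _).1.
    by apply: FS aX => i; apply: (acyclic_at_shift _ _).2.
  + move=> X Y f [cX aX] [cY aY]; split; first exact: compact_cone.
    by apply: FS (FI aX aY) => i []; apply: acyclic_at_cone.
  + move=> X Y f [cY aY] [cC aC]; split; first exact: compact_cone_src cY cC.
    by apply: FS (FI aY aC) => i []; apply: acyclic_at_cone_src.
  + move=> X Y f [cX aX] [cC aC]; split; first exact: compact_cone_tgt cX cC.
    by apply: FS (FI aX aC) => i []; apply: acyclic_at_cone_tgt.
  + move=> X Y XY [cY aY]; split; first exact: compact_retract XY cY.
    by apply: FS aY => i; apply: acyclic_at_retract.
- split; first exact: (compact_tensor U_iso U_quo k_char0 cX cY XYT).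
  move/is_tensorP: XYT => [D _]; apply: FS aX => i; apply: (tens_acyclic D).
- exists (conc 0 (erep k E)); split; first exact: rep_compact.
  move=> [_ aE]; apply: F0; apply: FS aE => i /rep_acyclic a0.
  by have [a _] := EP (Gs i); apply: (eg_neq0 (k := k) (a := a)); apply: a0.
(* If [X] is not acyclic at almost all groups, then at almost all groups it is not acyclic, and
   there the Kuenneth alternative falls on [Y]. *)
- have [aX|nX] := FC (fun i => acyclic_at (Gs i) X); first by left.
  right; split=> //; apply: FS (FI aT nX) => i [aTi nXi].
  by case: (kunneth D aTi).
Qed.
End Ultra.

(** The ultrafilter on a one-point index set. *)
Lemma group_primeP (G : fam U) : prime_ideal (@group_prime k U G).
Proof.
suff : prime_ideal (ultra_prime (fun _ : unit => G) (fun B : unit -> Prop => B tt)) by [].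
apply: ultra_primeP => //.
- by move=> B C h; apply: h.
- by move=> B; have [a|na] := pselect (B tt); [left|right].
Qed.

Definition gprime (G : fam U) : Spc k U := MkSpc (group_primeP G).

Lemma Spc_ext (P Q : Spc k U) : (forall X, P X <-> Q X) -> P = Q.
Proof.
case: P Q => [P hP] [Q hQ] /= h.
have e : P = Q by apply: funext => X; apply: propext.
by subst Q; rewrite (Prop_irrelevance hP hQ).
Qed.

Lemma gprime_iso (G H : fam U) (c : surjection G H) : injective c -> gprime G = gprime H.
Proof.
move=> ci; apply: Spc_ext => X; split=> -[cX aX]; split=> //.
  exact: (acyclic_at_iso (@surj_inv_inj _ _ _ ci) aX).
exact: (acyclic_at_iso ci aX).
Qed.

Definition gmap (c : pi0 U) : Spc k U := gprime (sval (cid (pi0_setP c))).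

Lemma gmapE (G : fam U) : gmap (pi0_class G) = gprime G.
Proof.
rewrite /gmap; case: cid => H /= e.
have : isog_class G H = isog_class H H by rewrite -e.
rewrite /isog_class => h.
have /isogE[c ci] : ([set: G] \isog [set: H])%g by rewrite h; apply: isog_refl.
by rewrite (gprime_iso ci).
Qed.

Lemma pi0_classP (c : pi0 U) : exists G : fam U, c = pi0_class G.
Proof.
have [G e] := pi0_setP c; exists G; case: c e => s h /= e; subst s.
by rewrite /pi0_class; congr Pi0; apply: Prop_irrelevance.
Qed.
End Primes.

(** * Infinitely many isomorphism classes *)

Section FewGroups.
Context (U : finGroupType -> Prop).

Definition iso (G H : finGroupType) : Prop := exists c : surjection G H, injective c.

Lemma table_bound (G : finGroupType) i j : ((table_of G).2 i j <= #|G|)%N.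
Proof. by rewrite /= [leqRHS]cardE index_size. Qed.

(** A group of order at most [N] is determined up to isomorphism by its order and multiplication
    table, which are coded in a finite type. *)
Lemma bounded_classes N : exists l : seq (fam U), forall K : fam U, (#|K| <= N)%N ->
  exists H, List.In H l /\ iso K H.
Proof.
pose code (K : fam U) : 'I_N.+1 * {ffun 'I_N.+1 * 'I_N.+1 -> 'I_N.+1} :=
  (inord #|K|, [ffun ij => inord ((table_of K).2 (ij.1 : 'I_N.+1) (ij.2 : 'I_N.+1))]).
have codeP (K H : fam U) : (#|K| <= N)%N -> (#|H| <= N)%N -> code K = code H -> iso K H.
  move=> kN hN [/(congr1 val) e1 e2].
  have cKH : #|K| = #|H| by move: e1; rewrite /= !inordK.
  apply: table_iso => // i j iK jK.
  have iN : (i < N.+1)%N by apply: leq_trans iK _; apply: leq_trans kN _.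
  have jN : (j < N.+1)%N by apply: leq_trans jK _; apply: leq_trans kN _.
  have := congr1 (fun f : {ffun _ -> _} => val (f (Ordinal iN, Ordinal jN))) e2.
  rewrite !ffunE /= !inordK //; last 2 first.
  - by rewrite ltnS (leq_trans (table_bound H i j)).
  - by rewrite ltnS (leq_trans (table_bound K i j)).
have [l lP] : exists l : seq (fam U), forall K : fam U, (#|K| <= N)%N ->
    code K \in enum {: 'I_N.+1 * {ffun 'I_N.+1 * 'I_N.+1 -> 'I_N.+1}} ->
    exists H, List.In H l /\ iso K H.
  elim: (enum _) => [|c s [l lP]]; first by exists [::].
  have [[H [hN hc]]|nH] := pselect (exists H : fam U, (#|H| <= N)%N /\ code H = c).
    exists (H :: l) => K kN; rewrite inE => /orP[/eqP e|/(lP K kN) [H' [H'l i]]].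
      by exists H; split; [left|apply: codeP => //; rewrite e hc].
    by exists H'; split=> //; right.
  exists l => K kN; rewrite inE => /orP[/eqP e|]; last exact: lP.
  by case: nH; exists K.
by exists l => K kN; apply: lP => //; rewrite mem_enum.
Qed.

Lemma iso_pi0 (G H : fam U) : pi0_class G = pi0_class H <-> iso G H.
Proof. exact: pi0_isog. Qed.

Context (U_quo : closed_under_quotients U) (p : nat) (p_prime : prime p)
  (U_pgroup : forall G : finGroupType, U G -> (p.-group [set: G])%g).

Lemma quotient_surj (K : fam U) (N : {group K}) (nN : (N <| [set: K])%g) :
  exists a : surjection K (coset_of N), True.
Proof.
have NK (x : K) : x \in 'N(N)%g by apply: (subsetP (normal_norm nN)); rewrite inE.
have m : {morph (coset N : K -> coset_of N) : x y / (x * y)%g} by move=> x y; rewrite morphM.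
have s (y : coset_of N) : exists x : K, coset N x = y.
  by have [x _ ->] := cosetP y; exists x.
by exists (mksurj m s).
Qed.

Lemma larger_cover (G K : fam U) : (#|G| < #|K|)%N ->
  exists H : fam U, #|H| = (p * #|G|)%N /\ exists a : surjection K H, True.
Proof.
move=> ltGK.
have [b eG] := p_natP (U_pgroup (fam_in G)); have [a eK] := p_natP (U_pgroup (fam_in K)).
rewrite !cardsT in eG eK; rewrite eG eK in ltGK.
have ba : (b < a)%N by rewrite -(ltn_exp2l _ _ (prime_gt1 p_prime)).
(* A finite [p]-group has normal subgroups of all orders dividing its own. One of order
   [p ^ (a - b.+1)] leaves a quotient of order [p ^ b.+1], that is [p * #|G|]. *)
have [|N [_ nN cN]] := @normal_pgroup p _ (a - b.+1) [group of [set: K]] [group of [set: K]]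
  (U_pgroup (fam_in K)) (normal_refl _).
  by rewrite cardsT eK pfactorK // leq_subr.
exists (Fam (U_quo (fam_in K) nN)); split; last exact: quotient_surj.
have e : #|{: coset_of N}| = (#|[set: K]| %/ #|N|)%N.
  rewrite divgS ?normal_sub // -(card_quotient (normal_norm nN)) -[LHS]cardsT; apply: eq_card => y; rewrite inE.
  by have [x Nx ->] := cosetP y; rewrite mem_quotient ?inE.
rewrite [LHS]e cardsT eK cN eG -expnS -expnB ?prime_gt0 ?leq_subr //.
by rewrite subKn.
Qed.
End FewGroups.

Section Infinite.
Context (k : fieldType) (U : finGroupType -> Prop) (U_iso : closed_under_iso U)
  (U_quo : closed_under_quotients U) (k_char0 : [pchar k] =i pred0)
  (p : nat) (p_prime : prime p)
  (U_pgroup : forall G : finGroupType, U G -> (p.-group [set: G])%g).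

Lemma not_finite_ultra : ~ finite_type (pi0 U) ->
  exists F : (skel U -> Prop) -> Prop,
  [/\ F (fun _ => True), ~ F (fun _ => False),
    forall A B : skel U -> Prop, F A -> F B -> F (fun i => A i /\ B i),
    forall A B : skel U -> Prop, (forall i, A i -> B i) -> F A -> F B
    & (forall A : skel U -> Prop, F A \/ F (fun i => ~ A i)) /\
      forall l : seq (fam U), F (fun t => forall H, List.In H l -> ~ iso (rep t) H)].
Proof.
move=> nfin.
(* [B] is the filter of sets that omit only finitely many isomorphism classes; it is proper because
   there are infinitely many. *)
pose B : (skel U -> Prop) -> Prop := fun A => exists l : seq (fam U),
  forall t, (forall H, List.In H l -> ~ iso (rep t) H) -> A t.
have BF : @filter.ProperFilter (skel U) B.
  split; last first.
    split=> [|A A' [l lA] [l' lA']|A A' AA' [l lA]]; first by exists [::].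
      exists (l ++ l') => t h; split; [apply: lA|apply: lA'] => H Hl; apply: h.
        by apply/List.in_or_app; left.
      by apply/List.in_or_app; right.
    by exists l => t h; apply: AA'; apply: lA.
  move=> [l h]; apply: nfin; exists (List.map (@pi0_class U) l) => c.
  have [G ->] := pi0_classP c.
  apply: contrapT => nG; apply: (h (skel_of G)) => H Hl i; apply: nG.
  have -> : pi0_class G = pi0_class H.
    transitivity (pi0_class (rep (skel_of G))); apply/pi0_isog => //.
    by exists (to_rep G); apply: to_rep_inj.
  exact: List.in_map.
have [F [FU BFF]] := filter.ultraFilterLemma BF.
exists F; split.
- exact: filter.filterT.
- exact: filter.filter_not_empty.
- by move=> A C; apply: filter.filterI.
- by move=> A C AC; apply: filter.filterS.
- split=> [A|l]; first exact: filter.in_ultra_setVsetC.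
  by apply: BFF; exists l.
Qed.

Lemma not_finite_prime : ~ finite_type (pi0 U) ->
  exists P : Spc k U, forall c, gmap U_iso U_quo k_char0 c <> P.
Proof.
move=> /not_finite_ultra[F [FT F0 FI FS [FC Fl]]].
exists (MkSpc (@ultra_primeP k U U_iso U_quo k_char0 (skel U) (@rep U) F FT F0 FI FS FC)) => c.
have [G ->] := pi0_classP c; rewrite gmapE => /(congr1 (@Spc_carrier k U)) /= e.
have [small smallP] := bounded_classes U #|fam_group G|.
have [cov covP] := bounded_classes U (p * #|fam_group G|).
have Fcov : F (fun t => exists H, List.In H cov /\ (#|G| < #|H|)%N /\
    exists a : surjection (rep t) H, True).
  apply: FS (Fl small) => t h.
  have ltG : (#|G| < #|rep t|)%N.
    rewrite ltnNge; apply/negP => /smallP [H [Hs i]]; exact: h Hs i.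
  have [H [cH [a _]]] := larger_cover U_quo p_prime U_pgroup ltG.
  have [|H' [H'c [c' ci]]] := covP H; first by rewrite cH.
  exists H'; split=> //; split; last by exists (surj_comp c' a).
  have := surj_card (surj_inv ci); rewrite cH; apply: leq_trans.
  rewrite -[X in (X < _)%N]mul1n ltn_mul2r prime_gt1 // andbT.
  by apply/card_gt0P; exists 1%g.
have [H [gtH FH]] : exists H : fam U, (#|G| < #|H|)%N /\
    F (fun t => exists a : surjection (rep t) H, True).
  move: cov {covP} Fcov; elim=> [|H l IH] Fcov.
    by case: F0; apply: FS Fcov => t [H []].
  have [h|h] := FC (fun t => (#|G| < #|H|)%N /\ exists a : surjection (rep t) H, True).
    have gt : (#|G| < #|H|)%N.
      by apply: contrapT => n; apply: F0; apply: FS h => t [].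
    by exists H; split=> //; apply: FS h => t [].
  apply: IH; apply: FS (FI _ _ Fcov h) => t [[H' [[<-|H'l] [gt a]]] n].
    by case: n.
  by exists H'.
have : group_prime (k := k) G (conc 0 (erep k H)).
  split; first exact: rep_compact.
  apply/rep_acyclic; apply: erep_zero => -[a _].
  by have := surj_card a; rewrite leqNgt gtH.
rewrite e => -[_ aF]; apply: F0; apply: FS (FI _ _ aF FH) => t [/rep_acyclic a0 [a _]].
by apply: (eg_neq0 (k := k) (a := a)); apply: a0.
Qed.
End Infinite.

(** * Finitely many isomorphism classes *)

Lemma mem_In (T : eqType) (x : T) s : x \in s -> List.In x s.
Proof.
elim: s => // y s IH; rewrite inE => /orP[/eqP ->|xs]; first by left.
by right; apply: IH.
Qed.

Lemma common_list (I T : Type) (R : T -> seq I -> Prop) (E : seq T) :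
  (forall e, exists t, forall t', List.incl t t' -> R e t') ->
  exists t, forall e, List.In e E -> R e t.
Proof.
move=> h; suff [t tP] : exists t, forall t', List.incl t t' -> forall e, List.In e E -> R e t'.
  by exists t; apply: tP.
elim: E => [|e E [t tP]]; first by exists [::].
have [s sP] := h e; exists (s ++ t) => t' st e' [<-|e'E].
  by apply: sP => i si; apply: st; apply/List.in_or_app; left.
by apply: tP => // i ti; apply: st; apply/List.in_or_app; right.
Qed.

Section Spans.
Context (k : fieldType).

(** Stated as an induction principle, so that a property closed under linear combinations need only
    be checked on the list. *)
Definition spanned (V : lmodType k) (l : seq V) : Prop := forall Q : V -> Prop,
  Q 0 -> (forall c x y, Q x -> Q y -> Q (c *: x + y)) ->
  (forall x, List.In x l -> Q x) -> forall x, Q x.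

Definition fin_span (V : lmodType k) : Prop := exists l : seq V, spanned l.

Lemma fin_span_image (V W : lmodType k) (f : {linear V -> W}) :
  (forall y, exists x, y = f x) -> fin_span V -> fin_span W.
Proof.
move=> fs [l lV]; exists (List.map f l) => Q Q0 QP Ql y.
have [x ->] := fs y; apply: (lV (fun x => Q (f x))) => [|c a b Qa Qb|a al].
- by rewrite linear0.
- by rewrite linearP; apply: QP.
- by apply: Ql; apply: List.in_map.
Qed.
End Spans.

(** * Short exact sequences of complexes; compactness of functors with finite-dimensional values *)

Section ShortExact.
Context (k : fieldType) (U : finGroupType -> Prop) (A B C : cplx k U).
Context (i : chmap A B) (p : chmap B C).
Hypotheses (ii : forall n G x, i n G x = 0 -> x = 0)
  (ps : forall n G y, exists x, y = p n G x)
  (p_i : forall n G x, p n G (i n G x) = 0)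
  (pk : forall n G y, p n G y = 0 -> exists x, y = i n G x).

Lemma ses_htpy : is_htpy (fun n => hom0 (A (n - 1)) (C n)) (chmap_comp p i).
Proof. by move=> n G x; rewrite -[LHS]/(p (n - 1) G (i (n - 1) G x)) p_i /= linear0 addr0. Qed.

Lemma ses_outE n G (z : cone i n G) : cone_out ses_htpy n G z = p n G z.1.
Proof. exact: addr0. Qed.

Lemma ses_qis : quasi_iso (cone_out ses_htpy).
Proof.
move=> n G; split.
  move=> [b a] dz; rewrite ses_outE => -[c ec].
  have ea : i (n - 1 - 1) G a = - cplx_d B (n - 1) G b.
    by have /= e := congr1 fst dz; zby e.
  have [b0 eb0] := ps c.
  have [|a0 ea0] := @pk (n - 1) G (b - cplx_d B n G b0).
    by rewrite linearB chmap_d -eb0 -[p _ _ b]/(p (n - 1) G (b, a).1) ec subrr.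
  exists (b0, a0).
  have e1 : b = cplx_d B n G b0 + i (n - 1) G a0 by rewrite -ea0 [RHS]addrC subrK.
  have e2 : a = - cplx_d A (n - 1) G a0.
    apply/eqP; rewrite -subr_eq0; apply/eqP; apply: ii.
    rewrite linearB linearN ea chmap_d -ea0 linearB cplx_dd subr0.
    by rewrite opprK addNr.
  exact: (congr2 pair e1 e2).
move=> c dc; have [b eb] := ps c.
have [|a ea] := @pk (n - 1 - 1) G (cplx_d B (n - 1) G b); first by rewrite chmap_d -eb.
exists (b, - a), 0; rewrite linear0 addr0 ses_outE; split=> //.
have e1 : cplx_d B (n - 1) G b + i (n - 1 - 1) G (- a) = 0 by rewrite linearN ea subrr.
have e2 : - cplx_d A (n - 1 - 1) G (- a) = 0.
  by rewrite linearN opprK; apply: ii; rewrite chmap_d -ea cplx_dd.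
exact: (congr2 pair e1 e2).
Qed.
End ShortExact.

Section FiniteCompact.
Context (k : fieldType) (U : finGroupType -> Prop) (U_iso : closed_under_iso U)
  (U_quo : closed_under_quotients U) (k_char0 : [pchar k] =i pred0).
Context (Gs : seq (fam U)).
Hypothesis GsP : forall K : fam U, exists H, List.In H Gs /\ iso K H.

(** Generators at [K] come from the finitely many surjections of [K] onto groups of [Gs] and from
    the spanning lists there. *)
Lemma fin_span_free (M : psh k U) : (forall G, fin_span (M G)) -> forall K, fin_span (free M K).
Proof.
move=> /dchoice[s sP] K.
pose l := List.flat_map (fun H : fam U => List.flat_map (fun a : surjection K H =>
  List.map (fun x => fgen_at a x : free M K) (s H)) (enum {: surjection K H})) Gs.
exists l => Q Q0 QP Ql.
have Qg (H : fam U) (a : surjection K H) x : List.In H Gs -> Q (fgen_at a x).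
  move=> HG; apply: (sP H (fun x => Q (fgen_at a x))) => [|c y z Qy Qz|y yl].
  - have f0 : fgen_at a (0 : M H) = 0 := linear0 (mklin (@fgen_at_lin k U M K H a)).
    by rewrite f0.
  - by rewrite fgen_at_lin; apply: QP.
  - apply: Ql; apply/List.in_flat_map; exists H; split=> //.
    apply/List.in_flat_map; exists a; split; first by apply: mem_In; rewrite mem_enum.
    by apply/List.in_map_iff; exists y.
apply: fmod_ind => // c al x y Qy; rewrite -[fg al x]scale1r; apply: QP => //.
have [H [HG [th ti]]] := GsP (rep c).
have -> : fg al x = fgen_at (surj_comp th al) (psh_map M (surj_inv ti) x).
  by rewrite fgen_at_iso // -psh_map_comp surj_Kinv psh_map_id fgen_at_rep.
exact: Qg.
Qed.

Definition concentrated (m : int) (X : cplx k U) : Prop := forall n, n <> m ->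
  forall (G : fam U) (x : X n G), x = 0.

Lemma free_concentrated m X : concentrated m X -> concentrated m (freec X).
Proof.
move=> X0 n nm G; apply: fmod_ind => // c al x y ->; rewrite addr0.
by rewrite (X0 n nm _ x) fg0.
Qed.

(** A map out of a free complex is determined by the units at the groups of [Gs], and there by those
    of the spanning lists; each of their images meets finitely many summands. *)
Lemma freec_cpt m X : concentrated m X -> (forall G, fin_span (X m G)) -> cpt (freec X).
Proof.
move=> X0 /dchoice[s sP] I Z f.
pose E := List.flat_map (fun H : fam U => List.map (fun x => existT (fun H => X m H) H x) (s H)) Gs.
pose fx (e : {H & X m H}) := f m (projT1 e) (funit (projT2 e)).
have [t tP] := @common_list I _ (fun e t => dsel Z t m _ (fx e) = fx e) E
  (fun e => dsel_fin (fx e)).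
have fixG (H : fam U) (x : X m H) : List.In H Gs -> dsel Z t m H (f m H (funit x)) = f m H (funit x).
  move=> HG; apply: (sP H (fun x => dsel Z t m H (f m H (funit x)) = f m H (funit x))).
  - by rewrite funit0 !linear0.
  - by move=> c y z ey ez; rewrite funit_lin !linearP ey ez.
  move=> y ys; apply: (tP (existT _ H y)); apply/List.in_flat_map; exists H; split=> //.
  by apply/List.in_map_iff; exists y.
exists t; apply: heq_ext => n.
apply: (@free_ext k U (X n) _ (f n) (psh_hom_comp (dsel Z t n) (f n))) => K x.
rewrite -[RHS]/(dsel Z t n K (f n K (funit x))).
have [en|ne] := pselect (n = m); last by rewrite (X0 n ne K x) funit0 !linear0.
subst n; have [H [HG [th ti]]] := GsP K.
have -> : x = psh_map (X m) th (psh_map (X m) (surj_inv ti) x).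
  by rewrite -psh_map_comp surj_Kinv psh_map_id.
by rewrite funit_iso // !psh_hom_nat fixG.
Qed.

Lemma syz_concentrated m X : concentrated m X -> concentrated m (syz X).
Proof.
move=> X0 n nm G x; apply: (@ker_in_inj _ _ _ _ (fepsc X)).
by rewrite linear0; apply: (free_concentrated X0 nm).
Qed.

Lemma fin_span_syz n (X : cplx k U) : (forall G, fin_span (X n G)) -> forall G, fin_span (syz X n G).
Proof.
move=> Xf G.
have pl : linear (fun w : freec X n G => syz_proj w).
  move=> c w w'; apply: (@ker_in_inj _ _ _ _ (fepsc X)); rewrite -/(syz_in X) linearP.
  rewrite !syz_projE linearP funit_lin; rewrite scalerBr; zmod.
apply: (@fin_span_image k _ _ (mklin pl)); last exact: fin_span_free.
by move=> y; exists (syz_in X n G y); rewrite /= syz_projK.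
Qed.

Lemma syz_ses X : quasi_iso (cone_out (@ses_htpy k U _ _ _ (syz_in X) (fepsc X) (@syz_eps k U X))).
Proof.
apply: ses_qis.
- by move=> n G x e; apply: (@ker_in_inj _ _ _ _ (fepsc X)); rewrite linear0.
- by move=> n G y; exists (funit y); rewrite fepsc_unit.
- move=> n G y ey; exists (syz_proj y); rewrite syz_projE ey funit0 subr0.
  by [].
Qed.

Lemma order_bound : exists N, forall K : fam U, (#|K| <= N)%N.
Proof.
have [N NP] : exists N, forall H, List.In H Gs -> (#|fam_group H| <= N)%N.
  elim: Gs => [|H l [N NP]]; first by exists 0%N.
  exists (maxn #|fam_group H| N) => H' [<-|H'l]; first exact: leq_maxl.
  by apply: leq_trans (NP _ H'l) _; apply: leq_maxr.
exists N => K; have [H [HG [c ci]]] := GsP K.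
exact: leq_trans (leq_card c ci) (NP _ HG).
Qed.

Lemma fin_compact m X : concentrated m X -> (forall G, fin_span (X m G)) -> compact_obj X.
Proof.
have [N NP] := order_bound.
(* [X] may be nonzero only at orders above [e]. Passing to the syzygy raises [e] by one, and once
   [e] reaches the largest order [N] the complex is zero; [d] bounds the number of such passages. *)
suff h d : forall e X, zero_upto e X -> (N <= e + d)%N -> concentrated m X ->
    (forall G, fin_span (X m G)) -> compact_obj X.
  apply: (h N 0%N) => // G; rewrite leqn0 => /eqP/card0_eq/(_ 1%g); by rewrite inE.
elim: d => [|d IH] e {}X X0 Ne Xm Xf.
  apply: compact_acyclic => // G n x _; exists 0.
  by rewrite linear0; apply: X0; apply: leq_trans (NP G) _; rewrite -[e]addn0.
have [_ r] := qis_retract (syz_ses X).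
apply: (compact_retract r); apply: compact_cone => //.
  apply: (IH e.+1); first exact: syz_zero.
  - by rewrite addSnnS.
  - exact: syz_concentrated.
  - exact: fin_span_syz.
apply: (cpt_compact k_char0 _ (@id_qis k U (freec X))); first exact: freec_Kproj.
exact: freec_cpt Xm Xf.
Qed.
End FiniteCompact.

Lemma pi0_card (U : finGroupType -> Prop) (G H : fam U) : pi0_class G = pi0_class H -> #|G| = #|H|.
Proof.
move=> /pi0_isog[c ci]; apply/eqP; rewrite eqn_leq (surj_card c) andbT.
exact: leq_card ci.
Qed.

Lemma pi0_surj (U : finGroupType -> Prop) (G H : fam U) (a : surjection G H) :
  #|G| = #|H| -> pi0_class G = pi0_class H.
Proof. by move=> e; apply/pi0_isog; exists a; apply: surj_card_inj; rewrite e. Qed.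

Section ConcFunctor.
Context (k : fieldType) (U : finGroupType -> Prop) (m : int).
Implicit Types (M N : psh k U).

Definition c_in_hom M : psh_hom M (conc m M m) :=
  @mkhom k U M (conc m M m) (@c_in k U m M) (@c_in_lin k U m M)
    (fun G H a x => esym (c_in_nat m a x)).

Lemma conc_map M N (u : psh_hom M N) : exists f : chmap (conc m M) (conc m N),
  forall G x, f m G (c_in m x) = c_in m (u G x).
Proof.
have [//|f fE] := @conc_lift k U m M (conc m N) (psh_hom_comp (c_in_hom N) u).
by exists f.
Qed.

Lemma c_in_inj M G : injective (@c_in k U m M G).
Proof. by move=> x y /(congr1 (c_out m M m G)). Qed.

Lemma c_in0 M G : c_in m (0 : M G) = 0.
Proof. by apply: c_out_inj; rewrite linear0. Qed.

Lemma conc_ext M X (f g : chmap (conc m M) X) :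
  (forall G x, f m G (c_in m x) = g m G (c_in m x)) -> forall i G x, f i G x = g i G x.
Proof.
move=> h i G x; have [e|ne] := pselect (i = m); last by rewrite (c_out_neq x ne) !linear0.
by subst i; rewrite -(c_outK x) h.
Qed.

Lemma retract_ch (X Y : cplx k U) (i : chmap X Y) (r : chmap Y X) :
  (forall n G x, r n G (i n G x) = x) -> retract X Y.
Proof.
move=> ri; exists (dmap i), (dmap r); rewrite -deq_map_comp; exact: deq_map_ext.
Qed.

Lemma conc_retract M N (i : psh_hom M N) (r : psh_hom N M) :
  (forall G x, r G (i G x) = x) -> retract (conc m M) (conc m N).
Proof.
move=> ri; have [f fE] := conc_map i; have [g gE] := conc_map r.
apply: (retract_ch (i := f) (r := g)).
apply: (conc_ext (f := chmap_comp g f) (g := chmap_id _)) => G x.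
by rewrite -[LHS]/(g m G (f m G (c_in m x))) fE gE ri.
Qed.

Lemma conc_ses (A B C : psh k U) (i : psh_hom A B) (p : psh_hom B C) :
  (forall G x, i G x = 0 -> x = 0) -> (forall G y, exists x, y = p G x) ->
  (forall G x, p G (i G x) = 0) -> (forall G y, p G y = 0 -> exists x, y = i G x) ->
  exists f : chmap (conc m A) (conc m B), retract (cone f) (conc m C).
Proof.
move=> ii ps pi pk; have [f fE] := conc_map i; have [g gE] := conc_map p.
have gf n G x : g n G (f n G x) = 0.
  apply: (conc_ext (f := chmap_comp g f) (g := ch0 _ _)) => H z.
  by rewrite -[LHS]/(g m H (f m H (c_in m z))) fE gE pi c_in0.
exists f; suff q : quasi_iso (cone_out (ses_htpy gf)) by have [] := qis_retract q.
apply: ses_qis => n G x.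
- have [e|ne] := pselect (n = m); last by rewrite (c_out_neq x ne).
  subst n; rewrite -(c_outK x) fE -[RHS](c_in0 B G) => /c_in_inj/ii ->.
  exact: c_in0.
- have [e|ne] := pselect (n = m); last by rewrite (c_out_neq x ne); exists 0; rewrite linear0.
  subst n; have [y ey] := ps G (c_out m C m G x); exists (c_in m y).
  by rewrite gE -ey c_outK.
- have [e|ne] := pselect (n = m); last first.
    by rewrite (c_out_neq x ne) => _; exists 0; rewrite linear0.
  subst n; rewrite -(c_outK x) gE -[X in _ = X](c_in0 C G) => /c_in_inj/pk [y ->].
  by exists (c_in m y); rewrite fE.
Qed.
End ConcFunctor.

(** * Functors supported on sets of isomorphism classes *)

Section ClassModules.
Context (k : fieldType) (U : finGroupType -> Prop).

Lemma prop_sub0 (S : Prop) : ~ S -> (0 : k^o) = 0.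
Proof. by []. Qed.
Lemma prop_subP (S : Prop) (c : k) (x y : k^o) :
  (~ S -> x = 0) -> (~ S -> y = 0) -> ~ S -> c *: x + y = 0.
Proof. by move=> ex ey nS; rewrite ex // ey // scaler0 addr0. Qed.
Definition prop_sub (S : Prop) : submod k^o :=
  @Submod k k^o (fun x => ~ S -> x = 0) (@prop_sub0 S) (@prop_subP S).

Definition prop_in (S : Prop) (x : k^o) : subM (prop_sub S) :=
  @Sub_ k _ (prop_sub S) (if pselect S then x else 0)
    (fun nS => match pselect S as b return ((if b then x else 0) = 0) with
               | left s => False_ind _ (nS s) | right _ => erefl end).

Lemma prop_inE (S : Prop) x : S -> subval _ (prop_in S x) = x.
Proof. by move=> s; rewrite /prop_in /=; case: pselect. Qed.
Lemma prop_out (S : Prop) x : ~ S -> subval _ (prop_in S x) = 0.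
Proof. by move=> s; rewrite /prop_in /=; case: pselect. Qed.
Lemma prop_sub_zero (S : Prop) (x : subM (prop_sub S)) : ~ S -> x = 0.
Proof. by move=> nS; apply: sub_inj; apply: (subvalP x). Qed.
Lemma prop_in_lin (S : Prop) : linear (prop_in S).
Proof.
move=> c x y; apply: sub_inj; have [s|s] := pselect S.
  by rewrite [LHS]prop_inE // -[RHS]/(c *: subval _ (prop_in S x) + subval _ (prop_in S y)) !prop_inE.
rewrite [LHS]prop_out // -[RHS]/(c *: subval _ (prop_in S x) + subval _ (prop_in S y)).
by rewrite !prop_out // scaler0 addr0.
Qed.

Lemma prop_in0 (S : Prop) : prop_in S 0 = 0.
Proof. exact: (linear0 (mklin (@prop_in_lin S))). Qed.

Section Module.
Context (Z : pi0 U -> Prop).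

Definition cl_ob (G : fam U) : lmodType k := subM (prop_sub (Z (pi0_class G))).

(** Equality of orders decides whether [a] is an isomorphism; isomorphisms act as the identity of
    [k], all other surjections as zero. *)
Definition cl_fun (G H : fam U) (a : surjection G H) (x : cl_ob H) : cl_ob G :=
  if #|G| == #|H| then prop_in _ (subval _ x) else 0.

Lemma cl_fun_eq (G H : fam U) (a : surjection G H) (x : cl_ob H) : #|G| = #|H| ->
  subval _ (cl_fun a x) = subval _ x.
Proof.
move=> e; rewrite /cl_fun e eqxx; have ec := pi0_surj a e.
have [z|nz] := pselect (Z (pi0_class G)); first by rewrite prop_inE.
by rewrite prop_out // (prop_sub_zero x) ?linear0 // -ec.
Qed.
Lemma cl_fun_neq (G H : fam U) (a : surjection G H) (x : cl_ob H) : #|G| <> #|H| ->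
  cl_fun a x = 0.
Proof. by move=> /eqP ne; rewrite /cl_fun (negPf ne). Qed.

Lemma cl_lin (G H : fam U) (a : surjection G H) : linear (cl_fun a).
Proof.
move=> c x y; apply: (@subval_inj k); have [e|ne] := pselect (#|fam_group G| = #|fam_group H|).
  by rewrite cl_fun_eq // !linearP !cl_fun_eq.
by rewrite !cl_fun_neq // scaler0 addr0.
Qed.
Lemma cl_id (G : fam U) (x : cl_ob G) : cl_fun (surj_id G) x = x.
Proof. by apply: (@subval_inj k); rewrite cl_fun_eq. Qed.
Lemma cl_comp (G H K : fam U) (b : surjection H K) (a : surjection G H) (x : cl_ob K) :
  cl_fun (surj_comp b a) x = cl_fun a (cl_fun b x).
Proof.
apply: (@subval_inj k); have [e|ne] := pselect (#|fam_group G| = #|fam_group K|).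
  have e' : #|fam_group H| = #|fam_group K|.
    by apply/eqP; rewrite eqn_leq (surj_card b) andbT -e (surj_card a).
  by rewrite !cl_fun_eq // e' e.
rewrite cl_fun_neq //; have [e|ne'] := pselect (#|fam_group G| = #|fam_group H|).
  by rewrite cl_fun_eq // cl_fun_neq -?e.
by rewrite cl_fun_neq.
Qed.
Definition clmod : psh k U :=
  @Psh k U cl_ob (fun G H a => mklin (@cl_lin G H a)) cl_id cl_comp
    (fun G H a b _ x => erefl).

Lemma clmod_span (G : fam U) : fin_span (clmod G).
Proof.
exists [:: prop_in _ 1] => Q Q0 QP Ql x.
have -> : x = (subval _ x : k) *: (prop_in _ 1 : clmod G) + 0.
  rewrite addr0; apply: (@subval_inj k).
  rewrite -[RHS]/((subval _ x : k) * subval _ (prop_in (Z (pi0_class G)) 1)).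
  have [z|nz] := pselect (Z (pi0_class G)); first by rewrite prop_inE // mulr1.
  by rewrite (prop_sub_zero x) // !linear0 mul0r.
by apply: QP => //; apply: Ql; left.
Qed.

Lemma clmod_acyclic n (G : fam U) : acyclic_at G (conc n clmod) <-> ~ Z (pi0_class G).
Proof.
split=> [aM z|nz]; last first.
  by move=> i x _; exists 0; rewrite linear0; apply: conc_zero => y; apply: prop_sub_zero.
move: n aM; apply: pred_ind => n aM.
have [y ey] := aM n (c_in (n - 1) (prop_in _ 1 : clmod G)) (conc_d _).
have e : c_in (n - 1) (prop_in _ 1 : clmod G) = c_in (n - 1) (0 : clmod G).
  by rewrite ey conc_d c_in0.
have := congr1 (subval _) (c_in_inj e); rewrite prop_inE // linear0 => /eqP.
by rewrite (negPf (oner_neq0 k)).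
Qed.
End Module.

Section Constant.
Definition kconst : psh k U :=
  @Psh k U (fun=> k^o) (fun G H a => idfun) (fun G x => erefl) (fun G H K b a x => erefl)
    (fun G H a b _ x => erefl).

Section Up.
Context (S : fam U -> Prop).
Hypothesis Sup : forall K' K : fam U, surjection K' K -> S K -> S K'.

Lemma up_st (G H : fam U) (a : surjection G H) (x : kconst H) :
  prop_sub (S H) x -> prop_sub (S G) (psh_map kconst a x).
Proof. by move=> h nG; apply: h => sH; apply: nG; apply: Sup a sH. Qed.

Definition kup : psh k U := @psh_sub k U kconst (fun G => prop_sub (S G)) up_st.
End Up.

Section Layer.
Context (S : fam U -> Prop) (Sup : forall K' K : fam U, surjection K' K -> S K -> S K').
Context (G : fam U) (SG : S G) (Smin : forall K, S K -> (#|G| <= #|K|)%N).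

(** Minimality of [G] keeps this set closed under groups surjecting onto a member: if such a group
    were isomorphic to [G], the member, having no smaller order than [G], would be isomorphic to [G]
    too. *)
Definition above (K : fam U) : Prop := S K /\ pi0_class K <> pi0_class G.

Lemma above_up (K' K : fam U) : surjection K' K -> above K -> above K'.
Proof.
move=> b [SK nK]; split; first exact: Sup b SK.
move=> e; apply: nK; rewrite -e; apply/esym/(pi0_surj b).
by apply/eqP; rewrite eqn_leq (surj_card b) andbT (pi0_card e) Smin.
Qed.

Lemma above_sub (K : fam U) (x : kconst K) : prop_sub (above K) x -> prop_sub (S K) x.
Proof. by move=> h nS; apply: h => -[]. Qed.

Definition layer_in_fun (K : fam U) (x : kup above_up K) : kup Sup K :=
  Sub_ (above_sub (subvalP x)).
Lemma layer_in_lin (K : fam U) : linear (@layer_in_fun K).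
Proof. by move=> c x y; apply: sub_inj. Qed.
Lemma layer_in_nat (K' K : fam U) (b : surjection K' K) (x : kup above_up K) :
  layer_in_fun (psh_map (kup above_up) b x) = psh_map (kup Sup) b (layer_in_fun x).
Proof. exact: sub_inj. Qed.
Definition layer_in : psh_hom (kup above_up) (kup Sup) :=
  @mkhom k U (kup above_up) (kup Sup) layer_in_fun layer_in_lin layer_in_nat.

Let Z (c : pi0 U) : Prop := c = pi0_class G.

Definition layer_pr_fun (K : fam U) (x : kup Sup K) : clmod Z K := prop_in _ (subval _ x).
Lemma layer_pr_lin (K : fam U) : linear (@layer_pr_fun K).
Proof. by move=> c x y; rewrite /layer_pr_fun linearP prop_in_lin. Qed.
Lemma layer_pr_nat (K' K : fam U) (b : surjection K' K) (x : kup Sup K) :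
  layer_pr_fun (psh_map (kup Sup) b x) = psh_map (clmod Z) b (layer_pr_fun x).
Proof.
apply: (@subval_inj k); rewrite -[psh_map (clmod Z) b _]/(cl_fun b _).
have [e|ne] := pselect (#|fam_group K'| = #|fam_group K|).
  rewrite cl_fun_eq // /layer_pr_fun; have ec := pi0_surj b e.
  have [z|nz] := pselect (Z (pi0_class K)); first by rewrite !prop_inE // ec.
  by rewrite !prop_out // ec.
rewrite cl_fun_neq // linear0 /layer_pr_fun.
have [z|nz] := pselect (Z (pi0_class K')); last by rewrite prop_out.
have -> : x = 0; last by rewrite linear0 prop_in0 linear0.
apply: prop_sub_zero => SK; apply: ne; apply/eqP.
by rewrite eqn_leq (surj_card b) andbT (pi0_card z) Smin.
Qed.
Definition layer_pr : psh_hom (kup Sup) (clmod Z) :=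
  @mkhom k U (kup Sup) (clmod Z) layer_pr_fun layer_pr_lin layer_pr_nat.

Lemma layer_ses m : exists f : chmap (conc m (kup above_up)) (conc m (kup Sup)),
  retract (cone f) (conc m (clmod Z)).
Proof.
apply: (@conc_ses k U m _ _ _ layer_in layer_pr) => K x.
- by move=> /(congr1 (subval _)) e; apply: (@subval_inj k).
- have [z|nz] := pselect (Z (pi0_class K)).
    have SK : S K.
      by have /pi0_isog[c _] : pi0_class K = pi0_class G := z; apply: Sup c SG.
    exists (prop_in (S K) (subval _ x)); apply: (@subval_inj k).
    by rewrite -[layer_pr _ _]/(prop_in _ _) !prop_inE.
  by exists 0; rewrite linear0; apply: prop_sub_zero.
- apply: (@subval_inj k); rewrite linear0 -[layer_pr _ _]/(prop_in _ _).
  have [z|nz] := pselect (Z (pi0_class K)); last by rewrite prop_out.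
  rewrite prop_inE //; apply: (subvalP x) => -[_]; apply; exact: z.
- move=> /(congr1 (subval _)); rewrite linear0 -[layer_pr _ _]/(prop_in _ _) => e.
  have h : prop_sub (above K) (subval _ x).
    move=> nA; have [z|nz] := pselect (Z (pi0_class K)); first by rewrite prop_inE in e.
    apply: (subvalP x) => SK; apply: nA; split=> //.
  by exists (Sub_ h); apply: sub_inj.
Qed.
End Layer.
End Constant.
End ClassModules.

Section UnitTensor.
Context (k : fieldType) (U : finGroupType -> Prop).

Definition all_up (K' K : fam U) (b : surjection K' K) (t : True) : True := t.
Definition kunit : cplx k U := conc 0 (kup k all_up).

(** By this a prime containing [kunit] would contain every compact object. *)
Lemma kunit_tensor (X : cplx k U) : is_tensor kunit X X.
Proof.
have deg (i j n : int) (e : i + j = n) (ei : i = 0) : j = n by rewrite -e ei add0r.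
pose u i (G : fam U) (c : kunit i G) : k := subval _ (c_out 0 (kup k all_up) i G c).
have uP i (G : fam U) s (c c' : kunit i G) : u i G (s *: c + c') = s * u i G c + u i G c' by [].
have u0 i (G : fam U) : u i G 0 = 0 by [].
have un i (G H : fam U) (a : surjection G H) c : u i G (psh_map (kunit i) a c) = u i H c by [].
pose b i j n (e : i + j = n) (G : fam U) (c : kunit i G) (x : X j G) : X n G :=
  match @eqP _ i 0 with
  | ReflectT ei => ct X (deg i j n e ei) G (u i G c *: x)
  | ReflectF _ => 0
  end.
have bE j n (e : 0 + j = n) (ej : j = n) (G : fam U) c (x : X j G) :
    b 0 j n e G c x = u 0 G c *: ct X ej G x.
  by rewrite /b; case: eqP => // ei; rewrite linearZ_LR (eq_irrelevance (deg _ _ _ e ei) ej).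
have b0 i j n (e : i + j = n) (G : fam U) c (x : X j G) : i <> 0 -> b i j n e G c x = 0.
  by rewrite /b; case: eqP.
have u1_ (G : fam U) : u 0 G (c_in 0 (prop_in True 1 : kup k all_up G)) = 1.
  exact: prop_inE.
have uone_ (G : fam U) (c : kunit 0 G) :
    c = u 0 G c *: c_in 0 (prop_in True 1 : kup k all_up G).
  apply: c_out_inj; apply: (@subval_inj k).
  by rewrite -[RHS]/(u 0 G c * subval _ (prop_in True 1)) prop_inE // mulr1.
clearbody u; exists b; split.
- move=> i j n e G; split=> [c s x y|x s c c'].
    rewrite /b; case: eqP => [ei|_]; last by rewrite scaler0 addr0.
    by rewrite scalerDr scalerA mulrC -scalerA linearP.
  rewrite /b; case: eqP => [ei|_]; last by rewrite scaler0 addr0.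
  by rewrite uP scalerDl -scalerA linearP.
- move=> i j n e G H a c x; rewrite /b; case: eqP => [ei|_]; last by rewrite linear0.
  by rewrite -psh_hom_nat linearZ_LR un.
- move=> i j n e e1 e2 G c x.
  have -> : b (i - 1) j (n - 1) e1 G (cplx_d kunit i G c) x = 0.
    by rewrite conc_d /b; case: eqP => // ei; rewrite u0 scale0r linear0.
  rewrite add0r; have [ei|ne] := pselect (i = 0); last by rewrite !b0 // linear0 scaler0.
  subst i; have ej : j = n by rewrite -e add0r.
  subst j; rewrite (bE _ _ e erefl) (bE _ _ e2 erefl) expr0z scale1r linearZ_LR.
  by rewrite !ct_id.
move=> n G M phi phib.
have e0 : 0 + n = n by rewrite add0r.
pose one : kup k all_up G := prop_in _ 1.
have hl := (phib 0 n e0).1 (c_in 0 one).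
have u1 : u 0 G (c_in 0 one) = 1 by apply: u1_.
have uone c : c = u 0 G c *: c_in 0 one by apply: uone_.
exists (mklin hl); split.
  move=> i j e c x; have [ei|ne] := pselect (i = 0); last first.
    rewrite b0 // (linear0 (mklin hl)) (c_out_neq c ne).
    exact: (esym (linear0 (mklin ((phib i j e).2 x)))).
  subst i; have ej : j = n by rewrite -e add0r.
  subst j; rewrite (bE _ _ e erefl) ct_id (eq_irrelevance e e0) (linearZ_LR (mklin hl)).
  rewrite -[LHS]/(u 0 G c *: mklin ((phib 0 n e0).2 x) (c_in 0 one)).
  by rewrite -linearZ_LR -uone.
move=> h' h'P x; have := h'P 0 n e0 (c_in 0 one) x.
by rewrite (bE _ _ e0 erefl) ct_id u1 scale1r.
Qed.
End UnitTensor.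

Section SomeClass.
Context (k : fieldType) (U : finGroupType -> Prop).
Context (Gs : seq (fam U)).
Hypothesis GsP : forall K : fam U, exists H, List.In H Gs /\ iso K H.
Context (P : cplx k U -> Prop) (PP : prime_ideal P).

Lemma prime_acyclic X : acyclic X -> P X.
Proof.
move=> aX; have PT := prime_thick PP; have [Y PY] := thick_nonempty PT.
exact: thick_retract PT _ _ (acyclic_retract Y aX) PY.
Qed.

Definition clof (G : fam U) : cplx k U := conc 0 (clmod k (fun c => c = pi0_class G)).

(** Induction on the length of a list of groups meeting every class in [S]: [layer_ses] splits off
    the class of a group of least order, and two-out-of-three applies. *)
Lemma kup_prime : (forall G : fam U, P (clof G)) ->
  forall d (S : fam U -> Prop) (Sup : forall K' K : fam U, surjection K' K -> S K -> S K')
    (l : seq (fam U)), (size l <= d)%N ->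
  (forall K, S K -> exists H, List.In H l /\ pi0_class K = pi0_class H) ->
  P (conc 0 (kup k Sup)).
Proof.
move=> PM; elim=> [|d IH] S Sup l ld lS.
  apply: prime_acyclic => G n x _; exists 0; rewrite linear0; apply: conc_zero => y.
  by apply: prop_sub_zero => /lS[H []]; move: ld; rewrite leqn0 => /nilP ->.
have [[G0 SG0]|nS] := pselect (exists G, S G); last first.
  apply: prime_acyclic => G n x _; exists 0; rewrite linear0; apply: conc_zero => y.
  by apply: prop_sub_zero => SG; apply: nS; exists G.
have [G SG Gmin] : exists2 G, S G & forall K, S K -> (#|fam_group G| <= #|fam_group K|)%N.
  have ex : exists n, `[< exists G : fam U, S G /\ #|fam_group G| = n >].
    by exists #|fam_group G0|; apply/asboolP; exists G0.
  case: (ex_minnP ex) => n /asboolP[G [SG eG]] nmin.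
  by exists G => // K SK; rewrite eG; apply: nmin; apply/asboolP; exists K.
have [f r] := @layer_ses k U S Sup G SG Gmin 0.
have PT := prime_thick PP.
apply: (thick_cone_tgt PT (f := f)); last exact: thick_retract PT _ _ r (PM G).
apply: (IH _ _ (filter (fun H => ~~ `[< pi0_class H = pi0_class G >]) l)).
  rewrite -ltnS; apply: leq_trans ld.
  have [H [Hl eH]] := lS G SG.
  rewrite size_filter -(count_predC (fun H : fam U => `[< pi0_class H = pi0_class G >]) l).
  rewrite -[X in (X < _)%N]add0n ltn_add2r -has_count.
  elim: l Hl {lS} => // H1 l IHl [e|Hl] /=; first by subst H1; apply/orP; left; apply/asboolP.
  by rewrite IHl // orbT.
move=> K [SK nK]; have [H [Hl eH]] := lS K SK; exists H; split=> //.
have nH : pi0_class H <> pi0_class G by rewrite -eH.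
elim: l Hl {ld lS} => // H' l IHl [eH'|Hl] /=.
  by subst H'; case: asboolP => //= _; left.
by case: ifP => _; [right|]; apply: IHl.
Qed.

Lemma some_class : exists G : fam U, ~ P (clof G).
Proof.
apply: contrapT => n.
have PM (G : fam U) : P (clof G) by apply: contrapT => h; apply: n; exists G.
have P1 : P (kunit k U).
  apply: (@kup_prime PM (size Gs) (fun=> True) (@all_up U) Gs (leqnn _)) => K _.
  by have [H [HG i]] := GsP K; exists H; split=> //; apply/iso_pi0.
have [X [cX nX]] := prime_proper PP; apply: nX.
exact: (prime_ideal_tensor PP cX (kunit_tensor X) P1).
Qed.
End SomeClass.

Lemma conc_colift (k : fieldType) (U : finGroupType -> Prop) n (M : psh k U) (X : cplx k U)
    (r : psh_hom (X n) M) :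
  (forall a (e : n = a - 1) G x, r G (dr X e G x) = 0) ->
  exists f : chmap X (conc n M), forall G x, f n G x = c_in n (r G x).
Proof.
move=> rd.
pose F i G (x : X i G) : conc n M i G :=
  match @eqP _ i n with
  | ReflectT e => ct (conc n M) (esym e) G (c_in n (r G (ct X e G x)))
  | ReflectF _ => 0
  end.
have Fl i G : linear (@F i G).
  move=> c x y; rewrite /F; case: eqP => [e|_]; last by rewrite scaler0 addr0.
  by rewrite !linearP c_in_lin linearP.
have Fn i (G H : fam U) (a : surjection G H) x :
    F i G (psh_map (X i) a x) = psh_map (conc n M i) a (F i H x).
  rewrite /F; case: eqP => [e|_]; last by rewrite linear0.
  by rewrite !psh_hom_nat -c_in_nat psh_hom_nat.
have Fd i G x : mkhom (@Fl (i - 1)) (@Fn (i - 1)) G (cplx_d X i G x) =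
    cplx_d (conc n M) i G (mkhom (@Fl i) (@Fn i) G x).
  rewrite conc_d -[LHS]/(F (i - 1) G (cplx_d X i G x)) /F; case: eqP => // e.
  have -> : ct X e G (cplx_d X i G x) = dr X (esym e) G x.
    by rewrite -(dr_id (X := X) erefl) (ct_dr e erefl (esym e)).
  by rewrite rd c_in0 linear0.
exists (@mkchmap k U X (conc n M) (fun i => mkhom (@Fl i) (@Fn i)) Fd) => G x.
by rewrite -[LHS]/(F n G x) /F; case: eqP => // e; rewrite !ct_id.
Qed.

(* The regular representation of the outer automorphisms of [G], placed on the
   isomorphism class of [G]. *)
Section IsoRepresentable.
Context (k : fieldType) (U : finGroupType -> Prop) (G : fam U).

(** The second clause makes the generators vanish away from the class of [G], since a surjection
    onto [G] from a group of the same order is an isomorphism. *)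
Definition ir_rel (K : fam U) (b : surjection K G -> k) : Prop :=
  (forall a a', surj_conj a a' -> b a = b a') /\ (#|K| <> #|G| -> forall a, b a = 0).

Definition ir_mod (K : fam U) : lmodType k := pres (@ir_rel K).
Definition ig (K : fam U) (a : surjection K G) : ir_mod K := gen (@ir_rel K) a.

Lemma ig_conj (K : fam U) (a a' : surjection K G) : surj_conj a a' -> ig a = ig a'.
Proof. by move=> h; apply: gen_eq => b [bc _]; apply: bc. Qed.

Lemma ig0 (K : fam U) (a : surjection K G) : #|K| <> #|G| -> ig a = 0.
Proof.
move=> h; have e : ig a = 1 *: ig a + ig a.
  by apply: gen_lin => b [_ b0]; rewrite b0 // mulr0 addr0.
by move: e; rewrite scale1r => /(congr1 (fun x => x - ig a)); rewrite addrK subrr.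
Qed.

Section Lift.
Context (K : fam U) (L : lmodType k) (f : surjection K G -> L).
Hypothesis fc : forall a a', surj_conj a a' -> f a = f a'.
Hypothesis f0 : #|K| <> #|G| -> forall a, f a = 0.

Lemma ir_test (phi : {linear L -> k^o}) : ir_rel (fun a => phi (f a)).
Proof. by split=> [a a' h|h a]; [rewrite (fc h)|rewrite f0 // linear0]. Qed.

Definition ir_lift : {linear ir_mod K -> L} := pres_lift ir_test.

Lemma ir_liftE a : ir_lift (ig a) = f a.
Proof. exact: pres_liftE. Qed.
End Lift.

Lemma ir_eq (K : fam U) (L : lmodType k) (f g : {linear ir_mod K -> L}) :
  (forall a, f (ig a) = g (ig a)) -> forall x, f x = g x.
Proof. exact: pres_eq. Qed.

Lemma ir_map_conj_ (K K' : fam U) (b : surjection K' K) (a a' : surjection K G) :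
  surj_conj a a' -> ig (surj_comp a b) = ig (surj_comp a' b).
Proof. by move=> h; apply: ig_conj; apply: surj_conj_comp. Qed.

Lemma ir_map_0 (K K' : fam U) (b : surjection K' K) : #|K| <> #|G| ->
  forall a : surjection K G, ig (surj_comp a b) = 0.
Proof.
move=> ne a; apply: ig0 => e; apply: ne; apply/eqP.
by rewrite eqn_leq (surj_card a) -e (surj_card b).
Qed.

Definition ir_map (K' K : fam U) (b : surjection K' K) : {linear ir_mod K -> ir_mod K'} :=
  ir_lift (@ir_map_conj_ K K' b) (ir_map_0 b).

Lemma ir_mapE (K' K : fam U) (b : surjection K' K) (a : surjection K G) :
  ir_map b (ig a) = ig (surj_comp a b).
Proof. exact: (ir_liftE (@ir_map_conj_ K K' b) (ir_map_0 b)). Qed.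

Lemma ir_map_id (K : fam U) x : ir_map (surj_id K) x = x.
Proof. by apply: (@ir_eq K _ (ir_map (surj_id K)) idfun) => a; rewrite ir_mapE surj_compr1. Qed.

Lemma ir_map_comp (K L M : fam U) (b : surjection L M) (a : surjection K L) x :
  ir_map (surj_comp b a) x = ir_map a (ir_map b x).
Proof.
apply: (@ir_eq M _ (ir_map (surj_comp b a)) (ir_map a \o ir_map b)) => c.
by rewrite -[RHS]/(ir_map a (ir_map b (ig c))) !ir_mapE surj_compA.
Qed.

Lemma ir_map_conj (K L : fam U) (a b : surjection K L) : surj_conj a b ->
  forall x, ir_map a x = ir_map b x.
Proof.
move=> ab; apply: ir_eq => c; rewrite !ir_mapE; apply: ig_conj.
exact: surj_conj_compl.
Qed.

Definition irep : psh k U := @Psh k U ir_mod ir_map ir_map_id ir_map_comp ir_map_conj.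

Lemma irep_mapE (K' K : fam U) (b : surjection K' K) (a : surjection K G) :
  psh_map irep b (ig a) = ig (surj_comp a b).
Proof. exact: ir_mapE. Qed.

Lemma irep_span (K : fam U) : fin_span (irep K).
Proof.
exists (List.map (fun a => ig a : irep K) (enum {: surjection K G})) => Q Q0 QP Ql.
apply: pres_ind => // c a x Qx; apply: QP => //; apply: Ql.
apply: (List.in_map (fun a => ig a : irep K)).
by apply: mem_In; rewrite mem_enum.
Qed.

Section Average.
Context (k_char0 : [pchar k] =i pred0).
Local Notation M := (clmod k (fun c => c = pi0_class G)).

Let w (K : fam U) : M K := prop_in _ 1.

Let w_map (K' K : fam U) (b : surjection K' K) (a : surjection K G) :
  psh_map M b (w K) = w K'.
Proof.
apply: (@subval_inj k); rewrite -[psh_map M b _]/(cl_fun b _).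
have [e|ne] := pselect (#|fam_group K'| = #|fam_group K|).
  rewrite cl_fun_eq // /w; have ec := pi0_surj b e.
  have [z|nz] := pselect (pi0_class K = pi0_class G); first by rewrite !prop_inE // ec.
  by rewrite !prop_out // ec.
rewrite cl_fun_neq // linear0 /w prop_out // => /pi0_card e; apply: ne; apply/eqP.
by rewrite eqn_leq (surj_card b) andbT e (surj_card a).
Qed.

(** The augmentation, which sends every generator to 1, is split by the average of the generators;
    dividing by their number uses characteristic zero. *)
Lemma clmod_retract m : retract (conc m M) (conc m irep).
Proof.
have w0 (K : fam U) : #|K| <> #|G| -> forall a : surjection K G, w K = 0.
  by move=> ne a; apply: prop_sub_zero => /pi0_card.
pose r (K : fam U) : {linear irep K -> M K} := @ir_lift K (M K) (fun=> w K) (fun a a' _ => erefl) (@w0 K).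
have rE (K : fam U) (a : surjection K G) : r K (ig a) = w K by rewrite /r ir_liftE.
have rn (K' K : fam U) (b : surjection K' K) x : r K' (psh_map irep b x) = psh_map M b (r K x).
  apply: (@ir_eq K _ (r K' \o psh_map irep b) (psh_map M b \o r K)) => a.
  rewrite -[LHS]/(r K' (psh_map irep b (ig a))) irep_mapE rE.
  by rewrite -[RHS]/(psh_map M b (r K (ig a))) rE (w_map b a).
pose avg (K : fam U) : irep K :=
  (#|{: surjection K G}|%:R : k)^-1 *: \sum_(a : surjection K G) ig a.
have avg0 (K : fam U) : pi0_class K <> pi0_class G -> avg K = 0.
  move=> ne; rewrite /avg big1 ?scaler0 // => a _; apply: ig0 => e; apply: ne.
  exact: pi0_surj e.
have avgn (K' K : fam U) (b : surjection K' K) : pi0_class K' = pi0_class K ->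
    psh_map irep b (avg K) = avg K'.
  move=> /pi0_card e.
  have bi : injective b by apply: surj_card_inj; rewrite e.
  have cb : bijective (fun a : surjection K G => surj_comp a b).
    exists (fun a : surjection K' G => surj_comp a (surj_inv bi)) => a.
      by rewrite -surj_compA surj_invK surj_compr1.
    by rewrite -surj_compA surj_Kinv surj_compr1.
  have es : psh_map irep b (\sum_(a : surjection K G) ig a) = \sum_(a : surjection K' G) ig a.
    rewrite linear_sum (reindex (fun a : surjection K G => surj_comp a b)); last exact: onW_bij.
    by apply: eq_bigr => a _; rewrite -irep_mapE.
  by rewrite /avg linearZ_LR es (bij_eq_card cb).
pose s (K : fam U) (x : M K) : irep K := (subval _ x : k) *: avg K.
have sl (K : fam U) : linear (@s K).
  by move=> c x y; rewrite /s linearP scalerDl -scalerA.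
have sn (K' K : fam U) (b : surjection K' K) x : s K' (psh_map M b x) = psh_map irep b (s K x).
  have -> : psh_map irep b (s K x) = (subval _ x : k) *: psh_map irep b (avg K).
    exact: (linearZ_LR (psh_map irep b)).
  rewrite /s -[psh_map M b x]/(cl_fun b x).
  have [e|ne] := pselect (#|fam_group K'| = #|fam_group K|).
    by rewrite cl_fun_eq // avgn //; apply: pi0_surj b e.
  rewrite cl_fun_neq // linear0 scale0r.
  have [eK|nK] := pselect (pi0_class K = pi0_class G); last by rewrite avg0 // linear0 scaler0.
  have es : psh_map irep b (\sum_(a : surjection K G) ig a) = 0.
    rewrite linear_sum big1 // => a _; rewrite [LHS]irep_mapE ig0 // => e.
    by apply: ne; rewrite e (pi0_card eK).
  by rewrite /avg (linearZ_LR (psh_map irep b)) es !scaler0.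
apply: (@conc_retract k U m M irep (mkhom sl sn) (PshHom rn)) => K x.
rewrite -[LHS]/(r K ((subval _ x : k) *: avg K)) (linearZ_LR (r K)).
have [eK|nK] := pselect (pi0_class K = pi0_class G); last first.
  by rewrite (prop_sub_zero x) // linear0 scale0r.
have [a _] : exists a : surjection K G, True by have /pi0_isog[c _] := eK; exists c.
have es : r K (\sum_(a : surjection K G) ig a) = \sum_(a : surjection K G) w K.
  by rewrite linear_sum; apply: eq_bigr => a' _; apply: rE.
rewrite /avg (linearZ_LR (r K)) es sumr_const -scaler_nat [_^-1 *: _]scalerA mulVf ?scale1r; last first.
  by apply: natr_neq0 => //; apply/card_gt0P; exists a.
apply: (@subval_inj k); rewrite linearZ_LR /w prop_inE // -[LHS]/(_ * _) mulr1.
by [].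
Qed.
End Average.
End IsoRepresentable.

Section NonAcyclic.
Context (k : fieldType) (U : finGroupType -> Prop) (G : fam U) (X : cplx k U).

Lemma surj_inv_conj (K L : finGroupType) (a a' : surjection K L) (ai : injective a)
    (ai' : injective a') : surj_conj a a' -> surj_conj (surj_inv ai) (surj_inv ai').
Proof.
move=> [g gP]; exists (surj_inv ai g^-1)%g => x; apply: (ai').
rewrite surj_inv_funK gP surjJ !surj_inv_funK -conjgM mulVg conjg1.
by [].
Qed.

(* A class in the homology of [X] at [G] and a functional detecting it split off
   a copy of the regular representation from the tensor product. *)
Lemma irep_retract : ~ acyclic_at G X -> exists m T,
  is_tensor X (conc m (irep k G)) T /\ retract (conc 0 (irep k G)) T.
Proof.
move=> /not_acyclic_functional[n [x [phi [dx phix phid]]]].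
(* The cycle [x] has degree [n - 1], so this [m] puts its products with the second factor in degree
   0. *)
pose m := 1 - n; pose E := irep k G; pose T := tens X (conc m E).
pose D : tdata X (conc m E) T := tens_data _ _.
exists m, T; split; first by apply/is_tensorP; exists D.
have e0 : n - 1 + m = 0 by rewrite /m; zmod.
pose iu (K : fam U) (a : surjection K G) : T 0 K :=
  tb D e0 (psh_map (X (n - 1)) a x) (c_in m (ig k a : E K)).
have iuc (K : fam U) (a a' : surjection K G) : surj_conj a a' -> iu K a = iu K a'.
  by move=> h; rewrite /iu (psh_map_conj h) (ig_conj k h).
have iu0 (K : fam U) : #|K| <> #|G| -> forall a : surjection K G, iu K a = 0.
  by move=> h a; rewrite /iu ig0 // c_in0 tb0r.
pose u (K : fam U) : {linear E K -> T 0 K} := ir_lift (@iuc K) (@iu0 K).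
have uE (K : fam U) (a : surjection K G) : u K (ig k a) = iu K a by rewrite /u ir_liftE.
have un (K' K : fam U) (b : surjection K' K) z : u K' (psh_map E b z) = psh_map (T 0) b (u K z).
  apply: (@ir_eq k U G K _ (u K' \o psh_map E b) (psh_map (T 0) b \o u K)) => a.
  rewrite -[LHS]/(u K' (psh_map E b (ig k a))) irep_mapE uE.
  rewrite -[RHS]/(psh_map (T 0) b (u K (ig k a))) uE /iu tb_nat psh_map_comp c_in_nat.
  by rewrite irep_mapE.
have du (K : fam U) z : cplx_d T 0 K (u K z) = 0.
  apply: (@ir_eq k U G K _ (cplx_d T 0 K \o u K) (hom0 E _ K)) => a.
  rewrite -[LHS]/(cplx_d T 0 K (u K (ig k a))) uE /iu.
  have e1 : n - 1 - 1 + m = 0 - 1 by zby e0.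
  have e2 : n - 1 + (m - 1) = 0 - 1 by zby e0.
  by rewrite (tb_d D e0 e1 e2) psh_hom_nat dx linear0 tb0l conc_d tb0r scaler0 addr0.
have [f fE] := conc_lift (u := PshHom un) du.
(* The retraction moves [y] back to [G] along the isomorphism [a], evaluates [phi] there, and scales
   the generator [a] by the result. If [a] is not an isomorphism, the generator is zero and so is
   the value. *)
pose F i (K : fam U) (y : X i K) (a : surjection K G) : E K :=
  match pselect (injective a) with
  | left ai => (at_deg phi (psh_map (X i) (surj_inv ai) y) : k) *: (ig k a : E K)
  | right _ => 0
  end.
have FE i (K : fam U) (y : X i K) (a : surjection K G) (ai : injective a) :
    F i K y a = (at_deg phi (psh_map (X i) (surj_inv ai) y) : k) *: (ig k a : E K).
  by rewrite /F; case: pselect => // ai'; rewrite (Prop_irrelevance ai' ai).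
have Fn i (K : fam U) (y : X i K) (a : surjection K G) : ~ injective a -> F i K y a = 0.
  by rewrite /F; case: pselect.
have F0 i (K : fam U) (y : X i K) : #|K| <> #|G| -> forall a, F i K y a = 0.
  by move=> ne a; rewrite /F; case: pselect => // ai; rewrite ig0 // scaler0.
have inj_conj (K : fam U) (a a' : surjection K G) : surj_conj a a' -> injective a -> injective a'.
  by move=> _ ai; apply: surj_card_inj; apply: leq_card ai.
have Fc i (K : fam U) (y : X i K) a a' : surj_conj a a' -> F i K y a = F i K y a'.
  move=> h; have [ai|na] := pselect (injective a).
    have ai' := inj_conj _ _ _ h ai.
    rewrite !FE (ig_conj k h); congr (at_deg phi _ *: _).
    by apply: psh_map_conj; apply: surj_inv_conj.
  rewrite !Fn // => ai'; apply: na; apply: surj_card_inj; exact: leq_card ai'.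
pose R i (K : fam U) (y : X i K) : {linear E K -> E K} := ir_lift (Fc i K y) (F0 i K y).
have RE i (K : fam U) (y : X i K) (a : surjection K G) : R i K y (ig k a) = F i K y a.
  by rewrite /R ir_liftE.
pose psi i j (e : i + j = 0) (K : fam U) (y : X i K) (z : conc m E j K) : E K :=
  R i K y (c_out m E j K z).
have psib i j (e : i + j = 0) (K : fam U) : bilin (@psi i j e K).
  split=> [y|z] c y1 y2; first by rewrite /psi !linearP.
  rewrite /psi; move: (c_out m E j K z) => {}z.
  have hl : linear (fun z => c *: R i K y1 z + R i K y2 z).
    move=> s v v'; rewrite (linearP (R i K y1)) (linearP (R i K y2)) !scalerDr !scalerA [s * c]mulrC; zmod.
  apply: (@ir_eq k U G K _ (R i K (c *: y1 + y2)) (mklin hl)) => a.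
  rewrite RE -[RHS]/(c *: R i K y1 (ig k a) + R i K y2 (ig k a)) !RE.
  have [ai|na] := pselect (injective a); last by rewrite !Fn // scaler0 addr0.
  rewrite !(FE _ _ _ _ ai) linearP at_deg_linear scalerDl -scalerA.
  by [].
have psin i j (e : i + j = 0) (K' K : fam U) (b : surjection K' K) y z :
    psh_map E b (psi i j e K y z) = psi i j e K' (psh_map (X i) b y) (psh_map (conc m E j) b z).
  rewrite /psi psh_hom_nat; move: (c_out m E j K z) => {}z.
  apply: (@ir_eq k U G K _ (psh_map E b \o R i K y) (R i K' (psh_map (X i) b y) \o psh_map E b)) => a.
  rewrite -[LHS]/(psh_map E b (R i K y (ig k a))) RE.
  rewrite -[RHS]/(R i K' (psh_map (X i) b y) (psh_map E b (ig k a))) irep_mapE RE.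
  have [abi|nab] := pselect (injective (surj_comp a b)); last first.
    have ne : #|K'| <> #|G| by move=> e'; apply: nab; apply: surj_card_inj; rewrite e'.
    rewrite (Fn _ _ _ _ nab); have [ai|na] := pselect (injective a); last by rewrite Fn // linear0.
    by rewrite (FE _ _ _ _ ai) linearZ_LR irep_mapE ig0 // scaler0.
  have ai : injective a.
    by apply: surj_card_inj; apply: leq_trans (surj_card b) (leq_card _ abi).
  rewrite (FE _ _ _ _ ai) (FE _ _ _ _ abi) linearZ_LR irep_mapE -psh_map_comp.
  congr (at_deg phi (psh_map _ _ _) *: _); apply: surj_ext => t; apply: (ai).
  rewrite surj_inv_funK -[RHS]/(surj_comp a b (surj_inv abi t)) surj_inv_funK.
  by [].
pose r := thom D psib psin.
have rE i j (e : i + j = 0) (K : fam U) y (a : surjection K G) z :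
    r K (tb D e y z) = R i K y (c_out m E j K z) by rewrite /r thomE.
(* The functional [phi] kills boundaries, hence so does [r]: the condition for a chain map to a
   complex concentrated in degree 0. *)
have rd a (e : 0 = a - 1) (K : fam U) t : r K (dr T e K t) = 0.
  apply: (@t_ext k U _ _ _ D a K _ (r K \o dr T e K) (hom0 (T a) E K)) => i j ei y z.
  have e1 : i - 1 + j = 0 by zby ei e.
  have e2 : i + (j - 1) = 0 by zby ei e.
  rewrite -[LHS]/(r K (dr T e K (tb D ei y z))) (tb_dr D ei e e1 e2) conc_d tb0r scaler0 addr0.
  rewrite /r thomE /psi -[RHS]/(0 : E K); move: (c_out m E j K z) => {}z.
  apply: (@ir_eq k U G K _ (R (i - 1) K (cplx_d X i K y)) (hom0 E E K)) => b.
  rewrite RE; have [bi|nb] := pselect (injective b); last by rewrite Fn.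
  by rewrite (FE _ _ _ _ bi) -psh_hom_nat phid scale0r.
have [g gE] := conc_colift rd.
apply: (retract_ch (i := f) (r := g)).
apply: (@conc_ext k U 0 E _ (chmap_comp g f) (chmap_id _)) => K z.
rewrite -[LHS]/(g 0 K (f 0 K (c_in 0 z))) fE gE -[PshHom un K z]/(u K z).
congr (c_in 0 _).
apply: (@ir_eq k U G K _ (r K \o u K) idfun) => a.
rewrite -[LHS]/(r K (u K (ig k a))) uE /iu /r thomE /psi c_inK RE.
have [ai|na] := pselect (injective a); last first.
  by rewrite Fn // ig0 // => e; apply: na; apply: surj_card_inj; rewrite e.
rewrite (FE _ _ _ _ ai) -psh_map_comp surj_invK psh_map_id at_deg_id phix.
exact: scale1r.
Qed.
End NonAcyclic.

Section Finite.
Context (k : fieldType) (U : finGroupType -> Prop) (U_iso : closed_under_iso U)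
  (U_quo : closed_under_quotients U) (k_char0 : [pchar k] =i pred0).
Hypothesis fin : finite_type (pi0 U).

Lemma finite_groups : exists Gs : seq (fam U), forall K : fam U, exists H, List.In H Gs /\ iso K H.
Proof.
have [s sP] := fin; exists (List.map (@class_rep U) s) => K.
exists (class_rep (pi0_class K)); split; first by apply: List.in_map.
by apply/iso_pi0; rewrite class_repP.
Qed.

Lemma conc_compact m (M : psh k U) : (forall G, fin_span (M G)) -> compact_obj (conc m M).
Proof.
move=> Mf; have [Gs GsP] := finite_groups.
apply: (fin_compact k_char0 GsP (m := m)) => [n nm G x|G]; first exact: c_out_neq.
apply: (@fin_span_image k _ _ (mklin (@c_in_lin k U m M G))); last exact: Mf.
by move=> y; exists (c_out m M m G y); rewrite /= c_outK.
Qed.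

Lemma prime_is_group (P : Spc k U) : exists G, P = gprime U_iso U_quo k_char0 G.
Proof.
have [Gs GsP] := finite_groups; have PP := Spc_prime P.
have PT := prime_thick PP; have [G nG] := some_class GsP PP.
have cG : compact_obj (clof k G) by apply: conc_compact => H; apply: clmod_span.
exists G; apply: Spc_ext => X; split=> [PX|[cX aX]].
  split; first exact: prime_compact PP _ PX.
  apply: contrapT => /irep_retract[m [T [XT r]]]; apply: nG.
  have cE : compact_obj (conc m (irep k G)) by apply: conc_compact => H; apply: irep_span.
  have PE : P (conc 0 (irep k G)).
    exact: (thick_retract PT r (prime_ideal_tensor PP cE XT PX)).
  exact: (thick_retract PT (clmod_retract G k_char0 0) PE).
have D := tens_data X (clof k G).
have XT : is_tensor X (clof k G) (tens X (clof k G)) by apply/is_tensorP; exists D.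
have PXG : P (tens X (clof k G)).
  (* On the class of [G] the factor [X] is acyclic, on all other classes the factor [clof G] is. *)
  apply: (prime_acyclic PP) => K; have [e|ne] := pselect (pi0_class K = pi0_class G).
    by have /pi0_isog[c ci] := e; apply: (tens_acyclic D); apply: acyclic_at_iso ci aX.
  by apply: (tens_acyclic (swap_data D)); apply/clmod_acyclic.
by have [|/nG] := prime_prime PP cX cG XT PXG.
Qed.

Lemma clmod_prime (Z : pi0 U -> Prop) (G : fam U) :
  gprime U_iso U_quo k_char0 G (conc 0 (clmod k Z)) <-> ~ Z (pi0_class G).
Proof.
split=> [[_ /clmod_acyclic]//|nZ]; split; last exact/clmod_acyclic.
by apply: conc_compact => H; apply: clmod_span.
Qed.

(** The functor that is [k] on the class of [H] alone lies in the prime of every other class and not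
    in that of [H]. *)
Lemma gmap_inj : injective (gmap U_iso U_quo k_char0).
Proof.
move=> c c'; have [G ->] := pi0_classP c; have [H ->] := pi0_classP c'.
rewrite !gmapE => e; apply: contrapT => ne.
have := (clmod_prime (fun d => d = pi0_class H) G).2 ne.
by rewrite e => /clmod_prime; apply.
Qed.
End Finite.

Theorem theorem5 (p : nat) (k : fieldType) (U : finGroupType -> Prop)
  (p_prime : prime p) (k_char0 : [pchar k] =i pred0)
  (U_iso : closed_under_iso U)
  (U_pgroup : forall G : finGroupType, U G -> (p.-group [set: G])%g)
  (U_quo : closed_under_quotients U) :
  exists f : pi0 U -> Spc k U,
    [/\ forall G : fam U, Spc_carrier (f (pi0_class G)) = group_prime G,
        (forall P : Spc k U, exists c : pi0 U, f c = P) <->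
          finite_type (pi0 U)
      & finite_type (pi0 U) -> 
          homeomorphism (@discrete_closed (pi0 U)) (@Spc_closed k U) f].
Proof.
pose f := gmap (k := k) U_iso U_quo k_char0.
have f_onto : finite_type (pi0 U) -> forall P : Spc k U, exists c : pi0 U, f c = P.
  move=> fin P; have [G ->] := prime_is_group U_iso U_quo k_char0 fin P.
  by exists (pi0_class G); apply: gmapE.
exists f; split=> [G||fin]; first by rewrite /f gmapE.
  split=> [onto|]; last exact: f_onto.
  apply: contrapT => /(not_finite_prime U_iso U_quo k_char0 p_prime U_pgroup)[P nP].
  by have [c ec] := onto P; apply: (nP c).
have [g gP] := dchoice (f_onto fin).
split=> //; exists g; split=> [Z _|c|P]; last exact: gP.
  (* Every set [Z] of classes corresponds to a closed set of the spectrum, the support of the single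
     compact object [clmod k Z]. *)
  exists (fun X => X = conc 0 (clmod k Z)); split=> [_ ->|P].
    by apply: (conc_compact k_char0 fin) => H; apply: clmod_span.
  have [G eG] := pi0_classP (g P); rewrite eG.
  have eP : P = gprime U_iso U_quo k_char0 G by transitivity (f (g P)); [rewrite gP|rewrite eG; apply: gmapE].
  rewrite /supp eP; split=> [z _ -> /(clmod_prime U_iso U_quo k_char0 fin)//|h].
  by apply: contrapT => nz; apply: (h _ erefl); apply/(clmod_prime U_iso U_quo k_char0 fin).
by apply: (@gmap_inj k U U_iso U_quo k_char0 fin); apply: gP.
Qed.
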